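(* Let $N$ be an integer with $4<N\le12$ and fix either sign in the equation $$u_{tt}-\Delta u\pm|u|^Nu=0\ \text{ on }\mathbb R^{3+1},\qquad u(0)=u_0,\quad u_t(0)=u_1 .\qquad(\ast)$$ There exist constants $\varepsilon_0>0$ and $C<\infty$ (depending only on $N$) such that the following holds. Let $R>0$ and let $(u_0,u_1)\in\dot H^1\times L^2$ be radial, outgoing initial data, supported outside the ball $B(0,R)=\{|x|\le R\}$, such that $$\|u_0\|_{\dot H^1}^2\,R^{4/N-1}\le\varepsilon_0 .$$ Then the corresponding solution $u$ of $(\ast)$ exists globally, forward in time (on $\mathbb R^3\times[0,\infty)$), and disperses: $$\|u\|_{L^{N/2}_tL^\infty_x}\le C\,\|u_0\|_{\dot H^1}\,R^{2/N-1/2}.$$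
   Context: All functions are real-valued; $r=|x|$, and subscript $r$ denotes the radial derivative. A pair $(u_0,u_1)$ of radially symmetric functions or distributions on $\mathbb R^3$ is called outgoing if $u_1=-(u_0)_r-\frac{u_0}{r}$. Solutions are understood as mild solutions, i.e. solutions of $$u(t)=\cos(t\sqrt{-\Delta})u_0+\frac{\sin(t\sqrt{-\Delta})}{\sqrt{-\Delta}}u_1\mp\int_0^t\frac{\sin((t-s)\sqrt{-\Delta})}{\sqrt{-\Delta}}|u(s)|^Nu(s)\,ds .$$ $\|f\|_{L^p_tL^q_x}=\big(\int_0^\infty\|f(\cdot,t)\|_{L^q_x}^p\,dt\big)^{1/p}$. $\dot H^1$ is the homogeneous Sobolev space on $\mathbb R^3$. *)

(* Defs.v *)
From HB Require Import structures.
From mathcomp Require Import all_boot all_order all_algebra.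
From mathcomp Require Import all_classical all_reals all_analysis.

Set Implicit Arguments.
Unset Strict Implicit.
Unset Printing Implicit Defensive.

Import Order.TTheory GRing.Theory Num.Theory.
Import numFieldNormedType.Exports.

Local Open Scope classical_set_scope.
Local Open Scope ring_scope.

Notation R3 R := (R * R * R)%type.

(* R^3 carries its Euclidean and normed structure as [R3 R]; the library states
   the Lebesgue measure on [measurableTypeR R], which is R with its Borel sets. *)
Notation R3meas R :=
  (measurableTypeR R * measurableTypeR R * measurableTypeR R)%type.

(* The canonical sigma-finite structure of [m1 \x m2] in the library is the one
   of subprobabilities, so that it is declared again for these products. *)
Lemma sigma_finite_product d1 d2 (T1 : measurableType d1)
    (T2 : measurableType d2) (R : realType)
    (m1 : {sigma_finite_measure set T1 -> \bar R})
    (m2 : {sigma_finite_measure set T2 -> \bar R}) :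
  sigma_finite setT (m1 \x m2)%E.
Proof.
have /sigma_finiteP[F [TF ndF Foo]] := sigma_finiteT m1.
have /sigma_finiteP[G [TG ndG Goo]] := sigma_finiteT m2.
exists (fun n => F n `*` G n).
  rewrite -setXTT TF TG predeqE => -[x y]; split.
    move=> [/= [n _ Fnx] [k _ Gky]]; exists (maxn n k) => //; split.
    - by move: x Fnx; exact/subsetPset/ndF/leq_maxl.
    - by move: y Gky; exact/subsetPset/ndG/leq_maxr.
  by move=> [n _ []/= ? ?]; split; exists n.
move=> k; have [? ?] := Foo k; have [? ?] := Goo k.
split; first exact: measurableX.
by rewrite product_measure1E// lte_mul_pinfty// ge0_fin_numE.
Qed.

Section Lebesgue.
Context {R : realType}.

Definition leb2 := (@lebesgue_measure R \x @lebesgue_measure R)%E.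
HB.instance Definition _ := Measure.on leb2.
HB.instance Definition _ := Measure_isSigmaFinite.Build _ _ _ leb2
  (@sigma_finite_product _ _ _ _ R lebesgue_measure lebesgue_measure).

Definition leb3 := (leb2 \x @lebesgue_measure R)%E.
HB.instance Definition _ := Measure.on leb3.
HB.instance Definition _ := Measure_isSigmaFinite.Build _ _ _ leb3
  (@sigma_finite_product _ _ _ _ R leb2 lebesgue_measure).

End Lebesgue.

Section Space.
Context {R : realType}.

Definition coord3 (i : 'I_3) (x : R3 R) : R :=
  [:: x.1.1; x.1.2; x.2]`_i.

Definition basis_vec (i : 'I_3) : R3 R :=
  ((i == 0%N :> nat)%:R, (i == 1%N :> nat)%:R, (i == 2%N :> nat)%:R).

Definition dot3 (x y : R3 R) : R := \sum_(i < 3) coord3 i x * coord3 i y.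

(* The library norm on a product type is the maximum norm. *)
Definition euclid (x : R3 R) : R := Num.sqrt (dot3 x x).

Definition Lp_fun (p : \bar R) (f : R3 R -> R) : Prop :=
  measurable_fun [set: R3meas R] f /\ finite_norm leb3 p f.

Definition pairing (f phi : R3 R -> R) : R :=
  Rintegral leb3 setT (fun x => f x * phi x).

Definition partial (i : 'I_3) (f : R3 R -> R) : R3 R -> R :=
  fun x => 'D_(basis_vec i) f x.

Definition partials (s : seq 'I_3) (f : R3 R -> R) : R3 R -> R :=
  foldr partial f s.

Definition smooth (f : R3 R -> R) : Prop :=
  forall s : seq 'I_3, continuous (partials s f) /\
    forall i x, derivable (partials s f) x (basis_vec i).

Definition test_function (f : R3 R -> R) : Prop :=
  smooth f /\ exists M : R, forall x, M < euclid x -> f x = 0.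

Definition schwartz (f : R3 R -> R) : Prop :=
  smooth f /\ forall (s : seq 'I_3) (k : nat),
    exists C : R, forall x, euclid x ^+ k * `|partials s f x| <= C.

Definition weak_gradient (f : R3 R -> R) (g : R3 R -> R3 R) : Prop :=
  forall i : 'I_3, Lp_fun 2%:E (coord3 i \o g) /\
    forall phi, test_function phi ->
      pairing f (partial i phi) = - pairing (coord3 i \o g) phi.

(* In dimension 3 the completion of the test functions for the norm
   |grad f|_{L^2} is realized inside L^6, by the Sobolev embedding. *)
Definition H1dot (f : R3 R -> R) : Prop :=
  Lp_fun 6%:E f /\ exists g, weak_gradient f g.

(* [weak_gradient f] determines the gradient up to a null set. *)
Definition grad (f : R3 R -> R) : R3 R -> R3 R :=
  xget (fun _ => 0) [set g | weak_gradient f g].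

Definition H1dot_norm (f : R3 R -> R) : \bar R :=
  ('N[leb3]_(2%:E) [EFin \o (euclid \o grad f)])%E.

Definition radial (f : R3 R -> R) : Prop :=
  exists2 h : R -> R, measurable_fun [set: measurableTypeR R] h &
    {ae leb3, forall x, f x = h (euclid x)}.

Definition radial_derivative (f : R3 R -> R) (x : R3 R) : R :=
  dot3 (grad f x) x / euclid x.

Definition outgoing (u0 u1 : R3 R -> R) : Prop :=
  {ae leb3, forall x, u1 x = - radial_derivative u0 x - u0 x / euclid x}.

Definition supported_outside_ball (rho : R) (f : R3 R -> R) : Prop :=
  {ae leb3, forall x, euclid x <= rho -> f x = 0}.

Definition tempered (f : R3 R -> R) : Prop :=
  measurable_fun [set: R3meas R] f /\
  forall phi, schwartz phi ->
    leb3.-integrable setT (fun x => (f x * phi x)%:E).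

(* Real and imaginary part of the Fourier transform
   x |-> \int exp(- i x.xi) psi(xi) dxi of a real function psi. *)
Definition fourier_re (psi : R3 R -> R) (x : R3 R) : R :=
  Rintegral leb3 setT (fun xi => cos (dot3 x xi) * psi xi).

Definition fourier_im (psi : R3 R -> R) (x : R3 R) : R :=
  - Rintegral leb3 setT (fun xi => sin (dot3 x xi) * psi xi).

(* Symbols of cos(t sqrt(-Delta)) and sin(t sqrt(-Delta)) / sqrt(-Delta); the
   second one should be t at xi = 0, but only its a.e. class matters. *)
Definition cos_symbol (t : R) (xi : R3 R) : R := cos (t * euclid xi).

Definition sin_symbol (t : R) (xi : R3 R) : R :=
  sin (t * euclid xi) / euclid xi.

(* For a tempered distribution f, the distribution m(sqrt(-Delta)) f is the one
   whose Fourier transform is m times that of f, i.e. its Fourier transform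
   maps a Schwartz function psi to <f, F (m psi)>, F being the Fourier transform
   on functions.  [multiplier_ft F m f psi] is the real (imaginary) part of this
   number for F := fourier_re (fourier_im); real psi suffice by linearity. *)
Definition multiplier_ft (F : (R3 R -> R) -> R3 R -> R)
    (m : R3 R -> R) (f psi : R3 R -> R) : R :=
  pairing f (F (fun xi => m xi * psi xi)).

Definition power_nonlinearity (N : nat) (v : R3 R -> R) : R3 R -> R :=
  fun x => `|v x| ^+ N * v x.

(* Mild solution on [0, +oo[ of u_tt - Delta u + (-1)^b |u|^N u = 0.  The
   Duhamel formula is an equality of tempered distributions for every t >= 0,
   written after Fourier transform, its time integral being a weak one. *)
Definition duhamel (F : (R3 R -> R) -> R3 R -> R) (N : nat) (b : bool)
    (u0 u1 : R3 R -> R) (u : R -> R3 R -> R) : Prop :=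
  forall (t : R) (psi : R3 R -> R), 0 <= t -> schwartz psi ->
  let source s :=
    multiplier_ft F (sin_symbol (t - s)) (power_nonlinearity N (u s)) psi in
  lebesgue_measure.-integrable `[0, t] (EFin \o source) /\
  pairing (u t) (F psi) =
    multiplier_ft F (cos_symbol t) u0 psi +
    multiplier_ft F (sin_symbol t) u1 psi -
    (-1) ^+ b * Rintegral lebesgue_measure `[0, t] source.

Definition global_mild_solution (N : nat) (b : bool)
    (u0 u1 : R3 R -> R) (u : R -> R3 R -> R) : Prop :=
  [/\ measurable_fun ((`[0, +oo[ : set (measurableTypeR R)) `*` [set: R3meas R])
        (fun z => u z.1 z.2),
      forall t, 0 <= t -> tempered (u t),
      {ae lebesgue_measure, forall s, 0 <= s -> tempered (power_nonlinearity N (u s))},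
      duhamel fourier_re N b u0 u1 u
    & duhamel fourier_im N b u0 u1 u].

Definition LpLq_norm (p : R) (q : \bar R) (u : R -> R3 R -> R) : \bar R :=
  ((\int[lebesgue_measure]_(t in `[0%R, +oo[) ('N[leb3]_q [EFin \o u t] `^ p)) `^ p^-1)%E.

End Space.

(* Main.v *)
(* Write a radial function as [V |x| / |x|] with an odd profile [V]; the wave equation then
   becomes one-dimensional.  If [G] is the radial derivative of [u0], being outgoing means
   [(r u0)' = - r u1], so that the incoming half of d'Alembert's formula cancels and the linear
   solution is [v (|x| - t) / |x|] with [v r = r u0 r].  By Cauchy-Schwarz applied to
   [u0 r = - \int_r^oo G], [|v r| <= D sqrt r] where [D] is a multiple of the H1dot norm, and since
   [v] lives in [r > R] the linear solution is at most [sqrt 2 * D * (|x| + t + R) ^ (- 1 / 2)].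
   The Duhamel term is integrated over the backward light cone, where [s + |y| + R >= s + R] turns
   the surplus power of the weight [(|y| + s + R) ^ (- 1 / 2)] into an integrable function of [s]:
   it is a contraction for this weight as soon as [D ^ N * R ^ (- (N - 4) / 2)] is small.  The
   solution is then bounded by a multiple of [D * (t + R) ^ (- 1 / 2)], whose [L ^ (N / 2)] norm in
   [t] is finite because [N > 4].
   In the weak Duhamel formula the wave multipliers fall on the test function: the Fourier transform
   of a radial function is the sine transform of its odd profile, on which they act by
   averages and translations, and Fourier transforms of multiplier times Schwartz function are
   [O (|x| ^ - 3)], which is enough to test non-integrable profiles. *)
Require Import Defs.
From mathcomp Require Import all_boot all_order all_algebra.
From mathcomp Require Import all_classical all_reals all_analysis.
From mathcomp Require Import measurable_realfun ess_sup_inf ring lra zify.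

Import Order.TTheory GRing.Theory Num.Theory.
Import numFieldNormedType.Exports.

Local Open Scope classical_set_scope.
Local Open Scope ring_scope.

Set Implicit Arguments.
Unset Strict Implicit.
Unset Printing Implicit Defensive.

(** * Integrals of real functions *)

Section RealIntegrals.
Context {d} {T : measurableType d} {R : realType}.
Implicit Types (m : {measure set T -> \bar R}) (f g : T -> R).

(** The data are known only almost everywhere and the gradient of [u0] only against test functions,
    so the reduction to one dimension is made under the integral sign: radial test fields show that
    the profile of [u0] is a primitive of [G], and the outgoing condition is integrated rather than
    differentiated. That condition also supplies the missing boundary value at infinity: with
    Cauchy-Schwarz for [u1] it gives [u0 = O(r^(-1/2))] with an uncontrolled constant, just enough
    to rewrite [u0 r] as an integral of [G] from [r] to infinity. Decay for multiplier times
    Schwartz function is obtained without differentiating the symbols: [sin(t|xi|)/|xi|] is a limit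
    of Fourier transforms of thin shells, as in Kirchhoff's formula, so its effect on a transform is
    an average over points at distance about [t]. Decay of order 3 is matched to profiles that are
    integrable against [(1 + r)^-2], which leaves room for the growth [sqrt r]. The smallness
    condition comes from scaling: with [K] proportional to the norm [B], the contraction factor is a
    multiple of [K^N rho^(-(N-4)/2)], hence of the power [N/2] of [B^2 rho^(4/N-1)]. *)

Definition integ m f := m.-integrable setT (EFin \o f).

Lemma integ_meas m f : integ m f -> measurable_fun setT f.
Proof. by move=> /measurable_int /measurable_EFinP. Qed.

Lemma integ_le m f g : measurable_fun setT f -> integ m g ->
  (forall x, `|f x| <= g x) -> integ m f.
Proof.
move=> mf ig fg; apply: (le_integrable measurableT _ _ ig).
  exact/measurable_EFinP.
by move=> x _ /=; rewrite lee_fin (le_trans (fg x)) // ler_norm.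
Qed.

Lemma integP m f : measurable_fun setT f ->
  (\int[m]_x (`|f x|)%:E < +oo)%E -> integ m f.
Proof. by move=> mf h; apply/integrableP; split => //; exact/measurable_EFinP. Qed.

Lemma integ_lty m f : integ m f -> (\int[m]_x (`|f x|)%:E < +oo)%E.
Proof. by move=> /integrableP[]. Qed.

Lemma integ_abs m f : integ m f -> integ m (fun x => `|f x|).
Proof. exact: integrable_norm. Qed.

Lemma integD m f g : integ m f -> integ m g -> integ m (fun x => f x + g x).
Proof. by move=> hf hg; exact: (integrableD measurableT hf hg). Qed.

Lemma integB m f g : integ m f -> integ m g -> integ m (fun x => f x - g x).
Proof. by move=> hf hg; exact: (integrableB measurableT hf hg). Qed.

Lemma integZ m (k : R) f : integ m f -> integ m (fun x => k * f x).
Proof. by move=> hf; exact: (integrableZl measurableT k hf). Qed.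

Lemma integN m f : integ m f -> integ m (fun x => - f x).
Proof. by move=> hf; exact: (integrableN hf). Qed.

Lemma integ_ext m f g : f =1 g -> integ m f -> integ m g.
Proof. by move=> /funext ->. Qed.

Lemma integ_bndM m f g (M : R) : integ m f -> measurable_fun setT g ->
  (forall x, `|g x| <= M) -> integ m (fun x => g x * f x).
Proof.
move=> hf mg gM; apply: (@integ_le _ _ (fun x => M * `|f x|)).
- by apply: measurable_funM => //; exact: integ_meas hf.
- exact/integZ/integ_abs.
- by move=> x; rewrite normrM ler_wpM2r.
Qed.

Lemma EFin_Rint m f : integ m f ->
  (Rintegral m setT f)%:E = (\int[m]_x (f x)%:E)%E.
Proof. by move=> h; rewrite /Rintegral fineK //; exact: integrable_fin_num. Qed.

Lemma Rint_ext m f g : f =1 g -> Rintegral m setT f = Rintegral m setT g.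
Proof. by move=> /funext ->. Qed.

Lemma RintD m f g : integ m f -> integ m g ->
  Rintegral m setT (fun x => f x + g x) = Rintegral m setT f + Rintegral m setT g.
Proof. by move=> hf hg; rewrite RintegralD. Qed.

Lemma RintB m f g : integ m f -> integ m g ->
  Rintegral m setT (fun x => f x - g x) = Rintegral m setT f - Rintegral m setT g.
Proof. by move=> hf hg; rewrite RintegralB. Qed.

Lemma RintZ m (k : R) f : integ m f ->
  Rintegral m setT (fun x => k * f x) = k * Rintegral m setT f.
Proof. by move=> hf; rewrite RintegralZl. Qed.

Lemma RintN m f : integ m f ->
  Rintegral m setT (fun x => - f x) = - Rintegral m setT f.
Proof.
move=> hf; rewrite -mulN1r -RintZ //; apply: Rint_ext => x; by rewrite mulN1r.
Qed.

Lemma Rint0 m : Rintegral m setT (fun=> 0 : R) = 0.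
Proof. by rewrite Rintegral_cst // mul0r. Qed.

Lemma Rint_ge0 m f : (forall x, 0 <= f x) -> 0 <= Rintegral m setT f.
Proof. by move=> h; apply: Rintegral_ge0 => x _. Qed.

Lemma Rint_le m f g : integ m f -> integ m g -> (forall x, f x <= g x) ->
  Rintegral m setT f <= Rintegral m setT g.
Proof. by move=> hf hg fg; apply: le_Rintegral => // x _. Qed.

Lemma Rint_norm_le m f g : integ m f -> integ m g -> (forall x, `|f x| <= g x) ->
  `|Rintegral m setT f| <= Rintegral m setT g.
Proof.
move=> hf hg fg; apply: (le_trans (le_normr_Rintegral measurableT hf)).
by apply: Rint_le => //; exact: integ_abs.
Qed.

Lemma Rint_norm_ub m f g : measurable_fun setT f -> integ m g ->
  (forall x, `|f x| <= g x) -> `|Rintegral m setT f| <= Rintegral m setT g.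
Proof. by move=> mf hg fg; apply: Rint_norm_le => //; exact: integ_le hg fg. Qed.

Lemma integ_ae m f g : integ m f -> measurable_fun setT g ->
  {ae m, forall x, f x = g x} -> integ m g.
Proof.
move=> hf mg fg; have mf := integ_meas hf; apply: integP => //.
rewrite (@ae_eq_integral _ _ _ m setT (fun x => (`|f x|)%:E)) //.
- exact: integ_lty.
- by apply/measurable_EFinP; exact: measurableT_comp.
- by apply/measurable_EFinP; exact: measurableT_comp.
- by apply: filterS fg => x -> _.
Qed.

Lemma Rint_ae m f g : measurable_fun setT f -> measurable_fun setT g ->
  {ae m, forall x, f x = g x} -> Rintegral m setT f = Rintegral m setT g.
Proof.
move=> mf mg fg; rewrite /Rintegral; congr fine; apply: ae_eq_integral => //.
- exact/measurable_EFinP.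
- exact/measurable_EFinP.
- by apply: filterS fg => x /= -> _.
Qed.

Lemma Rint_dominated m (F : nat -> T -> R) f g :
  (forall n, measurable_fun setT (F n)) -> measurable_fun setT f -> integ m g ->
  {ae m, forall x, (F n x @[n --> \oo] --> f x)} ->
  (forall n x, `|F n x| <= g x) ->
  integ m f /\ (Rintegral m setT (F n) @[n --> \oo] --> Rintegral m setT f).
Proof.
move=> mF mf ig Ff Fg.
have [|||||] := @dominated_convergence _ _ _ m setT measurableT
  (fun n => EFin \o F n) (EFin \o f) (EFin \o g).
- by move=> n; exact/measurable_EFinP.
- exact/measurable_EFinP.
- apply: filterS Ff => x Hx _; exact: cvg_EFin (nearW _ _) Hx.
- exact: ig.
- by apply: aeW => x n _ /=; rewrite lee_fin.
move=> h1 _ h3; split => //.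
by have := fine_cvg; apply; rewrite fineK ?integrable_fin_num.
Qed.

End RealIntegrals.

(** * Fubini and Tonelli for real-valued integrals *)

Section Products.
Context {d1 d2} {T1 : measurableType d1} {T2 : measurableType d2} {R : realType}.
Context (m1 : {sigma_finite_measure set T1 -> \bar R})
  (m2 : {sigma_finite_measure set T2 -> \bar R}).
Implicit Types f : T1 * T2 -> R.

Lemma Fubini_integ1 f : integ (m1 \x m2)%E f ->
  integ m1 (fun x => Rintegral m2 setT (fun y => f (x, y))).
Proof.
move=> hf; have h := integrable_fubini_F hf.
have mh : measurable_fun setT (fun x => Rintegral m2 setT (fun y => f (x, y))).
  exact: measurableT_comp (@fine_measurable _ _ _) (measurable_int _ h).
apply: integP => //.
case/integrableP: (h) => _; apply: le_lt_trans.
apply: ge0_le_integral => //.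
- by apply/measurable_EFinP; exact: measurableT_comp.
- by apply: measurableT_comp => //; exact: measurable_int h.
- move=> x _; rewrite /Rintegral /fubini_F /=.
  by case: (\int[m2]_y (f (x, y))%:E)%E => [r|//|//] /=; rewrite ?leey.
Qed.

Lemma Fubini1 f : integ (m1 \x m2)%E f ->
  Rintegral (m1 \x m2)%E setT f =
  Rintegral m1 setT (fun x => Rintegral m2 setT (fun y => f (x, y))).
Proof.
move=> hf; have h := integrable_fubini_F hf.
rewrite {1}/Rintegral -(integral12_prod_meas1 hf) {1}/Rintegral; congr fine.
apply: ae_eq_integral => //.
- exact: measurable_int h.
- apply/measurable_EFinP.
  exact: integ_meas (Fubini_integ1 hf).
- have := integrable_ae measurableT h.
  by apply: filterS => x /(_ I) fx _; rewrite fineK.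
Qed.

Lemma integrable_fubini_G_real f : integ (m1 \x m2)%E f ->
  m2.-integrable setT (fubini_G m1 (EFin \o f)).
Proof.
move=> hf; have mG := measurable_fubini_G hf.
apply/integrableP; split => //.
have := (integrable21ltyP m1 m2 (measurable_int _ hf)).1 hf.
apply: le_lt_trans; apply: ge0_le_integral => //.
- exact: measurableT_comp.
- apply: (@measurable_fun_fubini_tonelli_G _ _ _ _ _ m1
    (fun z => `|(EFin \o f) z|)%E) => //.
  by apply: measurableT_comp => //; exact: measurable_int hf.
- move=> y _; apply: le_abse_integral => //.
  by apply: measurableT_comp (measurable_int _ hf) _; exact: measurable_pair2.
Qed.

Lemma Fubini_integ2 f : integ (m1 \x m2)%E f ->
  integ m2 (fun y => Rintegral m1 setT (fun x => f (x, y))).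
Proof.
move=> hf; have h := integrable_fubini_G_real hf.
have mh : measurable_fun setT (fun y => Rintegral m1 setT (fun x => f (x, y))).
  exact: measurableT_comp (@fine_measurable _ _ _) (measurable_int _ h).
apply: integP => //.
case/integrableP: (h) => _; apply: le_lt_trans.
apply: ge0_le_integral => //.
- by apply/measurable_EFinP; exact: measurableT_comp.
- by apply: measurableT_comp => //; exact: measurable_int h.
- move=> x _; rewrite /Rintegral /fubini_G /=.
  by case: (\int[m1]_y (f (y, x))%:E)%E => [r|//|//] /=; rewrite ?leey.
Qed.

Lemma Fubini2 f : integ (m1 \x m2)%E f ->
  Rintegral (m1 \x m2)%E setT f =
  Rintegral m2 setT (fun y => Rintegral m1 setT (fun x => f (x, y))).
Proof.
move=> hf; have h := integrable_fubini_G_real hf.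
rewrite {1}/Rintegral -(integral21_prod_meas1 hf) {1}/Rintegral; congr fine.
apply: ae_eq_integral => //.
- exact: measurable_int h.
- apply/measurable_EFinP.
  exact: integ_meas (Fubini_integ2 hf).
- have := integrable_ae measurableT h.
  by apply: filterS => x /(_ I) fx _; rewrite fineK.
Qed.

Lemma Fubini_swap f : integ (m1 \x m2)%E f ->
  Rintegral m1 setT (fun x => Rintegral m2 setT (fun y => f (x, y))) =
  Rintegral m2 setT (fun y => Rintegral m1 setT (fun x => f (x, y))).
Proof. by move=> hf; rewrite -Fubini1 // Fubini2. Qed.

Lemma integ_prod f (G : T1 -> R) : measurable_fun setT f ->
  integ m1 G ->
  (forall x, (\int[m2]_y (`|f (x, y)|)%:E <= (G x)%:E)%E) ->
  integ (m1 \x m2)%E f.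
Proof.
move=> mf hG h.
have mf' : measurable_fun setT (EFin \o f) by exact/measurable_EFinP.
apply: (integrable12ltyP m1 m2 mf').2.
apply: le_lt_trans (integ_lty hG).
apply: ge0_le_integral => //.
- by move=> x _; exact: integral_ge0.
- apply: (@measurable_fun_fubini_tonelli_F _ _ _ _ _ m2
    (fun z => (`|f z|)%:E)) => //.
  by apply/measurable_EFinP; exact: measurableT_comp.
- apply/measurable_EFinP; apply: measurableT_comp => //; exact: integ_meas hG.
- move=> x _ /=; apply: (le_trans (h x)); by rewrite lee_fin ler_norm.
Qed.

Lemma integ_prodM f (G : T1 -> R) (H : T2 -> R) : measurable_fun setT f ->
  integ m1 G -> integ m2 H ->
  (forall x y, `|f (x, y)| <= G x * H y) -> integ (m1 \x m2)%E f.
Proof.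
move=> mf hG hH h.
apply: (@integ_prod _ (fun x => `|G x| * Rintegral m2 setT (fun y => `|H y|))) => //.
  apply: (@integ_ext _ _ _ _ (fun x => Rintegral m2 setT (fun y => `|H y|) * `|G x|)).
    by move=> x; rewrite mulrC.
  exact/integZ/integ_abs.
move=> x.
have iH : integ m2 (fun y => `|G x| * `|H y|) by apply/integZ/integ_abs.
rewrite -RintZ ?EFin_Rint //; last exact: integ_abs.
apply: ge0_le_integral => //.
- apply/measurable_EFinP; apply: measurableT_comp => //.
  exact: measurableT_comp.
- by apply/measurable_EFinP; exact: integ_meas iH.
- by move=> y _; rewrite lee_fin (le_trans (h x y)) // -normrM ler_norm.
Qed.

(** Integrability is not assumed: the parameter integral is [fine] of a difference of two Tonelli
    integrals, which is measurable even where one of them is infinite. Parameter integrals such as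
    [avg] and [duh] are therefore measurable everywhere before any bound on them is known. *)
Lemma measurable_Rint1 f : measurable_fun setT f ->
  measurable_fun setT (fun x => Rintegral m2 setT (fun y => f (x, y))).
Proof.
move=> mf.
have mf' : measurable_fun setT (EFin \o f) by exact/measurable_EFinP.
have mp : measurable_fun setT (fun x => \int[m2]_y ((EFin \o f)^\+ (x, y)))%E.
  by apply: measurable_fun_fubini_tonelli_F => //; exact: measurable_funepos.
have mn : measurable_fun setT (fun x => \int[m2]_y ((EFin \o f)^\- (x, y)))%E.
  by apply: measurable_fun_fubini_tonelli_F => //; exact: measurable_funeneg.
have h : measurable_fun setT (fun x => \int[m2]_y (f (x, y))%:E)%E.
  rewrite [X in measurable_fun _ X](_ : _ = fun x =>
    (\int[m2]_y ((EFin \o f)^\+ (x, y)) - \int[m2]_y ((EFin \o f)^\- (x, y)))%E).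
    exact: emeasurable_funB.
  apply/funext => x; rewrite [LHS]integralE.
  by congr (_ - _)%E; apply: eq_integral => y _; rewrite ?funeposE ?funenegE.
exact: measurableT_comp (@fine_measurable _ _ _) h.
Qed.

End Products.

(** * Measure-preserving maps *)

Section MeasurePreserving.
Context {d1 d2} {T1 : measurableType d1} {T2 : measurableType d2} {R : realType}.
Context (m1 : {measure set T1 -> \bar R}) (m2 : {measure set T2 -> \bar R}) (phi : T1 -> T2).

Definition measure_preserving := measurable_fun setT phi /\
  forall A, measurable A -> m1 (phi @^-1` A) = m2 A.

Context (mp : measure_preserving).

Lemma mp_ge0_integral (f : T2 -> \bar R) : measurable_fun setT f ->
  (forall y, 0 <= f y)%E -> (\int[m1]_x f (phi x) = \int[m2]_y f y)%E.
Proof.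
case: mp => mphi hphi mf f0.
have h := @ge0_integral_pushforward _ _ _ _ _ _ mphi m1 setT f measurableT mf
  (fun y _ => f0 y).
rewrite preimage_setT in h; rewrite -[LHS]h.
by apply: eq_measure_integral => A mA _; exact: hphi.
Qed.

Lemma mp_integ (f : T2 -> R) : integ m2 f -> integ m1 (f \o phi).
Proof.
move=> hf; have mf := integ_meas hf; apply: integP.
  by apply: measurableT_comp => //; case: mp.
rewrite (@mp_ge0_integral (fun y => (`|f y|)%:E)) //; first exact: integ_lty.
by apply/measurable_EFinP; exact: measurableT_comp.
Qed.

(** The positive and negative parts are transported separately, so measurability of [f] is enough
    and no integrability has to be carried along. *)
Lemma mp_Rint (f : T2 -> R) : measurable_fun setT f ->
  Rintegral m1 setT (fun x => f (phi x)) = Rintegral m2 setT f.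
Proof.
move=> mf; rewrite /Rintegral integralE [in RHS]integralE.
have mf' : measurable_fun setT (EFin \o f) by exact/measurable_EFinP.
have hp : (\int[m1]_x (EFin \o f)^\+ (phi x) = \int[m2]_y (EFin \o f)^\+ y)%E.
  by apply: mp_ge0_integral => //; exact: measurable_funepos.
have hn : (\int[m1]_x (EFin \o f)^\- (phi x) = \int[m2]_y (EFin \o f)^\- y)%E.
  by apply: mp_ge0_integral => //; exact: measurable_funeneg.
rewrite -[in RHS]hp -[in RHS]hn.
by congr (fine (_ - _)); apply: eq_integral => y _; rewrite ?funeposE ?funenegE.
Qed.

End MeasurePreserving.

(** * Rotations and polar coordinates in R^3 *)

Section ProductPreserving.
Context {d1 d2} {T1 : measurableType d1} {T2 : measurableType d2} {R : realType}.
Context (m1 : {sigma_finite_measure set T1 -> \bar R})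
  (m2 : {sigma_finite_measure set T2 -> \bar R}).

(** A map that moves one coordinate only, preserving the measure on every fibre, preserves the
    product measure: this is what makes shears of space measure-preserving. *)
Lemma mp_prod_r (F : T1 * T2 -> T2) : measurable_fun setT F ->
  (forall x, measure_preserving m2 m2 (fun y => F (x, y))) ->
  measure_preserving (m1 \x m2)%E (m1 \x m2)%E (fun z => (z.1, F z)).
Proof.
move=> mF hF.
have mphi : measurable_fun setT (fun z : T1 * T2 => (z.1, F z)).
  by apply: measurable_fun_pair.
split=> // A mA; apply: eq_integral => x _ /=.
have -> : xsection ((fun z : T1 * T2 => (z.1, F z)) @^-1` A) x =
    (fun y => F (x, y)) @^-1` (xsection A x).
  by apply/seteqP; split=> y; rewrite /xsection /= !inE.
by have [_ ->] := hF x; last exact: measurable_xsection.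
Qed.

(** The product measure is defined through sections at fixed first coordinate. Tonelli, applied to
    an indicator, gives the other description, used for maps that move the first coordinate. *)
Lemma prod_measure_ysection A : measurable A ->
  (m1 \x m2)%E A = (\int[m2]_y m1 (ysection A y))%E.
Proof.
move=> mA; rewrite -[A in LHS]setIT -integral_indic //.
rewrite fubini_tonelli2 //; last first.
  by apply/measurable_EFinP; exact: measurable_indic.
rewrite /fubini_G; apply: eq_integral => y _.
have my : measurable (ysection A y) by exact: measurable_ysection.
rewrite -[in RHS](setIT (ysection A y)) -(integral_indic m1 measurableT my).
apply: eq_integral => x _; congr EFin; rewrite !indicE; congr (nat_of_bool _)%:R.
by rewrite mem_ysection.
Qed.

Lemma mp_prod_l (F : T1 * T2 -> T1) : measurable_fun setT F ->
  (forall y, measure_preserving m1 m1 (fun x => F (x, y))) ->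
  measure_preserving (m1 \x m2)%E (m1 \x m2)%E (fun z => (F z, z.2)).
Proof.
move=> mF hF.
have mphi : measurable_fun setT (fun z : T1 * T2 => (F z, z.2)).
  by apply: measurable_fun_pair.
split=> // A mA.
have mA' : measurable ((fun z : T1 * T2 => (F z, z.2)) @^-1` A).
  by rewrite -[X in measurable X]setTI; exact: mphi.
apply: etrans (prod_measure_ysection mA') _; apply: etrans (esym (prod_measure_ysection mA)).
apply: eq_integral => y _ /=.
have -> : ysection ((fun z : T1 * T2 => (F z, z.2)) @^-1` A) y =
    (fun x => F (x, y)) @^-1` (ysection A y).
  by apply/seteqP; split=> x; rewrite /ysection /= !inE.
by have [_ ->] := hF y; last exact: measurable_ysection.
Qed.

End ProductPreserving.

Lemma mp_comp d1 d2 d3 (T1 : measurableType d1) (T2 : measurableType d2)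
    (T3 : measurableType d3) (R : realType) (m1 : {measure set T1 -> \bar R})
    (m2 : {measure set T2 -> \bar R}) (m3 : {measure set T3 -> \bar R})
    (f : T1 -> T2) (g : T2 -> T3) :
  measure_preserving m1 m2 f -> measure_preserving m2 m3 g ->
  measure_preserving m1 m3 (g \o f).
Proof.
move=> [mf hf] [mg hg]; split; first exact: measurableT_comp.
by move=> A mA; rewrite -hg // -hf // -[X in measurable X]setTI; exact: mg.
Qed.

Section Geometry.
Context {R : realType}.
Notation mu := (@lebesgue_measure R).
Implicit Types (x xi : R3 R) (a b : R).

Lemma lebesgue_shift a : measure_preserving mu mu (fun x : R => x + a).
Proof.
have mphi : measurable_fun setT (fun x : measurableTypeR R => x + a : measurableTypeR R).
  by apply: measurable_funD => //; exact: measurable_cst.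
split=> // A mA.
suff : mu A = pushforward mu (fun x : measurableTypeR R => x + a : measurableTypeR R) A by [].
apply: lebesgue_measure_unique => // X [[u v] /= _ <-].
rewrite /pushforward /=.
have -> : (fun x : R => x + a) @^-1` `]u, v] = `]u - a, v - a]%classic.
  by apply/seteqP; split=> y /=; rewrite !in_itv /= lerBrDr ltrBlDr.
rewrite !lebesgue_measure_itv /= !lte_fin ltrD2r.
by case: ifPn => // _; rewrite -!EFinB; congr EFin; lra.
Qed.

Lemma lebesgue_scale a A : 0 < a -> measurable A ->
  mu ((fun x : R => a * x) @^-1` A) = (a^-1%:E * mu A)%E.
Proof.
move=> a0 mA.
have mphi : measurable_fun setT (fun x : measurableTypeR R => a * x : measurableTypeR R).
  by apply: measurable_funM => //; exact: measurable_cst.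
suff -> : mu A = mscale (NngNum (ltW a0))
    (pushforward mu (fun x : measurableTypeR R => a * x : measurableTypeR R)) A.
  by rewrite /mscale /pushforward /= muleA -EFinM mulVf ?gt_eqF // mul1e.
move=> m; apply: lebesgue_measure_unique => // X [[u v] /= _ <-].
rewrite /mscale /= /pushforward.
have -> : (fun x : R => a * x) @^-1` `]u, v] = `]u / a, v / a]%classic.
  by apply/seteqP; split=> y /=; rewrite !in_itv /= ler_pdivlMr // ltr_pdivrMr // ![a * y]mulrC.
rewrite !lebesgue_measure_itv /= !lte_fin ltr_pM2r ?invr_gt0 //.
case: ifPn => // _; last by rewrite mule0.
by rewrite -!EFinB -EFinM; congr EFin; rewrite -mulrBl mulrC divfK ?gt_eqF.
Qed.

Lemma dot3E x y : dot3 x y = x.1.1 * y.1.1 + x.1.2 * y.1.2 + x.2 * y.2.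
Proof. by rewrite /dot3 !big_ord_recl big_ord0 /coord3 /= addr0 addrA. Qed.

Lemma euclidE x : euclid x = Num.sqrt (x.1.1 ^+ 2 + x.1.2 ^+ 2 + x.2 ^+ 2).
Proof. by rewrite /euclid dot3E !expr2. Qed.

Lemma euclid_ge0 x : 0 <= euclid x. Proof. exact: sqrtr_ge0. Qed.

Lemma euclid_sqr x : euclid x ^+ 2 = x.1.1 ^+ 2 + x.1.2 ^+ 2 + x.2 ^+ 2.
Proof. by rewrite euclidE sqr_sqrtr // !addr_ge0 // sqr_ge0. Qed.

Definition shear_y2 (t : R) x : R3 R := ((x.1.1, x.1.2 + t * x.2), x.2).
Definition shear_y1 (t : R) x : R3 R := ((x.1.1 + t * x.2, x.1.2), x.2).
Definition shear_z1 (t : R) x : R3 R := (x.1, x.2 + t * x.1.1).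
Definition shear_z2 (t : R) x : R3 R := (x.1, x.2 + t * x.1.2).

Lemma leb2_shift_r a : measure_preserving leb2 leb2 (fun p : R * R => (p.1, p.2 + a)).
Proof.
apply: (@mp_prod_r _ _ _ _ R mu mu (fun p : measurableTypeR R * measurableTypeR R => p.2 + a)).
  by apply: measurable_funD => //; exact: measurable_cst.
by move=> y; exact: lebesgue_shift.
Qed.

Lemma leb2_shift_l a : measure_preserving leb2 leb2 (fun p : R * R => (p.1 + a, p.2)).
Proof.
apply: (@mp_prod_l _ _ _ _ R mu mu (fun p : measurableTypeR R * measurableTypeR R => p.1 + a)).
  by apply: measurable_funD => //; exact: measurable_cst.
by move=> y; exact: lebesgue_shift.
Qed.

Lemma shear_y2_mp t : measure_preserving leb3 leb3 (shear_y2 t).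
Proof.
apply: (@mp_prod_l _ _ _ _ R leb2 mu
  (fun x : R3meas R => (x.1.1, x.1.2 + t * x.2) : measurableTypeR R * measurableTypeR R)).
  apply: measurable_fun_pair => /=; first exact: measurableT_comp measurable_fst _.
  apply: measurable_funD; first exact: measurableT_comp measurable_snd _.
  by apply: measurable_funM => //; exact: measurable_cst.
by move=> z; exact: (leb2_shift_r (t * z)).
Qed.

Lemma shear_y1_mp t : measure_preserving leb3 leb3 (shear_y1 t).
Proof.
apply: (@mp_prod_l _ _ _ _ R leb2 mu
  (fun x : R3meas R => (x.1.1 + t * x.2, x.1.2) : measurableTypeR R * measurableTypeR R)).
  apply: measurable_fun_pair => /=; last exact: measurableT_comp measurable_snd _.
  apply: measurable_funD; first exact: measurableT_comp measurable_fst _.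
  by apply: measurable_funM => //; exact: measurable_cst.
by move=> z; exact: (leb2_shift_l (t * z)).
Qed.

Lemma shear_z1_mp t : measure_preserving leb3 leb3 (shear_z1 t).
Proof.
apply: (@mp_prod_r _ _ _ _ R leb2 mu (fun x : R3meas R => x.2 + t * x.1.1)).
  apply: measurable_funD => //; apply: measurable_funM; first exact: measurable_cst.
  exact: measurableT_comp measurable_fst _.
by move=> z; exact: (lebesgue_shift (t * z.1)).
Qed.

Lemma shear_z2_mp t : measure_preserving leb3 leb3 (shear_z2 t).
Proof.
apply: (@mp_prod_r _ _ _ _ R leb2 mu (fun x : R3meas R => x.2 + t * x.1.2)).
  apply: measurable_funD => //; apply: measurable_funM; first exact: measurable_cst.
  exact: measurableT_comp measurable_snd _.
by move=> z; exact: (lebesgue_shift (t * z.2)).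
Qed.

Definition rot1 a b x : R3 R := ((a * x.1.1 - b * x.2, x.1.2), b * x.1.1 + a * x.2).
Definition rot2 a b x : R3 R := ((x.1.1, a * x.1.2 - b * x.2), b * x.1.2 + a * x.2).

(* A plane rotation is a product of three shears. *)
Lemma rot1_mp a b : 0 <= a -> a ^+ 2 + b ^+ 2 = 1 ->
  measure_preserving leb3 leb3 (rot1 a b).
Proof.
move=> a0 ab; have a1 : 1 + a != 0 by rewrite gt_eqF // ltr_pwDl.
(* [b / (1 + a)] is the tangent of the half angle; [0 <= a] keeps the angle away from pi, where it
   blows up. *)
have -> : rot1 a b = shear_y1 (- (b / (1 + a))) \o
    (shear_z1 b \o shear_y1 (- (b / (1 + a)))).
  apply/funext => -[[x y] z]; rewrite /rot1 /shear_y1 /shear_z1 /=.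
  have bE : b ^+ 2 = (1 + a) * (1 - a) by rewrite (_ : b ^+ 2 = 1 - a ^+ 2); [ring|rewrite -ab; ring].
  have E : b * (b / (1 + a)) = 1 - a.
    by rewrite mulrA -expr2 bE mulrAC mulfV // mul1r.
  congr ((_, _), _).
    rewrite (_ : x + _ + _ = x * (1 - b * (b / (1 + a))) - b / (1 + a) * z *
      (1 + (1 - b * (b / (1 + a))))); last by ring.
    by rewrite E; field.
  rewrite (_ : z + _ = b * x + z * (1 - b * (b / (1 + a)))); last by ring.
  by rewrite E; ring.
exact: (mp_comp (mp_comp (shear_y1_mp _) (shear_z1_mp b)) (shear_y1_mp _)).
Qed.

Lemma rot2_mp a b : 0 <= a -> a ^+ 2 + b ^+ 2 = 1 ->
  measure_preserving leb3 leb3 (rot2 a b).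
Proof.
move=> a0 ab; have a1 : 1 + a != 0 by rewrite gt_eqF // ltr_pwDl.
have -> : rot2 a b = shear_y2 (- (b / (1 + a))) \o
    (shear_z2 b \o shear_y2 (- (b / (1 + a)))).
  apply/funext => -[[x y] z]; rewrite /rot2 /shear_y2 /shear_z2 /=.
  have bE : b ^+ 2 = (1 + a) * (1 - a) by rewrite (_ : b ^+ 2 = 1 - a ^+ 2); [ring|rewrite -ab; ring].
  have E : b * (b / (1 + a)) = 1 - a.
    by rewrite mulrA -expr2 bE mulrAC mulfV // mul1r.
  congr ((_, _), _).
    rewrite (_ : y + _ + _ = y * (1 - b * (b / (1 + a))) - b / (1 + a) * z *
      (1 + (1 - b * (b / (1 + a))))); last by ring.
    by rewrite E; field.
  rewrite (_ : z + _ = b * y + z * (1 - b * (b / (1 + a)))); last by ring.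
  by rewrite E; ring.
exact: (mp_comp (mp_comp (shear_y2_mp _) (shear_z2_mp b)) (shear_y2_mp _)).
Qed.

(** The unit vector orthogonal to [(u, v)] is unique up to sign when [(u, v)] is not 0; the sign is
    the one for which [a] is nonnegative, as the decomposition into shears asks. *)
Lemma rotation_killing (u v : R) : exists a b,
  [/\ 0 <= a, a ^+ 2 + b ^+ 2 = 1 & a * u + b * v = 0].
Proof.
have [h|h] := eqVneq (u ^+ 2 + v ^+ 2) 0.
  exists 1, 0; split=> //; first by ring.
  have : u ^+ 2 == 0 by move/eqP: h; rewrite paddr_eq0 ?sqr_ge0 // => /andP[].
  by rewrite sqrf_eq0 => /eqP ->; ring.
have h0 : 0 < u ^+ 2 + v ^+ 2 by rewrite lt_neqAle eq_sym h addr_ge0 // sqr_ge0.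
pose s := Num.sqrt (u ^+ 2 + v ^+ 2).
have s0 : 0 < s by rewrite sqrtr_gt0.
have s2 : s ^+ 2 = u ^+ 2 + v ^+ 2 by rewrite sqr_sqrtr // ltW.
have [v0|v0] := leP 0 v.
  exists (v / s), (- u / s); split.
  - by rewrite divr_ge0 // ltW.
  - by rewrite !exprMn !exprVn sqrrN -mulrDl s2 addrC divff.
  - by field; rewrite gt_eqF.
exists (- v / s), (u / s); split.
- by rewrite divr_ge0 ?oppr_ge0 // ltW.
- by rewrite !exprMn !exprVn sqrrN -mulrDl s2 addrC divff.
- by field; rewrite gt_eqF.
Qed.

(** Two plane rotations kill two coordinates of [xi] in turn. In the rotated variables the phase
    depends on the height [x.2] alone, which is the setting of cylindrical coordinates. The sign of
    [k] is left open, since only even functions of [k] will occur. *)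
Lemma rotate_to_axis xi : exists (Q : R3 R -> R3 R) (k : R),
  [/\ measure_preserving leb3 leb3 Q, forall x, euclid (Q x) = euclid x,
   forall x, dot3 (Q x) xi = k * x.2 & `|k| = euclid xi].
Proof.
case: xi => -[u v] w.
have [a [b [a0 ab1 abv]]] := rotation_killing v w.
pose w' := - b * v + a * w.
have [c [e [c0 ce1 ceu]]] := rotation_killing u w'.
pose k := - e * u + c * w'.
exists (rot2 a b \o rot1 c e), k; split.
- exact: (mp_comp (rot1_mp c0 ce1) (rot2_mp a0 ab1)).
- move=> [[x y] z]; rewrite !euclidE /=; congr Num.sqrt.
  rewrite (_ : _ + _ = (c * x - e * z) ^+ 2 + (a ^+ 2 + b ^+ 2) * (y ^+ 2 +
    (e * x + c * z) ^+ 2)); last by ring.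
  rewrite ab1 (_ : _ + _ = (c ^+ 2 + e ^+ 2) * (x ^+ 2 + z ^+ 2) + y ^+ 2); last by ring.
  by rewrite ce1; ring.
- move=> [[x y] z]; rewrite dot3E /=.
  rewrite (_ : _ + _ = (c * x - e * z) * u + y * (a * v + b * w) +
    (e * x + c * z) * w'); last by rewrite /w'; ring.
  rewrite abv (_ : _ + _ = x * (c * u + e * w') + (- e * u + c * w') * z); last by ring.
  by rewrite ceu mulr0 add0r.
- rewrite -sqrtr_sqr euclidE /=; congr Num.sqrt.
  have -> : k ^+ 2 = k ^+ 2 + (c * u + e * w') ^+ 2 by rewrite ceu; ring.
  rewrite (_ : k ^+ 2 + _ = (c ^+ 2 + e ^+ 2) * (u ^+ 2 + w' ^+ 2)); last by rewrite /k; ring.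
  rewrite ce1 mul1r.
  have -> : w' ^+ 2 = w' ^+ 2 + (a * v + b * w) ^+ 2 by rewrite abv; ring.
  rewrite (_ : u ^+ 2 + _ = u ^+ 2 + (a ^+ 2 + b ^+ 2) * (v ^+ 2 + w ^+ 2));
    last by rewrite /w'; ring.
  by rewrite ab1; ring.
Qed.

Lemma leb3_shift (y : R3 R) : measure_preserving leb3 leb3 (fun x => x + y).
Proof.
have h1 : measure_preserving leb3 leb3 (fun x => (x.1, x.2 + y.2)).
  apply: (@mp_prod_r _ _ _ _ R leb2 mu (fun x : R3meas R => x.2 + y.2)).
    by apply: measurable_funD => //; exact: measurable_cst.
  by move=> z; exact: (lebesgue_shift y.2).
have h2 : measure_preserving leb3 leb3 (fun x => ((x.1.1 + y.1.1, x.1.2 + y.1.2), x.2)).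
  apply: (@mp_prod_l _ _ _ _ R leb2 mu (fun x : R3meas R =>
    (x.1.1 + y.1.1, x.1.2 + y.1.2) : measurableTypeR R * measurableTypeR R)).
    apply: measurable_fun_pair; apply: measurable_funD;
      [exact: measurableT_comp measurable_fst _|exact: measurable_cst|
       exact: measurableT_comp measurable_snd _|exact: measurable_cst].
  move=> z; exact: (mp_comp (leb2_shift_r y.1.2) (leb2_shift_l y.1.1)).
exact: (mp_comp h1 h2).
Qed.

End Geometry.

(** * Measurability in space and the fundamental theorem of calculus *)

Section MeasurabilityAndFTC.
Context {R : realType}.
Notation mu := (@lebesgue_measure R).

Lemma measurable_pred d (T : measurableType d) (b : T -> bool) :
  measurable_fun setT b -> measurable [set x | b x].
Proof.
move=> mb; rewrite (_ : [set x | b x] = setT `&` b @^-1` [set true]); first exact: mb.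
by rewrite setTI; apply/seteqP; split => x /=; case: (b x).
Qed.

Lemma measurable_comp_cont d (T : measurableType d) (g : R -> R) (f : T -> R) :
  continuous g -> measurable_fun setT f -> measurable_fun setT (fun x => g (f x)).
Proof.
move=> /continuous_measurable_fun mg mf.
exact: (measurableT_comp (mg : measurable_fun setT g) mf).
Qed.

Lemma measurable_sqrt d (T : measurableType d) (f : T -> R) :
  measurable_fun setT f -> measurable_fun setT (fun x => Num.sqrt (f x)).
Proof. apply: measurable_comp_cont; exact: sqrt_continuous. Qed.

Lemma measurable_x1 : measurable_fun setT (fun x : R3meas R => x.1.1).
Proof. exact: measurableT_comp measurable_fst measurable_fst. Qed.

Lemma measurable_x2 : measurable_fun setT (fun x : R3meas R => x.1.2).
Proof. exact: measurableT_comp measurable_snd measurable_fst. Qed.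

Lemma measurable_x3 : measurable_fun setT (fun x : R3meas R => x.2).
Proof. exact: measurable_snd. Qed.

Lemma measurable_euclid : measurable_fun setT (fun x : R3meas R => euclid x).
Proof.
rewrite (_ : (fun x : R3meas R => euclid x) =
  (fun x => Num.sqrt (x.1.1 ^+ 2 + x.1.2 ^+ 2 + x.2 ^+ 2))); last first.
  by apply/funext => x; rewrite euclidE.
apply: measurable_sqrt; apply: measurable_funD; [apply: measurable_funD|].
- by apply: measurable_funX; exact: measurable_x1.
- by apply: measurable_funX; exact: measurable_x2.
- by apply: measurable_funX; exact: measurable_x3.
Qed.

Lemma measurable_comp_euclid (h : R -> R) : measurable_fun setT h ->
  measurable_fun setT (fun x : R3meas R => h (euclid x)).
Proof. by move=> mh; exact: measurableT_comp mh measurable_euclid. Qed.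

Lemma measurable_inv d (T : measurableType d) (f : T -> R) :
  measurable_fun setT f -> measurable_fun setT (fun x => (f x)^-1).
Proof.
move=> mf; have mV : measurable_fun setT (fun x : R => x^-1).
  (* The inverse is expressed by a real power of the nonnegative number [x ^+ 2]; at 0 both sides
     are 0. *)
  rewrite (_ : (fun x : R => x^-1) = (fun x => x * ((x ^+ 2) `^ (-1)))).
    apply: measurable_funM => //.
    exact: (measurableT_comp (@measurable_powR R (-1)) (@exprn_measurable R setT 2)).
  apply/funext => x; have [->|x0] := eqVneq x 0; first by rewrite invr0 mul0r.
  by rewrite powR_inv1 ?sqr_ge0 // expr2 invfM mulrA divff // mul1r.
exact: (measurableT_comp (mV : measurable_fun setT _) mf).
Qed.

Lemma continuous_of_derive (F f : R -> R) : (forall x : R, is_derive x 1 F (f x)) ->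
  continuous F.
Proof.
by move=> dF x; apply: differentiable_continuous; apply/derivable1_diffP; case: (dF x).
Qed.

Lemma FTC_itv (f F : R -> R) (a b : R) : a <= b ->
  (forall x : R, a <= x <= b -> {for x, continuous f}) ->
  (forall x : R, a <= x <= b -> is_derive x 1 F (f x)) ->
  (\int[mu]_(x in `[a, b]) (f x)%:E)%E = (F b - F a)%:E.
Proof.
rewrite le_eqVlt => /orP[/eqP <- _ _|ab cf dF]; first by rewrite set_itv1 integral_set1 subrr.
have cF (x : R) : a <= x <= b -> {for x, continuous F}.
  by move=> hx; apply: differentiable_continuous; apply/derivable1_diffP; case: (dF x hx).
have [aa bb] : a <= a <= b /\ a <= b <= b by rewrite !lexx ltW.
rewrite (@continuous_FTC2 _ f F) //.
- by apply: continuous_in_subspaceT => x; rewrite inE /= in_itv /=; exact: cf.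
- split.
  + by move=> x; rewrite in_itv /= => /andP[h1 h2]; case: (dF x) => //; rewrite !ltW.
  + exact: cvg_at_right_filter (cF a aa).
  + exact: cvg_at_left_filter (cF b bb).
- move=> x; rewrite in_itv /= => /andP[h1 h2]; rewrite derive1E.
  by have hx : a <= x <= b; [rewrite !ltW|case: (dF x hx)].
Qed.

Lemma FTC_real (f F : R -> R) (a b : R) : a <= b -> continuous f ->
  (forall x : R, is_derive x 1 F (f x)) ->
  (\int[mu]_(x in `[a, b]) (f x)%:E)%E = (F b - F a)%:E.
Proof. move=> ab cf dF; exact: (FTC_itv ab (fun x _ => cf x) (fun x _ => dF x)). Qed.

End MeasurabilityAndFTC.

(** The half-lines []-oo, b[] form a pi-system generating the Borel sets. Both laws are restricted
    to [[0, +oo[], which makes them finite on this system even if [f] or [g] is negative on a set of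
    infinite measure, as happens for [pin] below. *)
Lemma pushforward_nonneg_unique d (T : measurableType d) (R : realType)
    (m : {measure set T -> \bar R}) (f g : T -> measurableTypeR R)
    (mf : measurable_fun setT f) (mg : measurable_fun setT g) :
  (forall b : R, m [set x | 0 <= f x < b] = m [set x | 0 <= g x < b]) ->
  (forall b : R, (m [set x | (0 <= f x < b)%R] < +oo)%E) ->
  forall A : set R, measurable A -> A `<=` `[0, +oo[%classic ->
  m (f @^-1` A) = m (g @^-1` A).
Proof.
move=> fg foo A mA AD.
have mD0 : measurable (`[0, +oo[%classic : set (measurableTypeR R)) by exact: measurable_itv.
pose M h (mh : measurable_fun setT (h : T -> measurableTypeR R)) : {measure set (measurableTypeR R) -> \bar R} :=
  mrestr (measure_function_pushforward__canonical__measure_function_Measure m mh) mD0.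
have ME h mh B : M h mh B = m (h @^-1` (B `&` `[0, +oo[%classic)) by [].
have MA h mh : M h mh A = m (h @^-1` A) by rewrite ME; congr (m (h @^-1` _)); exact/setIidPl.
have Mb h mh b : M h mh `]-oo, b[%classic = m [set x | 0 <= h x < b].
  rewrite ME; congr (m _); apply/seteqP; split => x /=; rewrite !in_itv /= andbT.
    by move=> [-> ->].
  by move=> /andP[].
rewrite -(MA f mf) -(MA g mg).
apply: (@measure_unique _ R (measurableTypeR R) (@RGenInftyO.G R)
  (fun n => `]-oo, n%:R[%classic)) => //.
- exact: RGenInftyO.measurableE.
- move=> _ _ [x ->] [y ->]; exists (Num.min x y).
  apply/seteqP; split => t /=; rewrite !in_itv /= lt_min; first by move=> [-> ->].
  by move=> /andP[].
- by move=> n; exists n%:R.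
- apply/seteqP; split => x // _; exists (Num.truncn `|x|).+1 => //=.
  by rewrite in_itv /= (le_lt_trans (ler_norm x)) // truncnS_gt.
- by move=> _ [b ->]; rewrite !Mb.
- by move=> n; rewrite Mb.
Qed.

(** * Cylindrical and polar coordinates by comparison of laws *)

Section PolarCoordinates.
Context {R : realType}.
Notation mu := (@lebesgue_measure R).

Definition disk (s : R) : set (R * R) := [set p | p.1 ^+ 2 + p.2 ^+ 2 < s].

(** The number pi, kept as a measure: the estimates use it through its finiteness and positivity. *)
Definition disk_area : R := fine (leb2 (disk 1)).

Lemma measurable_disk s : measurable (disk s : set (measurableTypeR R * measurableTypeR R)).
Proof.
apply: (@measurable_pred _ (measurableTypeR R * measurableTypeR R)%type
  (fun p => p.1 ^+ 2 + p.2 ^+ 2 < s)).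
apply: measurable_fun_ltr; last exact: measurable_cst.
by apply: measurable_funD; apply: measurable_funX.
Qed.

Lemma integral_cst_itv (a b : R) (c : \bar R) : a <= b ->
  (\int[mu]_(x in [set` `[a, b]]) c = c * (b - a)%:E)%E.
Proof.
move=> ab; apply: etrans (integral_cst _ _ _) _ => //; congr (_ * _)%E.
apply: etrans (lebesgue_measure_itv _) _; rewrite /= lte_fin.
case: ltP => [_|h]; first by rewrite -EFinB.
by congr EFin; apply/esym/eqP; rewrite subr_eq0 eq_le ab h.
Qed.

Lemma leb2X (A B : set (measurableTypeR R)) : measurable A -> measurable B ->
  leb2 (A `*` B) = (mu A * mu B)%E.
Proof. exact: product_measure1E. Qed.

Lemma ge0_integral_scale (a : R) (f : R -> \bar R) : 0 < a ->
  measurable_fun setT f -> (forall x, 0 <= f x)%E ->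
  (\int[mu]_x f (a * x)%R = a^-1%:E * \int[mu]_x f x)%E.
Proof.
move=> a0 mf f0.
have ma : measurable_fun setT (fun x : measurableTypeR R => a * x : measurableTypeR R).
  by apply: measurable_funM => //; exact: measurable_cst.
have aV : 0 <= a^-1 by rewrite invr_ge0 ltW.
have h := @ge0_integral_pushforward _ _ _ _ _ _ ma mu setT f measurableT mf (fun y _ => f0 y).
rewrite preimage_setT in h; rewrite -[LHS]h.
rewrite (@eq_measure_integral _ _ _ setT (mscale (NngNum aV) mu)).
  by rewrite ge0_integral_mscale.
by move=> A mA _; rewrite /mscale /=; exact: lebesgue_scale.
Qed.

Lemma disk_le1 : (leb2 (disk 1) <= 4%:E)%E.
Proof.
have m1 : measurable (`[(-1), 1]%classic : set (measurableTypeR R)) by exact: measurable_itv.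
have -> : 4%:E = leb2 (`[(-1 : R), 1]%classic `*` `[(-1 : R), 1]%classic).
  rewrite leb2X // !lebesgue_measure_itv /= lte_fin ifT; last by lra.
  by rewrite -EFinB -EFinM; congr EFin; ring.
apply: le_measure; rewrite ?inE; [exact: measurable_disk|exact: measurableX|].
move=> [x y]; rewrite /disk /= => h; rewrite !in_itv /=.
have hx : x ^+ 2 <= 1 by have := sqr_ge0 y; lra.
have hy : y ^+ 2 <= 1 by have := sqr_ge0 x; lra.
by split; apply/andP; split; nra.
Qed.

Lemma disk_areaE : leb2 (disk 1) = disk_area%:E.
Proof.
rewrite /disk_area fineK // ge0_fin_numE //.
by apply: le_lt_trans disk_le1 _; rewrite ltry.
Qed.

Lemma disk_area_gt0 : 0 < disk_area.
Proof.
have m1 : measurable (`[0, 2^-1]%classic : set (measurableTypeR R)) by exact: measurable_itv.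
rewrite -lte_fin -disk_areaE.
apply: (@lt_le_trans _ _ (leb2 (`[0 : R, 2^-1]%classic `*` `[0 : R, 2^-1]%classic))).
  rewrite leb2X // !lebesgue_measure_itv /= lte_fin invr_gt0 ltr0n.
  by rewrite -EFinB -EFinM lte_fin; lra.
apply: le_measure; rewrite ?inE; [exact: measurableX|exact: measurable_disk|].
by move=> [x y] /=; rewrite !in_itv /= => -[/andP[? ?] /andP[? ?]]; rewrite /disk /=; nra.
Qed.

(** Dilation by [a = s^(-1/2)], once inside the sections and once in the outer variable; together
    they contribute [a^-2 = s], the squared radius. *)
Lemma measure_disk s : leb2 (disk s) = (Num.max 0 s * disk_area)%:E.
Proof.
have [s0|s0] := leP s 0.
  rewrite mul0r (_ : disk s = set0) ?measure0 //.
  apply/seteqP; split => -[x y] //=; rewrite /disk /= => h.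
  by have := sqr_ge0 x; have := sqr_ge0 y; lra.
pose a := (Num.sqrt s)^-1.
have a0 : 0 < a by rewrite invr_gt0 sqrtr_gt0.
have a2 : a ^+ 2 * s = 1 by rewrite exprVn sqr_sqrtr ?ltW // mulVf // gt_eqF.
have aV : a^-1 * a^-1 = s by rewrite -expr2 invrK sqr_sqrtr // ltW.
rewrite EFinM -disk_areaE -{2}aV EFinM -muleA.
have mD1 := measurable_disk 1.
have -> : leb2 (disk s) = (\int[mu]_x (fun x => mu (xsection (disk s) x)) x)%E by [].
have E x : mu (xsection (disk s) x) = (a^-1%:E * mu (xsection (disk 1) (a * x)%R))%E.
  rewrite -(lebesgue_scale a0); last exact: measurable_xsection.
  congr (mu _); apply/seteqP; split => y; rewrite /xsection /= !inE /disk /=.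
    by rewrite !exprMn -mulrDr -a2 ltr_pM2l // exprn_gt0.
  by rewrite !exprMn -mulrDr -a2 ltr_pM2l // exprn_gt0.
under eq_integral do rewrite E.
have mx : measurable_fun setT (fun x : measurableTypeR R => mu (xsection (disk 1) x)).
  exact: measurable_fun_xsection.
rewrite ge0_integralZl //; last 2 first.
- apply: (measurableT_comp mx); apply: measurable_funM => //; exact: measurable_cst.
- by rewrite lee_fin invr_ge0 ltW.
by congr (_ * _)%E; rewrite (ge0_integral_scale a0 mx).
Qed.

(** Density at [r] of the distance to the origin on the horizontal plane at height [z]: the part of
    that plane at distance less than [r] is a disk of area [disk_area * (r^2 - z^2)]. *)
Definition ring_weight (z r : R) : R := if `|z| <= r then 2 * disk_area * r else 0.

Lemma ring_weight_ge0 z r : 0 <= ring_weight z r.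
Proof.
rewrite /ring_weight; case: ifP => // h; rewrite mulr_ge0 ?(le_trans _ h) //.
by rewrite mulr_ge0 // ltW // disk_area_gt0.
Qed.

Lemma measurable_ring_weight :
  measurable_fun setT (fun p : measurableTypeR R * measurableTypeR R => ring_weight p.1 p.2).
Proof.
apply: measurable_fun_ifT; last exact: measurable_cst.
- apply: measurable_fun_ler => //.
  by apply: measurableT_comp => //; exact: measurable_fst.
- by apply: measurable_funM => //; exact: measurable_cst.
Qed.

(** A map of the plane built to have a prescribed law: on the region under the graph of
    [ring_weight z] it is the first coordinate, so its law there has density [ring_weight z]. The
    value -1 discards the rest of the plane. *)
Let pin (z : R) (p : R * R) : R :=
  if [&& `|z| <= p.1, 0 <= p.2 & p.2 <= ring_weight z p.1] then p.1 else -1.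

Let measurable_pin z :
  measurable_fun setT (pin z : measurableTypeR R * measurableTypeR R -> measurableTypeR R).
Proof.
apply: measurable_fun_ifT => //.
apply: measurable_and; first by apply: measurable_fun_ler => //; exact: measurable_cst.
apply: measurable_and; first by apply: measurable_fun_ler => //; exact: measurable_cst.
apply: measurable_fun_ler => //.
have h : measurable_fun setT
    (fun p : measurableTypeR R * measurableTypeR R => (z, p.1) : measurableTypeR R * measurableTypeR R).
  by apply: measurable_fun_pair => //; exact: measurable_cst.
exact: (measurableT_comp measurable_ring_weight h).
Qed.

Let dist (z : R) (p : R * R) : R := Num.sqrt (p.1 ^+ 2 + p.2 ^+ 2 + z ^+ 2).

Let measurable_dist z :
  measurable_fun setT (dist z : measurableTypeR R * measurableTypeR R -> measurableTypeR R).
Proof.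
apply: measurable_sqrt; apply: measurable_funD; last exact: measurable_cst.
by apply: measurable_funD; apply: measurable_funX.
Qed.

Let below (b : R) (f : R * R -> R) : set (R * R) := [set p | 0 <= f p < b].

Let xsection_pin z b x :
  mu (xsection (below b (pin z)) x) =
  (if (`|z| <= x) && (x < b) then ring_weight z x else 0)%:E.
Proof.
case: ifP => [/andP[zx xb]|h].
  have -> : xsection (below b (pin z)) x = `[0, ring_weight z x]%classic.
    apply/seteqP; split => y; rewrite /xsection /below /= !inE /= ?in_itv /= /pin /= zx /=.
      by case: ifP => // _; rewrite lerNr oppr0 ler10.
    by move=> h; rewrite ifT // xb (le_trans _ zx).
  rewrite lebesgue_measure_itv /= lte_fin; case: ltP => [_|h]; first by rewrite -EFinB subr0.
  by congr EFin; apply/eqP; rewrite eq_le h ring_weight_ge0.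
have -> : xsection (below b (pin z)) x = set0.
  apply/seteqP; split => y //; rewrite /xsection /below /= !inE /= /pin /=.
  case: ifP => [/and3P[zx _ _] /andP[_ xb]|_]; last by rewrite lerNr oppr0 ler10.
  by move: h; rewrite zx xb.
by rewrite measure0.
Qed.

Let below_pin z b : leb2 (below b (pin z)) =
  (if 0 <= b then Num.max 0 (b ^+ 2 - z ^+ 2) * disk_area else 0)%:E.
Proof.
have -> : leb2 (below b (pin z)) = (\int[mu]_x mu (xsection (below b (pin z)) x))%E by [].
under eq_integral do rewrite xsection_pin.
have [zb|bz] := leP `|z| b.
  rewrite (le_trans _ zb) //.
  have -> : (\int[mu]_x (if (`|z| <= x) && (x < b) then ring_weight z x else 0)%:E =
      \int[mu]_(x in [set` `[`|z|%R, b[%R]) (2 * disk_area * x)%:E)%E.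
    rewrite [RHS]integral_mkcond; apply: eq_integral => x _.
    rewrite patchE mem_setE in_itv /= /ring_weight.
    by case: (`|z| <= x) => //=; case: (x < b).
  rewrite integral_itv_bndo_bndc; last first.
    by apply/measurable_EFinP; apply: measurable_funM => //; exact: measurable_cst.
  have cf : continuous (fun x : R => 2 * disk_area * x).
    exact: mulrl_continuous.
  have dF (x : R) : is_derive x 1 (fun x => disk_area * x ^+ 2) (2 * disk_area * x).
    by apply: is_derive_eq; rewrite /GRing.scale /=; ring.
  rewrite (FTC_real zb cf dF) max_r; last first.
    by rewrite subr_ge0 -(real_normK (num_real z)) lerXn2r // nnegrE // (le_trans _ zb).
  by congr EFin; rewrite real_normK ?num_real //; ring.
under eq_integral => x _.
  rewrite ifF; last by apply/negbTE/negP => /andP[]; lra.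
  over.
rewrite integral0; congr EFin; case: ifP => // b0.
rewrite max_l ?mul0r // subr_le0 -(real_normK (num_real z)) lerXn2r // ?nnegrE //.
exact: ltW.
Qed.

Let below_dist z b : leb2 (below b (dist z)) =
  (if 0 <= b then Num.max 0 (b ^+ 2 - z ^+ 2) * disk_area else 0)%:E.
Proof.
case: ifP => [b0|/negbT]; last first.
  rewrite -ltNge => b0; rewrite (_ : below b _ = set0) ?measure0 //.
  by apply/seteqP; split => p //=; rewrite /below /= => /andP[? ?]; lra.
rewrite -measure_disk; congr (leb2 _); apply/seteqP; split => -[x y]; rewrite /below /disk /dist /=.
  move=> /andP[_]; rewrite -(ltr_pXn2r (n := 2)) ?nnegrE ?sqrtr_ge0 // sqr_sqrtr; first lra.
  by rewrite !addr_ge0 // sqr_ge0.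
move=> h; rewrite sqrtr_ge0 /= -(ltr_pXn2r (n := 2)) ?nnegrE ?sqrtr_ge0 // sqr_sqrtr; first lra.
by rewrite !addr_ge0 // sqr_ge0.
Qed.

Let D0 : set (measurableTypeR R) := `[0, +oo[%classic.

Let mD0 : measurable D0. Proof. exact: measurable_itv. Qed.

Let same_law z (A : set (measurableTypeR R)) : measurable A -> A `<=` D0 ->
  leb2 (dist z @^-1` A) = leb2 (pin z @^-1` A).
Proof.
move=> mA AD.
apply: (pushforward_nonneg_unique (measurable_dist z) (measurable_pin z) _ _ mA AD) => b.
  by rewrite [LHS]below_dist [RHS]below_pin.
by rewrite [X in (X < _)%E]below_dist ltry.
Qed.

Lemma tonelli_leb2 (f : R * R -> \bar R) :
  measurable_fun setT (f : measurableTypeR R * measurableTypeR R -> \bar R) ->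
  (forall p, 0 <= f p)%E ->
  (\int[leb2]_p f p = \int[mu]_x \int[mu]_y f (x, y))%E.
Proof. exact: fubini_tonelli1. Qed.

Lemma tonelli_leb3 (f : R3 R -> \bar R) :
  measurable_fun setT (f : R3meas R -> \bar R) -> (forall p, 0 <= f p)%E ->
  (\int[leb3]_x f x = \int[mu]_z \int[leb2]_p f (p, z))%E.
Proof. exact: fubini_tonelli2. Qed.

(** At each height the distance to the origin and [pin z] have the same law on [[0, +oo[]. Replacing
    one by the other turns the integral over the horizontal plane into an iterated integral whose
    inner part has the constant length [ring_weight z r]. No change of variables theorem is
    involved. *)
Lemma cylindrical_ge0 (f : R * R -> \bar R) :
  measurable_fun setT (f : measurableTypeR R * measurableTypeR R -> \bar R) ->
  (forall p, 0 <= f p)%E ->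
  (\int[leb3]_x f (x.2, euclid x) =
   \int[leb2]_p ((ring_weight p.1 p.2)%:E * f p))%E.
Proof.
move=> mf f0.
have mx : measurable_fun setT (fun x : R3meas R => f (x.2, euclid x)).
  have h : measurable_fun setT (fun x : R3meas R => (x.2, euclid x) : measurableTypeR R * measurableTypeR R).
    by apply: measurable_fun_pair => //; exact: measurable_euclid.
  exact: (measurableT_comp mf h).
have mw : measurable_fun setT (fun p : measurableTypeR R * measurableTypeR R => (ring_weight p.1 p.2)%:E).
  apply/measurable_EFinP; exact: measurable_ring_weight.
have mwf : measurable_fun setT (fun p : measurableTypeR R * measurableTypeR R =>
    ((ring_weight p.1 p.2)%:E * f p)%E) by exact: emeasurable_funM.
have -> : (\int[leb3]_x f (x.2, euclid x) =
    \int[mu]_z \int[leb2]_p f (z, dist z p))%E.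
  apply: etrans (tonelli_leb3 mx (fun x => f0 _)) _; apply: eq_integral => z _.
  apply: eq_integral => -[x y] _.
  by rewrite euclidE /dist.
rewrite tonelli_leb2 //; last by move=> p; rewrite mule_ge0 // lee_fin ring_weight_ge0.
apply: eq_integral => z _.
have mfz : measurable_fun setT (fun r : measurableTypeR R => f (z, r)).
  exact: (measurableT_comp mf (pair1_measurable z)).
have h1 := @ge0_integral_pushforward _ _ _ _ _ _ (measurable_dist z) leb2 D0 (fun r => f (z, r))
   mD0 (measurable_funTS mfz) (fun y _ => f0 _).
have h2 := @ge0_integral_pushforward _ _ _ _ _ _ (measurable_pin z) leb2 D0 (fun r => f (z, r))
   mD0 (measurable_funTS mfz) (fun y _ => f0 _).
have E1 : dist z @^-1` D0 = setT.
  by apply/seteqP; split => p //= _; rewrite /D0 /= in_itv /= andbT sqrtr_ge0.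
rewrite E1 in h1.
apply: etrans (esym h1) _.
apply: (@etrans _ _ (\int[leb2]_(p in pin z @^-1` D0) f (z, pin z p))%E).
  rewrite -[RHS]h2; apply: eq_measure_integral => A mA AD.
  exact: same_law.
rewrite [LHS]integral_mkcond.
have mDp : measurable (pin z @^-1` D0).
  by rewrite -[X in measurable X]setTI; exact: measurable_pin.
rewrite tonelli_leb2; last 2 first.
- apply: (measurable_restrictT _ mDp).1; apply: measurable_funTS.
  exact: (measurableT_comp mfz (measurable_pin z)).
- by move=> p; rewrite erestrict_ge0.
apply: eq_integral => r _ /=.
have [zr|zr] := leP `|z| r; last first.
  rewrite /ring_weight leNgt zr /= mul0e integral0_eq // => y _.
  rewrite patchE ifF //; apply/negbTE; rewrite notin_setE /= /D0 /= in_itv /= andbT.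
  by rewrite /pin /= (leNgt `|z| r) zr /= lerNr oppr0 ler10.
have -> : (\int[mu]_y ((fun p => f (z, pin z p)) \_ (pin z @^-1` D0)) (r, y) =
    \int[mu]_(y in `[0%R, ring_weight z r]) f (z, r))%E.
  rewrite [RHS]integral_mkcond; apply: eq_integral => y _; rewrite !patchE.
  have -> : ((r, y) \in pin z @^-1` D0) = (y \in [set` `[0, ring_weight z r]]).
    apply/idP/idP; rewrite !inE /= /D0 /= !in_itv /= andbT /pin /= zr /=.
      by case: ifP => // _; rewrite lerNr oppr0 ler10.
    by move=> ->; rewrite (le_trans _ zr).
  case: ifP => //; rewrite inE /= in_itv /= => h.
  by rewrite /pin /= zr /= h.
by rewrite integral_cst_itv ?ring_weight_ge0 // subr0 muleC.
Qed.

Lemma tonelli_leb2' (f : R * R -> \bar R) :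
  measurable_fun setT (f : measurableTypeR R * measurableTypeR R -> \bar R) ->
  (forall p, 0 <= f p)%E ->
  (\int[leb2]_p f p = \int[mu]_y \int[mu]_x f (x, y))%E.
Proof. exact: fubini_tonelli2. Qed.

Definition sphere_weight (r : R) : R := if 0 <= r then 4 * disk_area * r ^+ 2 else 0.

Lemma sphere_weight_ge0 r : 0 <= sphere_weight r.
Proof.
rewrite /sphere_weight; case: ifP => // _.
by rewrite mulr_ge0 ?sqr_ge0 // mulr_ge0 // ltW // disk_area_gt0.
Qed.

Lemma measurable_sphere_weight : measurable_fun setT sphere_weight.
Proof.
apply: measurable_fun_ifT => //.
- by apply: measurable_fun_ler => //; exact: measurable_cst.
- apply: measurable_funM; first exact: measurable_cst.
  exact: measurable_funX.
Qed.

Lemma integral_ring_weight r : (\int[mu]_z (ring_weight z r)%:E = (sphere_weight r)%:E)%E.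
Proof.
rewrite /sphere_weight; case: ifPn => [r0|]; last first.
  rewrite -ltNge => r0; apply: integral0_eq => z _.
  by rewrite /ring_weight leNgt (lt_le_trans r0).
have -> : (\int[mu]_z (ring_weight z r)%:E =
    \int[mu]_(z in [set` `[(- r)%R, r]]) (2 * disk_area * r)%:E)%E.
  rewrite [RHS]integral_mkcond; apply: eq_integral => z _.
  rewrite patchE mem_setE in_itv /= /ring_weight ler_norml.
  by case: ifP.
rewrite integral_cst_itv; last by lra.
by rewrite -EFinM; congr EFin; ring.
Qed.

(** The height is integrated out of [cylindrical_ge0]: the constant [2 * disk_area * r] over
    [[-r, r]] gives the area of the sphere of radius [r]. *)
Lemma polar_ge0 (f : R -> \bar R) : measurable_fun setT f -> (forall r, 0 <= f r)%E ->
  (\int[leb3]_x f (euclid x) = \int[mu]_r ((sphere_weight r)%:E * f r))%E.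
Proof.
move=> mf f0.
have mf2 : measurable_fun setT (fun p : measurableTypeR R * measurableTypeR R => f p.2).
  exact: (measurableT_comp (mf : measurable_fun setT f) measurable_snd).
have mw : measurable_fun setT (fun p : measurableTypeR R * measurableTypeR R => (ring_weight p.1 p.2)%:E).
  apply/measurable_EFinP; exact: measurable_ring_weight.
apply: etrans (cylindrical_ge0 mf2 (fun p => f0 _)) _.
rewrite tonelli_leb2'; last 2 first.
- exact: emeasurable_funM.
- by move=> p; rewrite mule_ge0 // lee_fin ring_weight_ge0.
apply: eq_integral => r _ /=; rewrite ge0_integralZr //.
- by rewrite integral_ring_weight.
- exact: (measurableT_comp mw (pair2_measurable r)).
- by move=> z _; rewrite lee_fin ring_weight_ge0.
Qed.

Lemma polar_integ (h : R -> R) : measurable_fun setT h ->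
  integ leb3 (fun x => h (euclid x)) <-> integ mu (fun r => sphere_weight r * h r).
Proof.
move=> mh.
have mh' : measurable_fun setT (fun r => (`|h r|)%:E).
  by apply/measurable_EFinP; exact: measurableT_comp.
have E := polar_ge0 mh' (fun r => normr_ge0 _ : (0 <= (`|h r|)%:E)%E).
have E2 : (\int[mu]_r ((sphere_weight r)%:E * (`|h r|)%:E) =
   \int[mu]_r (`|sphere_weight r * h r|)%:E)%E.
  apply: eq_integral => r _.
  by rewrite normrM EFinM (ger0_norm (sphere_weight_ge0 _)).
split=> H; apply: integP.
- by apply: measurable_funM => //; exact: measurable_sphere_weight.
- by rewrite -E2 -E; exact: integ_lty.
- exact: measurable_comp_euclid.
- by rewrite E E2; exact: integ_lty.
Qed.

Lemma cylindrical_integ (f : R * R -> R) :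
  measurable_fun setT (f : measurableTypeR R * measurableTypeR R -> R) ->
  integ leb3 (fun x => f (x.2, euclid x)) ->
  integ leb2 (fun p => ring_weight p.1 p.2 * f p).
Proof.
move=> mf hf; apply: integP.
  by apply: measurable_funM => //; exact: measurable_ring_weight.
have := integ_lty hf; rewrite (@cylindrical_ge0 (fun p => (`|f p|)%:E)) //; last first.
  by apply/measurable_EFinP; exact: measurableT_comp.
congr (_ < _)%E; apply: eq_integral => p _.
by rewrite normrM EFinM (ger0_norm (ring_weight_ge0 _ _)).
Qed.

Lemma cylindrical_Rint (f : R * R -> R) :
  measurable_fun setT (f : measurableTypeR R * measurableTypeR R -> R) ->
  Rintegral leb3 setT (fun x => f (x.2, euclid x)) =
  Rintegral leb2 setT (fun p => ring_weight p.1 p.2 * f p).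
Proof.
move=> mf; rewrite /Rintegral integralE [in RHS]integralE.
have mf' : measurable_fun setT (EFin \o f : measurableTypeR R * measurableTypeR R -> _).
  exact/measurable_EFinP.
have hp := @cylindrical_ge0 (EFin \o f)^\+%E (measurable_funepos mf') (fun p => funepos_ge0 _ _).
have hn := @cylindrical_ge0 (EFin \o f)^\-%E (measurable_funeneg mf') (fun p => funeneg_ge0 _ _).
congr (fine (_ - _)%E); [apply: etrans _ (etrans hp _)|apply: etrans _ (etrans hn _)];
  apply: eq_integral => p _; rewrite ?funeposE ?funenegE //=.
  by rewrite EFinM maxe_pMr ?mule0 // lee_fin ring_weight_ge0.
by rewrite -mulrN EFinM maxe_pMr ?mule0 // lee_fin ring_weight_ge0.
Qed.

Lemma Fubini_leb2 (f : R * R -> R) : integ leb2 f ->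
  Rintegral leb2 setT f = Rintegral mu setT (fun y => Rintegral mu setT (fun x => f (x, y))).
Proof. exact: Fubini2. Qed.

Lemma Fubini_leb2_integ (f : R * R -> R) : integ leb2 f ->
  integ mu (fun y => Rintegral mu setT (fun x => f (x, y))).
Proof. exact: Fubini_integ2. Qed.

Lemma polar_Rint (h : R -> R) : measurable_fun setT h ->
  Rintegral leb3 setT (fun x => h (euclid x)) =
  Rintegral mu setT (fun r => sphere_weight r * h r).
Proof.
move=> mh; rewrite /Rintegral integralE [in RHS]integralE.
have mf' : measurable_fun setT (EFin \o h : measurableTypeR R -> _).
  exact/measurable_EFinP.
have hp := @polar_ge0 (EFin \o h)^\+%E (measurable_funepos mf') (fun p => funepos_ge0 _ _).
have hn := @polar_ge0 (EFin \o h)^\-%E (measurable_funeneg mf') (fun p => funeneg_ge0 _ _).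
congr (fine (_ - _)%E); [apply: etrans _ (etrans hp _)|apply: etrans _ (etrans hn _)];
  apply: eq_integral => p _; rewrite ?funeposE ?funenegE //=.
  by rewrite EFinM maxe_pMr ?mule0 // lee_fin sphere_weight_ge0.
by rewrite -mulrN EFinM maxe_pMr ?mule0 // lee_fin sphere_weight_ge0.
Qed.

Lemma ring_cosine k th r : k != 0 ->
  Rintegral mu setT (fun z => ring_weight z r * cos (k * z + th)) =
  if 0 <= r then 4 * disk_area * cos th * (r * (sin (k * r) / k)) else 0.
Proof.
move=> k0; case: ifPn => [r0|]; last first.
  rewrite -ltNge => r0; rewrite -[RHS](Rint0 mu); apply: Rint_ext => z.
  by rewrite /ring_weight leNgt (lt_le_trans r0) // mul0r.
have -> : Rintegral mu setT (fun z => ring_weight z r * cos (k * z + th)) =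
    fine (\int[mu]_(z in [set` `[(- r)%R, r]]) (2 * disk_area * r * cos (k * z + th))%:E)%E.
  congr fine; rewrite [RHS]integral_mkcond; apply: eq_integral => z _.
  rewrite patchE mem_setE in_itv /= /ring_weight ler_norml.
  by case: ifP; rewrite ?mul0r.
have h (z : R) : is_derive z 1 (fun z : R => k * z + th) k.
  by apply: is_derive_eq; rewrite /GRing.scale /=; ring.
have dF (z : R) : is_derive z 1 (fun z => 2 * disk_area * r / k * sin (k * z + th))
    (2 * disk_area * r * cos (k * z + th)).
  have h2 := @is_derive1_comp _ sin (fun z : R => k * z + th) z _ _ (is_derive_sin _) (h z).
  have h3 := @is_deriveZ _ _ _ _ (2 * disk_area * r / k) _ _ _ h2.
  apply: is_derive_eq; rewrite /GRing.scale /=; field.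
  exact: k0.
have cf : continuous (fun z : R => 2 * disk_area * r * cos (k * z + th)).
  exact: continuous_of_derive.
have rr : - r <= r by lra.
rewrite (FTC_real rr cf dF) /=.
have -> : k * - r + th = - (k * r - th) by ring.
by rewrite sinN sinD sinB; field.
Qed.

(** After rotation of [xi] to an axis the integrand depends on height and radius only, and the
    height integral of the cosine is explicit; the odd part of the phase integrates to 0, which
    leaves the factor [cos th]. Integrability of [g] comes from Fubini and is recorded because it
    does not follow from the formula for [g] without a further estimate. *)
Lemma radial_fourier (h : R -> R) (xi : R3 R) th : measurable_fun setT h ->
  integ leb3 (fun x => h (euclid x)) -> euclid xi != 0 ->
  let g r := if 0 <= r then
    4 * disk_area * cos th * (h r * (r * (sin (euclid xi * r) / euclid xi))) else 0 in
  integ mu g /\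
  Rintegral leb3 setT (fun x => h (euclid x) * cos (dot3 x xi + th)) =
  Rintegral mu setT g.
Proof.
move=> mh ih xi0 g.
have [Q [k [mpQ eQ dQ kxi]]] := rotate_to_axis xi.
have k0 : k != 0 by rewrite -normr_eq0 kxi.
have mdot : measurable_fun setT (fun x : R3meas R => dot3 x xi).
  rewrite (_ : (fun x : R3meas R => _) = fun x : R3meas R =>
     x.1.1 * xi.1.1 + x.1.2 * xi.1.2 + x.2 * xi.2); last by apply/funext => x; rewrite dot3E.
  apply: measurable_funD; [apply: measurable_funD|]; apply: measurable_funM;
    (exact: measurable_cst || exact: measurable_x1 || exact: measurable_x2 || exact: measurable_x3).
have mF : measurable_fun setT (fun x : R3meas R => h (euclid x) * cos (dot3 x xi + th)).
  apply: measurable_funM; first exact: measurable_comp_euclid.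
  apply: measurable_comp_cont; first exact: continuous_cos.
  by apply: measurable_funD => //; exact: measurable_cst.
pose f (p : R * R) := h p.2 * cos (k * p.1 + th).
have mf : measurable_fun setT (f : measurableTypeR R * measurableTypeR R -> R).
  apply: measurable_funM; first exact: (measurableT_comp (mh : measurable_fun setT h) measurable_snd).
  apply: measurable_comp_cont; first exact: continuous_cos.
  by apply: measurable_funD; [apply: measurable_funM => //|]; exact: measurable_cst.
have Ef x : f (x.2, euclid x) = h (euclid (Q x)) * cos (dot3 (Q x) xi + th).
  by rewrite /f /= eQ dQ.
have if3 : integ leb3 (fun x => f (x.2, euclid x)).
  apply: (@integ_ext _ (R3meas R) _ _ (fun x => cos (k * x.2 + th) * h (euclid x))).
    by move=> x; rewrite /f /= mulrC.
  apply: (@integ_bndM _ _ _ _ _ _ 1) => //.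
    apply: measurable_comp_cont; first exact: continuous_cos.
    apply: measurable_funD; [apply: measurable_funM|]; (exact: measurable_cst || exact: measurable_x3).
  by move=> x; rewrite ler_norml cos_geN1 cos_le1.
have if2 := cylindrical_integ mf if3.
have Eg r : Rintegral mu setT (fun z => ring_weight z r * f (z, r)) = g r.
  rewrite /f /=.
  transitivity (h r * Rintegral mu setT (fun z => ring_weight z r * cos (k * z + th))).
    rewrite -RintZ; last first.
      apply: (@integ_le _ (measurableTypeR R) _ mu _ (fun z => ring_weight z r)).
      - apply: measurable_funM.
          exact: (measurableT_comp measurable_ring_weight (pair2_measurable r)).
        apply: measurable_comp_cont; first exact: continuous_cos.
        by apply: measurable_funD; [apply: measurable_funM => //|]; exact: measurable_cst.
      - apply: integP.
          exact: (measurableT_comp measurable_ring_weight (pair2_measurable r)).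
        under eq_integral do rewrite ger0_norm ?ring_weight_ge0 //.
        by rewrite integral_ring_weight ltry.
      - move=> z; rewrite normrM ger0_norm ?ring_weight_ge0 // ler_piMr ?ring_weight_ge0 //.
        by rewrite ler_norml cos_geN1 cos_le1.
    by apply: Rint_ext => z; rewrite mulrCA.
  rewrite ring_cosine // /g; case: ifP => _; last by rewrite mulr0.
  have -> : sin (k * r) / k = sin (euclid xi * r) / euclid xi.
    rewrite -kxi; have [k1|k1] := leP 0 k; first by rewrite ger0_norm.
    by rewrite ltr0_norm // mulNr sinN invrN mulrNN.
  by ring.
split.
  apply: (@integ_ext _ (measurableTypeR R) _ mu _ g Eg); exact: (Fubini_leb2_integ if2).
rewrite -(mp_Rint mpQ mF).
transitivity (Rintegral leb3 setT (fun x => f (x.2, euclid x))).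
  by apply: Rint_ext => x; rewrite Ef.
rewrite cylindrical_Rint // Fubini_leb2 //.
by apply: Rint_ext => r; rewrite -Eg.
Qed.

Lemma lebesgue_neg : measure_preserving mu mu (fun x : R => - x).
Proof.
split; first exact: oppr_measurable.
by move=> A mA; exact: lebesgue_measureN.
Qed.

Lemma even_extension (g : R -> R) : measurable_fun setT g -> (forall r, g (- r) = g r) ->
  integ mu (fun r => if 0 <= r then g r else 0) ->
  integ mu g /\
  Rintegral mu setT g = 2 * Rintegral mu setT (fun r => if 0 <= r then g r else 0).
Proof.
move=> mg eg; set h := (fun r => if 0 <= r then g r else 0) => ih.
have ihN : integ mu (fun r => h (- r)) by exact: (mp_integ lebesgue_neg ih).
have mh := integ_meas ih.
have ae : {ae mu, forall r, h r + h (- r) = g r}.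
  exists [set 0]; split => //; first exact: lebesgue_measure_set1.
  move=> r /= H; apply: contrapT => /eqP r0; apply: H; rewrite /h oppr_ge0 eg.
  by case: (ltgtP r 0) r0 => // _ _; rewrite ?addr0 ?add0r.
have mhh : measurable_fun setT (fun r => h r + h (- r)).
  by apply: measurable_funD => //; exact: integ_meas ihN.
split; first exact: integ_ae (integD ih ihN) mg ae.
by rewrite -(@Rint_ae _ (measurableTypeR R) _ mu _ _ mhh mg ae) RintD // (mp_Rint lebesgue_neg mh) mulr_natl mulr2n.
Qed.

End PolarCoordinates.

(** * Decay of Fourier transforms *)

Section EuclideanNorm.
Context {R : realType}.
Implicit Types (x y : R3 R).

Lemma dot3_le x y : dot3 x y <= euclid x * euclid y.
Proof.
have [h|h] := leP (dot3 x y) 0; first by rewrite (le_trans h) // mulr_ge0 // euclid_ge0.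
rewrite -(ler_pXn2r (n := 2)) ?nnegrE ?mulr_ge0 ?euclid_ge0 ?(ltW h) //.
rewrite exprMn !euclid_sqr dot3E.
case: x y {h} => [[x1 x2] x3] [[y1 y2] y3] /=; rewrite -subr_ge0.
rewrite (_ : _ - _ = (x1 * y2 - x2 * y1) ^+ 2 + (x1 * y3 - x3 * y1) ^+ 2 +
  (x2 * y3 - x3 * y2) ^+ 2); last by ring.
by rewrite !addr_ge0 // sqr_ge0.
Qed.

Lemma euclidN x : euclid (- x) = euclid x.
Proof. by rewrite !euclidE /= !sqrrN. Qed.

Lemma euclidD x y : euclid (x + y) <= euclid x + euclid y.
Proof.
rewrite -(ler_pXn2r (n := 2)) ?nnegrE ?addr_ge0 ?euclid_ge0 //.
have := dot3_le x y; rewrite sqrrD !euclid_sqr dot3E.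
by case: x y => [[x1 x2] x3] [[y1 y2] y3] /= h; rewrite mulr2n; nra.
Qed.

Lemma norm_dot3_le x y : `|dot3 x y| <= euclid x * euclid y.
Proof.
rewrite ler_norml dot3_le andbT lerNl -(euclidN x).
apply: le_trans (dot3_le _ _); rewrite !dot3E /=; lra.
Qed.

Lemma coord3_le i x : `|coord3 i x| <= euclid x.
Proof.
rewrite -(ler_pXn2r (n := 2)) ?nnegrE ?euclid_ge0 // real_normK ?num_real // euclid_sqr.
case: x => [[x1 x2] x3] /=; have := sqr_ge0 x1; have := sqr_ge0 x2; have := sqr_ge0 x3.
by case: i => -[|[|[|//]]] ? /=; rewrite /coord3 /=; lra.
Qed.

Lemma euclid_basis i : euclid (basis_vec i : R3 R) = 1.
Proof.
rewrite euclidE; case: i => -[|[|[|//]]] ? /=;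
by rewrite ?expr1n ?expr0n /= ?addr0 ?add0r sqrtr1.
Qed.

Lemma euclidZ (a : R) x : euclid (a *: x) = `|a| * euclid x.
Proof.
rewrite !euclidE /= -sqrtr_sqr -sqrtrM ?sqr_ge0 //; congr Num.sqrt.
by case: x => [[x1 x2] x3] /=; rewrite /GRing.scale /=; ring.
Qed.

Lemma euclid_le_coord x : euclid x <= `|x.1.1| + `|x.1.2| + `|x.2|.
Proof.
rewrite -(ler_pXn2r (n := 2)) ?nnegrE ?euclid_ge0 ?addr_ge0 // euclid_sqr.
rewrite -[x.1.1 ^+ 2]real_normK ?num_real // -[x.1.2 ^+ 2]real_normK ?num_real //.
rewrite -[x.2 ^+ 2]real_normK ?num_real //.
move: (normr_ge0 x.1.1) (normr_ge0 x.1.2) (normr_ge0 x.2).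
move: `|x.1.1| `|x.1.2| `|x.2| => a b c a0 b0 c0.
by have := mulr_ge0 a0 b0; have := mulr_ge0 a0 c0; have := mulr_ge0 b0 c0; nra.
Qed.

Definition decay (n : nat) x : R := (1 + euclid x) ^- n.

Lemma bracket_gt0 x : 0 < 1 + euclid x. Proof. by rewrite ltr_pwDl // euclid_ge0. Qed.

Lemma decay_gt0 n x : 0 < decay n x.
Proof. by rewrite invr_gt0 exprn_gt0 // bracket_gt0. Qed.

Lemma decay_ge0 n x : 0 <= decay n x. Proof. exact/ltW/decay_gt0. Qed.

(** Peetre's inequality: translating by [y] costs a fixed power of [1 + |y|]. *)
Lemma decay_shift n x y : decay n (x + y) <= (1 + euclid y) ^+ n * decay n x.
Proof.
rewrite /decay -(invrK ((1 + euclid y) ^+ n)) -invfM lef_pV2 ?posrE; last 2 first.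
- by rewrite exprn_gt0 // bracket_gt0.
- by rewrite mulr_gt0 ?invr_gt0 // exprn_gt0 // bracket_gt0.
rewrite mulrC ler_pdivrMr ?exprn_gt0 ?bracket_gt0 // -exprMn.
rewrite lerXn2r ?nnegrE ?mulr_ge0 ?(ltW (bracket_gt0 _)) //.
have := euclidD (x + y) (- y); rewrite addrK euclidN => h.
by have := mulr_ge0 (euclid_ge0 (x + y)) (euclid_ge0 y); lra.
Qed.

Lemma decay_le n m x : (n <= m)%N -> decay m x <= decay n x.
Proof.
move=> nm; rewrite /decay lef_pV2 ?posrE ?exprn_gt0 ?bracket_gt0 //.
by rewrite ler_weXn2l // lerDl euclid_ge0.
Qed.

Lemma decay_le1 n x : decay n x <= 1.
Proof. by have := decay_le x (leq0n n); rewrite {2}/decay expr0 invr1. Qed.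

End EuclideanNorm.

(** * Integrability of powers *)

Section PowerIntegrals.
Context {R : realType}.
Notation mu := (@lebesgue_measure R).

Lemma powR_cvgy0 (p : R) : 0 < p -> (x `^ (- p)) @[x --> +oo] --> 0.
Proof.
move=> p0; apply/cvgrPdist_le => e e0.
exists (e^-1 `^ p^-1); split; first exact: num_real.
move=> x ex; have x0 : 0 < x by apply: le_lt_trans ex; exact: powR_ge0.
rewrite sub0r normrN ger0_norm ?powR_ge0 // powRN.
rewrite -[e]invrK lef_pV2 ?posrE ?powR_gt0 ?invr_gt0 //.
rewrite -[e^-1]powRr1 ?invr_ge0 ?(ltW e0) // -[X in _ `^ X](mulVf (lt0r_neq0 p0)) powRrM.
by rewrite ge0_ler_powR ?nnegrE ?powR_ge0 ?(ltW x0) ?(ltW p0) ?(ltW ex).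
Qed.

Lemma integral_powR_tail (a p : R) : 0 < a -> 0 < p ->
  (\int[mu]_(x in `[0%R, +oo[) ((a + x) `^ (- p - 1))%:E = (p^-1 * a `^ (- p))%:E)%E.
Proof.
move=> a0 p0.
pose F x := - p^-1 * (a + x) `^ (- p).
have dF (x : R) : 0 <= x -> is_derive x 1 F ((a + x) `^ (- p - 1)).
  move=> x0; have h : 0 < a + x by rewrite ltr_pwDl.
  have d1 : is_derive x 1 (fun x : R => a + x) 1.
    by rewrite -[X in is_derive _ _ _ X]add0r; exact: (is_deriveD (is_derive_cst _ _ _) (is_derive_id _ _)).
  have d2 := @is_derive1_comp _ (fun y => y `^ (- p)) (fun x : R => a + x) x _ _
     (is_derive1_powR (- p) h) d1.
  have d3 := @is_deriveZ _ _ _ _ (- p^-1) _ _ _ d2.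
  apply: is_derive_eq; rewrite /GRing.scale /= mulr1 mulrA mulrNN mulVf ?mul1r //.
  exact: lt0r_neq0.
have cF (x : R) : 0 <= x -> {for x, continuous F}.
  by move=> x0; apply: differentiable_continuous; apply/derivable1_diffP; case: (dF x x0).
rewrite (@ge0_continuous_FTC2y _ _ F _ 0).
- by rewrite /F addr0 sub0e; congr EFin; rewrite mulNr opprK.
- by move=> x _; exact: powR_ge0.
- apply: continuous_in_subspaceT => x; rewrite inE /= in_itv /= andbT => x0.
  have h : 0 < a + x by rewrite ltr_pwDl.
  have d1 : is_derive x 1 (fun x : R => a + x) 1.
    by rewrite -[X in is_derive _ _ _ X]add0r; exact: (is_deriveD (is_derive_cst _ _ _) (is_derive_id _ _)).
  have d2 := @is_derive1_comp _ (fun y => y `^ (- p - 1)) (fun x : R => a + x) x _ _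
     (is_derive1_powR (- p - 1) h) d1.
  by apply: differentiable_continuous; apply/derivable1_diffP; case: d2.
- rewrite -(mulr0 (- p^-1)); apply: cvgM; first exact: cvg_cst.
  apply: (@cvg_comp _ _ _ (fun x => a + x) (fun y => y `^ (- p)) _ +oo%R) => /=.
    by apply: cvg_addrl; exact: cvg_id.
  exact: powR_cvgy0.
- by move=> x x0; case: (dF x (ltW x0)).
- by apply: cvg_at_right_filter; exact: cF.
- move=> x; rewrite in_itv /= andbT => x0; rewrite derive1E.
  exact: (@derive_val _ _ _ _ _ _ _ (dF x (ltW x0))).
Qed.

Lemma integ_inv_sqr : integ mu (fun r : R => if 0 <= r then (1 + r) `^ (- 1 - 1) else 0).
Proof.
have mp : measurable_fun setT (fun r : R => if 0 <= r then (1 + r) `^ (- 1 - 1) else 0).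
  apply: measurable_fun_ifT; last exact: measurable_cst.
    by apply: measurable_fun_ler => //; exact: measurable_cst.
  apply: (measurableT_comp (@measurable_powR R (- 1 - 1))).
  by apply: measurable_funD => //; exact: measurable_cst.
apply: integP => //.
have E := @integral_powR_tail 1 1 ltr01 ltr01; rewrite [LHS]integral_mkcond in E.
rewrite (_ : (\int[mu]_x _ = (1^-1 * 1 `^ (- 1))%:E)%E) ?ltry // -E.
apply: eq_integral => r _; rewrite patchE mem_setE in_itv /= andbT.
by case: ifP => // _; rewrite ?ger0_norm ?powR_ge0 ?normr0.
Qed.

Lemma integ_decay4 : integ leb3 (fun x : R3 R => decay 4 x).
Proof.
have mh : measurable_fun setT (fun r : R => (1 + r) ^- 4).
  apply: measurable_inv; apply: measurable_funX.
  by apply: measurable_funD => //; exact: measurable_cst.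
apply: (polar_integ mh).2.
have ip := integ_inv_sqr.
apply: (@integ_le _ (measurableTypeR R) _ mu _ (fun r => 4 * disk_area *
   (if 0 <= r then (1 + r) `^ (- 1 - 1) else 0))).
- by apply: measurable_funM => //; exact: measurable_sphere_weight.
- exact: integZ.
- move=> r; rewrite /sphere_weight; case: ifP => r0; last by rewrite mul0r normr0 mulr0.
  have r1 : 0 < 1 + r by rewrite ltr_pwDl.
  rewrite ger0_norm; last first.
    rewrite mulr_ge0 ?invr_ge0 ?exprn_ge0 ?(ltW r1) //.
    by rewrite mulr_ge0 ?sqr_ge0 // mulr_ge0 // ltW // disk_area_gt0.
  rewrite -mulrA ler_wpM2l //; first by rewrite mulr_ge0 // ltW // disk_area_gt0.
  rewrite (_ : - 1 - 1 = - 2%:R); last by rewrite -opprD.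
  rewrite powRN powR_mulrn ?(ltW r1) // ler_pdivrMr ?exprn_gt0 //.
  rewrite mulrC -[4%N]/(2 + 2)%N exprD mulfK ?gt_eqF ?exprn_gt0 //.
  by rewrite lerXn2r ?nnegrE ?(ltW r1) // lerDr.
Qed.

Lemma integ_le_decay4 (f : R3 R -> R) C :
  measurable_fun setT (f : R3meas R -> R) -> (forall x, `|f x| <= C * decay 4 x) ->
  integ leb3 f.
Proof.
move=> mf h; apply: (@integ_le _ (R3meas R) _ leb3 _ (fun x => C * decay 4 x)) => //.
exact: (integZ C integ_decay4).
Qed.

End PowerIntegrals.

Lemma continuous_at_pair (T U V : topologicalType) (f : T -> U) (g : T -> V) x :
  {for x, continuous f} -> {for x, continuous g} ->
  {for x, continuous (fun y => (f y, g y))}.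
Proof. by move=> cf cg; exact: (@cvg_pair _ _ _ (nbhs x) (nbhs (f x)) (nbhs (g x)) _ _ _ _ _ cf cg). Qed.

(** * Measurability of continuous functions of several variables *)

Section ContinuousMeasurable.
Context {R : realType}.

Let fl (n : nat) (z : R) : R := (Num.floor (n.+1%:R * z))%:~R / n.+1%:R.

Let fl_cvg z : fl n z @[n --> \oo] --> z.
Proof.
apply/cvgrPdist_le => e e0.
have := @cvg_harmonic R => /cvgrPdist_le /(_ e e0).
apply: filterS => n; rewrite sub0r normrN /harmonic /= => h.
apply: le_trans h; rewrite [X in _ <= X]ger0_norm ?invr_ge0 //.
have n0 : 0 < n.+1%:R :> R by [].
have h1 := floor_le (n.+1%:R * z).
have h2 : n.+1%:R * z < (Num.floor (n.+1%:R * z) + 1)%:~R by exact: floorD1_gt.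
rewrite intrD in h2.
rewrite /fl; set k := (Num.floor _)%:~R in h1 h2 *.
have -> : z - k / n.+1%:R = (n.+1%:R * z - k) / n.+1%:R by field; rewrite gt_eqF.
rewrite normrM (ger0_norm (_ : 0 <= n.+1%:R^-1)) ?invr_ge0 // ler_piMl ?invr_ge0 //.
by rewrite ger0_norm ?subr_ge0 // lerBlDl ltW.
Qed.

(* A function measurable in the first variable and continuous in the second one is a
   limit of functions which are piecewise constant in the second variable. *)
Lemma measurable_caratheodory d (T : measurableType d) (f : T * measurableTypeR R -> R) :
  (forall z, measurable_fun setT (fun p => f (p, z))) ->
  (forall p, continuous (fun z : R => f (p, z))) ->
  measurable_fun setT f.
Proof.
move=> mf cf.
apply: (@measurable_fun_cvg _ _ _ _ (fun n (x : T * measurableTypeR R) => f (x.1, fl n x.2))); last first.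
  by move=> [p z] _ /=; exact: (@cvg_comp _ _ _ (fun n => fl n z) (fun z : R => f (p, z)) _ (nbhs z) _ (@fl_cvg z) (cf p z)).
move=> n _ Y mY; rewrite setTI.
have -> : (fun x : T * measurableTypeR R => f (x.1, fl n x.2)) @^-1` Y =
  \bigcup_(k : int) (((fun p => f (p, k%:~R / n.+1%:R)) @^-1` Y) `*`
     [set z : R | (k%:~R <= n.+1%:R * z) && (n.+1%:R * z < (k + 1)%:~R)]).
  apply/seteqP; split => -[p z] /=.
    move=> H; exists (Num.floor (n.+1%:R * z)) => //=; split => //.
    by rewrite floor_le floorD1_gt.
  move=> [k _ [/= H /andP[h1 h2]]].
  suff -> : fl n z = k%:~R / n.+1%:R by [].
  by rewrite /fl; congr (_%:~R / _); apply: floor_def; rewrite h1 h2.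
apply: countable_bigcupT_measurable; first exact: countableP.
move=> k; apply: measurableX.
  by rewrite -[X in measurable X]setTI; exact: mf.
apply: (@measurable_pred _ (measurableTypeR R) (fun z => (k%:~R <= n.+1%:R * z) && (n.+1%:R * z < (k + 1)%:~R))).
apply: measurable_and.
  apply: measurable_fun_ler; first exact: measurable_cst.
  by apply: measurable_funM => //; exact: measurable_cst.
apply: measurable_fun_ltr; last exact: measurable_cst.
by apply: measurable_funM => //; exact: measurable_cst.
Qed.

(** One coordinate is peeled off at a time, so that only continuity in each variable separately is
    used and the product sigma-algebra need not be compared with the open sets of the product. *)
Lemma continuous_measurable_R3 (f : R3 R -> R) : continuous f ->
  measurable_fun setT (f : R3meas R -> R).
Proof.
move=> cf.
apply: measurable_caratheodory => [z|[x y]]; last first.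
  move=> z; apply: (@continuous_comp _ _ _ (fun z : R => ((x, y), z)) f); last exact: cf.
  by apply: continuous_at_pair; [exact: cvg_cst|exact: cvg_id].
apply: (@measurable_caratheodory _ (measurableTypeR R) (fun p => f (p, z))) => [y|x]; last first.
  move=> y; apply: (@continuous_comp _ _ _ (fun y : R => ((x, y), z)) f); last exact: cf.
  by apply: continuous_at_pair; [apply: continuous_at_pair; [exact: cvg_cst|exact: cvg_id]|exact: cvg_cst].
have : continuous (fun x : R => f ((x, y), z)).
  move=> x; apply: (@continuous_comp _ _ _ (fun x : R => ((x, y), z)) f); last exact: cf.
  by apply: continuous_at_pair; [apply: continuous_at_pair; [exact: cvg_id|exact: cvg_cst]|exact: cvg_cst].
exact: continuous_measurable_fun.
Qed.

End ContinuousMeasurable.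

(** * Fourier transforms of rapidly decreasing functions *)

Section FourierDecay.
Context {R : realType}.
Notation mu := (@lebesgue_measure R).
Implicit Types (x y xi : R3 R) (f g psi : R3 R -> R) (th : R).

(* Shifting the phase by [pi / 2] turns the cosine transform into the sine transform. *)
Definition phase_fourier (th : R) f x : R :=
  Rintegral leb3 setT (fun xi => cos (dot3 x xi + th) * f xi).

Lemma measurable_dot3_l x : measurable_fun setT (fun xi : R3meas R => dot3 x xi).
Proof.
rewrite (_ : (fun xi : R3meas R => _) = fun xi : R3meas R =>
   x.1.1 * xi.1.1 + x.1.2 * xi.1.2 + x.2 * xi.2); last by apply/funext => y; rewrite dot3E.
apply: measurable_funD; [apply: measurable_funD|]; apply: measurable_funM;
  (exact: measurable_cst || exact: measurable_x1 || exact: measurable_x2 || exact: measurable_x3).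
Qed.

Lemma measurable_cos_phase x th :
  measurable_fun setT (fun xi : R3meas R => cos (dot3 x xi + th)).
Proof.
apply: measurable_comp_cont; first exact: continuous_cos.
by apply: measurable_funD; [exact: measurable_dot3_l|exact: measurable_cst].
Qed.

Lemma cos_le1_norm (t : R) : `|cos t| <= 1.
Proof. by rewrite ler_norml cos_geN1 cos_le1. Qed.

Lemma integ_cos_phase x th f : integ leb3 f ->
  integ leb3 (fun xi => cos (dot3 x xi + th) * f xi).
Proof.
move=> hf; apply: (@integ_bndM _ (R3meas R) _ leb3 f _ 1) => //.
  exact: measurable_cos_phase.
by move=> y; exact: cos_le1_norm.
Qed.

Lemma phase_fourier_le f x th : integ leb3 f ->
  `|phase_fourier th f x| <= Rintegral leb3 setT (fun xi => `|f xi|).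
Proof.
move=> hf; apply: Rint_norm_le; [exact: integ_cos_phase|exact: integ_abs|].
by move=> y; rewrite normrM ler_piMl // cos_le1_norm.
Qed.

Lemma coord3D i x y : coord3 i (x + y) = coord3 i x + coord3 i y.
Proof. by case: i => -[|[|[|//]]] ?. Qed.

Lemma dot3_lineE x xi i (h : R) :
  dot3 x (h *: basis_vec i + xi) = dot3 x xi + h * coord3 i x.
Proof.
case: x xi => [[x1 x2] x3] [[y1 y2] y3]; rewrite !dot3E /=.
case: i => -[|[|[|//]]] ?; rewrite /coord3 /= /GRing.scale /=; ring.
Qed.

(** Partial derivatives are read on lines, where the chain rule and the mean value theorem for
    functions of one variable apply. *)
Lemma is_derive_line f xi i (s l : R) :
  is_derive (s *: basis_vec i + xi) (basis_vec i) f l <->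
  is_derive s 1 (fun s : R => f (s *: basis_vec i + xi)) l.
Proof.
have E : (fun h : R => h^-1 *: (((fun s : R => f (s *: basis_vec i + xi)) \o shift s) (h *: 1)
    - f (s *: basis_vec i + xi))) =
  (fun h : R => h^-1 *: ((f \o shift (s *: basis_vec i + xi)) (h *: basis_vec i) -
    f (s *: basis_vec i + xi))).
  apply/funext => h /=; congr (_ *: (f _ - _)).
  by rewrite [h *: 1]mulr1 scalerDl addrA.
split => -[df dl]; split.
- by rewrite /derivable E.
- by rewrite -dl /derive E.
- by rewrite /derivable -E.
- by rewrite -dl /derive E.
Qed.

Lemma is_derive_line0 f xi i (l : R) : is_derive xi (basis_vec i) f l <->
  is_derive (0 : R) 1 (fun s : R => f (s *: basis_vec i + xi)) l.
Proof.
have := is_derive_line f xi i 0 l.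
by rewrite {1}scale0r add0r.
Qed.

Lemma is_derive_cvg_quotient f xi i (l : R) : is_derive xi (basis_vec i) f l ->
  (fun n => n.+1%:R * (f (n.+1%:R^-1 *: basis_vec i + xi) - f xi)) @ \oo --> l.
Proof.
move=> [df dl].
have h : (h^-1 *: ((f \o shift xi) (h *: basis_vec i) - f xi)) @[h --> 0^'] --> l.
  by rewrite -dl; exact: df.
have h' := cvg_dnbhs_at_right h.
have [H _] := cvg_at_rightP (fun h => h^-1 *: ((f \o shift xi) (h *: basis_vec i) - f xi)) 0 l.
have h0 (n : nat) : 0 < (harmonic n : R) by rewrite /harmonic /= invr_gt0.
have := H h' harmonic (conj h0 (@cvg_harmonic R)).
by rewrite /harmonic /=; under eq_fun do rewrite invrK.
Qed.

(** The difference quotients of [f] have integral 0 by translation invariance, and they tend to [g].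
    The mean value theorem and Peetre's inequality with a shift of length at most 1 dominate them by
    [16 * K * decay 4], where 16 is [2^4]. *)
Lemma integral_partial_eq0 i f g (K : R) : integ leb3 f ->
  measurable_fun setT (g : R3meas R -> R) ->
  (forall xi, is_derive xi (basis_vec i) f (g xi)) ->
  (forall xi, `|g xi| <= K * decay 4 xi) ->
  Rintegral leb3 setT g = 0.
Proof.
move=> hf mg dfg gK.
have mf := integ_meas hf.
pose D (n : nat) xi := n.+1%:R * (f (n.+1%:R^-1 *: basis_vec i + xi) - f xi).
have K0 : 0 <= K.
  have := le_trans (normr_ge0 _) (gK 0).
  by rewrite pmulr_lge0 // decay_gt0.
have mpn n : measure_preserving leb3 leb3 (fun xi => n.+1%:R^-1 *: basis_vec i + xi).
  have -> : (fun xi : R3 R => n.+1%:R^-1 *: basis_vec i + xi) =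
      (fun xi => xi + n.+1%:R^-1 *: basis_vec i) by apply/funext => xi; rewrite addrC.
  exact: leb3_shift.
have if' n : integ leb3 (fun xi => f (n.+1%:R^-1 *: basis_vec i + xi)) := mp_integ (mpn n) hf.
have iD n : integ leb3 (D n) by exact: (integZ _ (integB (if' n) hf)).
have D0 n : Rintegral leb3 setT (D n) = 0.
  rewrite RintZ; last exact: (integB (if' n) hf).
  by rewrite (RintB (if' n) hf) (mp_Rint (mpn n) mf) subrr mulr0.
have bD n xi : `|D n xi| <= 16 * K * decay 4 xi.
  have n0 : 0 < n.+1%:R^-1 :> R by rewrite invr_gt0.
  have dl (s : R) : is_derive s 1 (fun s : R => f (s *: basis_vec i + xi)) (g (s *: basis_vec i + xi)).
    by apply: (is_derive_line f xi i s _).1; exact: dfg.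
  have [c c01] := @MVT_segment R (fun s : R => f (s *: basis_vec i + xi))
    (fun s => g (s *: basis_vec i + xi)) 0 (n.+1%:R^-1) (ltW n0) (fun s _ => dl s)
    (continuous_subspaceT (continuous_of_derive dl)).
  rewrite scale0r add0r subr0 => E.
  rewrite /D E mulrCA mulfV ?pnatr_eq0 // mulr1.
  apply: (le_trans (gK _)); rewrite [16 * K]mulrC -[X in _ <= X]mulrA; apply: ler_wpM2l => //.
  rewrite addrC; apply: (le_trans (decay_shift _ _ _)).
  apply: ler_wpM2r; first exact: decay_ge0.
  rewrite (_ : 16 = 2 ^+ 4 :> R); last by rewrite -natrX.
  have hc : euclid (c *: basis_vec i : R3 R) <= 1.
    rewrite euclidZ euclid_basis mulr1; move: c01; rewrite in_itv /= => /andP[c0 c1].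
    rewrite ger0_norm // (le_trans c1) // invf_le1 //.
    by rewrite ler1n.
  rewrite lerXn2r ?nnegrE ?(ltW (bracket_gt0 _)) //.
  by rewrite -[2]/(1 + 1) lerD2l.
have [||] := @Rint_dominated _ (R3meas R) _ leb3 D g (fun xi => 16 * K * decay 4 xi) _ mg
  (integZ _ integ_decay4) _ (bD).
- by move=> n; exact: integ_meas (iD n).
- by apply: aeW => xi; exact: is_derive_cvg_quotient.
move=> _; rewrite (_ : (fun n => Rintegral leb3 setT (D n)) = fun=> 0); last exact/funext.
by move=> h; apply/esym; exact: (cvg_unique (@norm_hausdorff _ _) (cvg_cst _) h).
Qed.

(** Integration by parts, as the vanishing of the integral of a partial derivative of the cosine
    times [f]. Since the sine is a cosine with phase shifted by [- pi / 2], the family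
    [phase_fourier] is stable under this operation. *)
Lemma phase_fourier_partial i f g (K : R) x th :
  measurable_fun setT (f : R3meas R -> R) -> measurable_fun setT (g : R3meas R -> R) ->
  (forall xi, is_derive xi (basis_vec i) f (g xi)) ->
  (forall xi, `|f xi| <= K * decay 4 xi) -> (forall xi, `|g xi| <= K * decay 4 xi) ->
  phase_fourier th g x = coord3 i x * phase_fourier (th - pi / 2) f x.
Proof.
move=> mf mg dfg fK gK.
have hf := integ_le_decay4 mf fK; have hg := integ_le_decay4 mg gK.
have ch := integ_cos_phase x (th - pi / 2) hf.
have cg := integ_cos_phase x th hg.
apply/eqP; rewrite -subr_eq0 -(RintZ (coord3 i x) ch).
rewrite -(RintB cg (integZ (coord3 i x) ch)); apply/eqP.
apply: (@integral_partial_eq0 i (fun xi => cos (dot3 x xi + th) * f xi) _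
  ((1 + `|coord3 i x|) * K)).
- exact: integ_cos_phase.
- apply: integ_meas (integB cg (integZ (coord3 i x) ch)).
- move=> xi.
  apply/is_derive_line0.
  have df0 := (is_derive_line0 f xi i (g xi)).1 (dfg xi).
  have d0 : is_derive (0 : R) 1 (fun s : R => dot3 x xi + th + s * coord3 i x) (coord3 i x).
    by apply: is_derive_eq; rewrite /GRing.scale /=; ring.
  have d1 := @is_derive1_comp _ cos (fun s : R => dot3 x xi + th + s * coord3 i x) 0 _ _
    (is_derive_cos _) d0.
  have -> : (fun s : R => cos (dot3 x (s *: basis_vec i + xi) + th) * f (s *: basis_vec i + xi)) =
      (cos \o (fun s : R => dot3 x xi + th + s * coord3 i x)) * (fun s : R => f (s *: basis_vec i + xi)).
    by apply/funext => s; rewrite dot3_lineE /GRing.mul /=; congr (cos _ * _); ring.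
  have := is_deriveM d1 df0.
  rewrite /= mul0r addr0 scale0r add0r.
  have -> : sin (dot3 x xi + th) = cos (dot3 x xi + (th - pi / 2)).
    by rewrite addrA cosB cos_pihalf sin_pihalf mulr0 add0r mulr1.
  by congr is_derive; rewrite /GRing.scale /=; ring.
- move=> xi; apply: (le_trans (ler_normB _ _)).
  rewrite (_ : (1 + `|coord3 i x|) * K * decay 4 xi =
    K * decay 4 xi + `|coord3 i x| * (K * decay 4 xi)); last by ring.
  rewrite !normrM; apply: lerD.
    by apply: le_trans (gK xi); rewrite ler_piMl // cos_le1_norm.
  rewrite ler_wpM2l //.
  by apply: le_trans (fK xi); rewrite ler_piMl // cos_le1_norm.
Qed.

(** Rapid decay of the pure derivatives in a single direction up to order [n]. Mixed derivatives can
    be ignored because [|x|^3] is controlled by the sum of the [|x_i|^3]. *)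
Fixpoint nice (i : 'I_3) (n : nat) f : Prop :=
  [/\ measurable_fun setT (f : R3meas R -> R),
   (forall k, exists C : R, forall x, `|f x| <= C * decay k x) &
   if n is m.+1 then (forall x, derivable f x (basis_vec i)) /\ nice i m (partial i f)
   else True].

Lemma nice_meas i n f : nice i n f -> measurable_fun setT (f : R3meas R -> R).
Proof. by case: n => [|n] []. Qed.

Lemma nice_bound i n f k : nice i n f -> exists C : R, forall x, `|f x| <= C * decay k x.
Proof. by case: n => [|n] []. Qed.

Lemma nice_S i n f : nice i n.+1 f -> nice i n f.
Proof.
elim: n f => [|n IH] f; first by move=> [? ? _]; split.
by move=> [mf bf [df nf]]; split => //; split => //; exact: IH.
Qed.

Lemma niceD i n f g : nice i n f -> nice i n g -> nice i n (fun x => f x + g x).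
Proof.
elim: n f g => [|n IH] f g.
  move=> [mf bf _] [mg bg _]; split => //; first exact: measurable_funD.
  move=> k; have [C hC] := bf k; have [D hD] := bg k; exists (C + D) => x.
  by rewrite mulrDl (le_trans (ler_normD _ _)) // lerD.
move=> [mf bf [df nf]] [mg bg [dg ng]]; split; first exact: measurable_funD.
  move=> k; have [C hC] := bf k; have [D hD] := bg k; exists (C + D) => x.
  by rewrite mulrDl (le_trans (ler_normD _ _)) // lerD.
split => [x|]; first exact: derivableD.
have -> : partial i (fun x => f x + g x) = (fun x => partial i f x + partial i g x).
  by apply/funext => x; rewrite /partial deriveD.
exact: IH.
Qed.

Lemma is_derive_coord i j x :
  is_derive x (basis_vec i) (coord3 j : R3 R -> R) (coord3 j (basis_vec i)).
Proof.
apply/is_derive_line0.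
have -> : (fun s : R => coord3 j (s *: basis_vec i + x)) =
    (fun s : R => s * coord3 j (basis_vec i) + coord3 j x).
  apply/funext => s; rewrite coord3D; congr (_ + _).
  by case: i => -[|[|[|//]]] ?; case: j => -[|[|[|//]]] ?; rewrite /coord3 /= /GRing.scale.
by apply: is_derive_eq; rewrite /GRing.scale /=; ring.
Qed.

Lemma measurable_coord3 j : measurable_fun setT (coord3 j : R3meas R -> R).
Proof.
case: j => -[|[|[|//]]] ?.
- exact: measurable_x1.
- exact: measurable_x2.
- exact: measurable_x3.
Qed.

Lemma nice_scale i n (a : R) f : nice i n f -> nice i n (fun x => a * f x).
Proof.
have B f' : (forall k, exists C : R, forall x, `|f' x| <= C * decay k x) ->
    (forall k, exists C : R, forall x, `|a * f' x| <= C * decay k x).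
  move=> bf k; have [C hC] := bf k; exists (`|a| * C) => x.
  by rewrite normrM -mulrA ler_wpM2l.
elim: n f => [|n IH] f.
  by move=> [mf bf _]; split => //; [apply: measurable_funM => //|exact: B].
move=> [mf bf [df nf]]; split; [exact: measurable_funM|exact: B|split => [x|]].
  exact: derivableZ.
have -> : partial i (fun x => a * f x) = (fun x => a * partial i f x).
  by apply/funext => x; rewrite /partial deriveZ.
exact: IH.
Qed.

Lemma nice_coord i j n f : nice i n f -> nice i n (fun x => coord3 j x * f x).
Proof.
have M f' : measurable_fun setT (f' : R3meas R -> R) ->
    measurable_fun setT ((fun x => coord3 j x * f' x) : R3meas R -> R).
  by move=> mf; apply: measurable_funM => //; exact: measurable_coord3.
have B f' : (forall k, exists C : R, forall x, `|f' x| <= C * decay k x) ->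
    (forall k, exists C : R, forall x, `|coord3 j x * f' x| <= C * decay k x).
  move=> bf k; have [C hC] := bf k.+1; exists C => x.
  rewrite normrM; apply: (@le_trans _ _ ((1 + euclid x) * (C * decay k.+1 x))).
    apply: ler_pM => //; apply: (le_trans (coord3_le j x)).
    by rewrite lerDr.
  rewrite mulrCA ler_wpM2l //.
    have := le_trans (normr_ge0 _) (hC 0); by rewrite pmulr_lge0 // decay_gt0.
  rewrite /decay exprS invfM mulrA mulfV ?mul1r // gt_eqF // bracket_gt0 //.
elim: n f => [|n IH] f.
  by move=> [mf bf _]; split => //; [exact: M|exact: B].
move=> [mf bf [df nf]]; split; [exact: M|exact: B|].
have D x : is_derive x (basis_vec i) (fun x => coord3 j x * f x)
    (coord3 j x * partial i f x + coord3 j (basis_vec i) * f x).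
  have h := is_deriveM (is_derive_coord i j x) (DeriveDef (df x) erefl).
  apply: (is_derive_eq h); rewrite /GRing.scale /= /partial; ring.
split => [x|]; first by case: (D x).
have -> : partial i (fun x => coord3 j x * f x) =
    (fun x => coord3 j x * partial i f x + coord3 j (basis_vec i) * f x).
  by apply/funext => x; rewrite /partial; exact: (@derive_val _ _ _ _ _ _ _ (D x)).
apply: niceD; first exact: IH.
by apply: nice_scale; apply: nice_S; split.
Qed.

Lemma schwartz_nice f i n : schwartz f -> nice i n f.
Proof.
move=> [sf bf]; suff : forall s, nice i n (partials s f) by move/(_ [::]).
have B s k : exists C : R, forall x, `|partials s f x| <= C * decay k x.
  have [C0 h0] := bf s 0%N; have [C1 h1] := bf s k.
  exists (2 ^+ k * (C0 + C1)) => x.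
  rewrite /decay ler_pdivlMr ?exprn_gt0 ?bracket_gt0 //.
  have E0 := euclid_ge0 x.
  have h0x : `|partials s f x| <= C0 by have := h0 x; rewrite expr0 mul1r.
  have C10 : 0 <= C1 by apply: le_trans (h1 x); rewrite mulr_ge0 // exprn_ge0.
  have C00 : 0 <= C0 by apply: le_trans h0x.
  have [x1|x1] := leP (euclid x) 1.
    rewrite mulrC; apply: ler_pM => //; first by rewrite exprn_ge0 // addr_ge0.
      by rewrite lerXn2r ?nnegrE ?addr_ge0 //; lra.
    by rewrite (le_trans h0x) // lerDl.
  apply: (@le_trans _ _ (2 ^+ k * (euclid x ^+ k * `|partials s f x|))).
    rewrite mulrA -exprMn mulrC ler_wpM2r // lerXn2r ?nnegrE ?addr_ge0 ?mulr_ge0 //; lra.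
  by rewrite ler_wpM2l ?exprn_ge0 // (le_trans (h1 x)) // lerDr.
elim: n => [|n IH] s.
  by split; [apply: continuous_measurable_R3; case: (sf s)|exact: B|].
split; [by apply: continuous_measurable_R3; case: (sf s)|exact: B|].
by split => [x|]; [case: (sf s) => _; exact|exact: (IH (i :: s))].
Qed.

Lemma nice_phase_fourier i n f x th : nice i n.+1 f ->
  phase_fourier th (partial i f) x = coord3 i x * phase_fourier (th - pi / 2) f x.
Proof.
move=> [mf bf [df nf]]; have [C hC] := bf 4%N; have [D hD] := nice_bound 4 nf.
apply: (@phase_fourier_partial i f _ (Num.max C D)) => //.
- exact: nice_meas nf.
- by move=> y; apply: (le_trans (hC y)); rewrite ler_wpM2r ?decay_ge0 // le_max lexx.
- by move=> y; apply: (le_trans (hD y)); rewrite ler_wpM2r ?decay_ge0 // le_max lexx orbT.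
Qed.

Lemma nice_integ i n f : nice i n f -> integ leb3 f.
Proof.
move=> nf; have [C hC] := nice_bound 4 nf; exact: integ_le_decay4 (nice_meas nf) hC.
Qed.

(** Order 3 is what is needed to test a radial function [V(|x|)/|x|] with [V] integrable against
    [(1 + r)^-2]: the sphere contributes [r^2], the quotient removes one power of [r]. The bound is
    uniform in the phase, so that real and imaginary parts are covered together. *)
Definition fourier_decay f := integ leb3 f /\
  exists C : R, forall th x, `|phase_fourier th f x| <= C * decay 3 x.

(** Three integrations by parts in each coordinate direction bound [|x_i|^3] times the transform by
    an integral of a third derivative, and the transform itself is bounded by the integral of
    [|f|]. *)
Lemma nice_fourier_decay f : (forall i, nice i 3 f) -> fourier_decay f.
Proof.
move=> nf; have hf := nice_integ (nf 0); split => //.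
have H i : exists C : R, forall th x, `|coord3 i x| ^+ 3 * `|phase_fourier th f x| <= C.
  have n3 := nf i; have [_ _ [_ n2]] := n3; have [_ _ [_ n1]] := n2; have [_ _ [_ n0]] := n1.
  exists (Rintegral leb3 setT (fun xi => `|partial i (partial i (partial i f)) xi|)) => th x.
  have := phase_fourier_le x (th + pi / 2 + pi / 2 + pi / 2) (@nice_integ i 0 _ n0).
  rewrite (@nice_phase_fourier i 0 _ _ _ n1) addrK (@nice_phase_fourier i 1 _ _ _ n2) addrK.
  by rewrite (@nice_phase_fourier i 2 _ _ _ n3) addrK !normrM !mulrA -expr2 -exprSr.
have [C0 h0] := H 0; have [C1 h1] := H 1; have [C2 h2] := H (inord 2).
pose C := Rintegral leb3 setT (fun xi => `|f xi|).
exists (8 * C + 8 * 27 * (C0 + C1 + C2)) => th x.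
rewrite /decay ler_pdivlMr ?exprn_gt0 ?bracket_gt0 //.
have hC := phase_fourier_le x th hf; rewrite -/C in hC.
have {h0} := h0 th x; have {h1} := h1 th x; have {h2} := h2 th x.
rewrite /coord3 /= inordK //=.
have := euclid_le_coord x; have := euclid_ge0 x.
move: (normr_ge0 x.1.1) (normr_ge0 x.1.2) (normr_ge0 x.2) (normr_ge0 (phase_fourier th f x)) hC.
move: `|x.1.1| `|x.1.2| `|x.2| `|phase_fourier th f x| (euclid x) C => a b c p r D.
move=> a0 b0 c0 p0 pD r0 rabc hc hb ha.
have a3 := exprn_ge0 3 a0; have b3 := exprn_ge0 3 b0; have c3 := exprn_ge0 3 c0.
(* Either [r <= 1], or [1 + r <= 2 r] and [r] is at most three times the largest coordinate: hence
   the factors 8 and 27. *)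
have M : (1 + r) ^+ 3 <= 8 * (1 + 27 * (a ^+ 3 + b ^+ 3 + c ^+ 3)).
  have [m [m0 mr m3]] : exists m, [/\ 0 <= m, r <= 3 * m & m ^+ 3 <= a ^+ 3 + b ^+ 3 + c ^+ 3].
    exists (Num.max a (Num.max b c)); split.
    - by rewrite le_max a0.
    - have h1 : a <= Num.max a (Num.max b c) by rewrite le_max lexx.
      have h2 : b <= Num.max a (Num.max b c) by rewrite !le_max lexx orbT.
      have h3 : c <= Num.max a (Num.max b c) by rewrite !le_max lexx !orbT.
      lra.
    - by rewrite /Num.max; case: ifP => _; [case: ifP => _|]; lra.
  have [r1|r1] := leP r 1.
    have : (1 + r) ^+ 3 <= 2 ^+ 3 by rewrite lerXn2r ?nnegrE ?addr_ge0 //; lra.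
    have -> : 2 ^+ 3 = 8 :> R by rewrite -natrX.
    lra.
  have : (1 + r) ^+ 3 <= (2 * r) ^+ 3 by rewrite lerXn2r ?nnegrE ?addr_ge0 ?mulr_ge0 //; lra.
  have : r ^+ 3 <= (3 * m) ^+ 3 by rewrite lerXn2r ?nnegrE ?mulr_ge0.
  rewrite !exprMn; have -> : 2 ^+ 3 = 8 :> R by rewrite -natrX.
  have -> : 3 ^+ 3 = 27 :> R by rewrite -natrX.
  lra.
apply: (le_trans (ler_wpM2l p0 M)).
by have := pD; lra.
Qed.

End FourierDecay.

Lemma ae_imply d (T : measurableType d) (R : realType) (m : {measure set T -> \bar R})
    (P Q : T -> Prop) : (forall x, P x -> Q x) ->
  {ae m, forall x, P x} -> {ae m, forall x, Q x}.
Proof. by move=> PQ; apply: filterS. Qed.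

Lemma le_of_eq (R : realType) (x y : R) : x = y -> x <= y.
Proof. by move=> ->. Qed.

(** * Decay after multiplication by the wave symbols *)

Section WaveSymbols.
Context {R : realType}.
Notation mu := (@lebesgue_measure R).
Implicit Types (x y xi : R3 R) (f g psi : R3 R -> R) (th t : R).

Lemma sin_lipschitz (a b : R) : `|sin a - sin b| <= `|a - b|.
Proof.
wlog ab : a b / b <= a.
  move=> H; have [/H //|/ltW/H] := leP b a.
  by rewrite distrC [X in _ <= X]distrC.
have [c _ ->] := @MVT_segment R sin cos b a ab (fun (x : R) _ => is_derive_sin x)
  (continuous_subspaceT (@continuous_sin R)).
by rewrite normrM ler_piMl // cos_le1_norm.
Qed.

Lemma norm_sin_le (a : R) : `|sin a| <= `|a|.
Proof. by have := sin_lipschitz a 0; rewrite sin0 !subr0. Qed.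

Lemma sin_quotient_le (r k : R) : 0 <= r -> `|sin (r * k) / k| <= r.
Proof.
move=> r0; have [->|k0] := eqVneq k 0; first by rewrite invr0 mulr0 normr0.
rewrite normrM normfV ler_pdivrMr ?normr_gt0 //.
by apply: (le_trans (norm_sin_le _)); rewrite normrM (ger0_norm r0).
Qed.

Lemma sin_symbol_le t xi : 0 <= t -> `|sin_symbol t xi| <= t.
Proof. by move=> t0; exact: sin_quotient_le. Qed.

(** A Lipschitz bound in the radius that is uniform in the frequency [k]; it controls the error of a
    thin shell for all [xi] at once. *)
Lemma sin_profile_lip (t r k : R) : 0 <= t -> t <= r ->
  `|r * (sin (r * k) / k) - t * (sin (t * k) / k)| <= (r - t) * (r + t).
Proof.
move=> t0 tr; have r0 := le_trans t0 tr.
have -> : r * (sin (r * k) / k) - t * (sin (t * k) / k) =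
  (r - t) * (sin (r * k) / k) + t * ((sin (r * k) - sin (t * k)) / k) by ring.
apply: (le_trans (ler_normD _ _)); rewrite mulrDr lerD //.
  by rewrite normrM ger0_norm ?subr_ge0 // ler_wpM2l ?subr_ge0 // sin_quotient_le.
rewrite normrM (ger0_norm t0) mulrC ler_wpM2r //.
have [->|k0] := eqVneq k 0; first by rewrite invr0 mulr0 normr0 subr_ge0.
rewrite normrM normfV ler_pdivrMr ?normr_gt0 //.
by apply: (le_trans (sin_lipschitz _ _)); rewrite -mulrBl normrM ger0_norm ?subr_ge0.
Qed.

Lemma ae_radial (P : R -> Prop) : {ae mu, forall r, P r} -> {ae leb3, forall x : R3 R, P (euclid x)}.
Proof.
move=> [N [mN N0 PN]].
pose S : set (R3meas R) := [set x | N (euclid x)].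
have mS : measurable S.
  rewrite (_ : S = setT `&` (fun x : R3meas R => euclid x) @^-1` N) ?setTI //.
  by rewrite -[X in measurable X]setTI; exact: measurable_euclid.
exists S; split => //; last by move=> x /= hx; apply: PN.
have mf : measurable_fun setT (fun r : R => (\1_N r : R)%:E).
  by apply/measurable_EFinP; exact: measurable_indic.
have f0 r : (0 <= (\1_N r : R)%:E)%E by rewrite lee_fin indicE.
rewrite -[S in LHS]setIT -integral_indic //.
have -> : (\int[leb3]_x (\1_S x)%:E = \int[leb3]_x (\1_N (euclid x))%:E)%E.
  by apply: eq_integral => x _; rewrite !indicE; do 3 congr (_ _); apply/idP/idP; rewrite !inE.
rewrite (polar_ge0 mf f0).
have mw : measurable_fun setT (fun r : R => ((sphere_weight r)%:E * (\1_N r : R)%:E)%E).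
  by apply: emeasurable_funM => //; apply/measurable_EFinP; exact: measurable_sphere_weight.
rewrite -(@integral0 _ _ _ mu setT); apply: ae_eq_integral => //.
exists N; split => // r /= hr; apply: contrapT => Nr; apply: hr => _.
by rewrite indicE memNset // mule0.
Qed.

Lemma ae_euclid_neq0 : {ae leb3, forall x : R3 R, euclid x != 0}.
Proof.
apply: (ae_radial (P := fun r => r != 0)); exists [set 0]; split => //.
  exact: lebesgue_measure_set1.
by move=> r /= /negP; rewrite negbK => /eqP.
Qed.

Let shell (t d r : R) : R := if (t <= r) && (r <= t + d) then 1 else 0.

Let measurable_shell t d : measurable_fun setT (shell t d).
Proof.
apply: measurable_fun_ifT; [|exact: measurable_cst|exact: measurable_cst].
by apply: measurable_and; apply: measurable_fun_ler => //; exact: measurable_cst.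
Qed.

Let shell_ge0 t d r : 0 <= shell t d r.
Proof. by rewrite /shell; case: ifP. Qed.

Let integ_shell t d : 0 <= d -> integ mu (shell t d) /\ Rintegral mu setT (shell t d) = d.
Proof.
move=> d0.
have E : (\int[mu]_x (shell t d x)%:E = d%:E)%E.
  have h := @integral_cst_itv R t (t + d) 1%:E; rewrite mul1e in h.
  have {h} := h _; rewrite lerDl => /(_ d0); rewrite addrAC subrr add0r => <-.
  rewrite [RHS]integral_mkcond; apply: eq_integral => x _.
  by rewrite patchE mem_setE in_itv /= /shell; case: ifP.
split; last by rewrite /Rintegral E.
apply: integP; first exact: measurable_shell.
under eq_integral do rewrite ger0_norm ?shell_ge0 //.
by rewrite E ltry.
Qed.

Let shell_le_decay t d r : 0 <= t -> 0 <= d -> sphere_weight r * shell t d r <=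
  4 * disk_area * (t + d) ^+ 2 * shell t d r.
Proof.
move=> t0 d0; rewrite /shell; case: ifP => [/andP[tr rd]|_]; last by rewrite !mulr0.
rewrite !mulr1 /sphere_weight (le_trans t0 tr); rewrite ler_wpM2l //.
  by rewrite mulr_ge0 // ltW // disk_area_gt0.
by rewrite lerXn2r ?nnegrE ?addr_ge0 // (le_trans t0).
Qed.

Let integ_shell3 t d : 0 <= t -> 0 <= d -> integ leb3 (fun x => shell t d (euclid x)) /\
  Rintegral leb3 setT (fun x => shell t d (euclid x)) <= 4 * disk_area * (t + d) ^+ 2 * d.
Proof.
move=> t0 d0; have [i1 Es] := integ_shell t d0.
have iw : integ mu (fun r => sphere_weight r * shell t d r).
  apply: (@integ_le _ (measurableTypeR R) _ mu _ (fun r => 4 * disk_area * (t + d) ^+ 2 * shell t d r)).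
  - by apply: measurable_funM; [exact: measurable_sphere_weight|exact: measurable_shell].
  - exact: integZ.
  - by move=> r; rewrite ger0_norm ?mulr_ge0 ?sphere_weight_ge0 ?shell_ge0 // shell_le_decay.
split; first by apply: (polar_integ _).2 => //; exact: measurable_shell.
rewrite polar_Rint; last exact: measurable_shell.
rewrite -[X in _ <= _ * X]Es -RintZ //; apply: Rint_le => //; first exact: integZ.
by move=> r; exact: shell_le_decay.
Qed.

Lemma measurable_sin_symbol : measurable_fun setT (fun z : R3meas R * measurableTypeR R => sin_symbol z.2 z.1).
Proof.
have me : measurable_fun setT (fun z : R3meas R * measurableTypeR R => euclid z.1).
  exact: (measurableT_comp measurable_euclid measurable_fst).
apply: measurable_funM; last exact: measurable_inv.
apply: measurable_comp_cont; first exact: continuous_sin.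
by apply: measurable_funM => //; exact: measurable_snd.
Qed.

Lemma measurable_sin_symbol1 t : measurable_fun setT (fun xi : R3meas R => sin_symbol t xi).
Proof. exact: (measurableT_comp measurable_sin_symbol (pair2_measurable t)). Qed.

Lemma integ_sin_symbol t f : 0 <= t -> integ leb3 f -> integ leb3 (fun xi => sin_symbol t xi * f xi).
Proof.
move=> t0 hf; apply: (@integ_bndM _ (R3meas R) _ leb3 f _ t) => //.
  exact: measurable_sin_symbol1.
by move=> xi; exact: sin_symbol_le.
Qed.

Lemma measurable_dot3 :
  measurable_fun setT (fun z : R3meas R * R3meas R => dot3 z.1 z.2).
Proof.
rewrite (_ : (fun z : R3meas R * R3meas R => _) = fun z : R3meas R * R3meas R =>
   z.1.1.1 * z.2.1.1 + z.1.1.2 * z.2.1.2 + z.1.2 * z.2.2); last by apply/funext => y; rewrite dot3E.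
apply: measurable_funD; [apply: measurable_funD|]; apply: measurable_funM.
- exact: (measurableT_comp measurable_x1 measurable_fst).
- exact: (measurableT_comp measurable_x1 measurable_snd).
- exact: (measurableT_comp measurable_x2 measurable_fst).
- exact: (measurableT_comp measurable_x2 measurable_snd).
- exact: (measurableT_comp measurable_x3 measurable_fst).
- exact: (measurableT_comp measurable_x3 measurable_snd).
Qed.

Lemma dot3C x y : dot3 x y = dot3 y x.
Proof. by rewrite !dot3E; ring. Qed.

(** The transform of the shell is [4 * disk_area] times the integral of [r * sin (r k) / k] over
    [[t, t + d]]. Freezing [r] at [t] gives the multiple of [sin_symbol t], with an error smaller
    than the main term by a factor [d]. *)
Let shell_transform t d xi : 0 <= t -> 0 < d -> d <= 1 -> euclid xi != 0 ->
  `|Rintegral leb3 setT (fun y => shell t d (euclid y) * cos (dot3 y xi + 0)) -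
    4 * disk_area * d * (t * sin_symbol t xi)| <= 4 * disk_area * d * (d * (2 * t + 1)).
Proof.
move=> t0 d0 d1 k0.
have [is3 _] := integ_shell3 t0 (ltW d0); have [is1 Es1] := integ_shell t (ltW d0).
have [ig ->] := radial_fourier 0 (measurable_shell t d) is3 k0.
rewrite /sin_symbol; move: (euclid xi) k0 ig => k k0 ig.
have c0 : 0 < 4 * (disk_area : R) by rewrite mulr_gt0 // disk_area_gt0.
move: (4 * disk_area) c0 ig => c c0 ig.
have -> : c * d * (t * (sin (t * k) / k)) =
    Rintegral mu setT (fun r => c * (t * (sin (t * k) / k)) * shell t d r).
  by rewrite (RintZ _ is1) Es1; ring.
have -> : c * d * (d * (2 * t + 1)) =
    Rintegral mu setT (fun r => c * (d * (2 * t + 1)) * shell t d r).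
  by rewrite (RintZ _ is1) Es1; ring.
have iz a : integ mu (fun r => a * shell t d r) by exact: integZ.
rewrite -(RintB ig (iz _)); apply: Rint_norm_le; [exact: (integB ig (iz _))|exact: iz|].
move=> r; rewrite /shell; case: (boolP ((t <= r) && (r <= t + d))) => [/andP[tr rd]|_]; last first.
  by rewrite !(mul0r,mulr0) if_same subr0 normr0.
rewrite (le_trans t0 tr) cos0 !(mulr1,mul1r) -mulrBr normrM (gtr0_norm c0).
apply: ler_wpM2l; first exact: ltW.
rewrite (mulrC k); apply: (le_trans (sin_profile_lip _ t0 tr)).
by apply: ler_pM; lra.
Qed.

Let integ_shell_cos t d xi : 0 <= t -> 0 <= d ->
  integ leb3 (fun y => shell t d (euclid y) * cos (dot3 y xi + 0)).
Proof.
move=> t0 d0; have [is3 _] := integ_shell3 t0 d0.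
apply: (@integ_ext _ (R3meas R) _ _ (fun y => cos (dot3 y xi + 0) * shell t d (euclid y))).
  by move=> y; rewrite mulrC.
apply: (@integ_bndM _ (R3meas R) _ leb3 _ _ 1 is3); last by move=> y; exact: cos_le1_norm.
apply: measurable_comp_cont; first exact: continuous_cos.
apply: measurable_funD; last exact: measurable_cst.
rewrite (_ : (fun y : R3meas R => dot3 y xi) = (fun y : R3meas R => dot3 xi y)).
  exact: measurable_dot3_l.
by apply/funext => y; rewrite dot3C.
Qed.

(* Average over a thin shell: by Fubini it multiplies the transform by the Fourier
   transform of the shell, which is close to a multiple of [sin_symbol t]. *)
Let shell_average t d f x th (C : R) : 0 <= t -> 0 < d -> d <= 1 -> 0 <= C ->
  integ leb3 f -> (forall th x, `|phase_fourier th f x| <= C * decay 3 x) ->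
  t * `|phase_fourier th (fun xi => sin_symbol t xi * f xi) x| <=
  C * (2 + t) ^+ 3 * (t + d) ^+ 2 * decay 3 x +
  d * (2 * t + 1) * Rintegral leb3 setT (fun xi => `|f xi|).
Proof.
move=> t0 d0 d1 C0 hf fC.
have [is3 Es3] := integ_shell3 t0 (ltW d0).
have [is1 Es1] := integ_shell t (ltW d0).
have mf := integ_meas hf.
have [c [c0 cE]] : exists c : R, 0 < c /\ 4 * disk_area = c.
  by exists (4 * disk_area); rewrite mulr_gt0 // disk_area_gt0.
rewrite cE in Es3.
pose F (z : R3 R * R3 R) := cos (dot3 x z.1 + th) * f z.1 *
  (shell t d (euclid z.2) * cos (dot3 z.2 z.1 + 0)).
have mF : measurable_fun setT (F : R3meas R * R3meas R -> R).
  apply: measurable_funM; first apply: measurable_funM.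
  - exact: (measurableT_comp (measurable_cos_phase x th) measurable_fst).
  - exact: (measurableT_comp mf measurable_fst).
  - apply: measurable_funM.
      exact: (measurableT_comp (measurable_comp_euclid (measurable_shell t d)) measurable_snd).
    apply: measurable_comp_cont; first exact: continuous_cos.
    apply: measurable_funD; last exact: measurable_cst.
    have msw : measurable_fun setT (fun z : R3meas R * R3meas R => (z.2, z.1)).
      by apply: measurable_fun_pair; [exact: measurable_snd|exact: measurable_fst].
    exact: (measurableT_comp measurable_dot3 msw).
have iF : integ (leb3 \x leb3)%E F.
  apply: (@integ_prodM _ _ _ _ _ leb3 leb3 F (fun xi => `|f xi|) (fun y => shell t d (euclid y))) => //.
    exact: integ_abs.
  move=> xi y; rewrite /F /= !normrM (ger0_norm (shell_ge0 _ _ _)).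
  apply: ler_pM.
  - by rewrite mulr_ge0.
  - by rewrite mulr_ge0 ?shell_ge0.
  - by rewrite ler_piMl // cos_le1_norm.
  - by rewrite ler_piMr ?shell_ge0 // cos_le1_norm.
pose P := Rintegral leb3 setT (fun y => Rintegral leb3 setT (fun xi => F (xi, y))).
(* For fixed [y] the product of the two cosines splits into the transforms of [f] at [x + y] and
   [x - y]. Since [1 + |y| <= 1 + t + d <= 2 + t], Peetre's inequality costs the factor
   [(2 + t) ^+ 3]. *)
have hP : `|P| <= C * (2 + t) ^+ 3 * decay 3 x * (c * (t + d) ^+ 2 * d).
  apply: (@le_trans _ _ (C * (2 + t) ^+ 3 * decay 3 x *
     Rintegral leb3 setT (fun y => shell t d (euclid y)))); last first.
    by rewrite ler_wpM2l // mulr_ge0 ?decay_ge0 // mulr_ge0 // exprn_ge0 // addr_ge0.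
  rewrite -RintZ //; apply: Rint_norm_le.
  - exact: (Fubini_integ2 iF).
  - exact: integZ.
  move=> y.
  have -> : Rintegral leb3 setT (fun xi => F (xi, y)) =
     shell t d (euclid y) * (2^-1 * (phase_fourier th f (x + y) + phase_fourier th f (x - y))).
    have i1 := integ_cos_phase (x + y) th hf; have i2 := integ_cos_phase (x - y) th hf.
    rewrite -(RintD i1 i2) -RintZ; last exact: integD.
    rewrite -RintZ; last exact/integZ/integD.
    apply: Rint_ext => xi; rewrite /F /= addr0.
    have -> : dot3 (x + y) xi + th = (dot3 x xi + th) + dot3 y xi by rewrite !dot3E /=; ring.
    have -> : dot3 (x - y) xi + th = (dot3 x xi + th) - dot3 y xi by rewrite !dot3E /=; ring.
    by set a := dot3 x xi + th; rewrite cosD cosB; field.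
  rewrite normrM (ger0_norm (shell_ge0 _ _ _)) /shell; case: ifP => [/andP[ty yd]|_]; last first.
    by rewrite mul0r mulr0.
  rewrite mul1r mulr1 normrM ger0_norm ?invr_ge0 //.
  have B (z : R3 R) : euclid z = euclid y -> `|phase_fourier th f (x + z)| <= C * (2 + t) ^+ 3 * decay 3 x.
    move=> zy; apply: (le_trans (fC _ _)); rewrite -mulrA ler_wpM2l //.
    apply: (le_trans (decay_shift _ _ _)); rewrite ler_wpM2r ?decay_ge0 //.
    by rewrite lerXn2r ?nnegrE ?addr_ge0 ?euclid_ge0 // zy; lra.
  have := B y erefl; have := B (- y) (euclidN y).
  have := ler_normD (phase_fourier th f (x + y)) (phase_fourier th f (x - y)).
  by lra.
have EP : P = Rintegral leb3 setT (fun xi => Rintegral leb3 setT (fun y => F (xi, y))).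
  by rewrite /P -(Fubini_swap iF).
pose S xi := sin_symbol t xi * f xi.
have iS : integ leb3 S by exact: integ_sin_symbol.
have iSc := integ_cos_phase x th iS.
have iFx := Fubini_integ1 iF.
have hPS : `|P - c * d * t * phase_fourier th S x| <=
    c * d * (d * (2 * t + 1)) * Rintegral leb3 setT (fun xi => `|f xi|).
  rewrite EP -(RintZ (c * d * t) iSc) -(RintB iFx (integZ _ iSc)) -RintZ; last exact: integ_abs.
  have iD := integB iFx (integZ (c * d * t) iSc).
  (* The frequency 0 is removed, as [sin_symbol] has only its default value there and
     [shell_transform] excludes it. *)
  have -> : Rintegral leb3 setT (fun xi => Rintegral leb3 setT (fun y => F (xi, y)) -
      c * d * t * (cos (dot3 x xi + th) * S xi)) =
    Rintegral leb3 setT (fun xi => if euclid xi != 0 then Rintegral leb3 setT (fun y => F (xi, y)) -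
      c * d * t * (cos (dot3 x xi + th) * S xi) else 0).
    apply: Rint_ae.
    - exact: integ_meas iD.
    - apply: measurable_fun_ifT; [|exact: integ_meas iD|exact: measurable_cst].
      apply: measurable_neg; apply: measurable_fun_eqr; [exact: measurable_euclid|exact: measurable_cst].
    - by apply: (@ae_imply _ (R3meas R) _ leb3 _ _ _ ae_euclid_neq0) => xi ->.
  apply: Rint_norm_ub.
  - apply: measurable_fun_ifT; [|exact: integ_meas iD|exact: measurable_cst].
    apply: measurable_neg; apply: measurable_fun_eqr; [exact: measurable_euclid|exact: measurable_cst].
  - exact/integZ/integ_abs.
  move=> xi; case: ifPn => [k0|_]; last first.
    rewrite normr0; apply: mulr_ge0; last exact: normr_ge0.
    have tp : 0 <= 2 * t + 1 by lra.
    exact: (mulr_ge0 (ltW (mulr_gt0 c0 d0)) (mulr_ge0 (ltW d0) tp)).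
  have -> : Rintegral leb3 setT (fun y => F (xi, y)) = cos (dot3 x xi + th) * f xi *
      Rintegral leb3 setT (fun y => shell t d (euclid y) * cos (dot3 y xi + 0)).
    by rewrite -(RintZ _ (integ_shell_cos xi t0 (ltW d0))).
  have H := shell_transform t0 d0 d1 k0; rewrite cE in H.
  move: (Rintegral _ _ _) H => I H.
  rewrite (_ : _ - _ = cos (dot3 x xi + th) * (f xi * (I - c * d * (t * sin_symbol t xi)))); last first.
    by rewrite /S; ring.
  rewrite !normrM mulrCA; apply: (@le_trans _ _ (`|f xi| * (c * d * (d * (2 * t + 1))))).
    apply: ler_wpM2l; first exact: normr_ge0.
    apply: le_trans H; rewrite -[X in _ <= X]mul1r.
    by apply: ler_wpM2r; [exact: normr_ge0|exact: cos_le1_norm].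
  by rewrite mulrC.
have cd : 0 < c * d by rewrite mulr_gt0.
rewrite -(ler_pM2l cd).
have -> : c * d * (t * `|phase_fourier th S x|) = `|c * d * t * phase_fourier th S x|.
  have cdt := mulr_ge0 (ltW cd) t0.
  rewrite normrM (ger0_norm cdt); exact: mulrA.
have := ler_normB P (P - c * d * t * phase_fourier th S x).
rewrite opprB addrC subrK => h; apply: (le_trans h).
by apply: (le_trans (lerD hP hPS)); apply: le_of_eq; ring.
Qed.

(** The thickness of the shell tends to 0 in [shell_average]; the error term there carries no decay
    in [x], but it is linear in [d] for each fixed [x]. The time [t = 0] is separate because the
    average only controls [t] times the transform. *)
Lemma sin_symbol_decay f (C : R) : 0 <= C ->
  integ leb3 f -> (forall th x, `|phase_fourier th f x| <= C * decay 3 x) ->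
  forall t th x, 0 <= t ->
  `|phase_fourier th (fun xi => sin_symbol t xi * f xi) x| <= C * (2 + t) ^+ 3 * t * decay 3 x.
Proof.
move=> C0 hf fC t th x t0.
have [->|tn0] := eqVneq t 0.
  rewrite mulr0 mul0r /phase_fourier (_ : Rintegral _ _ _ = 0) ?normr0 //.
  rewrite -[RHS](Rint0 leb3); apply: Rint_ext => xi.
  by rewrite /sin_symbol mul0r sin0 !mul0r mulr0.
have tp : 0 < t by rewrite lt_neqAle eq_sym tn0.
rewrite -(ler_pM2l tp); set A := `|_|; set M := Rintegral leb3 setT (fun xi => `|f xi|).
have M0 : 0 <= M by apply: Rint_ge0.
pose K := C * (2 + t) ^+ 3 * decay 3 x.
have K0 : 0 <= K by rewrite mulr_ge0 ?decay_ge0 // mulr_ge0 // exprn_ge0 // addr_ge0.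
have H d : 0 < d -> d <= 1 -> t * A <= K * t ^+ 2 + d * ((2 * t + 1) * (K + M)).
  move=> d0 d1; apply: (le_trans (shell_average x th t0 d0 d1 C0 hf fC)).
  rewrite -/M (_ : C * _ * _ * _ = K * (t + d) ^+ 2); last by rewrite /K; ring.
  have -> : K * (t + d) ^+ 2 = K * t ^+ 2 + K * (d * (2 * t + d)) by ring.
  rewrite -addrA lerD2l.
  have : K * (d * (2 * t + d)) <= K * (d * (2 * t + 1)).
    by rewrite ler_wpM2l // ler_wpM2l ?(ltW d0) // lerD2l.
  by lra.
rewrite [X in _ <= X](_ : _ = K * t ^+ 2); last by rewrite /K; ring.
rewrite leNgt; apply/negP => h.
pose L := (2 * t + 1) * (K + M) + 1.
have L0 : 0 < L by rewrite ltr_wpDl // mulr_ge0 ?addr_ge0 // mulr_ge0.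
pose e := t * A - K * t ^+ 2.
have e0 : 0 < e by rewrite subr_gt0.
(* An excess [e] over the claimed bound would have to be at most [d * L] for every small [d]; this
   fails for [d] at most [e / (2 L)]. *)
have := H (Num.min 1 (e / L / 2)); rewrite lt_min ltr01 /= ge_min lexx /= => /(_ _ isT).
rewrite !divr_gt0 // => /(_ isT).
have : Num.min 1 (e / L / 2) * ((2 * t + 1) * (K + M)) <= e / 2.
  apply: (@le_trans _ _ (e / L / 2 * L)).
    apply: ler_pM.
    - by rewrite le_min ler01 /= !divr_ge0 // ltW.
    - by rewrite mulr_ge0 ?addr_ge0 // mulr_ge0.
    - by rewrite ge_min lexx orbT.
    - by rewrite /L lerDl.
  by rewrite mulrAC divfK // gt_eqF.
by rewrite {1 2}/e; lra.
Qed.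

Let shell_norm t d r : `|shell t d r| = shell t d r.
Proof. by rewrite ger0_norm // shell_ge0. Qed.

Let int_sin_symbol t xi : 0 <= t ->
  Rintegral mu setT (fun s => shell 0 t s * (sin_symbol s xi * euclid xi ^+ 2)) =
  1 - cos_symbol t xi.
Proof.
move=> t0; set k := euclid xi.
have E s : sin_symbol s xi * k ^+ 2 = k * sin (s * k).
  rewrite /sin_symbol -/k; have [->|k0] := eqVneq k 0; first by rewrite expr0n mulr0 mul0r.
  by field.
have -> : Rintegral mu setT (fun s => shell 0 t s * (sin_symbol s xi * k ^+ 2)) =
    fine (\int[mu]_(s in [set` `[0%R, t]]) (k * sin (s * k))%:E)%E.
  congr fine; rewrite [RHS]integral_mkcond; apply: eq_integral => s _.
  rewrite patchE mem_setE in_itv /= /shell add0r E.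
  by case: ifP; rewrite ?mul0r ?mul1r.
have dl (s : R) : is_derive s 1 (fun s : R => s * k) k.
  by apply: is_derive_eq; rewrite /GRing.scale /=; ring.
have dF (s : R) : is_derive s 1 (fun s : R => - cos (s * k)) (k * sin (s * k)).
  have h := @is_derive1_comp _ cos (fun s : R => s * k) s _ _ (is_derive_cos _) (dl s).
  apply: (is_derive_eq (is_deriveN h)); rewrite /=; ring.
have cf : continuous (fun s : R => k * sin (s * k)).
  exact: (@continuous_of_derive _ _ (fun s => k * (cos (s * k) * k))).
by rewrite (FTC_real t0 cf dF) /= mul0r cos0 /cos_symbol -/k; ring.
Qed.

Lemma measurable_cos_symbol t : measurable_fun setT (fun xi : R3meas R => cos_symbol t xi).
Proof.
apply: measurable_comp_cont; first exact: continuous_cos.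
by apply: measurable_funM; [exact: measurable_cst|exact: measurable_euclid].
Qed.

Lemma integ_cos_symbol t f : integ leb3 f -> integ leb3 (fun xi => cos_symbol t xi * f xi).
Proof.
move=> hf; apply: (@integ_bndM _ (R3meas R) _ leb3 f _ 1) => //.
  exact: measurable_cos_symbol.
by move=> xi; exact: cos_le1_norm.
Qed.

(* Integrates [sin_symbol s] in [s]: cos (t k) = 1 - k ^ 2 \int_0^t sin (s k) / k ds. *)
Lemma cos_symbol_decay f (C D : R) : 0 <= C -> 0 <= D ->
  integ leb3 f -> (forall th x, `|phase_fourier th f x| <= C * decay 3 x) ->
  let q xi := euclid xi ^+ 2 * f xi in
  integ leb3 q -> (forall th x, `|phase_fourier th q x| <= D * decay 3 x) ->
  forall t th x, 0 <= t ->
  `|phase_fourier th (fun xi => cos_symbol t xi * f xi) x| <=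
    (C + t * (D * (2 + t) ^+ 3 * t)) * decay 3 x.
Proof.
move=> C0 D0 hf fC q hq qD t th x t0.
have [i1 Es] := integ_shell 0 t0; have ms := measurable_shell 0 t.
pose F (z : R3 R * R) := cos (dot3 x z.1 + th) * (shell 0 t z.2 * (sin_symbol z.2 z.1 * q z.1)).
have mF : measurable_fun setT (F : R3meas R * measurableTypeR R -> R).
  apply: measurable_funM; first exact: (measurableT_comp (measurable_cos_phase x th) measurable_fst).
  apply: measurable_funM; first exact: (measurableT_comp (ms : measurable_fun setT _) measurable_snd).
  apply: measurable_funM; first exact: measurable_sin_symbol.
  exact: (measurableT_comp (integ_meas hq) measurable_fst).
have shell_sin s xi : `|shell 0 t s * sin_symbol s xi| <= t * shell 0 t s.
  rewrite normrM shell_norm mulrC /shell; case: ifP => [/andP[s0 st]|_]; last by rewrite !mulr0.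
  by rewrite !mulr1 (le_trans (sin_symbol_le _ s0)) // -[t]add0r.
have iF : integ (leb3 \x mu)%E F.
  apply: (@integ_prodM _ _ _ _ _ leb3 mu F (fun xi => `|q xi|) (fun s => t * shell 0 t s)) => //.
  - exact: integ_abs.
  - exact: integZ.
  move=> xi s; rewrite (_ : F (xi, s) = cos (dot3 x xi + th) * (q xi * (shell 0 t s * sin_symbol s xi))).
    rewrite normrM; apply: (@le_trans _ _ (1 * `|q xi * (shell 0 t s * sin_symbol s xi)|)).
      by rewrite ler_wpM2r // cos_le1_norm.
    by rewrite mul1r normrM ler_wpM2l.
  by rewrite /F /=; ring.
have iq s : 0 <= s -> integ leb3 (fun xi => sin_symbol s xi * q xi) by move=> s0; exact: integ_sin_symbol.
have E1 xi : Rintegral mu setT (fun s => F (xi, s)) = cos (dot3 x xi + th) * (f xi - cos_symbol t xi * f xi).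
  have is1 : integ mu (fun s => shell 0 t s * (sin_symbol s xi * euclid xi ^+ 2)).
    apply: (@integ_le _ (measurableTypeR R) _ mu _ (fun s => euclid xi ^+ 2 * (t * shell 0 t s))).
    - apply: measurable_funM => //; apply: measurable_funM; last exact: measurable_cst.
      exact: (measurableT_comp measurable_sin_symbol (pair1_measurable xi)).
    - exact/integZ/integZ.
    - by move=> s; rewrite mulrA normrM mulrC ger0_norm ?sqr_ge0 // ler_wpM2l // sqr_ge0.
  rewrite /F /= (_ : f xi - _ = (1 - cos_symbol t xi) * f xi); last by ring.
  rewrite -(int_sin_symbol xi t0) [_ * f xi]mulrC -RintZ // -RintZ; last exact: integZ.
  by apply: Rint_ext => s; rewrite /q; ring.
have E2 s : Rintegral leb3 setT (fun xi => F (xi, s)) =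
    shell 0 t s * phase_fourier th (fun xi => sin_symbol s xi * q xi) x.
  rewrite /F /= /shell; case: ifP => [/andP[s0 _]|_].
    by rewrite mul1r; apply: Rint_ext => xi; rewrite mul1r.
  by rewrite mul0r -[RHS](Rint0 leb3); apply: Rint_ext => xi; rewrite mul0r mulr0.
have ic := integ_cos_phase x th (integ_cos_symbol t hf).
have icf := integ_cos_phase x th hf.
have -> : phase_fourier th (fun xi => cos_symbol t xi * f xi) x =
    phase_fourier th f x - Rintegral mu setT (fun s => Rintegral leb3 setT (fun xi => F (xi, s))).
  rewrite -(Fubini_swap iF).
  have -> : Rintegral leb3 setT (fun xi => Rintegral mu setT (fun s => F (xi, s))) =
    phase_fourier th f x - phase_fourier th (fun xi => cos_symbol t xi * f xi) x.
    rewrite -(RintB icf ic); apply: Rint_ext => xi; rewrite E1; ring.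
  by ring.
apply: (le_trans (ler_normB _ _)); rewrite mulrDl lerD //.
apply: (@le_trans _ _ (Rintegral mu setT (fun s => D * (2 + t) ^+ 3 * t * decay 3 x * shell 0 t s))).
  apply: Rint_norm_le; [exact: Fubini_integ2 iF|exact: integZ|].
  move=> s; rewrite E2 normrM shell_norm /shell; case: ifP => [/andP[s0 st]|_]; last first.
    by rewrite mul0r mulr0.
  rewrite add0r in st; rewrite mul1r mulr1.
  apply: (le_trans (sin_symbol_decay D0 hq qD th x s0)).
  apply: ler_wpM2r; first exact: decay_ge0.
  apply: ler_pM => //; first by rewrite mulr_ge0 // exprn_ge0 // addr_ge0.
  apply: ler_wpM2l => //; rewrite lerXn2r ?nnegrE ?addr_ge0 //; lra.
by rewrite RintZ // Es; apply: le_of_eq; ring.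
Qed.

End WaveSymbols.

(** * Wave multipliers on radial functions *)

Lemma integ_prod_R d1 d2 (T1 : measurableType d1) (T2 : measurableType d2) (R : realType)
    (m1 : {sigma_finite_measure set T1 -> \bar R})
    (m2 : {sigma_finite_measure set T2 -> \bar R}) (f : T1 * T2 -> R) (G : T1 -> R) :
  measurable_fun setT f -> integ m1 G ->
  (forall x, integ m2 (fun y => f (x, y))) ->
  (forall x, Rintegral m2 setT (fun y => `|f (x, y)|) <= G x) ->
  integ (m1 \x m2)%E f.
Proof.
move=> mf hG h1 h2; apply: (integ_prod mf hG) => x.
by rewrite -EFin_Rint ?lee_fin //; exact: (integ_abs (h1 x)).
Qed.

Section OddProfiles.
Context {R : realType}.
Notation mu := (@lebesgue_measure R).
Implicit Types (V : R -> R) (x xi : R3 R) (t k th r a : R).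

(* If [V] is the odd extension of [r * H r], this is the radial function [H (euclid x)]. *)
Definition radial_of V x : R := V (euclid x) / euclid x.

Definition odd_fun V := forall r, V (- r) = - V r.

Definition wt r : R := (1 + `|r|) ^- 2.

Lemma wt_gt0 r : 0 < wt r.
Proof. by rewrite invr_gt0 exprn_gt0 // ltr_pwDl. Qed.

Lemma wt_ge0 r : 0 <= wt r. Proof. exact/ltW/wt_gt0. Qed.

Lemma wtK r : (1 + `|r|) ^+ 2 * wt r = 1.
Proof. by rewrite mulfV // gt_eqF // exprn_gt0 // ltr_pwDl. Qed.

Lemma measurable_wt : measurable_fun setT wt.
Proof.
by apply: measurable_inv; apply: measurable_funX; apply: measurable_funD.
Qed.

Lemma wt_shift r a : wt r <= (1 + `|a|) ^+ 2 * wt (r + a).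
Proof.
have p1 : 0 < 1 + `|r| by rewrite ltr_pwDl.
have p2 : 0 < 1 + `|r + a| by rewrite ltr_pwDl.
rewrite /wt ler_pdivlMr ?exprn_gt0 // mulrC ler_pdivrMr ?exprn_gt0 // -exprMn.
rewrite lerXn2r ?nnegrE ?mulr_ge0 ?addr_ge0 //.
have := ler_normD r a; have := mulr_ge0 (normr_ge0 r) (normr_ge0 a); lra.
Qed.

(** The profiles that can be tested: [radial_of V] times a function of decay 3 is integrable on
    space. The class contains bounded functions, functions of growth [sqrt |r|] and
    square-integrable functions, that is, the sources, the profile of [u0] and the profile of
    [u1]. *)
Definition adm V := measurable_fun setT V /\ integ mu (fun r => wt r * V r).

Lemma adm_mul (chi V : R -> R) (B : R) : measurable_fun setT chi ->
  (forall r, `|chi r| <= B * wt r) -> adm V -> integ mu (fun r => chi r * V r).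
Proof.
move=> mc hc [mV iV].
apply: (@integ_le _ (measurableTypeR R) _ mu _ (fun r => B * `|wt r * V r|)).
- exact: measurable_funM.
- exact/integZ/integ_abs.
- move=> r; rewrite !normrM mulrA ler_wpM2r //.
  by rewrite (ger0_norm (wt_ge0 r)).
Qed.

Lemma adm_le V W : measurable_fun setT V -> adm W -> (forall r, `|V r| <= `|W r|) -> adm V.
Proof.
move=> mV [mW iW] VW; split => //.
apply: (@integ_le _ (measurableTypeR R) _ mu _ (fun r => `|wt r * W r|)).
- by apply: measurable_funM => //; exact: measurable_wt.
- exact: integ_abs.
- by move=> r; rewrite !normrM ler_wpM2l.
Qed.

Lemma measurable_shift V a : measurable_fun setT V -> measurable_fun setT (fun r : R => V (r + a)).
Proof.
move=> mV; have [ms _] := lebesgue_shift a.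
exact: (measurableT_comp (mV : measurable_fun setT V) ms).
Qed.

Lemma integ_shift V a : integ mu V -> integ mu (fun r => V (r + a)).
Proof. exact: (mp_integ (lebesgue_shift a)). Qed.

Lemma Rint_shift V a : measurable_fun setT V ->
  Rintegral mu setT (fun r => V (r + a)) = Rintegral mu setT V.
Proof. exact: (mp_Rint (lebesgue_shift a)). Qed.

Lemma adm_shift V a : adm V -> adm (fun r => V (r + a)).
Proof.
move=> [mV iV]; split; first exact: measurable_shift.
apply: (@integ_le _ (measurableTypeR R) _ mu _
   (fun r => (1 + `|a|) ^+ 2 * `|wt (r + a) * V (r + a)|)).
- apply: measurable_funM; first exact: measurable_wt.
  exact: measurable_shift.
- by apply: integZ; exact: (integ_shift a (integ_abs iV)).
- move=> r; rewrite !normrM !(ger0_norm (wt_ge0 _)) mulrA ler_wpM2r //.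
  exact: wt_shift.
Qed.

Lemma admD V W : adm V -> adm W -> adm (fun r => V r + W r).
Proof.
move=> [mV iV] [mW iW]; split; first exact: measurable_funD.
apply: (@integ_ext _ (measurableTypeR R) _ mu (fun r => wt r * V r + wt r * W r)).
  by move=> r; rewrite mulrDr.
exact: integD.
Qed.

Lemma admZ c V : adm V -> adm (fun r => c * V r).
Proof.
move=> [mV iV]; split; first by apply: measurable_funM.
apply: (@integ_ext _ (measurableTypeR R) _ mu (fun r => c * (wt r * V r))).
  by move=> r; rewrite mulrCA.
exact: integZ.
Qed.

Lemma adm_abs V : adm V -> adm (fun r => `|V r|).
Proof.
move=> aV; apply: (adm_le _ aV); last by move=> r; rewrite normr_id.
by apply: measurableT_comp => //; case: aV.
Qed.

Definition box t a : R := if `|a| <= t then 1 else 0.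

Lemma measurable_box t : measurable_fun setT (box t).
Proof.
apply: measurable_fun_ifT; [|exact: measurable_cst|exact: measurable_cst].
by apply: measurable_fun_ler; [exact: normr_measurable|exact: measurable_cst].
Qed.

Lemma box_ge0 t a : 0 <= box t a. Proof. by rewrite /box; case: ifP. Qed.

Lemma box_wt t a : 0 <= t -> `|box t a| <= (1 + t) ^+ 2 * wt a.
Proof.
move=> t0; rewrite ger0_norm ?box_ge0 // /box; case: ifP => h; last first.
  by rewrite mulr_ge0 ?wt_ge0 // exprn_ge0 // addr_ge0.
apply: (@le_trans _ _ ((1 + `|a|) ^+ 2 * wt a)); first by rewrite wtK.
by rewrite ler_wpM2r ?wt_ge0 // lerXn2r ?nnegrE ?addr_ge0 // lerD2l.
Qed.

Lemma integ_wt : integ mu wt.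
Proof.
have h : integ mu (fun r => if 0 <= r then wt r else 0).
  apply: (@integ_le _ (measurableTypeR R) _ mu _ (fun r => if 0 <= r then (1 + r) `^ (- 1 - 1) else 0)).
  - apply: measurable_fun_ifT; [|exact: measurable_wt|exact: measurable_cst].
    by apply: measurable_fun_ler => //; exact: measurable_cst.
  - exact: integ_inv_sqr.
  - move=> r; case: ifP => r0; last by rewrite normr0.
    rewrite ger0_norm ?wt_ge0 // /wt (ger0_norm r0) (_ : - 1 - 1 = - 2%:R); last by rewrite -opprD.
    by rewrite powRN powR_mulrn // addr_ge0.
have ew r : wt (- r) = wt r by rewrite /wt normrN.
by have [] := even_extension measurable_wt ew h.
Qed.

Lemma integ_boxT t : 0 <= t -> integ mu (box t).
Proof.
move=> t0; apply: (@integ_le _ (measurableTypeR R) _ mu _ (fun a => (1 + t) ^+ 2 * wt a)).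
- exact: measurable_box.
- by apply: integZ; exact: integ_wt.
- by move=> a; exact: box_wt.
Qed.

Lemma adm_bounded V (M : R) : measurable_fun setT V -> (forall r, `|V r| <= M) -> adm V.
Proof.
move=> mV VM; have M0 : 0 <= M by exact: le_trans (normr_ge0 _) (VM 0).
apply: (@adm_le V (fun=> M)) => //; last by move=> r; rewrite (ger0_norm M0).
split; first exact: measurable_cst.
apply: (@integ_ext _ (measurableTypeR R) _ mu (fun r => M * wt r)); first by move=> r; rewrite mulrC.
by apply: integZ; exact: integ_wt.
Qed.

(** With [halfsum], the two terms of d'Alembert's formula: [avg] carries the initial velocity and
    [halfsum] the initial position. *)
Definition avg t V r : R := 2^-1 * Rintegral mu setT (fun a => box t a * V (r + a)).

Definition halfsum t V r : R := 2^-1 * (V (r + t) + V (r - t)).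

Lemma integ_box t V r : 0 <= t -> adm V -> integ mu (fun a => box t a * V (r + a)).
Proof.
move=> t0 aV; apply: (@adm_mul _ (fun a => V (r + a)) ((1 + t) ^+ 2)).
- exact: measurable_box.
- by move=> a; exact: box_wt.
- have := adm_shift r aV; congr adm; apply/funext => a; by rewrite addrC.
Qed.

Lemma measurable_box_shift t V : measurable_fun setT V ->
  measurable_fun setT (fun p : measurableTypeR R * measurableTypeR R => box t p.2 * V (p.1 + p.2)).
Proof.
move=> mV; apply: measurable_funM.
  exact: (measurableT_comp (measurable_box t : measurable_fun setT _) measurable_snd).
apply: (measurableT_comp (mV : measurable_fun setT _)).
exact: measurable_funD.
Qed.

Lemma measurable_avg t V : measurable_fun setT V -> measurable_fun setT (avg t V).
Proof.
move=> mV; apply: measurable_funM; first exact: measurable_cst.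
exact: (@measurable_Rint1 _ _ (measurableTypeR R) (measurableTypeR R) R mu
  (fun p => box t p.2 * V (p.1 + p.2)) (measurable_box_shift t mV)).
Qed.

Let avg_kernel t V : 0 <= t -> adm V ->
  integ (mu \x mu)%E (fun p : measurableTypeR R * measurableTypeR R =>
     wt p.2 * (box t p.1 * V (p.2 + p.1))).
Proof.
move=> t0 aV; have [mV iV] := aV.
pose I := Rintegral mu setT (fun r => `|wt r * V r|).
have ib := integ_boxT t0.
apply: (@integ_prod_R _ _ _ _ _ mu mu _ (fun a => (1 + t) ^+ 2 * I * box t a)).
- apply: measurable_funM; first exact: (measurableT_comp (measurable_wt : measurable_fun setT _) measurable_snd).
  apply: measurable_funM; first exact: (measurableT_comp (measurable_box t : measurable_fun setT _) measurable_fst).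
  by apply: (measurableT_comp (mV : measurable_fun setT _)); exact: measurable_funD.
- exact: integZ.
- move=> a; have [_ h] := adm_shift a aV.
  apply: (@integ_ext _ (measurableTypeR R) _ mu (fun r => box t a * (wt r * V (r + a)))).
    by move=> r /=; ring.
  exact: integZ.
- move=> a /=; rewrite /box; case: ifP => at1; last first.
    rewrite mulr0 le_eqVlt; apply/orP; left; apply/eqP; rewrite -[RHS](Rint0 mu).
    by apply: Rint_ext => r; rewrite mul0r mulr0 normr0.
  rewrite mulr1 -RintZ; last exact: integ_abs.
  have h := Rint_shift a (_ : measurable_fun setT (fun r => (1 + t) ^+ 2 * `|wt r * V r|)).
  rewrite -h; last first.
    apply: measurable_funM; first exact: measurable_cst.
    apply: measurableT_comp => //; apply: measurable_funM => //; exact: measurable_wt.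
  have [_ i1] := adm_shift a aV.
  apply: Rint_le.
  - apply: (@integ_ext _ (measurableTypeR R) _ mu (fun r => `|wt r * V (r + a)|)).
      by move=> r; rewrite mul1r.
    exact: integ_abs.
  - by apply: (@integ_shift (fun r => (1 + t) ^+ 2 * `|wt r * V r|)); exact/integZ/integ_abs.
  - move=> r; rewrite mul1r !normrM mulrA ler_wpM2r // !(ger0_norm (wt_ge0 _)).
    apply: (le_trans (wt_shift r a)); rewrite ler_wpM2r ?wt_ge0 //.
    by rewrite lerXn2r ?nnegrE ?addr_ge0 // lerD2l.
Qed.

Lemma adm_avg t V : 0 <= t -> adm V -> adm (avg t V).
Proof.
move=> t0 aV; split; first by apply: measurable_avg; case: aV.
have h := Fubini_integ2 (avg_kernel t0 aV).
apply: (@integ_ext _ (measurableTypeR R) _ mu (fun r => 2^-1 * Rintegral mu setT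
   (fun a => wt r * (box t a * V (r + a))))); last exact: integZ.
by move=> r; rewrite (RintZ _ (integ_box r t0 aV)) /avg; ring.
Qed.

Lemma adm_halfsum t V : adm V -> adm (halfsum t V).
Proof. by move=> aV; apply: admZ; apply: admD; exact: adm_shift. Qed.

Definition sine_transform V k : R := Rintegral mu setT (fun r => V r * sin (k * r)).

Lemma measurable_sin_lin k a : measurable_fun setT (fun r : R => sin (k * r + a)).
Proof.
apply: measurable_comp_cont; first exact: continuous_sin.
apply: measurable_funD; last exact: measurable_cst.
by apply: measurable_funM; first exact: measurable_cst.
Qed.

Lemma integ_sin_lin V k a : integ mu V -> integ mu (fun r => V r * sin (k * r + a)).
Proof.
move=> iV; apply: (@integ_ext _ (measurableTypeR R) _ mu (fun r => sin (k * r + a) * V r)).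
  by move=> r; rewrite mulrC.
apply: (@integ_bndM _ (measurableTypeR R) _ mu V _ 1 iV); first exact: measurable_sin_lin.
by move=> r; exact: sin_max.
Qed.

Let Rint_shift_sin V k a : integ mu V ->
  Rintegral mu setT (fun r => V (r + a) * sin (k * r)) =
  Rintegral mu setT (fun r => V r * sin (k * r - k * a)).
Proof.
move=> iV; have h := integ_sin_lin k (- (k * a)) iV.
rewrite -(Rint_shift a (integ_meas h)); apply: Rint_ext => r.
by congr (_ * sin _); ring.
Qed.

Let integ_shift_sin V k a : integ mu V -> integ mu (fun r => V (r + a) * sin (k * r)).
Proof.
move=> iV; have := integ_sin_lin k 0 (integ_shift a iV).
by apply: integ_ext => r; rewrite addr0.
Qed.

Lemma sine_transform_halfsum t V k : integ mu V ->
  sine_transform (halfsum t V) k = cos (t * k) * sine_transform V k.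
Proof.
move=> iV.
have E r : halfsum t V r * sin (k * r) =
    2^-1 * (V (r + t) * sin (k * r) + V (r + - t) * sin (k * r)) by rewrite /halfsum; ring.
have h1 := integ_sin_lin k (- (k * t)) iV; have h2 := integ_sin_lin k (- (k * - t)) iV.
rewrite {1}/sine_transform (Rint_ext mu E) (RintZ _ (integD (integ_shift_sin k t iV)
  (integ_shift_sin k (- t) iV))) (RintD (integ_shift_sin k t iV) (integ_shift_sin k (- t) iV)).
rewrite !Rint_shift_sin // -(RintD h1 h2) -(RintZ _ (integD h1 h2)).
rewrite /sine_transform -RintZ; last first.
  by have := integ_sin_lin k 0 iV; apply: integ_ext => r; rewrite addr0.
apply: Rint_ext => r; rewrite mulrN opprK sinB sinD (mulrC k t); by field.
Qed.

Lemma Rint_box_ftc t (f F : R -> R) : 0 <= t -> continuous f ->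
  (forall x : R, is_derive x 1 F (f x)) ->
  Rintegral mu setT (fun a => box t a * f a) = F t - F (- t).
Proof.
move=> t0 cf dF.
have -> : Rintegral mu setT (fun a => box t a * f a) =
    fine (\int[mu]_(a in [set` `[(- t)%R, t]]) (f a)%:E)%E.
  congr fine; rewrite [RHS]integral_mkcond; apply: eq_integral => a _.
  by rewrite patchE mem_setE in_itv /= /box ler_norml; case: ifP; rewrite ?mul0r ?mul1r.
by rewrite (FTC_real _ cf dF) //; lra.
Qed.

(** Fubini moves the translation by [a] from the profile into the phase, and a second exchange
    leaves the integral of [sin (k r - k a)] over [|a| <= t], which is
    [2 sin (k r) sin (k t) / k]. *)
Lemma sine_transform_avg t V k : 0 <= t -> k != 0 -> integ mu V ->
  sine_transform (avg t V) k = sin (t * k) / k * sine_transform V k.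
Proof.
move=> t0 k0 iV; have mV := integ_meas iV; have ib := integ_boxT t0.
pose F (p : R * R) := box t p.1 * (V (p.2 + p.1) * sin (k * p.2)).
have mF : measurable_fun setT (F : measurableTypeR R * measurableTypeR R -> R).
  apply: measurable_funM.
    exact: (measurableT_comp (measurable_box t : measurable_fun setT _) measurable_fst).
  apply: measurable_funM.
    by apply: (measurableT_comp (mV : measurable_fun setT _)); exact: measurable_funD.
  apply: measurable_comp_cont; first exact: continuous_sin.
  by apply: measurable_funM; first exact: measurable_cst.
have iF : integ (mu \x mu)%E F.
  apply: (@integ_prod_R _ _ _ _ _ mu mu _
    (fun a => Rintegral mu setT (fun r => `|V r|) * box t a)).
  - exact: mF.
  - exact: integZ.
  - by move=> a; exact: (integZ (box t a) (integ_shift_sin k a iV)).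
  - move=> a; rewrite mulrC -[X in _ * X](Rint_shift a (integ_meas (integ_abs iV))).
    have iVa := integ_abs (integ_shift a iV).
    rewrite -(RintZ _ iVa); apply: Rint_le.
    + exact: (integ_abs (integZ (box t a) (integ_shift_sin k a iV))).
    + exact: integZ.
    + move=> r; rewrite /F /= normrM (ger0_norm (box_ge0 _ _)) ler_wpM2l ?box_ge0 //.
      by rewrite normrM ler_piMr // sin_max.
have -> : sine_transform (avg t V) k =
    2^-1 * Rintegral mu setT (fun r => Rintegral mu setT (fun a => F (a, r))).
  have h := Fubini_integ2 iF.
  rewrite -(RintZ _ h); apply: Rint_ext => r.
  rewrite /avg -mulrA; congr (_ * _); rewrite mulrC.
  have ha : integ mu (fun a => box t a * V (r + a)).
    apply: (@integ_bndM _ (measurableTypeR R) _ mu (fun a => V (r + a)) _ 1).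
    - by have := integ_shift r iV; apply: integ_ext => a; rewrite addrC.
    - exact: measurable_box.
    - by move=> a; rewrite /box; case: ifP; rewrite ?normr1 ?normr0.
  by rewrite -(RintZ _ ha); apply: Rint_ext => a; rewrite /F /=; ring.
rewrite -(Fubini_swap iF).
have E1 a : Rintegral mu setT (fun r => F (a, r)) =
   Rintegral mu setT (fun r => box t a * (V r * sin (k * r - k * a))).
  rewrite (RintZ _ (integ_sin_lin k (- (k * a)) iV)) -(Rint_shift_sin k a iV).
  by rewrite -(RintZ _ (integ_shift_sin k a iV)).
rewrite (Rint_ext mu E1).
pose G (p : R * R) := box t p.1 * (V p.2 * sin (k * p.2 - k * p.1)).
have mG : measurable_fun setT (G : measurableTypeR R * measurableTypeR R -> R).
  apply: measurable_funM.
    exact: (measurableT_comp (measurable_box t : measurable_fun setT _) measurable_fst).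
  apply: measurable_funM.
    exact: (measurableT_comp (mV : measurable_fun setT _) measurable_snd).
  apply: measurable_comp_cont; first exact: continuous_sin.
  by apply: measurable_funB; apply: measurable_funM => //; exact: measurable_cst.
have iG : integ (mu \x mu)%E G.
  apply: (@integ_prodM _ _ _ _ _ mu mu _ (box t) (fun r => `|V r|)).
  - exact: mG.
  - exact: ib.
  - exact: integ_abs.
  - move=> a r; rewrite /G /= normrM (ger0_norm (box_ge0 _ _)) ler_wpM2l ?box_ge0 //.
    by rewrite normrM ler_piMr // sin_max.
have iVs : integ mu (fun r => V r * sin (k * r)).
  by have := integ_sin_lin k 0 iV; apply: integ_ext => r; rewrite addr0.
have hG := Fubini_integ2 iG.
rewrite (Fubini_swap iG) /sine_transform -(RintZ _ hG) -(RintZ _ iVs).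
apply: Rint_ext => r; rewrite /G /=.
have cs : continuous (fun a : R => sin (k * r - k * a)).
  by apply: (@continuous_of_derive _ _ (fun a => - k * cos (k * r - k * a))) => a;
    apply: is_derive_eq; rewrite /GRing.scale /=; ring.
have dl (a : R) : is_derive a 1 (fun a : R => k * r - k * a) (- k).
  by apply: is_derive_eq; rewrite /GRing.scale /=; ring.
have dF (a : R) : is_derive a 1 (fun a : R => k^-1 * cos (k * r - k * a)) (sin (k * r - k * a)).
  have h := @is_derive1_comp _ cos (fun a : R => k * r - k * a) a _ _ (is_derive_cos _) (dl a).
  apply: (is_derive_eq (@is_deriveZ _ _ _ _ k^-1 _ _ _ h)).
  by rewrite /GRing.scale /=; field.
have ibs : integ mu (fun a => box t a * sin (k * r - k * a)).
  apply: (@integ_ext _ (measurableTypeR R) _ mu (fun a => sin (k * r - k * a) * box t a)).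
    by move=> a; rewrite mulrC.
  apply: (@integ_bndM _ (measurableTypeR R) _ mu (box t) _ 1 ib).
    exact: continuous_measurable_fun.
  by move=> a; exact: sin_max.
have -> : Rintegral mu setT (fun a => box t a * (V r * sin (k * r - k * a))) =
    V r * Rintegral mu setT (fun a => box t a * sin (k * r - k * a)).
  by rewrite -(RintZ _ ibs); apply: Rint_ext => a; ring.
rewrite (Rint_box_ftc t0 cs dF) mulrN opprK cosB cosD (mulrC k t).
by field.
Qed.

Lemma adm_compact V (M : R) : 0 <= M -> adm V -> (forall r, M < `|r| -> V r = 0) ->
  integ mu V /\ integ mu (fun r => r * V r).
Proof.
move=> M0 aV VM.
have B r : `|box M r| <= (1 + M) ^+ 2 * wt r by exact: box_wt.
have E r : box M r * V r = V r.
  by rewrite /box; case: leP => [_|h]; rewrite ?mul1r // VM // mulr0.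
split.
  apply: (@integ_ext _ (measurableTypeR R) _ mu _ V E); exact: (adm_mul (measurable_box M) B aV).
apply: (@integ_ext _ (measurableTypeR R) _ mu (fun r => (r * box M r) * V r)).
  by move=> r; rewrite -mulrA E.
apply: (@adm_mul _ _ (M * (1 + M) ^+ 2) _ _ aV).
  by apply: measurable_funM => //; exact: measurable_box.
move=> r; rewrite normrM -mulrA; have := B r; rewrite /box; have [h|h] := leP `|r| M => Br.
  by apply: ler_pM.
rewrite normr0 mulr0; apply: mulr_ge0 => //; apply: mulr_ge0; last exact: wt_ge0.
by apply: exprn_ge0; exact: addr_ge0.
Qed.

Lemma measurable_radial_of V : measurable_fun setT V ->
  measurable_fun setT (fun x : R3meas R => radial_of V x).
Proof.
move=> mV; apply: measurable_funM; first exact: measurable_comp_euclid.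
by apply: measurable_inv; exact: measurable_euclid.
Qed.

Lemma radial_of_sphere V r : 0 <= r ->
  sphere_weight r * (V r / r) = 4 * disk_area * (r * V r).
Proof.
rewrite le_eqVlt => /orP[/eqP <-|r0]; first by rewrite /sphere_weight lexx; ring.
by rewrite /sphere_weight (ltW r0); field; rewrite gt_eqF.
Qed.

Lemma radial_sine_fourier V xi th : odd_fun V -> integ mu V -> integ mu (fun r => r * V r) ->
  euclid xi != 0 ->
  Rintegral leb3 setT (fun x => radial_of V x * cos (dot3 x xi + th)) =
  2 * disk_area * cos th / euclid xi * sine_transform V (euclid xi).
Proof.
move=> oV iV irV k0; have mV := integ_meas iV.
have V0 : V 0 = 0.
  by have := oV 0; rewrite oppr0; lra.
pose h (r : R) := V r / r.
have mh : measurable_fun setT h by apply: measurable_funM => //; exact: measurable_inv.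
have ih : integ leb3 (fun x => h (euclid x)).
  apply: (polar_integ mh).2.
  apply: (@integ_le _ (measurableTypeR R) _ mu _ (fun r => 4 * disk_area * `|r * V r|)).
  - by apply: measurable_funM => //; exact: measurable_sphere_weight.
  - exact/integZ/integ_abs.
  - move=> r; have [r0|r0] := leP 0 r.
      rewrite radial_of_sphere // normrM ger0_norm //.
      by rewrite mulr_ge0 // ltW // disk_area_gt0.
    rewrite /sphere_weight (leNgt 0 r) r0 /= mul0r normr0 mulr_ge0 //.
    by rewrite mulr_ge0 // ltW // disk_area_gt0.
have [ig E] := radial_fourier th mh ih k0.
rewrite [LHS]E; set k := euclid xi in k0 ig *.
pose g r := 4 * disk_area * cos th / k * (V r * sin (k * r)).
have Eg r : (if 0 <= r then 4 * disk_area * cos th * (h r * (r * (sin (k * r) / k))) else 0) =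
    (if 0 <= r then g r else 0).
  case: ifP => // _; rewrite /g /h; have [->|r0] := eqVneq r 0.
    by rewrite V0; ring.
  by field; rewrite k0 r0.
have mg : measurable_fun setT g.
  apply: measurable_funM; first exact: measurable_cst.
  apply: measurable_funM => //.
  by have := measurable_sin_lin k 0; congr measurable_fun; apply/funext => r; rewrite addr0.
have eg r : g (- r) = g r by rewrite /g oV mulrN sinN; ring.
have [_ Eg2] := even_extension mg eg (@integ_ext _ (measurableTypeR R) _ mu _ _ Eg ig).
have iVs : integ mu (fun r => V r * sin (k * r)).
  by have := integ_sin_lin k 0 iV; apply: integ_ext => r; rewrite addr0.
rewrite (Rint_ext mu Eg).
have -> : Rintegral mu setT (fun r => if 0 <= r then g r else 0) = 2^-1 * Rintegral mu setT g.
  by rewrite Eg2; field.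
by rewrite /g (RintZ _ iVs) /sine_transform; field.
Qed.

End OddProfiles.

(** * Wave multipliers tested against radial functions *)

Section RadialMultipliers.
Context {R : realType}.
Notation mu := (@lebesgue_measure R).
Implicit Types (V W : R -> R) (x xi : R3 R) (t k th r a : R) (psi m : R3 R -> R).

Lemma schwartz_fourier_decay psi : schwartz psi -> fourier_decay psi.
Proof. by move=> sp; apply: nice_fourier_decay => i; exact: schwartz_nice. Qed.

(** Serves the cosine symbol: in [1 - cos (t k) = k^2 * ...] the factor [k^2] is put on the test
    function. *)
Lemma schwartz_fourier_decay2 psi : schwartz psi ->
  fourier_decay (fun xi => euclid xi ^+ 2 * psi xi).
Proof.
move=> sp.
have -> : (fun xi => euclid xi ^+ 2 * psi xi) = (fun xi =>
   coord3 0 xi * (coord3 0 xi * psi xi) + coord3 1 xi * (coord3 1 xi * psi xi) +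
   coord3 (inord 2) xi * (coord3 (inord 2) xi * psi xi)).
  apply/funext => xi; rewrite euclid_sqr /coord3 inordK //=; ring.
apply: nice_fourier_decay => i.
by apply: niceD; [apply: niceD|]; do 2 apply: nice_coord; exact: schwartz_nice.
Qed.

Lemma schwartz_wave_decay psi t : schwartz psi -> 0 <= t -> exists C : R,
  [/\ 0 <= C, forall th x, `|phase_fourier th psi x| <= C * decay 3 x,
   forall s th x, 0 <= s <= t ->
     `|phase_fourier th (fun xi => sin_symbol s xi * psi xi) x| <= C * decay 3 x &
   forall s th x, 0 <= s <= t ->
     `|phase_fourier th (fun xi => cos_symbol s xi * psi xi) x| <= C * decay 3 x].
Proof.
move=> sp t0.
have [ip [C1 h1]] := schwartz_fourier_decay sp.
have [iq [C2 h2]] := schwartz_fourier_decay2 sp.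
have C10 : 0 <= C1.
  by have := le_trans (normr_ge0 _) (h1 0 0); rewrite pmulr_lge0 // decay_gt0.
have C20 : 0 <= C2.
  by have := le_trans (normr_ge0 _) (h2 0 0); rewrite pmulr_lge0 // decay_gt0.
have p0 (s : R) : 0 <= s -> 0 <= (2 + s) ^+ 3 by move=> s0; rewrite exprn_ge0 // addr_ge0.
pose A := C1 * (2 + t) ^+ 3 * t; pose B := C2 * (2 + t) ^+ 3 * t.
have A0 : 0 <= A by apply: mulr_ge0 => //; apply: mulr_ge0 => //; exact: p0.
have B0 : 0 <= B by apply: mulr_ge0 => //; apply: mulr_ge0 => //; exact: p0.
have tB : 0 <= t * B by exact: mulr_ge0.
have mono (C s : R) : 0 <= C -> 0 <= s <= t -> C * (2 + s) ^+ 3 * s <= C * (2 + t) ^+ 3 * t.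
  move=> C0 /andP[s0 st]; apply: ler_pM => //; first by apply: mulr_ge0 => //; exact: p0.
  by apply: ler_wpM2l => //; rewrite lerXn2r ?nnegrE ?addr_ge0 ?lerD2l.
exists (C1 + A + t * B); split.
- by rewrite addr_ge0 // addr_ge0.
- move=> th x; apply: (le_trans (h1 th x)); apply: ler_wpM2r; first exact: decay_ge0.
  by rewrite -addrA lerDl addr_ge0.
- move=> s th x s0t; have /andP[s0 st] := s0t.
  apply: (le_trans (sin_symbol_decay C10 ip h1 th x s0)).
  apply: ler_wpM2r; first exact: decay_ge0.
  apply: (le_trans (mono _ _ C10 s0t)); rewrite -/A; lra.
- move=> s th x s0t; have /andP[s0 st] := s0t.
  apply: (le_trans (cos_symbol_decay C10 C20 ip h1 iq h2 th x s0)).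
  apply: ler_wpM2r; first exact: decay_ge0.
  apply: (@le_trans _ _ (C1 + t * B)); last by rewrite lerD2r lerDl.
  rewrite lerD2l.
  apply: ler_pM => //; last exact: mono.
  by apply: mulr_ge0 => //; apply: mulr_ge0 => //; exact: p0.
Qed.

Lemma measurable_phase_fourier psi th : measurable_fun setT (psi : R3meas R -> R) ->
  measurable_fun setT (fun x : R3meas R => phase_fourier th psi x).
Proof.
move=> mp; apply: (@measurable_Rint1 _ _ (R3meas R) (R3meas R) R leb3
  (fun z => cos (dot3 z.1 z.2 + th) * psi z.2)).
apply: measurable_funM; last exact: (measurableT_comp mp measurable_snd).
apply: measurable_comp_cont; first exact: continuous_cos.
by apply: measurable_funD; [exact: measurable_dot3|exact: measurable_cst].
Qed.

Lemma integ_radial_of V : integ mu V -> integ mu (fun r => r * V r) ->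
  integ leb3 (fun x => radial_of V x).
Proof.
move=> iV irV; have mV := integ_meas iV.
have mh : measurable_fun setT (fun r : R => V r / r).
  by apply: measurable_funM => //; exact: measurable_inv.
apply: (polar_integ mh).2.
have c0 : 0 <= 4 * (disk_area : R) by rewrite mulr_ge0 // ltW // disk_area_gt0.
apply: (@integ_le _ (measurableTypeR R) _ mu _ (fun r => 4 * disk_area * `|r * V r|)).
- by apply: measurable_funM => //; exact: measurable_sphere_weight.
- exact/integZ/integ_abs.
- move=> r; have [r0|r0] := leP 0 r; first by rewrite radial_of_sphere // normrM ger0_norm.
  by rewrite /sphere_weight (leNgt 0 r) r0 /= mul0r normr0 mulr_ge0.
Qed.

Lemma adm_radial_integ V : adm V -> integ leb3 (fun x => radial_of V x * decay 3 x).
Proof.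
move=> [mV iV].
have mh : measurable_fun setT (fun r : R => V r / r * (1 + r) ^- 3).
  apply: measurable_funM; first by apply: measurable_funM => //; exact: measurable_inv.
  apply: measurable_inv; apply: measurable_funX; apply: measurable_funD => //.
apply: (polar_integ mh).2.
have c0 : 0 <= 4 * (disk_area : R) by rewrite mulr_ge0 // ltW // disk_area_gt0.
apply: (@integ_le _ (measurableTypeR R) _ mu _ (fun r => 4 * disk_area * `|wt r * V r|)).
- by apply: measurable_funM => //; exact: measurable_sphere_weight.
- exact/integZ/integ_abs.
- move=> r; have [r0|r0] := leP 0 r; last first.
    by rewrite /sphere_weight (leNgt 0 r) r0 /= mul0r normr0 mulr_ge0.
  rewrite mulrA radial_of_sphere // -mulrA normrM ger0_norm // ler_wpM2l //.
  rewrite !normrM (ger0_norm (wt_ge0 r)) mulrAC ler_wpM2r //.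
  have r1 : 0 < 1 + r by rewrite ltr_pwDl.
  rewrite (ger0_norm r0) ger0_norm ?invr_ge0 ?exprn_ge0 ?(ltW r1) //.
  rewrite /wt (ger0_norm r0) [(1 + r) ^+ 3]exprS invfM mulrA ler_piMl ?invr_ge0 ?exprn_ge0 ?(ltW r1) //.
  by rewrite ler_pdivrMr // mul1r lerDr.
Qed.

(** Fubini moves the Fourier transform from the test function to the radial factor, where it is a
    sine transform divided by the frequency. There the multiplier can be absorbed into the profile,
    which is what [mWV] says. Both profiles have to give integrable functions on space for these
    exchanges. *)
Lemma radial_multiplier_integrable V W m psi th : odd_fun V -> odd_fun W ->
  integ mu V -> integ mu (fun r => r * V r) -> integ mu W -> integ mu (fun r => r * W r) ->
  integ leb3 psi -> integ leb3 (fun xi => m xi * psi xi) ->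
  (forall xi, euclid xi != 0 ->
    sine_transform W (euclid xi) = m xi * sine_transform V (euclid xi)) ->
  Rintegral leb3 setT (fun x => radial_of V x * phase_fourier th (fun xi => m xi * psi xi) x) =
  Rintegral leb3 setT (fun x => radial_of W x * phase_fourier th psi x).
Proof.
move=> oV oW iV irV iW irW ip imp mWV.
have H U f : odd_fun U -> integ mu U -> integ mu (fun r => r * U r) -> integ leb3 f ->
  integ leb3 (fun xi => f xi * Rintegral leb3 setT (fun x => radial_of U x * cos (dot3 x xi + th))) /\
  Rintegral leb3 setT (fun x => radial_of U x * phase_fourier th f x) =
  Rintegral leb3 setT (fun xi => f xi *
    Rintegral leb3 setT (fun x => radial_of U x * cos (dot3 x xi + th))).
  move=> oU iU irU jf; have iR := integ_radial_of iU irU.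
  pose F (z : R3 R * R3 R) := radial_of U z.1 * (cos (dot3 z.1 z.2 + th) * f z.2).
  have mF : measurable_fun setT (F : R3meas R * R3meas R -> R).
    apply: measurable_funM; first exact: (measurableT_comp (integ_meas iR) measurable_fst).
    apply: measurable_funM; last exact: (measurableT_comp (integ_meas jf) measurable_snd).
    apply: measurable_comp_cont; first exact: continuous_cos.
    by apply: measurable_funD; [exact: measurable_dot3|exact: measurable_cst].
  have iF : integ (leb3 \x leb3)%E F.
    apply: (@integ_prodM _ _ _ _ _ leb3 leb3 F (fun x => `|radial_of U x|) (fun xi => `|f xi|)).
    - exact: mF.
    - exact: integ_abs.
    - exact: integ_abs.
    - move=> x xi; rewrite /F /= !normrM ler_wpM2l //.
      by rewrite ler_piMl // cos_le1_norm.
  have E xi : Rintegral leb3 setT (fun x => F (x, xi)) = f xi *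
      Rintegral leb3 setT (fun x => radial_of U x * cos (dot3 x xi + th)).
    rewrite -RintZ; last first.
      apply: (@integ_ext _ (R3meas R) _ _ (fun x => cos (dot3 xi x + th) * radial_of U x)).
        by move=> x; rewrite mulrC dot3C.
      exact: integ_cos_phase.
    by apply: Rint_ext => x; rewrite /F /=; ring.
  split; first by apply: (@integ_ext _ (R3meas R) _ _ _ _ E); exact: (Fubini_integ2 iF).
  transitivity (Rintegral leb3 setT (fun x => Rintegral leb3 setT (fun xi => F (x, xi)))).
    apply: Rint_ext => x; rewrite /F /= RintZ //; exact: integ_cos_phase.
  by rewrite (Fubini_swap iF); apply: Rint_ext => xi; exact: E.
have [i1 ->] := H V _ oV iV irV imp; have [i2 ->] := H W _ oW iW irW ip.
apply: Rint_ae; [exact: integ_meas i1|exact: integ_meas i2|].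
apply: (@ae_imply _ (R3meas R) _ leb3 _ _ _ ae_euclid_neq0) => xi k0.
by rewrite (radial_sine_fourier th oV iV irV k0) (radial_sine_fourier th oW iW irW k0) mWV //; ring.
Qed.

Definition trunc (n : nat) V r : R := if `|r| <= n%:R then V r else 0.

Lemma trunc_le n V r : `|trunc n V r| <= `|V r|.
Proof. by rewrite /trunc; case: ifP; rewrite ?normr0. Qed.

Lemma measurable_trunc n V : measurable_fun setT V -> measurable_fun setT (trunc n V).
Proof.
move=> mV; apply: measurable_fun_ifT; [|exact: mV|exact: measurable_cst].
by apply: measurable_fun_ler; [exact: normr_measurable|exact: measurable_cst].
Qed.

Lemma adm_trunc n V : adm V -> adm (trunc n V).
Proof.
move=> aV; apply: (adm_le _ aV); last exact: trunc_le.
by apply: measurable_trunc; case: aV.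
Qed.

Lemma odd_trunc n V : odd_fun V -> odd_fun (trunc n V).
Proof. by move=> oV r; rewrite /trunc normrN oV; case: ifP; rewrite ?oppr0. Qed.

Lemma odd_avg t V : 0 <= t -> adm V -> odd_fun V -> odd_fun (avg t V).
Proof.
move=> t0 aV oV r; have mV := proj1 aV; rewrite /avg -mulrN; congr (_ * _).
have mB : measurable_fun setT (fun a : R => box t a * V (- r + a)).
  exact: (measurableT_comp (measurable_box_shift t mV) (pair1_measurable (- r : measurableTypeR R))).
rewrite -(mp_Rint (@lebesgue_neg R) mB).
have -> : (fun a => box t (- a) * V (- r + - a)) = (fun a => -1 * (box t a * V (r + a))).
  apply/funext => a; rewrite -opprD oV /box normrN mulN1r; exact: mulrN.
by rewrite (RintZ _ (integ_box r t0 aV)) mulN1r.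
Qed.

Lemma odd_halfsum t V : odd_fun V -> odd_fun (halfsum t V).
Proof.
move=> oV r; rewrite /halfsum.
have -> : - r + t = - (r - t) by ring.
have -> : - r - t = - (r + t) by ring.
rewrite !oV; ring.
Qed.

(** Extends a multiplier identity from truncated profiles to all of [adm] by dominated convergence,
    the decay of order 3 making the majorants integrable. A separate majorant [U] is needed because
    the images of the truncations need not be dominated by their limit [W]: cancellations in an
    average of [V] are lost after truncation, and the average of [|V|] takes its place. *)
Lemma radial_multiplier_limit (VM WM : nat -> R -> R) V W U (F G : R3 R -> R) (C : R) :
  measurable_fun setT (F : R3meas R -> R) -> measurable_fun setT (G : R3meas R -> R) ->
  (forall x, `|F x| <= C * decay 3 x) -> (forall x, `|G x| <= C * decay 3 x) ->
  adm V -> adm U -> measurable_fun setT W ->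
  (forall n, measurable_fun setT (VM n)) -> (forall n, measurable_fun setT (WM n)) ->
  (forall n r, `|VM n r| <= `|V r|) -> (forall n r, `|WM n r| <= `|U r|) ->
  (forall r, VM n r @[n --> \oo] --> V r) -> (forall r, WM n r @[n --> \oo] --> W r) ->
  (forall n, Rintegral leb3 setT (fun x => radial_of (VM n) x * F x) =
     Rintegral leb3 setT (fun x => radial_of (WM n) x * G x)) ->
  [/\ integ leb3 (fun x => radial_of V x * F x), integ leb3 (fun x => radial_of W x * G x) &
    Rintegral leb3 setT (fun x => radial_of V x * F x) =
    Rintegral leb3 setT (fun x => radial_of W x * G x)].
Proof.
move=> mF mG FC GC aV aU mW mVM mWM bV bW cV cW E.
have D (Y : R -> R) (YM : nat -> R -> R) Z (K : R3 R -> R) : measurable_fun setT (K : R3meas R -> R) ->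
    (forall x, `|K x| <= C * decay 3 x) -> adm Z -> measurable_fun setT Y ->
    (forall n, measurable_fun setT (YM n)) -> (forall n r, `|YM n r| <= `|Z r|) ->
    (forall r, YM n r @[n --> \oo] --> Y r) ->
    integ leb3 (fun x => radial_of Y x * K x) /\
    Rintegral leb3 setT (fun x => radial_of (YM n) x * K x) @[n --> \oo] -->
      Rintegral leb3 setT (fun x => radial_of Y x * K x).
  move=> mK KC aZ mY mYM YZ cY.
  apply: (@Rint_dominated _ (R3meas R) _ leb3 (fun n x => radial_of (YM n) x * K x)
    (fun x => radial_of Y x * K x) (fun x => C * `|radial_of Z x * decay 3 x|)).
  - by move=> n; apply: measurable_funM => //; exact: measurable_radial_of.
  - by apply: measurable_funM => //; exact: measurable_radial_of.
  - exact: (integZ C (integ_abs (adm_radial_integ aZ))).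
  - apply: aeW => x; apply: cvgM; last exact: cvg_cst.
    by apply: cvgM; [exact: cY|exact: cvg_cst].
  - move=> n x; rewrite !normrM (ger0_norm (decay_ge0 _ _)) mulrCA.
    apply: ler_pM => //.
    by rewrite ?normrM ler_wpM2r.
have [i1 c1] := D V VM V F mF FC aV (proj1 aV) mVM bV cV.
have [i2 c2] := D W WM U G mG GC aU mW mWM bW cW.
split => //.
have EE : (fun n => Rintegral leb3 setT (fun x => radial_of (VM n) x * F x)) =
  (fun n => Rintegral leb3 setT (fun x => radial_of (WM n) x * G x)) by apply/funext.
rewrite EE in c1.
exact: (cvg_unique (@norm_hausdorff _ _) c1 c2).
Qed.

Lemma trunc_near V r (c : R) : \forall n \near \oo, forall s, `|s| <= `|r| + c -> trunc n V s = V s.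
Proof.
exists (Num.truncn (`|r| + `|c|)).+1 => // n /= hn s hs.
rewrite /trunc ifT //; apply: (le_trans hs); apply: (@le_trans _ _ (`|r| + `|c|)).
  by rewrite lerD2l ler_norm.
apply/ltW/(lt_le_trans (truncnS_gt _)).
by rewrite ler_nat.
Qed.

Lemma near_eq_cvg_cst (u : nat -> R) (l : R) : (\forall n \near \oo, u n = l) -> u n @[n --> \oo] --> l.
Proof. by move=> h; apply: cvg_near_cst. Qed.

Lemma radial_sin_multiplier V psi t th : schwartz psi -> 0 <= t -> odd_fun V -> adm V ->
  [/\ integ leb3 (fun x => radial_of V x *
        phase_fourier th (fun xi => sin_symbol t xi * psi xi) x),
    integ leb3 (fun x => radial_of (avg t V) x * phase_fourier th psi x) &
  Rintegral leb3 setT (fun x => radial_of V x *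
    phase_fourier th (fun xi => sin_symbol t xi * psi xi) x) =
  Rintegral leb3 setT (fun x => radial_of (avg t V) x * phase_fourier th psi x)].
Proof.
move=> sp t0 oV aV; have mV := proj1 aV.
have [C [C0 h1 h2 _]] := schwartz_wave_decay sp t0.
have ip := proj1 (schwartz_fourier_decay sp).
have isp := integ_sin_symbol t0 ip.
have habs n r : `|avg t (trunc n V) r| <= `|avg t (fun r => `|V r|) r|.
  rewrite /avg !normrM ler_wpM2l //; apply: (@le_trans _ _ (Rintegral mu setT
      (fun a => box t a * `|V (r + a)|))); last exact: ler_norm.
  apply: Rint_norm_le.
  - exact: (integ_box r t0 (adm_trunc n aV)).
  - exact: (integ_box r t0 (adm_abs aV)).
  - move=> a; rewrite normrM (ger0_norm (box_ge0 _ _)) ler_wpM2l ?box_ge0 //.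
    exact: trunc_le.
apply: (@radial_multiplier_limit (fun n => trunc n V) (fun n => avg t (trunc n V)) V (avg t V)
  (avg t (fun r => `|V r|)) _ _ C).
- by apply: measurable_phase_fourier; exact: integ_meas isp.
- by apply: measurable_phase_fourier; exact: integ_meas ip.
- by move=> x; apply: h2; rewrite t0 lexx.
- exact: h1.
- exact: aV.
- by apply: adm_avg => //; exact: adm_abs.
- exact: measurable_avg.
- by move=> n; exact: measurable_trunc.
- by move=> n; apply: measurable_avg; exact: measurable_trunc.
- by move=> n r; exact: trunc_le.
- exact: habs.
- move=> r; apply: near_eq_cvg_cst; apply: filterS (trunc_near V r 0) => n; apply.
  by rewrite addr0.
- move=> r; apply: near_eq_cvg_cst; apply: filterS (trunc_near V r t) => n H.
  rewrite /avg; congr (_ * _); apply: Rint_ext => a; rewrite /box; case: ifP => h; last by rewrite !mul0r.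
  by rewrite H // (le_trans (ler_normD _ _)) // lerD2l.
- move=> n; have an := adm_trunc n aV; have on := odd_trunc n oV.
  have [iv irv] : integ mu (trunc n V) /\ integ mu (fun r => r * trunc n V r).
    apply: (@adm_compact _ _ n%:R) => // r nr.
    by rewrite /trunc leNgt nr.
  (* Finite speed of propagation: the average of a profile living in [|r| <= n] lives in
     [|r| <= n + t], so it is integrable as well. *)
  have [iw irw] : integ mu (avg t (trunc n V)) /\ integ mu (fun r => r * avg t (trunc n V) r).
    apply: (@adm_compact _ _ (n%:R + t)); [by rewrite addr_ge0|exact: adm_avg|].
    move=> r nr; rewrite /avg (_ : Rintegral _ _ _ = 0) ?mulr0 // -[RHS](Rint0 mu).
    apply: Rint_ext => a; rewrite /box; case: ifP => h; last by rewrite mul0r.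
    rewrite /trunc ifF ?mulr0 //; apply/negbTE; rewrite -ltNge.
    by have := ler_normB (r + a) a; rewrite addrK; lra.
  apply: radial_multiplier_integrable => //.
  + exact: (odd_avg t0 an on).
  + by move=> xi k0; rewrite sine_transform_avg.
Qed.

Lemma radial_cos_multiplier V psi t th : schwartz psi -> 0 <= t -> odd_fun V -> adm V ->
  [/\ integ leb3 (fun x => radial_of V x *
        phase_fourier th (fun xi => cos_symbol t xi * psi xi) x),
    integ leb3 (fun x => radial_of (halfsum t V) x * phase_fourier th psi x) &
  Rintegral leb3 setT (fun x => radial_of V x *
    phase_fourier th (fun xi => cos_symbol t xi * psi xi) x) =
  Rintegral leb3 setT (fun x => radial_of (halfsum t V) x * phase_fourier th psi x)].
Proof.
move=> sp t0 oV aV; have mV := proj1 aV.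
have [C [C0 h1 _ h2]] := schwartz_wave_decay sp t0.
have ip := proj1 (schwartz_fourier_decay sp).
have isp := integ_cos_symbol t ip.
have mh W : measurable_fun setT W -> measurable_fun setT (halfsum t W).
  move=> mW; apply: measurable_funM; first exact: measurable_cst.
  by apply: measurable_funD; exact: measurable_shift.
apply: (@radial_multiplier_limit (fun n => trunc n V) (fun n => halfsum t (trunc n V)) V (halfsum t V)
  (halfsum t (fun r => `|V r|)) _ _ C).
- by apply: measurable_phase_fourier; exact: integ_meas isp.
- by apply: measurable_phase_fourier; exact: integ_meas ip.
- by move=> x; apply: h2; rewrite t0 lexx.
- exact: h1.
- exact: aV.
- by apply: adm_halfsum => //; exact: adm_abs.
- exact: mh.
- by move=> n; exact: measurable_trunc.
- by move=> n; apply: mh; exact: measurable_trunc.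
- by move=> n r; exact: trunc_le.
- move=> n r; rewrite /halfsum !normrM ler_wpM2l //.
  apply: (le_trans (ler_normD _ _)); apply: le_trans (ler_norm _).
  by apply: lerD; exact: trunc_le.
- move=> r; apply: near_eq_cvg_cst; apply: filterS (trunc_near V r 0) => n; apply.
  by rewrite addr0.
- move=> r; apply: near_eq_cvg_cst; apply: filterS (trunc_near V r t) => n H.
  rewrite /halfsum !H //.
    by have := ler_normB r t; rewrite (ger0_norm t0).
  by have := ler_normD r t; rewrite (ger0_norm t0).
- move=> n; have an := adm_trunc n aV; have on := odd_trunc n oV.
  have [iv irv] : integ mu (trunc n V) /\ integ mu (fun r => r * trunc n V r).
    apply: (@adm_compact _ _ n%:R) => // r nr.
    by rewrite /trunc leNgt nr.
  have [iw irw] : integ mu (halfsum t (trunc n V)) /\ integ mu (fun r => r * halfsum t (trunc n V) r).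
    apply: (@adm_compact _ _ (n%:R + t)); [by rewrite addr_ge0|exact: adm_halfsum|].
    move=> r nr; rewrite /halfsum /trunc !ifF ?addr0 ?mulr0 //; apply/negbTE; rewrite -ltNge.
      by have := ler_normD (r - t) t; rewrite subrK (ger0_norm t0); lra.
    by have := ler_normB (r + t) t; rewrite addrK (ger0_norm t0); lra.
  apply: radial_multiplier_integrable => //.
  + exact: odd_halfsum.
  + by move=> xi k0; rewrite sine_transform_halfsum.
Qed.

End RadialMultipliers.

(** * The profile of outgoing data *)

Section FlatFunctions.
Context {R : realType}.
Implicit Types (e x q a b r : R) (f g F : R -> R).

(** The functions [x^-n exp (- e / x)], whose span is stable under differentiation. The parameter
    [e] tends to 0 at the end, which turns products of such functions into indicators of
    intervals. *)
Definition flat e (n : nat) x : R := if 0 < x then x^-1 ^+ n * expR (- e * x^-1) else 0.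

(** Keeping the term of order [n + 2] of the exponential series leaves a bound by a multiple of
    [x^2], which is enough for the derivative at 0 to exist and vanish. *)
Lemma flat_le e n x : 0 < e -> `|flat e n x| <= (n.+2)`!%:R / e ^+ n.+2 * x ^+ 2.
Proof.
move=> e0; rewrite /flat; case: ifP => x0; last first.
  by rewrite normr0 mulr_ge0 ?sqr_ge0 // divr_ge0 // exprn_ge0 // ltW.
have y0 : 0 < e * x^-1 by rewrite divr_gt0.
rewrite ger0_norm; last by rewrite mulr_ge0 ?expR_ge0 // exprn_ge0 // invr_ge0 ltW.
have f0 : 0 < (n.+2)`!%:R :> R by rewrite ltr0n fact_gt0.
have h : (e * x^-1) ^+ n.+2 / (n.+2)`!%:R <= expR (e * x^-1).
  by apply: le_trans (expR_ge1Dxn n.+1 (ltW y0)); rewrite lerDr.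
have h1 : expR (- e * x^-1) <= (n.+2)`!%:R / (e * x^-1) ^+ n.+2.
  rewrite mulNr expRN -[leRHS]invf_div lef_pV2 // posrE ?expR_gt0 //.
  by rewrite divr_gt0 // exprn_gt0.
apply: (le_trans (ler_wpM2l _ h1)); first by rewrite exprn_ge0 // invr_ge0 ltW.
rewrite exprMn 2!exprS le_eqVlt; apply/orP; left; apply/eqP.
rewrite !exprS; field; rewrite ?expf_neq0 ?gt_eqF // ?invr_gt0 //.
Qed.

Lemma is_derive_of_quadratic_bound f C : (forall x, `|f x| <= C * x ^+ 2) -> is_derive (0 : R) 1 f 0.
Proof.
move=> h; have f0 : f 0 = 0.
  by have := h 0; rewrite expr0n /= mulr0 normr_le0 => /eqP.
have H0 : `|C| * `|h| @[h --> (0 : R)^'] --> (0 : R).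
  have h0 : h @[h --> (0 : R)^'] --> (0 : R) by apply: cvg_within_filter; exact: cvg_id.
  have := cvgM (@cvg_cst _ `|C| _ _ _) (cvg_norm h0); rewrite normr0 mulr0; exact.
have H : h^-1 *: ((f \o shift 0) (h *: 1) - f 0) @[h --> 0^'] --> (0 : R).
  apply: (@squeeze_cvgr _ _ _ _ (fun h => - (`|C| * `|h|)) (fun h => `|C| * `|h|)).
  - near=> k; rewrite -ler_norml f0 subr0 /GRing.scale /= mulr1 addr0 normrM normfV.
    have k0 : k != 0 by near: k; exact: nbhs_dnbhs_neq.
    rewrite ler_pdivrMl ?normr_gt0 //; apply: (le_trans (h k)).
    by apply: (le_trans (ler_norm _)); rewrite normrM normrX expr2 [leRHS]mulrCA.
  - rewrite -[X in _ --> X](@oppr0 R); exact: (cvgN H0).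
  - exact: H0.
apply: DeriveDef; first by apply/cvg_ex; exists 0.
exact: cvg_lim H.
Unshelve. all: by end_near.
Qed.

Lemma is_derive_flat e n x : 0 < e ->
  is_derive x 1 (flat e n) (e * flat e n.+2 x - n%:R * flat e n.+1 x).
Proof.
move=> e0; have [x0|x0|->] := ltgtP x 0.
- have xN : (0 < x) = false by apply/negbTE; rewrite -leNgt ltW.
  rewrite /flat !xN !mulr0 subr0.
  apply: (@near_eq_is_derive _ _ _ (cst 0) _ _ _ _ _ (is_derive_cst _ _ _)).
  near=> y; rewrite ifF //; apply/negbTE; rewrite -leNgt ltW //.
  by near: y; exact: lt_nbhsl.
- have xn0 : x != 0 by rewrite gt_eqF.
  have d1 : is_derive x 1 (fun y : R => y^-1) (- x^-1 ^+ 2).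
    have := @is_deriveV _ (fun y : R => y) x 1 1 xn0 (is_derive_id _ _).
    by move=> h; apply: (is_derive_eq h); rewrite /GRing.scale /= mulr1 exprVn.
  have d2 (z : R) : is_derive z 1 (fun z : R => z ^+ n * expR (- e * z))
      ((n%:R * z ^+ n.-1 - e * z ^+ n) * expR (- e * z)).
    have dl : is_derive z 1 (fun z : R => - e * z) (- e).
      by apply: is_derive_eq; rewrite /GRing.scale /=; ring.
    have de := @is_derive1_comp _ expR (fun z : R => - e * z) z _ _ (is_derive_expR _) dl.
    have dx := @is_deriveX _ _ (fun z : R => z) n z 1 1 (is_derive_id _ _).
    have dx' : is_derive z 1 (fun z : R => z ^+ n) (n%:R * z ^+ n.-1).
      have -> : (fun z : R => z ^+ n) = (fun z : R => z) ^+ n by apply/funext => y; rewrite exprfctE.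
      by apply: (is_derive_eq dx); rewrite /GRing.scale /= mulr1.
    apply: (is_derive_eq (is_deriveM dx' de)); rewrite /GRing.scale /=; ring.
  have d3 := @is_derive1_comp _ _ (fun y : R => y^-1) x _ _ (d2 x^-1) d1.
  apply: (@near_eq_is_derive _ _ _ _ _ _ _ _ _ (is_derive_eq d3 _)).
    by near=> y; rewrite /flat ifT //; near: y; exact: lt_nbhsr.
  rewrite /flat !x0; case: n {d2 d3} => [|n]; rewrite /= ?expr0 !exprS; ring.
- rewrite /flat ltxx !mulr0 subr0.
  by apply: (@is_derive_of_quadratic_bound _ ((n.+2)`!%:R / e ^+ n.+2)) => y; exact: flat_le.
Unshelve. all: by end_near.
Qed.

Lemma flat0_ge0 e x : 0 <= flat e 0 x.
Proof. by rewrite /flat; case: ifP => // _; rewrite expr0 mul1r expR_ge0. Qed.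

Lemma flat0_le1 e x : 0 < e -> flat e 0 x <= 1.
Proof.
move=> e0; rewrite /flat; case: ifP => // x0; rewrite expr0 mul1r -expR0 ler_expR mulNr.
by rewrite oppr_le0 divr_ge0 // ltW.
Qed.

Lemma continuous_flat e n : 0 < e -> continuous (flat e n).
Proof. by move=> e0; apply: continuous_of_derive => x; exact: is_derive_flat. Qed.

Lemma flat_cvg1 x : 0 < x -> flat n.+1%:R^-1 0 x @[n --> \oo] --> (1 : R).
Proof.
move=> x0; rewrite /flat x0.
have E : (fun n : nat => x^-1 ^+ 0 * expR (- n.+1%:R^-1 * x^-1)) =
   expR \o (fun n : nat => - n.+1%:R^-1 * x^-1) by apply/funext => n /=; rewrite expr0 mul1r.
have H : (- n.+1%:R^-1 * x^-1) @[n --> \oo] --> - 0 * x^-1.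
  by apply: cvgM; [apply: cvgN; exact: cvg_harmonic|exact: cvg_cst].
have := continuous_cvg _ (@continuous_expR R (- 0 * x^-1)) H.
by rewrite E oppr0 mul0r expR0; apply.
Qed.

(* Closed under differentiation on the positive half-line; [sm_prim] makes room for a
   primitive of a bump. *)
Inductive sm : (R -> R) -> Prop :=
| sm_cst (c : R) : sm (fun=> c)
| sm_powR (p : R) : sm (fun q : R => q `^ p)
| sm_flatl (e : R) n (a : R) : 0 < e -> sm (fun q => flat e n (q - a))
| sm_flatr (e : R) n (b : R) : 0 < e -> sm (fun q => flat e n (b - q))
| sm_add f g : sm f -> sm g -> sm (fun q => f q + g q)
| sm_mul f g : sm f -> sm g -> sm (fun q => f q * g q)
| sm_prim f F : sm f -> (forall q : R, 0 < q -> is_derive q 1 F (f q)) -> sm F.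

Lemma sm_scale (c : R) f : sm f -> sm (fun q => c * f q).
Proof. by move=> sf; apply: sm_mul => //; exact: sm_cst. Qed.

Lemma sm_derive f : sm f -> exists2 g, sm g & forall q : R, 0 < q -> is_derive q 1 f (g q).
Proof.
elim => {f} [c|p|e n a e0|e n b e0|f g _ [f' sf df] _ [g' sg dg]|f g hf [f' sf df] hg [g' sg dg]|f F sf _ dF].
- exists (fun=> 0); [exact: sm_cst|move=> q _; exact: is_derive_cst].
- exists (fun q => p * q `^ (p - 1)); first by apply: sm_scale; exact: sm_powR.
  by move=> q q0; exact: is_derive1_powR.
- exists (fun q => e * flat e n.+2 (q - a) + - n%:R * flat e n.+1 (q - a)).
    by apply: sm_add; apply: sm_scale; exact: sm_flatl.
  move=> q _; have dl : is_derive q 1 (fun q : R => q - a) 1.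
    by apply: is_derive_eq; rewrite subr0.
  apply: (is_derive_eq (@is_derive1_comp _ (flat e n) (fun q : R => q - a) q _ _
    (is_derive_flat n _ e0) dl)); ring.
- exists (fun q => n%:R * flat e n.+1 (b - q) + - e * flat e n.+2 (b - q)).
    by apply: sm_add; apply: sm_scale; exact: sm_flatr.
  move=> q _; have dl : is_derive q 1 (fun q : R => b - q) (- 1).
    by apply: is_derive_eq; ring.
  apply: (is_derive_eq (@is_derive1_comp _ (flat e n) (fun q : R => b - q) q _ _
    (is_derive_flat n _ e0) dl)); ring.
- exists (fun q => f' q + g' q); first exact: sm_add.
  by move=> q q0; exact: (is_deriveD (df q q0) (dg q q0)).
- exists (fun q => f q * g' q + g q * f' q).
    by apply: sm_add; apply: sm_mul.
  by move=> q q0; exact: (is_deriveM (df q q0) (dg q q0)).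
- by exists f.
Qed.

(** Vanishing below a positive threshold keeps the real powers in [sm] away from their singularity,
    so that [f (|x|^2)] is smooth on all of space, the origin included. *)
Definition smooth_off0 f :=
  (exists2 a : R, 0 < a & forall q, q < a -> f q = 0) /\
  exists2 g, sm g & forall q : R, 0 < q -> f q = g q.

Lemma is_derive_smooth_off0 f : smooth_off0 f -> exists2 f', smooth_off0 f' &
  forall q : R, is_derive q 1 f (f' q).
Proof.
move=> [[a a0 fa] [g sg fg]]; have [g' sg' dg] := sm_derive sg.
have d1 (q : R) : q < a -> is_derive q 1 f 0.
  move=> qa; apply: (@near_eq_is_derive _ _ _ (cst 0) _ _ _ _ _ (is_derive_cst _ _ _)).
  by near=> y; rewrite fa //; near: y; exact: lt_nbhsl.
have d2 (q : R) : 0 < q -> is_derive q 1 f (g' q).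
  move=> q0; apply: (@near_eq_is_derive _ _ _ g _ _ _ _ _ (dg q q0)).
  by near=> y; rewrite fg //; near: y; exact: lt_nbhsr.
exists (fun q => if 0 < q then g' q else 0); last first.
  move=> q; case: ifP => q0; first exact: d2.
  by apply: d1; apply: le_lt_trans a0; rewrite leNgt q0.
split; last by exists g' => // q ->.
exists a => // q qa; case: ifP => // q0.
have [_ <-] := d2 q q0; by have [_ ->] := d1 q qa.
Unshelve. all: by end_near.
Qed.

End FlatFunctions.

(** * Radial test fields *)

Section RadialTestFields.
Context {R : realType}.
Notation mu := (@lebesgue_measure R).
Implicit Types (x : R3 R) (f g th : R -> R).

(** A syntactic class stable under partial derivatives, so that smoothness of all orders becomes an
    induction on the list of directions. *)
Inductive radial_smooth : (R3 R -> R) -> Prop :=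
| rs_radial f : smooth_off0 f -> radial_smooth (fun x => f (dot3 x x))
| rs_coord i F : radial_smooth F -> radial_smooth (fun x => coord3 i x * F x)
| rs_add F G : radial_smooth F -> radial_smooth G -> radial_smooth (fun x => F x + G x)
| rs_scale (c : R) F : radial_smooth F -> radial_smooth (fun x => c * F x).

Lemma continuous_coord3 i : continuous (coord3 i : R3 R -> R).
Proof.
case: i => -[|[|[|//]]] ? x; rewrite /coord3 /=.
- by apply: (@continuous_comp _ _ _ fst fst); [exact: cvg_fst|exact: cvg_fst].
- by apply: (@continuous_comp _ _ _ fst snd); [exact: cvg_fst|exact: cvg_snd].
- exact: cvg_snd.
Qed.

Lemma continuous_dot3 : continuous (fun x : R3 R => dot3 x x).
Proof.
have -> : (fun x : R3 R => dot3 x x) = (fun x => coord3 0 x * coord3 0 x +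
    coord3 1 x * coord3 1 x + coord3 (inord 2) x * coord3 (inord 2) x).
  by apply/funext => x; rewrite dot3E /coord3 inordK.
move=> x; apply: cvgD; [apply: cvgD|]; apply: cvgM; exact: continuous_coord3.
Qed.

Lemma is_derive_dot3 i x (f f' : R -> R) : (forall q : R, is_derive q 1 f (f' q)) ->
  is_derive x (basis_vec i) (fun x => f (dot3 x x)) (2 * (coord3 i x * f' (dot3 x x))).
Proof.
move=> df; apply/is_derive_line0.
have E (s : R) : dot3 (s *: basis_vec i + x) (s *: basis_vec i + x) =
    dot3 x x + 2 * coord3 i x * s + s ^+ 2.
  case: x => [[x1 x2] x3]; rewrite !dot3E /=.
  case: i => -[|[|[|//]]] ?; rewrite /coord3 /= /GRing.scale /=; ring.
have -> : (fun s : R => f (dot3 (s *: basis_vec i + x) (s *: basis_vec i + x))) =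
   f \o (fun s => dot3 x x + 2 * coord3 i x * s + s ^+ 2) by apply/funext => s /=; rewrite E.
have d1 : is_derive (0 : R) 1 (fun s : R => dot3 x x + 2 * coord3 i x * s + s ^+ 2) (2 * coord3 i x).
  have -> : (fun s : R => dot3 x x + 2 * coord3 i x * s + s ^+ 2) =
    (fun s : R => dot3 x x + (2 * coord3 i x * s + s * s)) by apply/funext => s; ring.
  by apply: is_derive_eq; rewrite /GRing.scale /=; ring.
apply: (is_derive_eq (is_derive1_comp (df _) d1)).
by rewrite mulr0 expr0n /= !addr0; ring.
Qed.

Lemma radial_smooth_partial i F : radial_smooth F ->
  (forall x, derivable F x (basis_vec i)) /\ radial_smooth (partial i F).
Proof.
have sol (H : R3 R -> R) G : (forall x, is_derive x (basis_vec i) H (G x)) -> radial_smooth G ->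
    (forall x, derivable H x (basis_vec i)) /\ radial_smooth (partial i H).
  move=> dF rG; split; first by move=> x; case: (dF x).
  suff -> : partial i H = G by [].
  by apply/funext => x; rewrite /partial; exact: (@derive_val _ _ _ _ _ _ _ (dF x)).
elim => {F} [f sf|j F rF [dF rdF]|F G rF [dF rdF] rG [dG rdG]|c F rF [dF rdF]].
- have [f' sf' df] := is_derive_smooth_off0 sf.
  apply: (@sol _ (fun x => 2 * (coord3 i x * f' (dot3 x x)))); first by move=> x; exact: is_derive_dot3.
  by apply: rs_scale; apply: rs_coord; exact: rs_radial.
- apply: (@sol _ (fun x => coord3 j x * partial i F x + coord3 j (basis_vec i) * F x)).
    move=> x; have h := is_deriveM (is_derive_coord i j x) (DeriveDef (dF x) erefl).
    apply: (is_derive_eq h); rewrite /GRing.scale /= /partial; ring.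
  by apply: rs_add; [exact: rs_coord|exact: rs_scale].
- apply: (@sol _ (fun x => partial i F x + partial i G x)); last exact: rs_add.
  by move=> x; exact: (is_deriveD (DeriveDef (dF x) erefl) (DeriveDef (dG x) erefl)).
- apply: (@sol _ (fun x => c * partial i F x)); last exact: rs_scale.
  by move=> x; exact: (is_deriveZ c (DeriveDef (dF x) erefl)).
Qed.

Lemma radial_smooth_continuous F : radial_smooth F -> continuous F.
Proof.
elim => {F} [f sf|j F _ cF|F G _ cF _ cG|c F _ cF] x.
- apply: (@continuous_comp _ _ _ (fun x => dot3 x x) f); first exact: continuous_dot3.
  have [f' _ df] := is_derive_smooth_off0 sf; exact: continuous_of_derive df _.
- by apply: cvgM; [exact: continuous_coord3|exact: cF].
- by apply: cvgD; [exact: cF|exact: cG].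
- by apply: cvgM; [exact: cvg_cst|exact: cF].
Qed.

Lemma radial_smooth_smooth F : radial_smooth F -> smooth F.
Proof.
move=> rF; have H s : radial_smooth (partials s F).
  by elim: s => [|i s IH] //=; case: (radial_smooth_partial i IH).
move=> s; split; first exact: radial_smooth_continuous.
by move=> i; case: (radial_smooth_partial i (H s)).
Qed.

Lemma radial_field_test i th (b : R) : smooth_off0 th -> (forall q, b < q -> th q = 0) ->
  test_function (fun x => coord3 i x * th (dot3 x x)).
Proof.
move=> st tb; split.
  by apply: radial_smooth_smooth; apply: rs_coord; exact: rs_radial.
exists (1 + `|b|) => x xb; rewrite tb ?mulr0 //.
have -> : dot3 x x = euclid x ^+ 2 by rewrite euclid_sqr dot3E !expr2.
apply: (le_lt_trans (ler_norm b)).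
have : 1 + `|b| < euclid x by [].
have := normr_ge0 b; nra.
Qed.

Lemma radial_field_partial i th th' x : (forall q : R, is_derive q 1 th (th' q)) ->
  partial i (fun x => coord3 i x * th (dot3 x x)) x =
  th (dot3 x x) + 2 * (coord3 i x ^+ 2 * th' (dot3 x x)).
Proof.
move=> dth; have h := is_deriveM (is_derive_coord i i x) (is_derive_dot3 i x dth).
rewrite /partial (@derive_val _ _ _ _ _ _ _ h) /GRing.scale /=.
have -> : coord3 i (basis_vec i) = 1 :> R by case: i {h} => -[|[|[|//]]] ?.
ring.
Qed.

End RadialTestFields.

(** * Primitives of locally integrable functions *)

Section Primitives.
Context {R : realType}.
Notation mu := (@lebesgue_measure R).
Implicit Types (a b c s r y : R) (f g k F : R -> R).

Definition iv a b s : R := if (a < s) && (s <= b) then 1 else 0.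

(** The integral over []a, b]] without orientation: it is 0 when [b <= a]. Primitives from [rho]
    thereby extend by 0 to the left, as befits functions supported outside the ball. *)
Definition prim f a b : R := Rintegral mu setT (fun s => iv a b s * f s).

Lemma iv_ge0 a b s : 0 <= iv a b s. Proof. by rewrite /iv; case: ifP. Qed.

Lemma iv_le1 a b s : iv a b s <= 1. Proof. by rewrite /iv; case: ifP. Qed.

Lemma iv_norm_le1 a b s : `|iv a b s| <= 1.
Proof. by rewrite ger0_norm ?iv_ge0 // iv_le1. Qed.

Lemma measurable_iv_comp d (T : measurableType d) (A B S : T -> R) :
  measurable_fun setT A -> measurable_fun setT B -> measurable_fun setT S ->
  measurable_fun setT (fun x => iv (A x) (B x) (S x)).
Proof.
move=> mA mB mS; apply: measurable_fun_ifT; [|exact: measurable_cst|exact: measurable_cst].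
by apply: measurable_and; [exact: measurable_fun_ltr|exact: measurable_fun_ler].
Qed.

Lemma measurable_iv a b : measurable_fun setT (iv a b).
Proof.
by apply: (@measurable_iv_comp _ _ (fun=> a) (fun=> b) (fun s => s)); first exact: measurable_cst;
  first exact: measurable_cst.
Qed.

Lemma iv_le_box a b s : iv a b s <= box (`|a| + `|b|) s.
Proof.
rewrite /iv /box; case: ifP => [/andP[h1 h2]|_]; last by case: ifP.
rewrite ifT // ler_norml; apply/andP; split.
  by have := ler_norm (- a); rewrite normrN; have := normr_ge0 b; lra.
by have := ler_norm b; have := normr_ge0 a; lra.
Qed.

Lemma integ_iv a b : integ mu (iv a b).
Proof.
apply: (@integ_le _ (measurableTypeR R) _ mu _ (box (`|a| + `|b|))).
- exact: measurable_iv.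
- by apply: integ_boxT; rewrite addr_ge0.
- by move=> s; rewrite ger0_norm ?iv_ge0 // iv_le_box.
Qed.

Lemma prim_ftc a b f F : a <= b -> continuous f -> (forall x : R, is_derive x 1 F (f x)) ->
  prim f a b = F b - F a.
Proof.
move=> ab cf dF.
have mf : measurable_fun setT f by exact: continuous_measurable_fun.
have -> : prim f a b = fine (\int[mu]_(s in [set` `[a, b]]) (f s)%:E)%E.
  rewrite -integral_itv_obnd_cbnd; last first.
    by apply: measurableT_comp => //; exact: measurable_funTS.
  congr fine; rewrite [RHS]integral_mkcond; apply: eq_integral => s _.
  by rewrite patchE mem_setE in_itv /= /iv; case: ifP; rewrite ?mul0r ?mul1r.
by rewrite (FTC_real ab cf dF).
Qed.

Lemma prim_eq0 a b f : b <= a -> prim f a b = 0.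
Proof.
move=> ba; rewrite /prim -[RHS](Rint0 mu); apply: Rint_ext => s.
by rewrite /iv; case: ifP => [/andP[h1 h2]|_]; [exfalso; lra|rewrite mul0r].
Qed.

Lemma integ_iv_sub a b c d f : a <= c -> d <= b -> measurable_fun setT f ->
  integ mu (fun s => iv a b s * f s) -> integ mu (fun s => iv c d s * f s).
Proof.
move=> ac db mf jf; apply: (@integ_le _ (measurableTypeR R) _ mu _ _ _ (integ_abs jf)).
  by apply: measurable_funM => //; exact: measurable_iv.
move=> s; rewrite !normrM ler_wpM2r // !ger0_norm ?iv_ge0 // /iv.
case: ifP => [/andP[h1 h2]|_]; last by case: ifP.
by rewrite ifT // (le_lt_trans ac h1) (le_trans h2 db).
Qed.

Lemma prim_add a b c f : a <= b <= c -> measurable_fun setT f ->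
  integ mu (fun s => iv a c s * f s) -> prim f a c = prim f a b + prim f b c.
Proof.
move=> /andP[ab bc] mf i; have i1 := integ_iv_sub (lexx a) bc mf i.
have i2 := integ_iv_sub ab (lexx c) mf i.
rewrite /prim -(RintD i1 i2); apply: Rint_ext => s; rewrite -mulrDl; congr (_ * _).
rewrite /iv; case: (ltP a s) => h1; case: (leP s c) => h2; case: (leP s b) => h3;
  case: (ltP b s) => h4 //=; rewrite ?addr0 ?add0r //; exfalso; lra.
Qed.

(** Fubini on the triangle [a < r <= s <= y]. It replaces integration by parts for primitives of
    functions that are merely integrable. *)
Lemma prim_triangle a y f k : measurable_fun setT f -> measurable_fun setT k ->
  integ mu (fun s => iv a y s * f s) -> integ mu (fun s => iv a y s * k s) ->
  prim (fun s => k s * prim f a s) a y = prim (fun r => f r * prim k r y) a y /\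
  integ mu (fun s => iv a y s * (k s * prim f a s)).
Proof.
move=> mf mk jf jk.
pose H (p : R * R) := iv a y p.1 * k p.1 * (iv a p.1 p.2 * f p.2).
have m1 : measurable_fun setT (fst : measurableTypeR R * measurableTypeR R -> R) by exact: measurable_fst.
have m2 : measurable_fun setT (snd : measurableTypeR R * measurableTypeR R -> R) by exact: measurable_snd.
have mH : measurable_fun setT (H : measurableTypeR R * measurableTypeR R -> R).
  apply: measurable_funM; apply: measurable_funM.
  - by apply: (measurable_iv_comp _ _ m1); exact: measurable_cst.
  - exact: (measurableT_comp (mk : measurable_fun setT _) m1).
  - by apply: (measurable_iv_comp _ m1 m2); exact: measurable_cst.
  - exact: (measurableT_comp (mf : measurable_fun setT _) m2).
have iH : integ (mu \x mu)%E H.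
  apply: (@integ_prodM _ _ _ _ _ mu mu H (fun s => `|iv a y s * k s|) (fun s => `|iv a y s * f s|)).
  - exact: mH.
  - exact: integ_abs.
  - exact: integ_abs.
  - move=> s r; rewrite /H /= normrM.
    have [sy|sy] := leP s y; last first.
      by rewrite {1}/iv (leNgt s y) sy andbF mul0r normr0 mul0r mulr_ge0.
    rewrite ler_wpM2l // !normrM ler_wpM2r // !ger0_norm ?iv_ge0 // /iv.
    case: ifP => [/andP[h1 h2]|_]; last by case: ifP.
    by rewrite ifT // h1 (le_trans h2 sy).
have E1 s : Rintegral mu setT (fun r => H (s, r)) = iv a y s * (k s * prim f a s).
  have [sy|sy] := leP s y; last first.
    rewrite /iv (leNgt s y) sy andbF mul0r -[RHS](Rint0 mu); apply: Rint_ext => r.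
    by rewrite /H /= /iv (leNgt s y) sy andbF !mul0r.
  rewrite mulrA /prim -RintZ //.
  exact: (integ_iv_sub (lexx a) sy mf jf).
split; last by apply: (@integ_ext _ (measurableTypeR R) _ mu _ _ E1); exact: (Fubini_integ1 iH).
rewrite {1}/prim -(Rint_ext mu E1) (Fubini_swap iH) {1}/prim; apply: Rint_ext => r.
have [ra|ra] := leP r a.
  rewrite {1}/iv (ltNge a r) ra /= mul0r -[RHS](Rint0 mu); apply: Rint_ext => s.
  by rewrite /H /= {2}/iv (ltNge a r) ra /= mul0r mulr0.
have [yr|ry] := ltP y r.
  rewrite {1}/iv (leNgt r y) yr andbF mul0r -[RHS](Rint0 mu); apply: Rint_ext => s.
  rewrite /H /= /iv; have [rs|sr] := leP r s; last by rewrite andbF mul0r mulr0.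
  by rewrite (leNgt s y) (lt_le_trans yr rs) andbF !mul0r.
have -> : iv a y r = 1 by rewrite /iv ra ry.
rewrite mul1r.
(* The sections of the triangle are closed at [s = r], while [prim k r y] excludes this point; the
   two integrals agree up to a null set. *)
have -> : prim k r y = Rintegral mu setT (fun s => (if r <= s then iv a y s else 0) * k s).
  rewrite /prim; apply: Rint_ae.
  - by apply: measurable_funM => //; exact: measurable_iv.
  - apply: measurable_funM => //; apply: measurable_fun_ifT; [|exact: measurable_iv|exact: measurable_cst].
    by apply: measurable_fun_ler => //; exact: measurable_cst.
  - exists [set r]; split => //; first exact: lebesgue_measure_set1.
    move=> s /= hs; apply: contrapT => sr; apply: hs; congr (_ * _).
    rewrite /iv; case: (ltgtP r s) => rs; last by case: sr.
      by rewrite (lt_trans ra rs).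
    by [].
rewrite -RintZ; last first.
  apply: (@integ_le _ (measurableTypeR R) _ mu _ _ _ (integ_abs jk)).
    apply: measurable_funM => //; apply: measurable_fun_ifT; [|exact: measurable_iv|exact: measurable_cst].
    by apply: measurable_fun_ler => //; exact: measurable_cst.
  by move=> s; rewrite !normrM ler_wpM2r //; case: ifP => // _; rewrite normr0.
apply: Rint_ext => s; rewrite /H /=; case: ifP => rs.
  by have -> : iv a s r = 1; [rewrite /iv ra rs|ring].
by rewrite {2}/iv rs andbF; ring.
Qed.

(** Lebesgue's differentiation theorem: the indefinite integral of [f] cut off at [a] is the zero
    function, and almost everywhere its derivative is the integrand. *)
Lemma prim_eq0_ae a f : measurable_fun setT f -> (forall y, integ mu (fun s => iv a y s * f s)) ->
  (forall y, a < y -> prim f a y = 0) -> {ae mu, forall s, a < s -> f s = 0}.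
Proof.
move=> mf jf pf0; pose g s := if a < s then f s else 0.
have mg : measurable_fun setT g.
  apply: measurable_fun_ifT; [|exact: mf|exact: measurable_cst].
  by apply: measurable_fun_ltr => //; exact: measurable_cst.
have E y s : (if s <= y then g s else 0) = iv a y s * f s.
  by rewrite /g /iv; case: (a < s); case: (s <= y); rewrite /= ?mul0r ?mul1r.
have jg y : mu.-integrable `]-oo, y] (EFin \o g).
  rewrite integrable_mkcond //.
  have := jf y; congr (_.-integrable _ _); apply/funext => s.
  by rewrite patchE mem_setE in_itv /= -E; case: ifP.
have lg : locally_integrable setT g.
  split => //; first exact: openT.
  move=> K _ cK; have [M [_ HM]] := compact_bounded cK.
  have h := jf (`|M| + 1); have /integrableP[_ h2] := integ_abs h.
  have KM s : K s -> s <= `|M| + 1.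
    move=> Ks; apply: le_trans (ler_norm s) _; apply: (HM (`|M| + 1)) => //.
    by have := ler_norm M; lra.
  apply: le_lt_trans h2.
  rewrite [leLHS]integral_mkcond; apply: ge0_le_integral => //.
  - by move=> s _; rewrite patchE; case: ifP.
  - apply/(measurable_restrictT _ (compact_measurable cK)).
    by apply/measurable_EFinP; apply: measurable_funTS; exact: measurableT_comp.
  - by apply/measurable_EFinP; do 2 apply: measurableT_comp => //; exact: integ_meas h.
  - move=> s _; rewrite patchE; case: ifPn => [|_]; last by rewrite lee_fin.
    by rewrite inE => Ks /=; rewrite -E (KM s Ks) normr_id.
have F0 : (fun y : R => \int[mu]_(t in `]-oo, y]) g t) = cst 0.
  apply/funext => y.
  have -> : \int[mu]_(t in `]-oo, y]) g t = prim f a y.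
    congr fine; rewrite [LHS]integral_mkcond; apply: eq_integral => s _.
    by rewrite patchE mem_setE in_itv /= -E; case: ifP.
  by have [ay|ya] := ltP a y; [exact: pf0|exact: prim_eq0].
have := FTC1Ny jg lg; apply: (@ae_imply _ (measurableTypeR R)) => s [_].
by rewrite F0 derive1_cst /g => h as_; rewrite as_ in h.
Qed.

End Primitives.

Lemma ae_imply2 d (T : measurableType d) (R : realType) (m : {measure set T -> \bar R})
    (P Q S : T -> Prop) : {ae m, forall x, P x} -> {ae m, forall x, Q x} ->
  (forall x, P x -> Q x -> S x) -> {ae m, forall x, S x}.
Proof. by move=> hP hQ h; apply: filterS2 hP hQ. Qed.

(** * The weak gradient of a radial function *)

Section RadialWeakDerivative.
Context {R : realType}.
Notation mu := (@lebesgue_measure R).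
Implicit Types (x : R3 R) (f phi : R3 R -> R).

Lemma le_add1_pow n (y : R) : 0 <= y -> y <= 1 + y ^+ n.+1.
Proof.
move=> y0; have [y1|y1] := leP y 1; first by rewrite (le_trans y1) // lerDl exprn_ge0.
by rewrite (@le_trans _ _ (y ^+ n.+1)) ?lerDr // ler_eXnr // ltW.
Qed.

Lemma Lp_integ n f : Lp_fun n.+1%:R%:E f -> integ leb3 (fun x => `|f x| ^+ n.+1).
Proof.
move=> [mf ff]; have mn : measurable_fun setT ((fun x => `|f x| ^+ n.+1) : R3meas R -> R).
  by apply: measurable_funX; exact: measurableT_comp.
apply: (integP mn); have r0 : n.+1%:R != 0 :> R by rewrite pnatr_eq0.
have h := poweR_Lnorm (leb3 : {measure set (R3meas R) -> \bar R}) (EFin \o f) r0.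
have : ('N[leb3]_(n.+1%:R%:E)[EFin \o f] `^ n.+1%:R < +oo)%E by apply: poweR_lty.
rewrite h; apply: le_lt_trans; rewrite le_eqVlt; apply/orP; left; apply/eqP.
apply: eq_integral => x _ /=.
by rewrite powR_mulrn // ger0_norm ?exprn_ge0.
Qed.

(** The crude bound [|f| <= 1 + |f| ^+ n.+1] replaces Hoelder's inequality and treats the exponents
    2 and 6 alike. *)
Lemma Lp_mul_integ n f phi C : Lp_fun n.+1%:R%:E f ->
  measurable_fun setT (phi : R3meas R -> R) -> 0 <= C -> (forall x, `|phi x| <= C * decay 4 x) ->
  integ leb3 (fun x => f x * phi x).
Proof.
move=> Lf mphi C0 hphi; have h := Lp_integ Lf.
apply: (@integ_le _ (R3meas R) _ leb3 _ (fun x => C * (decay 4 x + `|f x| ^+ n.+1))).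
- by apply: measurable_funM => //; case: Lf.
- by apply: integZ; apply: integD => //; exact: integ_decay4.
- move=> x; rewrite normrM mulrC.
  have d0 := decay_ge0 4 x; have d1 : decay 4 x <= 1 by exact: decay_le1.
  apply: (@le_trans _ _ (C * decay 4 x * `|f x|)); first by rewrite ler_wpM2r.
  rewrite -mulrA ler_wpM2l //.
  apply: (@le_trans _ _ (decay 4 x * (1 + `|f x| ^+ n.+1))).
    by rewrite ler_wpM2l // le_add1_pow.
  by rewrite mulrDr mulr1 lerD2l ler_piMl // exprn_ge0.
Qed.

Lemma bounded_support_decay (k : R -> R) (M L : R) : 0 <= L -> (forall r, `|k r| <= M) ->
  (forall r, L < r -> k r = 0) -> forall x, `|k (euclid x)| <= M * (1 + L) ^+ 4 * decay 4 x.
Proof.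
move=> L0 kM kL x; have M0 : 0 <= M by exact: le_trans (normr_ge0 _) (kM 0).
have e0 := euclid_ge0 x; have L1 : 0 <= 1 + L by rewrite addr_ge0.
have [xL|xL] := leP (euclid x) L; last first.
  rewrite kL // normr0; apply: mulr_ge0; last exact: decay_ge0.
  by apply: mulr_ge0 => //; exact: exprn_ge0.
apply: (le_trans (kM _)); rewrite -mulrA ler_peMr // /decay.
have p : 0 < (1 + euclid x) ^+ 4 by rewrite exprn_gt0 // ltr_pwDl.
by rewrite ler_pdivlMr // mul1r lerXn2r ?nnegrE ?addr_ge0 // lerD2l.
Qed.

Lemma smooth_off0_bounded (th : R -> R) (b : R) : smooth_off0 th ->
  (forall q, b < q -> th q = 0) -> exists2 M, 0 <= M & forall q, `|th q| <= M.
Proof.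
move=> sth thb; have [th' _ dth] := is_derive_smooth_off0 sth.
have cth := continuous_of_derive dth.
have [[a a0 tha] _] := sth.
have b0 : (0 : R) <= `|b| by [].
have [c _ hc] := @EVT_max R (fun q => `|th q|) 0 `|b| b0
  (continuous_subspaceT (fun q : R => cvg_norm (cth q))).
exists `|th c| => // q; have [q0|q0] := ltP q 0.
  by rewrite tha ?normr0 // (lt_trans q0).
have [qb|qb] := leP q `|b|; first by apply: hc; rewrite in_itv /= q0 qb.
by rewrite thb ?normr0 // (le_lt_trans (ler_norm b)).
Qed.

Lemma derive_off_support (th th' : R -> R) (b : R) : (forall q : R, is_derive q 1 th (th' q)) ->
  (forall q, b < q -> th q = 0) -> forall q, b < q -> th' q = 0.
Proof.
move=> dth thb q bq.
have d0 : is_derive q 1 th 0.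
  apply: (@near_eq_is_derive _ _ _ (cst 0) _ _ _ _ _ (is_derive_cst _ _ _)).
  by near=> y; rewrite thb //; near: y; exact: lt_nbhsr.
by have [_ <-] := dth q; have [_ ->] := d0.
Unshelve. all: by end_near.
Qed.

Lemma euclid_dot3 x : dot3 x x = euclid x ^+ 2.
Proof. by rewrite euclid_sqr dot3E !expr2. Qed.

(** The weak gradient is tested with the three components of the field [x * th(|x|^2)], whose
    divergence is [3 th + 2 |x|^2 th']. The sum of the three identities sees the gradient only
    through its radial component, and polar coordinates turn it into an identity on the half-line.
    Fields vanishing near the origin are allowed and no others. *)
Lemma weak_gradient_radial f g (h G th th' : R -> R) (b : R) :
  Lp_fun 6%:E f -> weak_gradient f g -> measurable_fun setT h -> measurable_fun setT G ->
  {ae leb3, forall x, f x = h (euclid x)} ->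
  {ae leb3, forall x, dot3 (g x) x / euclid x = G (euclid x)} ->
  smooth_off0 th -> smooth_off0 th' -> (forall q : R, is_derive q 1 th (th' q)) ->
  (forall q, b < q -> th q = 0) ->
  [/\ integ mu (fun r => sphere_weight r * (h r * (3 * th (r ^+ 2) + 2 * (r ^+ 2 * th' (r ^+ 2))))),
    integ mu (fun r => sphere_weight r * (G r * (r * th (r ^+ 2)))) &
    Rintegral mu setT (fun r => sphere_weight r * (h r * (3 * th (r ^+ 2) + 2 * (r ^+ 2 * th' (r ^+ 2))))) =
    - Rintegral mu setT (fun r => sphere_weight r * (G r * (r * th (r ^+ 2))))].
Proof.
move=> Lf wf mh mG fh gG sth sth' dth thb.
have thb' := derive_off_support dth thb.
have [M M0 hM] := smooth_off0_bounded sth thb.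
have [M' M'0 hM'] := smooth_off0_bounded sth' thb'.
pose L := 1 + `|b|; have L0 : 0 <= L by rewrite addr_ge0.
have L1 r : L < r -> b < r ^+ 2.
  move=> rL; have := normr_ge0 b; have := ler_norm b; move: rL; rewrite /L; nra.
have mth : measurable_fun setT th by exact: continuous_measurable_fun (continuous_of_derive dth).
have mth' : measurable_fun setT th'.
  have [th'' _ dth'] := is_derive_smooth_off0 sth'.
  exact: continuous_measurable_fun (continuous_of_derive dth').
have msq (k : R -> R) : measurable_fun setT k -> measurable_fun setT (fun r : R => k (r ^+ 2)).
  by move=> mk; apply: (measurableT_comp (mk : measurable_fun setT _)); exact: measurable_funX.
pose i_ k (hk : (k < 3)%N) := Ordinal hk.
pose p i x := th (dot3 x x) + 2 * (coord3 i x ^+ 2 * th' (dot3 x x)).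
have pE i : partial i (fun x => coord3 i x * th (dot3 x x)) = p i.
  by apply/funext => x; exact: (radial_field_partial i x dth).
have mr (k : R -> R) : measurable_fun setT k -> measurable_fun setT (fun x : R3meas R => k (dot3 x x)).
  move=> mk; have := measurable_comp_euclid (msq k mk); congr measurable_fun.
  by apply/funext => x; rewrite euclid_dot3.
have mp i : measurable_fun setT (p i : R3meas R -> R).
  apply: measurable_funD; first exact: mr.
  apply: measurable_funM; first exact: measurable_cst.
  by apply: measurable_funM; [apply: measurable_funX; exact: measurable_coord3|exact: mr].
have D1 := @bounded_support_decay (fun r => th (r ^+ 2)) M L L0 (fun r => hM _)
  (fun r rL => thb _ (L1 r rL)).
have D2 := @bounded_support_decay (fun r => th' (r ^+ 2)) M' L L0 (fun r => hM' _)
  (fun r rL => thb' _ (L1 r rL)).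
have L14 : 0 <= (1 + L) ^+ 4 by rewrite exprn_ge0 // addr_ge0.
have bp i x : `|p i x| <= (M * (1 + L) ^+ 4 + 2 * (L ^+ 2 * (M' * (1 + L) ^+ 4))) * decay 4 x.
  rewrite mulrDl; apply: (le_trans (ler_normD _ _)); apply: lerD.
    by rewrite euclid_dot3; exact: D1.
  rewrite normrM ger0_norm // -(mulrA 2) ler_wpM2l // normrM normrX euclid_dot3 -(mulrA (L ^+ 2)).
  have [xL|xL] := leP (euclid x) L; last first.
    rewrite (thb' _ (L1 _ xL)) normr0 mulr0.
    apply: mulr_ge0; first exact: sqr_ge0.
    by apply: mulr_ge0; [exact: mulr_ge0|exact: decay_ge0].
  apply: ler_pM => //.
  by rewrite lerXn2r ?nnegrE // (le_trans (coord3_le i x)).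
have bf i x : `|coord3 i x * th (dot3 x x)| <= L * (M * (1 + L) ^+ 4) * decay 4 x.
  rewrite normrM euclid_dot3; have [xL|xL] := leP (euclid x) L; last first.
    rewrite (thb _ (L1 _ xL)) normr0 mulr0.
    by apply: mulr_ge0; [do 2 (apply: mulr_ge0 => //)|exact: decay_ge0].
  rewrite -mulrA; apply: ler_pM => //; exact: le_trans (coord3_le i x) xL.
have iA i : integ leb3 (fun x => f x * p i x).
  apply: (@Lp_mul_integ 5 f (p i) _ Lf (mp i) _ (bp i)).
  apply: addr_ge0; first exact: mulr_ge0.
  by do 3 (apply: mulr_ge0 => //); rewrite ?sqr_ge0.
have iB i : integ leb3 (fun x => coord3 i (g x) * (coord3 i x * th (dot3 x x))).
  apply: (@Lp_mul_integ 1 (coord3 i \o g) _ (L * (M * (1 + L) ^+ 4)) (wf i).1 _ _ (bf i)).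
    by apply: measurable_funM; [exact: measurable_coord3|exact: mr].
  by do 2 (apply: mulr_ge0 => //).
have E i : Rintegral leb3 setT (fun x => f x * p i x) =
    - Rintegral leb3 setT (fun x => coord3 i (g x) * (coord3 i x * th (dot3 x x))).
  have := (wf i).2 _ (radial_field_test i sth thb).
  by rewrite pE.
have E0 := E (i_ 0%N isT); have E1 := E (i_ 1%N isT); have E2 := E (i_ 2%N isT).
have A0 := iA (i_ 0%N isT); have A1 := iA (i_ 1%N isT); have A2 := iA (i_ 2%N isT).
have B0 := iB (i_ 0%N isT); have B1 := iB (i_ 1%N isT); have B2 := iB (i_ 2%N isT).
have A01 := integD A0 A1; have B01 := integD B0 B1.
have A012 := integD A01 A2; have B012 := integD B01 B2.
(* The three coordinate identities added up; the integrands are fixed by the summation lemmas. *)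
have SE : Rintegral leb3 setT _ = - Rintegral leb3 setT _ :=
  etrans (RintD A01 A2) (etrans (f_equal2 +%R (RintD A0 A1) erefl)
   (etrans (f_equal2 +%R (f_equal2 +%R E0 E1) E2)
   (esym (etrans (f_equal -%R (etrans (RintD B01 B2) (f_equal2 +%R (RintD B0 B1) erefl)))
     (etrans (opprD _ _) (f_equal2 +%R (opprD _ _) erefl)))))).
pose hh r := h r * (3 * th (r ^+ 2) + 2 * (r ^+ 2 * th' (r ^+ 2))).
pose GG r := G r * (r * th (r ^+ 2)).
have mhh : measurable_fun setT hh.
  apply: measurable_funM => //; apply: measurable_funD; apply: measurable_funM;
    [exact: measurable_cst|exact: msq|exact: measurable_cst|].
  by apply: measurable_funM; [exact: measurable_funX|exact: msq].
have mGG : measurable_fun setT GG.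
  by apply: measurable_funM => //; apply: measurable_funM => //; exact: msq.
have aeA : {ae leb3, forall x, f x * p (i_ 0%N isT) x + f x * p (i_ 1%N isT) x +
    f x * p (i_ 2%N isT) x = hh (euclid x)}.
  apply: (@ae_imply _ (R3meas R) _ leb3 _ _ _ fh) => x ->.
  rewrite /hh /p -euclid_dot3 -2!mulrDr; congr (_ * _).
  set t := th _; set t' := th' _; rewrite dot3E /coord3 /=; ring.
have aeB : {ae leb3, forall x, coord3 (i_ 0%N isT) (g x) * (coord3 (i_ 0%N isT) x * th (dot3 x x)) +
    coord3 (i_ 1%N isT) (g x) * (coord3 (i_ 1%N isT) x * th (dot3 x x)) +
    coord3 (i_ 2%N isT) (g x) * (coord3 (i_ 2%N isT) x * th (dot3 x x)) = GG (euclid x)}.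
  apply: (@ae_imply2 _ (R3meas R) _ leb3 _ _ _ gG ae_euclid_neq0) => x gx x0.
  rewrite /GG -gx -euclid_dot3; set t := th _; rewrite dot3E /coord3 /=.
  by field.
have rA : Rintegral leb3 setT (fun x => hh (euclid x)) = - Rintegral leb3 setT (fun x => GG (euclid x)).
  rewrite -(Rint_ae (integ_meas A012) (measurable_comp_euclid mhh) aeA).
  by rewrite -(Rint_ae (integ_meas B012) (measurable_comp_euclid mGG) aeB).
split.
- apply: (polar_integ mhh).1; exact: (integ_ae A012 (measurable_comp_euclid mhh) aeA).
- apply: (polar_integ mGG).1; exact: (integ_ae B012 (measurable_comp_euclid mGG) aeB).
- by rewrite -(polar_Rint mhh) -(polar_Rint mGG).
Qed.

End RadialWeakDerivative.

(** * The weak radial derivative tested with bumps *)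

Section RadialProfile.
Context {R : realType}.
Notation mu := (@lebesgue_measure R).
Implicit Types (q r s y e a b rho : R) (h G k : R -> R).

(** A smooth bump carried by []a, b[]; as [e] tends to 0 it converges pointwise to the indicator of
    this interval. *)
Definition beta e a b q : R := flat e 0 (q - a) * flat e 0 (b - q).

Lemma beta_ge0 e a b q : 0 <= beta e a b q.
Proof. by rewrite mulr_ge0 ?flat0_ge0. Qed.

Lemma beta_le_iv e a b q : 0 < e -> beta e a b q <= iv a b q.
Proof.
move=> e0; rewrite /iv; case: ifPn => [_|]; first by rewrite mulr_ile1 ?flat0_ge0 ?flat0_le1.
rewrite negb_and -leNgt -ltNge => /orP[qa|bq].
  by rewrite /beta {1}/flat subr_gt0 (ltNge a q) qa mul0r.
by rewrite /beta {2}/flat subr_gt0 (ltNge q b) (ltW bq) mulr0.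
Qed.

Lemma beta_eq0 e a b q : 0 < e -> (q <= a) || (b < q) -> beta e a b q = 0.
Proof.
move=> e0 h; apply/eqP; rewrite eq_le beta_ge0 andbT (le_trans (beta_le_iv _ _ _ e0)) //.
by rewrite /iv; case: ifP => // /andP[h1 h2]; exfalso; case/orP: h => ?; lra.
Qed.

Lemma continuous_beta e a b : 0 < e -> continuous (beta e a b).
Proof.
move=> e0 q; apply: cvgM.
  apply: (@continuous_comp _ _ _ (fun q => q - a) (flat e 0)); last exact: continuous_flat.
  by apply: cvgB; [exact: cvg_id|exact: cvg_cst].
apply: (@continuous_comp _ _ _ (fun q => b - q) (flat e 0)); last exact: continuous_flat.
by apply: cvgB; [exact: cvg_cst|exact: cvg_id].
Qed.

Lemma measurable_beta e a b : 0 < e -> measurable_fun setT (beta e a b).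
Proof. by move=> e0; exact: continuous_measurable_fun (@continuous_beta e a b e0). Qed.

Lemma integ_beta e a b : 0 < e -> integ mu (beta e a b).
Proof.
move=> e0; apply: (@integ_le _ (measurableTypeR R) _ mu _ (iv a b)).
- exact: measurable_beta.
- exact: integ_iv.
- by move=> q; rewrite ger0_norm ?beta_ge0 ?beta_le_iv.
Qed.

Lemma beta_cvg a b q : beta n.+1%:R^-1 a b q @[n --> \oo] --> (if (a < q) && (q < b) then 1 else 0 : R).
Proof.
have n0 n : 0 < n.+1%:R^-1 :> R by rewrite invr_gt0 ltr0n.
case: ifPn => [/andP[aq qb]|].
  by rewrite -[X in _ --> X]mulr1; apply: cvgM; apply: flat_cvg1; rewrite subr_gt0.
rewrite negb_and -!leNgt => h; apply: near_eq_cvg_cst; near=> n.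
apply/eqP; rewrite /beta mulf_eq0 /flat !subr_gt0; case/orP: h => h.
  by rewrite (ltNge a) h eqxx.
by rewrite (ltNge q b) h eqxx orbT.
Unshelve. all: by end_near.
Qed.

Lemma Rint_beta_gt0 e a b : 0 < e -> a < b -> 0 < Rintegral mu setT (beta e a b).
Proof.
move=> e0 ab; rewrite lt_neqAle Rint_ge0 ?andbT; last by move=> q; exact: beta_ge0.
apply/negP => /eqP E.
have [m /andP[am mb]] : exists m, a < m < b.
  by exists ((a + b) / 2); apply/andP; split; rewrite ?ltr_pdivlMr ?ltr_pdivrMr //; lra.
have bm : 0 < beta e a b m.
  rewrite /beta /flat !subr_gt0 am mb; apply: mulr_gt0; rewrite expr0 mul1r; exact: expR_gt0.
have := @prim_eq0_ae R a (beta e a b) (measurable_beta a b e0).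
have ib := integ_beta a b e0.
have jb y : integ mu (fun s => iv a y s * beta e a b s).
  by apply: (@integ_bndM _ (measurableTypeR R) _ mu _ _ 1 ib); [exact: measurable_iv|exact: iv_norm_le1].
move=> /(_ jb) [|N [mN N0 subN]].
  move=> y ay; apply/eqP; rewrite eq_le; apply/andP; split.
    rewrite E; apply: Rint_le => // s; rewrite ler_piMl ?beta_ge0 // iv_le1 //.
  by apply: Rint_ge0 => s; rewrite mulr_ge0 ?iv_ge0 ?beta_ge0.
have : (mu (`]a, b[%classic : set R) <= mu N)%E.
  apply: le_measure; [by rewrite inE; exact: measurable_itv|by rewrite inE|].
  move=> s /=; rewrite in_itv /= => /andP[as_ sb]; apply: subN => /= hs.
  have := hs as_; apply/eqP; rewrite gt_eqF // /beta /flat !subr_gt0 as_ sb.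
  by apply: mulr_gt0; rewrite expr0 mul1r; exact: expR_gt0.
by rewrite N0 lebesgue_measure_itv /= lte_fin ab -EFinB lee_fin; lra.
Qed.

Lemma is_derive_cumulative k (q : R) : continuous k -> integ mu k ->
  is_derive q 1 (fun q => Rintegral mu setT (fun s => if s <= q then k s else 0)) (k q).
Proof.
move=> ck ik; have mk := integ_meas ik.
have E (y : R) : Rintegral mu setT (fun s => if s <= y then k s else 0) =
    \int[mu]_(s in `]-oo, y]) k s.
  congr fine; rewrite [RHS]integral_mkcond; apply: eq_integral => s _.
  by rewrite patchE mem_setE in_itv /=; case: ifP.
have jk : mu.-integrable `]-oo, (q + 1)] (EFin \o k).
  by apply: (@integrableS _ _ _ mu setT).
have [dF vF] := @continuous_FTC1 R k -oo%O q (q + 1) (ltr_pwDr ltr01 (lexx q)) jk (ltNyr q) (ck q).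
rewrite (_ : (fun q => _) = (fun y : R => \int[mu]_(s in `]-oo, y]) k s)); last exact/funext.
by apply: DeriveDef; [exact: dF|rewrite -derive1E; exact: vF].
Qed.

Definition weak_radial_derivative h G := forall (th th' : R -> R) b,
  smooth_off0 th -> smooth_off0 th' -> (forall q : R, is_derive q 1 th (th' q)) ->
  (forall q, b < q -> th q = 0) ->
  [/\ integ mu (fun r => sphere_weight r * (h r * (3 * th (r ^+ 2) + 2 * (r ^+ 2 * th' (r ^+ 2))))),
    integ mu (fun r => sphere_weight r * (G r * (r * th (r ^+ 2)))) &
    Rintegral mu setT (fun r => sphere_weight r * (h r * (3 * th (r ^+ 2) + 2 * (r ^+ 2 * th' (r ^+ 2))))) =
    - Rintegral mu setT (fun r => sphere_weight r * (G r * (r * th (r ^+ 2))))].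

(* The test field [x_i |x|^-3 K(|x|^2)] has divergence [2 K'(|x|^2) / |x|]; a second bump
   inside the ball makes [K] vanish near the origin. *)
Lemma weak_radial_bump rho h G e y : 0 < rho -> rho < y -> 0 < e -> 
  (forall r, r <= rho -> h r = 0) -> (forall r, r <= rho -> G r = 0) ->
  weak_radial_derivative h G ->
  Rintegral mu setT (fun r => 2 * (r * h r) * beta e (rho ^+ 2 / 2) (y ^+ 2) (r ^+ 2)) =
  Rintegral mu setT (fun r => G r *
    Rintegral mu setT (fun s => if s <= r ^+ 2 then 0 else beta e (rho ^+ 2 / 2) (y ^+ 2) s)).
Proof.
move=> rho0 rhoy e0 h0 G0 W.
have rho2 : 0 < rho ^+ 2 by exact: exprn_gt0.
have rhoy2 : rho ^+ 2 < y ^+ 2 by rewrite ltr_pXn2r ?nnegrE // ltW // (lt_trans rho0).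
pose b1 := beta e (rho ^+ 2 / 2) (y ^+ 2).
(* In the variable [q = r^2] this bump lives strictly inside the ball, where [h] and [G] vanish, so
   it leaves no trace in the final identity. *)
pose b2 := beta e (rho ^+ 2 / 8) (rho ^+ 2 / 4).
have i1 : integ mu b1 by exact: integ_beta.
have i2 : integ mu b2 by exact: integ_beta.
pose m1 := Rintegral mu setT b1; pose m2 := Rintegral mu setT b2.
have m20 : 0 < m2 by apply: Rint_beta_gt0 => //; lra.
pose c := m1 / m2; pose k s := b1 s - c * b2 s.
have i2c := integZ c i2.
have ik : integ mu k by exact: integB.
have ck : continuous k.
  move=> s; apply: cvgB; first exact: continuous_beta.
  by apply: cvgM; [exact: cvg_cst|exact: continuous_beta].
have k0 : Rintegral mu setT k = 0.
  rewrite (RintB i1 i2c) (RintZ _ i2) -/m1 -/m2 /c divfK ?subrr // gt_eqF //.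
pose K q := Rintegral mu setT (fun s => if s <= q then k s else 0).
have dK (q : R) : is_derive q 1 K (k q) by exact: is_derive_cumulative.
have klow q : q <= rho ^+ 2 / 8 -> k q = 0.
  by move=> hq; rewrite /k /b1 /b2 !beta_eq0 ?mulr0 ?subr0 // ?hq //; apply/orP; left; lra.
have khigh q : y ^+ 2 < q -> k q = 0.
  move=> hq; rewrite /k /b1 /b2 !beta_eq0 ?mulr0 ?subr0 //; apply/orP; right => //; lra.
have Klow q : q <= rho ^+ 2 / 8 -> K q = 0.
  move=> hq; rewrite /K -[RHS](Rint0 mu); apply: Rint_ext => s; case: ifP => // sq.
  by rewrite klow // (le_trans sq).
have KE q : K q = - Rintegral mu setT (fun s => if s <= q then 0 else k s).
  have j1 : integ mu (fun s => if s <= q then k s else 0).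
    apply: (@integ_le _ (measurableTypeR R) _ mu _ _ _ (integ_abs ik)).
      apply: measurable_fun_ifT; [|exact: integ_meas ik|exact: measurable_cst].
      by apply: measurable_fun_ler => //; exact: measurable_cst.
    by move=> s; case: ifP => // _; rewrite normr0.
  have j2 : integ mu (fun s => if s <= q then 0 else k s).
    apply: (@integ_le _ (measurableTypeR R) _ mu _ _ _ (integ_abs ik)).
      apply: measurable_fun_ifT; [|exact: measurable_cst|exact: integ_meas ik].
      by apply: measurable_fun_ler => //; exact: measurable_cst.
    by move=> s; case: ifP => // _; rewrite normr0.
  apply/eqP; rewrite -subr_eq0 opprK -(RintD j1 j2) -[X in _ == X]k0; apply/eqP.
  by apply: Rint_ext => s; case: ifP; rewrite ?addr0 ?add0r.
have Khigh q : y ^+ 2 < q -> K q = 0.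
  move=> hq; rewrite KE (_ : Rintegral _ _ _ = 0) ?oppr0 // -[RHS](Rint0 mu).
  apply: Rint_ext => s; case: leP => // qs; by rewrite khigh // (lt_trans hq qs).
have smk : sm k.
  apply: sm_add; first by apply: sm_mul; [exact: sm_flatl|exact: sm_flatr].
  have -> : (fun q => - (c * b2 q)) = (fun q => - c * b2 q) by apply/funext => q; rewrite mulNr.
  by apply: sm_scale; apply: sm_mul; [exact: sm_flatl|exact: sm_flatr].
have smK : sm K by apply: (sm_prim smk) => q _; exact: dK.
(* The exponent [- 3 / 2] makes the two terms containing [K] cancel in [3 th + 2 q th'], which
   becomes [2 q^(-1/2) k]. *)
pose th q := q `^ (- (3 / 2)) * K q.
have sth : smooth_off0 th.
  split; last by exists th => //; apply: sm_mul => //; exact: sm_powR.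
  exists (rho ^+ 2 / 8); first by rewrite divr_gt0.
  by move=> q hq; rewrite /th Klow ?mulr0 // ltW.
have [th' sth' dth] := is_derive_smooth_off0 sth.
have thb q : y ^+ 2 < q -> th q = 0 by move=> hq; rewrite /th Khigh // mulr0.
have th'E q : 0 < q -> th' q = q `^ (- (3 / 2)) * k q + K q * (- (3 / 2) * q `^ (- (3 / 2) - 1)).
  move=> q0; have [_ <-] := dth q.
  have D := is_deriveM (is_derive1_powR (- (3 / 2)) q0) (dK q).
  exact: (@derive_val _ _ _ _ _ _ _ D).
have [j1 j2 E] := W th th' (y ^+ 2) sth sth' dth thb.
have pw r : 0 < r -> (r ^+ 2) `^ (- (3 / 2)) = r ^- 3.
  move=> r0; rewrite -powR_mulrn ?(ltW r0) // -powRrM (_ : 2%:R * - (3 / 2) = - 3%:R); last by field.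
  by rewrite powRN powR_mulrn // ltW.
have c0 := @disk_area_gt0 R.
have E1 r : sphere_weight r * (h r * (3 * th (r ^+ 2) + 2 * (r ^+ 2 * th' (r ^+ 2)))) =
    4 * disk_area * (2 * (r * h r) * b1 (r ^+ 2)).
  have [rr|rr] := leP r rho; first by rewrite h0 // !(mul0r, mulr0).
  have r0 : 0 < r by exact: lt_trans rr.
  have rr2 : rho ^+ 2 < r ^+ 2 by rewrite ltr_pXn2r ?nnegrE // ltW.
  have r20 : 0 < r ^+ 2 by exact: exprn_gt0.
  rewrite th'E // /th; have -> : k (r ^+ 2) = b1 (r ^+ 2).
    by rewrite /k /b2 beta_eq0 ?mulr0 ?subr0 //; apply/orP; right; lra.
  have -> : (r ^+ 2) `^ (- (3 / 2) - 1) = r ^- 5.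
    rewrite -powR_mulrn ?(ltW r0) // -powRrM (_ : 2%:R * (- (3 / 2) - 1) = - 5%:R); last by field.
    by rewrite powRN powR_mulrn // ltW.
  by rewrite pw // /sphere_weight (ltW r0); field; rewrite gt_eqF.
have E2 r : sphere_weight r * (G r * (r * th (r ^+ 2))) =
    - (4 * disk_area) * (G r * Rintegral mu setT (fun s => if s <= r ^+ 2 then 0 else b1 s)).
  have [rr|rr] := leP r rho; first by rewrite G0 // !(mul0r, mulr0).
  have r0 : 0 < r by exact: lt_trans rr.
  have rr2 : rho ^+ 2 < r ^+ 2 by rewrite ltr_pXn2r ?nnegrE // ltW.
  have -> : Rintegral mu setT (fun s => if s <= r ^+ 2 then 0 else b1 s) = - K (r ^+ 2).
    rewrite KE opprK; apply: Rint_ext => s; case: leP => // rs.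
    by rewrite /k /b2 beta_eq0 ?mulr0 ?subr0 //; apply/orP; right; lra.
  by rewrite /th pw // /sphere_weight (ltW r0); field; rewrite gt_eqF.
move: E; rewrite (Rint_ext mu E1) (Rint_ext mu E2).
have c4 : 4 * (disk_area : R) != 0 by rewrite gt_eqF // mulr_gt0.
have j1' : integ mu (fun r => 2 * (r * h r) * b1 (r ^+ 2)).
  apply: (@integ_ext _ (measurableTypeR R) _ mu (fun r => (4 * disk_area)^-1 * (sphere_weight r *
    (h r * (3 * th (r ^+ 2) + 2 * (r ^+ 2 * th' (r ^+ 2))))))); last exact: integZ.
  by move=> r; rewrite E1 mulKf.
have j2' : integ mu (fun r => G r * Rintegral mu setT (fun s => if s <= r ^+ 2 then 0 else b1 s)).
  apply: (@integ_ext _ (measurableTypeR R) _ mu (fun r => - (4 * disk_area)^-1 * (sphere_weight r *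
    (G r * (r * th (r ^+ 2)))))); last exact: integZ.
  by move=> r; rewrite E2 mulrA mulrNN mulVf ?mul1r.
rewrite (RintZ _ j1') (RintZ _ j2') mulNr opprK => /(mulfI c4); exact.
Qed.

End RadialProfile.

(** * The profile as a primitive *)

Section ProfileRepresentation.
Context {R : realType}.
Notation mu := (@lebesgue_measure R).
Implicit Types (q r s y a b rho : R) (f h G k : R -> R).

Lemma Rint_iv a b : a <= b -> Rintegral mu setT (iv a b) = b - a.
Proof.
move=> ab; have d1 (x : R) : is_derive x 1 (fun x : R => x) (1 : R) by exact: is_derive_id.
rewrite -(@prim_ftc _ _ _ (fun=> 1) (fun x => x) ab _ d1); last exact: cst_continuous.
by apply: Rint_ext => s; rewrite mulr1.
Qed.

Lemma prim_linear a b : a <= b -> prim (fun s => 2 * s) a b = b ^+ 2 - a ^+ 2 :> R.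
Proof.
move=> ab; apply: (@prim_ftc _ _ _ _ (fun s => s ^+ 2)) => //.
  by move=> s; apply: cvgM; [exact: cvg_cst|exact: cvg_id].
move=> x; rewrite (_ : (fun s : R => s ^+ 2) = (fun s => s * s)); last by apply/funext => s; rewrite expr2.
by apply: is_derive_eq; rewrite /GRing.scale /=; ring.
Qed.

Lemma measurable_prim k a : measurable_fun setT k -> measurable_fun setT (prim k a).
Proof.
move=> mk; apply: (@measurable_Rint1 _ _ (measurableTypeR R) (measurableTypeR R) R mu
  (fun p => iv a p.1 p.2 * k p.2)).
apply: measurable_funM; last exact: (measurableT_comp (mk : measurable_fun setT _) measurable_snd).
by apply: (measurable_iv_comp _ measurable_fst measurable_snd); exact: measurable_cst.
Qed.

Lemma integ_iv_bounded a b k f (C : R) : measurable_fun setT k -> measurable_fun setT f ->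
  (forall s, a < s -> s <= b -> `|k s| <= C) -> integ mu (fun s => iv a b s * f s) ->
  integ mu (fun s => iv a b s * (k s * f s)).
Proof.
move=> mk mf kC jf.
apply: (@integ_le _ (measurableTypeR R) _ mu _ (fun s => C * `|iv a b s * f s|)).
- by apply: measurable_funM; [exact: measurable_iv|exact: measurable_funM].
- exact/integZ/integ_abs.
- move=> s; rewrite /iv; case: ifP => [/andP[h1 h2]|_]; last by rewrite !mul0r normr0 mulr0.
  by rewrite !mul1r normrM ler_wpM2r // kC.
Qed.

Lemma weak_radial_limit rho h G y : 0 < rho -> rho < y -> measurable_fun setT h ->
  measurable_fun setT G -> (forall r, r <= rho -> h r = 0) -> (forall r, r <= rho -> G r = 0) ->
  integ mu (fun s => iv rho y s * h s) -> integ mu (fun s => iv rho y s * G s) ->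
  weak_radial_derivative h G ->
  prim (fun r => 2 * r * h r) rho y = prim (fun r => G r * (y ^+ 2 - r ^+ 2)) rho y.
Proof.
move=> rho0 rhoy mh mG h0 G0 jh jG W.
pose a := rho ^+ 2 / 2; have rho2 : 0 < rho ^+ 2 by exact: exprn_gt0.
have y0 : 0 < y by exact: lt_trans rhoy.
have rhoy2 : rho ^+ 2 < y ^+ 2 by rewrite ltr_pXn2r ?nnegrE // ltW.
have arho : a < rho ^+ 2 by rewrite /a; lra.
have ay : a < y ^+ 2 by exact: lt_trans rhoy2.
have n0 n : 0 < n.+1%:R^-1 :> R by rewrite invr_gt0 ltr0n.
have msq : measurable_fun setT (fun r : R => r ^+ 2) by exact: measurable_funX.
have mb n : measurable_fun setT (fun r : R => beta n.+1%:R^-1 a (y ^+ 2) (r ^+ 2)).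
  exact: (measurableT_comp (measurable_beta a (y ^+ 2) (n0 n) : measurable_fun setT _) msq).
have sq_lt r : rho < r -> (r ^+ 2 < y ^+ 2) = (r < y).
  by move=> rr; rewrite ltr_pXn2r ?nnegrE ?(ltW y0) // ltW // (lt_trans rho0).
have sq_gt r : rho < r -> a < r ^+ 2.
  by move=> rr; apply: (lt_trans arho); rewrite ltr_pXn2r ?nnegrE ?(ltW rho0) // ltW // (lt_trans rho0).
pose B n r := Rintegral mu setT (fun s => if s <= r ^+ 2 then 0 else beta n.+1%:R^-1 a (y ^+ 2) s).
have mint n r : measurable_fun setT (fun s => if s <= r ^+ 2 then 0 else beta n.+1%:R^-1 a (y ^+ 2) s).
  apply: measurable_fun_ifT; [|exact: measurable_cst|exact: measurable_beta].
  by apply: measurable_fun_ler => //; exact: measurable_cst.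
have ble n r s : `|if s <= r ^+ 2 then 0 else beta n.+1%:R^-1 a (y ^+ 2) s| <= iv a (y ^+ 2) s.
  by case: ifP; rewrite ?normr0 ?iv_ge0 // ger0_norm ?beta_ge0 ?beta_le_iv.
have B_le n r : `|B n r| <= y ^+ 2 - a.
  rewrite -(Rint_iv (ltW ay)); apply: Rint_norm_le.
  - by apply: (@integ_le _ (measurableTypeR R) _ mu _ (iv a (y ^+ 2)) _ (integ_iv _ _)); [exact: mint|exact: ble].
  - exact: integ_iv.
  - exact: ble.
have mB n : measurable_fun setT (B n).
  apply: (@measurable_Rint1 _ _ (measurableTypeR R) (measurableTypeR R) R mu
    (fun p => if p.2 <= p.1 ^+ 2 then 0 else beta n.+1%:R^-1 a (y ^+ 2) p.2)).
  have m2 : measurable_fun setT (snd : measurableTypeR R * measurableTypeR R -> R) by exact: measurable_snd.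
  apply: measurable_fun_ifT; [|exact: measurable_cst|].
    apply: measurable_fun_ler => //; exact: (measurableT_comp (msq : measurable_fun setT _) measurable_fst).
  exact: (measurableT_comp (measurable_beta a (y ^+ 2) (n0 n) : measurable_fun setT _) m2).
have B_cvg r : rho < r -> r < y -> B n r @[n --> \oo] --> y ^+ 2 - r ^+ 2.
  move=> rr ry; have r2y : r ^+ 2 <= y ^+ 2 by rewrite ltW // sq_lt.
  rewrite -(Rint_iv r2y).
  apply: (@Rint_dominated _ (measurableTypeR R) _ mu _ _ (iv a (y ^+ 2)) _ _ _ _ _).2.
  - by move=> n; exact: mint.
  - exact: measurable_iv.
  - exact: integ_iv.
  - exists [set y ^+ 2]; split => //; first exact: lebesgue_measure_set1.
    move=> s /= hs; apply: contrapT => sy; apply: hs.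
    have [sr|sr] := leP s (r ^+ 2).
      by rewrite /iv (ltNge _ s) sr /=; exact: cvg_cst.
    rewrite /iv sr /=.
    have := @beta_cvg R a (y ^+ 2) s; rewrite (lt_trans (sq_gt _ rr) sr) /=.
    by rewrite le_eqVlt (introF eqP sy).
  - by move=> n s; exact: ble.
have y_null (P : R -> Prop) : (forall r, r <> y -> P r) -> {ae mu, forall r, P r}.
  move=> hP; exists [set y]; split => //; first exact: lebesgue_measure_set1.
  by move=> s /= hs; apply: contrapT => sy; apply: hs; exact: hP.
have C1 : Rintegral mu setT (fun r => 2 * (r * h r) * beta n.+1%:R^-1 a (y ^+ 2) (r ^+ 2))
    @[n --> \oo] --> prim (fun r => 2 * r * h r) rho y.
  apply: (@Rint_dominated _ (measurableTypeR R) _ mu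
    (fun n r => 2 * (r * h r) * beta n.+1%:R^-1 a (y ^+ 2) (r ^+ 2)) _
    (fun r => 2 * y * `|iv rho y r * h r|) _ _ _ _ _).2.
  - move=> n; apply: measurable_funM; last exact: mb.
    by apply: measurable_funM => //; exact: measurable_funM.
  - apply: measurable_funM; first exact: measurable_iv.
    by apply: measurable_funM => //; apply: measurable_funM.
  - exact/integZ/integ_abs.
  - apply: y_null => r ry; have [rr|rr] := leP r rho.
      rewrite h0 //.
      have E0 : (fun n : nat => 2 * (r * 0) * beta n.+1%:R^-1 a (y ^+ 2) (r ^+ 2)) = (fun=> 0).
        by apply/funext => n; rewrite !mulr0 mul0r.
      by rewrite E0 !mulr0; exact: cvg_cst.
    have := @beta_cvg R a (y ^+ 2) (r ^+ 2); rewrite sq_gt //= sq_lt //.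
    rewrite (_ : (r < y) = (rho < r) && (r <= y)); last by rewrite rr /= le_eqVlt (introF eqP ry).
    move=> H; rewrite (_ : iv rho y r * (2 * r * h r) = 2 * (r * h r) * iv rho y r); last by ring.
    by apply: cvgM; [exact: cvg_cst|exact: H].
  - move=> n r; have [rr|rr] := leP r rho; first by rewrite h0 // !mulr0 mul0r normr0 mulr0.
    have r0 : 0 < r by exact: lt_trans rr.
    have [ry|ry] := leP r y; last first.
      by rewrite beta_eq0 ?n0 // ?mulr0 ?normr0 ?mulr_ge0 ?(ltW y0) //; rewrite ltr_pXn2r ?nnegrE ?(ltW y0) ?(ltW r0) // ry orbT.
    rewrite /iv rr ry /= mul1r normrM (ger0_norm (beta_ge0 _ _ _ _)).
    apply: (@le_trans _ _ `|2 * (r * h r)|).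
      by rewrite ler_piMr // (le_trans (beta_le_iv _ _ _ (n0 n))) // iv_le1.
    by rewrite normrM (ger0_norm (ler0n _ 2)) normrM (gtr0_norm r0) mulrA ler_wpM2r // ler_wpM2l.
have C2 : Rintegral mu setT (fun r => G r * B n r)
    @[n --> \oo] --> prim (fun r => G r * (y ^+ 2 - r ^+ 2)) rho y.
  apply: (@Rint_dominated _ (measurableTypeR R) _ mu (fun n r => G r * B n r) _
    (fun r => (y ^+ 2 - a) * `|iv rho y r * G r|) _ _ _ _ _).2.
  - by move=> n; apply: measurable_funM; [exact: mG|exact: mB].
  - apply: measurable_funM; first exact: measurable_iv.
    apply: measurable_funM; first exact: mG.
    by apply: measurable_funB; [exact: measurable_cst|exact: msq].
  - exact/integZ/integ_abs.
  - apply: y_null => r ry; have [rr|rr] := leP r rho.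
      rewrite G0 // mul0r mulr0.
      have E0 : (fun n : nat => 0 * B n r) = (fun=> 0) by apply/funext => n; rewrite mul0r.
      by rewrite E0; exact: cvg_cst.
    have [ry'|yr] := ltP r y.
      by rewrite /iv rr (ltW ry') mul1r; apply: cvgM; [exact: cvg_cst|exact: B_cvg].
    have yr' : y < r by rewrite lt_neqAle yr andbT; apply/eqP => e; apply: ry.
    have -> : iv rho y r = 0 by rewrite /iv (leNgt r y) yr' andbF.
    rewrite mul0r; apply: near_eq_cvg_cst; near=> n.
    rewrite (_ : B n r = 0) ?mulr0 // /B -[RHS](Rint0 mu); apply: Rint_ext => s.
    case: leP => // rs; apply: beta_eq0 => //; apply/orP; right; apply: le_lt_trans rs.
    by rewrite ler_pXn2r ?nnegrE ?(ltW y0) // (le_trans (ltW y0)).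
  - move=> n r; have [rr|rr] := leP r rho; first by rewrite G0 // mul0r mulr0 normr0 mulr0.
    have [ry|ry] := leP r y; last first.
      rewrite (_ : B n r = 0) ?mulr0 ?normr0; first by rewrite mulr_ge0 // subr_ge0 ltW.
      rewrite /B -[RHS](Rint0 mu); apply: Rint_ext => s.
      case: leP => // rs; apply: beta_eq0 => //; apply/orP; right; apply: lt_trans rs.
      by rewrite ltr_pXn2r ?nnegrE ?(ltW y0) // ltW // (lt_trans y0).
    by rewrite /iv rr ry /= mul1r normrM mulrC ler_wpM2r.
have EE : (fun n : nat => Rintegral mu setT (fun r => 2 * (r * h r) * beta n.+1%:R^-1 a (y ^+ 2) (r ^+ 2)))
   = (fun n : nat => Rintegral mu setT (fun r => G r * B n r)).
  by apply/funext => n; exact: (@weak_radial_bump R rho h G n.+1%:R^-1 y).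
rewrite EE in C1; exact: (cvg_unique (@norm_hausdorff _ _) C1 C2).
Unshelve. all: by end_near.
Qed.

(** By [prim_triangle] the right-hand side of [weak_radial_limit] is the integral of
    [2 r * prim G rho r]. Hence [2 r (h - prim G rho)] has a vanishing primitive and is 0 almost
    everywhere. *)
Lemma weak_radial_primitive rho h G : 0 < rho -> measurable_fun setT h ->
  measurable_fun setT G -> (forall r, r <= rho -> h r = 0) -> (forall r, r <= rho -> G r = 0) ->
  (forall y, integ mu (fun s => iv rho y s * h s)) -> (forall y, integ mu (fun s => iv rho y s * G s)) ->
  weak_radial_derivative h G ->
  {ae mu, forall r, rho < r -> h r = prim G rho r}.
Proof.
move=> rho0 mh mG h0 G0 jh jG W.
pose f r := 2 * r * h r - 2 * r * prim G rho r.
have m2 : measurable_fun setT (fun r : R => 2 * r) by exact: measurable_funM.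
have jk y : integ mu (fun s => iv rho y s * (2 * s)).
  apply: (@integ_le _ (measurableTypeR R) _ mu _ (fun s => 2 * `|y| * iv rho y s)).
  - by apply: measurable_funM => //; exact: measurable_iv.
  - by apply: integZ; exact: integ_iv.
  - move=> s; rewrite mulrC normrM (ger0_norm (iv_ge0 _ _ _)) /iv; case: ifP => [/andP[h1 h2]|_]; last by rewrite !mulr0.
    by rewrite !mulr1 normrM ger0_norm // ler_wpM2l // !ger0_norm //; lra.
have jh2 y : integ mu (fun s => iv rho y s * (2 * s * h s)).
  apply: (@integ_iv_bounded rho y (fun s => 2 * s) h (2 * `|y|)) => // s h1 h2.
  by rewrite normrM ger0_norm // ler_wpM2l // !ger0_norm //; lra.
have mf : measurable_fun setT f.
  by apply: measurable_funB; apply: measurable_funM => //; exact: measurable_prim.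
have T y := prim_triangle mG m2 (jG y) (jk y).
have jf y : integ mu (fun s => iv rho y s * f s).
  apply: (@integ_ext _ (measurableTypeR R) _ mu (fun s => iv rho y s * (2 * s * h s) -
     iv rho y s * (2 * s * prim G rho s))); first by move=> s; rewrite -mulrBr.
  by apply: integB => //; exact: (T y).2.
have := prim_eq0_ae mf jf; have H : forall y, rho < y -> prim f rho y = 0.
  move=> y ry; have -> : prim f rho y = prim (fun r => 2 * r * h r) rho y -
      prim (fun r => 2 * r * prim G rho r) rho y.
    rewrite /prim -(RintB (jh2 y) (T y).2); apply: Rint_ext => s; rewrite -mulrBr //.
  rewrite (weak_radial_limit rho0 ry mh mG h0 G0 (jh y) (jG y) W) (T y).1; apply/eqP.
  rewrite subr_eq0; apply/eqP; apply: Rint_ext => s; rewrite /iv; case: ifP => [/andP[h1 h2]|_]; last by rewrite !mul0r.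
  by rewrite prim_linear.
move=> /(_ H); apply: (@ae_imply _ (measurableTypeR R)) => s hs rs.
have s0 : s != 0 by rewrite gt_eqF // (lt_trans rho0).
have := hs rs; rewrite /f -mulrBr => /eqP; rewrite mulf_eq0 subr_eq0 => /orP[|/eqP //].
by rewrite mulf_eq0 pnatr_eq0 /= (negbTE s0).
Qed.

(** The outgoing condition in the form [(s h)' = h + s G = - s h1], integrated from [rho]. The
    product rule is once more [prim_triangle], now with the kernel 1. *)
Lemma weak_radial_velocity rho r h G h1 : 0 < rho -> rho < r ->
  measurable_fun setT G -> measurable_fun setT h1 ->
  (forall s, rho < s -> G s = - h1 s - h s / s) -> integ mu (fun s => iv rho r s * G s) ->
  {ae mu, forall s, rho < s -> h s = prim G rho s} ->
  r * prim G rho r = - prim (fun s => s * h1 s) rho r.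
Proof.
move=> rho0 rr mG mh1 EG jG hg.
have jk : integ mu (fun s => iv rho r s * 1).
  by apply: (@integ_ext _ (measurableTypeR R) _ mu (iv rho r)); [move=> s; rewrite mulr1|exact: integ_iv].
have jsG : integ mu (fun s => iv rho r s * (s * G s)).
  by apply: (@integ_iv_bounded rho r (fun s => s) G r) => // s h2 h3; rewrite ger0_norm //; lra.
have [T1 T2] := prim_triangle mG (@measurable_cst _ _ _ _ _ (1 : R)) jG jk.
have E1 : prim (fun s => s * h1 s) rho r =
    Rintegral mu setT (fun s => - (iv rho r s * (s * G s)) - iv rho r s * (1 * prim G rho s)).
  apply: Rint_ae.
  - by apply: measurable_funM; [exact: measurable_iv|exact: measurable_funM].
  - apply: measurable_funB; first by apply: measurableT_comp => //; exact: integ_meas jsG.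
    exact: integ_meas T2.
  - apply: (@ae_imply _ (measurableTypeR R) _ mu _ _ _ hg) => s hs.
    rewrite /iv; case: ifP => [/andP[h2 h3]|_]; last by rewrite !mul0r ?oppr0 ?addr0.
    rewrite EG // -(hs h2); field; rewrite gt_eqF // (lt_trans rho0) //.
rewrite E1 (RintB (integN jsG) T2) RintN //.
have -> : Rintegral mu setT (fun s => iv rho r s * (1 * prim G rho s)) =
    prim (fun s => G s * prim (fun=> 1) s r) rho r by exact: T1.
have -> : prim (fun s => G s * prim (fun=> 1) s r) rho r =
    Rintegral mu setT (fun s => r * (iv rho r s * G s) - iv rho r s * (s * G s)).
  apply: Rint_ext => s; rewrite /iv; case: ifP => [/andP[h2 h3]|_]; last by rewrite !mul0r mulr0 subr0.
  rewrite (_ : prim (fun=> 1) s r = r - s); first by ring.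
  by rewrite -(Rint_iv h3); apply: Rint_ext => z; rewrite mulr1.
rewrite (RintB (integZ r jG) jsG) (RintZ _ jG) -/(prim G rho r); ring.
Qed.

End ProfileRepresentation.

(** * The pointwise bound on the profile *)

Section OutgoingProfile.
Context {R : realType}.
Notation mu := (@lebesgue_measure R).
Implicit Types (r s y a b rho : R) (f h G k P Q : R -> R).

(** The best choice is [l = b / a]. If one factor is 0, a positive [x] is refuted by an [l] that is
    large or small enough. *)
Lemma le_mul_of_amgm (x a b : R) : 0 <= a -> 0 <= b ->
  (forall l, 0 < l -> 2 * x <= l * a ^+ 2 + l^-1 * b ^+ 2) -> x <= a * b.
Proof.
move=> a0 b0 H; have [a1|a1] := eqVneq a 0; last have [b1|b1] := eqVneq b 0.
- rewrite a1 mul0r; rewrite a1 expr0n /= in H; rewrite leNgt; apply/negP => x0.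
  have [b1|b1] := eqVneq b 0.
    by have := H 1 ltr01; rewrite b1 expr0n /= mulr0; lra.
  have b2 : 0 < b ^+ 2 by rewrite exprn_even_gt0.
  have l0 : 0 < b ^+ 2 / x by rewrite divr_gt0.
  by have := H _ l0; rewrite invfM invrK mulr0 add0r mulrAC mulVf ?gt_eqF //; lra.
- rewrite b1 mulr0; rewrite b1 expr0n /= in H; rewrite leNgt; apply/negP => x0.
  have a2 : 0 < a ^+ 2 by rewrite exprn_even_gt0.
  have l0 : 0 < x / a ^+ 2 by rewrite divr_gt0.
  by have := H _ l0; rewrite mulr0 addr0 divfK ?gt_eqF //; lra.
- have l0 : 0 < b / a by rewrite divr_gt0 // lt_neqAle eq_sym ?a1 ?b1.
  have := H _ l0.
  have -> : b / a * a ^+ 2 + (b / a)^-1 * b ^+ 2 = 2 * (a * b) by field; rewrite a1 b1.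
  lra.
Qed.

(** Derived from the arithmetic-geometric inequality with a free parameter, which yields the
    integrability of [f] at the same time. *)
Lemma Rint_cauchy_schwarz f P Q a b : 0 <= a -> 0 <= b -> measurable_fun setT f ->
  integ mu (fun s => P s ^+ 2) -> integ mu (fun s => Q s ^+ 2) ->
  Rintegral mu setT (fun s => P s ^+ 2) <= a ^+ 2 ->
  Rintegral mu setT (fun s => Q s ^+ 2) <= b ^+ 2 ->
  (forall s, `|f s| <= `|P s| * `|Q s|) ->
  integ mu f /\ `|Rintegral mu setT f| <= a * b.
Proof.
move=> a0 b0 mf iP iQ Pa Qb fPQ.
have am (l s : R) : 0 < l -> `|f s| <= l / 2 * P s ^+ 2 + l^-1 / 2 * Q s ^+ 2.
  move=> l0; apply: (le_trans (fPQ s)).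
  have h : 0 <= (l * `|P s| - `|Q s|) ^+ 2 by exact: sqr_ge0.
  rewrite -(real_normK (num_real (P s))) -(real_normK (num_real (Q s))).
  have -> : l / 2 * `|P s| ^+ 2 + l^-1 / 2 * `|Q s| ^+ 2 =
    `|P s| * `|Q s| + (l * `|P s| - `|Q s|) ^+ 2 * (l^-1 / 2) by field; rewrite gt_eqF.
  by rewrite lerDl mulr_ge0 // divr_ge0 // invr_ge0 ltW.
have il l : integ mu (fun s => l / 2 * P s ^+ 2 + l^-1 / 2 * Q s ^+ 2).
  by apply: integD; exact: integZ.
have jf : integ mu f.
  by apply: (@integ_le _ (measurableTypeR R) _ mu _ _ mf (il 1)) => s; exact: am.
split=> //; apply: le_mul_of_amgm => // l l0.
have : `|Rintegral mu setT f| <= l / 2 * a ^+ 2 + l^-1 / 2 * b ^+ 2.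
  apply: (@le_trans _ _ (Rintegral mu setT (fun s => l / 2 * P s ^+ 2 + l^-1 / 2 * Q s ^+ 2))).
    by apply: Rint_norm_le => // s; exact: am.
  rewrite (RintD (integZ _ iP) (integZ _ iQ)) (RintZ _ iP) (RintZ _ iQ).
  by apply: lerD; apply: ler_wpM2l => //; rewrite divr_ge0 // ?invr_ge0 ltW.
have -> : l * a ^+ 2 + l^-1 * b ^+ 2 = 2 * (l / 2 * a ^+ 2 + l^-1 / 2 * b ^+ 2).
  by field; rewrite gt_eqF.
by rewrite ler_pM2l.
Qed.

Lemma integ_inv_sqr_tail a b : 0 < a ->
  integ mu (fun s => (iv a b s / s) ^+ 2) /\
  Rintegral mu setT (fun s => (iv a b s / s) ^+ 2) <= a^-1.
Proof.
move=> a0; pose F s := (iv a b s / s) ^+ 2.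
have mF : measurable_fun setT F.
  apply: measurable_funX; apply: measurable_funM; first exact: measurable_iv.
  exact: measurable_inv.
have F0 s : 0 <= F s by exact: sqr_ge0.
have jF : integ mu F.
  apply: (@integ_le _ (measurableTypeR R) _ mu _ (fun s => a ^- 2 * iv a b s)) => //.
    by apply: integZ; exact: integ_iv.
  move=> s; rewrite ger0_norm // /F /iv; case: ifP => [/andP[h1 h2]|_]; last first.
    by rewrite mul0r expr0n /= mulr0.
  have s0 : 0 < s by exact: lt_trans h1.
  by rewrite mul1r mulr1 exprVn lef_pV2 ?posrE ?exprn_gt0 // lerXn2r ?nnegrE ?ltW.
split=> //; rewrite -(Rint_shift a mF) -lee_fin EFin_Rint; last exact: (integ_shift a jF).
have h := @integral_powR_tail R a 1 a0 ltr01.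
rewrite invr1 mul1r powR_inv1 ?ltW // in h.
rewrite -h [leRHS]integral_mkcond; apply: ge0_le_integral => //.
- by move=> s _; rewrite lee_fin.
- by apply/measurable_EFinP; exact: measurable_shift.
- apply/(measurable_restrictT _ _).1 => //; apply/measurable_EFinP; apply: measurable_funTS.
  apply: (measurableT_comp (@measurable_powR R (-1 - 1) : measurable_fun setT _)).
  by apply: measurable_funD.
- move=> s _; rewrite patchE mem_setE in_itv /= andbT; have [s0|s0] := leP 0 s; last first.
    have -> : F (s + a) = 0 by rewrite /F /iv ltrDr (ltNge 0 s) ltW //= mul0r expr0n.
    by [].
  have as0 : 0 < s + a by rewrite ltr_wpDl.
  rewrite lee_fin (addrC a s) (_ : - 1 - 1 = - 2%:R :> R); last by rewrite -opprD.
  rewrite powRN powR_mulrn ?(ltW as0) // /F /iv; case: ifP => _; first by rewrite mul1r exprVn.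
  by rewrite mul0r expr0n /= invr_ge0 exprn_ge0 // ltW.
Qed.

(** Cauchy-Schwarz on []r, y]] gives [D / sqrt r] up to the value at [y], so decay of the profile at
    infinity is required. It comes from the outgoing condition: [y] times the profile is an integral
    of [s h1], of size at most [A * sqrt y], hence the value at [y] is at most [A / sqrt y]. The
    constant [A] then disappears as [y] tends to infinity. *)
Lemma profile_bound rho G h1 (D A : R) r : 0 < rho -> 0 <= D -> 0 <= A -> rho < r ->
  measurable_fun setT G -> measurable_fun setT h1 ->
  integ mu (fun s => (s * G s) ^+ 2) -> Rintegral mu setT (fun s => (s * G s) ^+ 2) <= D ^+ 2 ->
  integ mu (fun s => (s * h1 s) ^+ 2) -> Rintegral mu setT (fun s => (s * h1 s) ^+ 2) <= A ^+ 2 ->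
  (forall y, integ mu (fun s => iv rho y s * G s)) ->
  (forall y, rho < y -> y * prim G rho y = - prim (fun s => s * h1 s) rho y) ->
  `|prim G rho r| <= D / Num.sqrt r.
Proof.
move=> rho0 D0 A0 rr mG mh1 jG GD j1 h1A lG vel; have r0 : 0 < r by exact: lt_trans rr.
have sr0 : 0 < Num.sqrt r by rewrite sqrtr_gt0.
have far y : rho < y -> `|prim G rho y| <= A / Num.sqrt y.
  move=> ry; have y0 : 0 < y by exact: lt_trans ry.
  have sy0 : 0 < Num.sqrt y by rewrite sqrtr_gt0.
  have := @Rint_cauchy_schwarz (fun s => iv rho y s * (s * h1 s)) (iv rho y) (fun s => s * h1 s)
    (Num.sqrt y) A (ltW sy0) A0.
  case=> //.
  - by apply: measurable_funM; [exact: measurable_iv|exact: measurable_funM].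
  - apply: (@integ_ext _ (measurableTypeR R) _ mu (iv rho y)); last exact: integ_iv.
    by move=> s; rewrite /iv; case: ifP; rewrite ?expr1n ?expr0n.
  - rewrite sqr_sqrtr ?(ltW y0) //; have -> : (fun s => iv rho y s ^+ 2) = iv rho y.
      by apply/funext => s; rewrite /iv; case: ifP; rewrite ?expr1n ?expr0n.
    by rewrite Rint_iv ?(ltW ry) //; lra.
  - by move=> s; rewrite normrM.
  - move=> _ H; have E : `|y * prim G rho y| <= Num.sqrt y * A by rewrite vel // normrN.
    rewrite normrM (gtr0_norm y0) in E.
    rewrite ler_pdivlMr // -(ler_pM2l sy0) mulrCA -expr2 sqr_sqrtr ?(ltW y0) //.
    by rewrite mulrC.
have near y : r < y -> `|prim G r y| <= D / Num.sqrt r.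
  move=> ry; have [i1 i2] := integ_inv_sqr_tail y r0.
  have := @Rint_cauchy_schwarz (fun s => iv r y s * G s) (fun s => iv r y s / s) (fun s => s * G s)
    (Num.sqrt r)^-1 D.
  rewrite mulrC; case=> //.
  - by apply: measurable_funM => //; exact: measurable_iv.
  - by rewrite exprVn sqr_sqrtr // ltW.
  - move=> s; rewrite -normrM /iv; case: ifP => [/andP[h2 h3]|_]; last by rewrite !mul0r normr0.
    by rewrite !mul1r mulKf // gt_eqF // (lt_trans r0).
have split y : r < y -> `|prim G rho r| <= A / Num.sqrt y + D / Num.sqrt r.
  move=> ry; have E : prim G rho y = prim G rho r + prim G r y.
    by apply: prim_add => //; rewrite (ltW rr) (ltW ry).
  have -> : prim G rho r = prim G rho y - prim G r y by rewrite E addrK.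
  apply: (le_trans (ler_normB _ _)); apply: lerD; last exact: near.
  by apply: far; exact: lt_trans ry.
rewrite leNgt; apply/negP => H; pose e := `|prim G rho r| - D / Num.sqrt r.
have e0 : 0 < e by rewrite /e subr_gt0.
(* So far out that [A / sqrt y] is less than the supposed excess [e]. *)
pose y := r + (A / e) ^+ 2 + 1.
have ry : r < y by have := sqr_ge0 (A / e); rewrite /y; lra.
have y0 : 0 < y by exact: lt_trans ry.
have : A / Num.sqrt y < e.
  rewrite ltr_pdivrMr ?sqrtr_gt0 // mulrC -ltr_pdivrMr //.
  rewrite -(@ger0_norm _ (A / e)); last by rewrite divr_ge0 // ltW.
  rewrite -sqrtr_sqr ltr_sqrt // /y; lra.
have := split y ry; rewrite /e; lra.
Qed.

End OutgoingProfile.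

(** * From the data to the profile *)

Section OutgoingData.
Context {R : realType}.
Notation mu := (@lebesgue_measure R).
Implicit Types (r s y rho : R) (x : R3 R).

(** Beyond [rho] the sphere weight is bounded below by its value at [rho], so global integrability
    of a power on space gives local integrability on the half-line. *)
Lemma radial_locally_integrable n (h : R -> R) rho y : 0 < rho -> measurable_fun setT h ->
  integ mu (fun r => sphere_weight r * `|h r| ^+ n.+1) ->
  integ mu (fun r => iv rho y r * h r).
Proof.
move=> rho0 mh jh; have c0 := @disk_area_gt0 R.
apply: (@integ_le _ (measurableTypeR R) _ mu _ (fun r => iv rho y r +
   (4 * disk_area * rho ^+ 2)^-1 * (sphere_weight r * `|h r| ^+ n.+1))).
- by apply: measurable_funM => //; exact: measurable_iv.
- by apply: integD; [exact: integ_iv|exact: integZ].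
- move=> r; have q0 : 0 < 4 * disk_area * rho ^+ 2 by rewrite mulr_gt0 ?exprn_gt0 ?mulr_gt0.
  have p0 : 0 <= `|h r| ^+ n.+1 by rewrite exprn_ge0.
  have w0 := sphere_weight_ge0 r.
  have s0 : 0 <= (4 * disk_area * rho ^+ 2)^-1 * (sphere_weight r * `|h r| ^+ n.+1).
    by rewrite mulr_ge0 ?invr_ge0 ?(ltW q0) // mulr_ge0.
  rewrite /iv; case: ifP => [/andP[h1 h2]|_]; last by rewrite mul0r normr0 add0r.
  rewrite mul1r; apply: (le_trans (le_add1_pow n (normr_ge0 _))); rewrite lerD2l.
  rewrite mulrA ler_peMl // mulrC ler_pdivlMr // mul1r /sphere_weight.
  have r0 : 0 < r by exact: lt_trans h1.
  rewrite (ltW r0) ler_pM2l ?mulr_gt0 // ler_pXn2r ?nnegrE ?ltW //.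
Qed.

Lemma dot3_sqr_le (g x : R3 R) : (dot3 g x / euclid x) ^+ 2 <= euclid g ^+ 2.
Proof.
have [x0|x0] := eqVneq (euclid x) 0; first by rewrite x0 invr0 mulr0 expr0n sqr_ge0.
have ex : 0 < euclid x by rewrite lt_neqAle eq_sym x0 euclid_ge0.
rewrite exprMn exprVn ler_pdivrMr ?exprn_gt0 // -exprMn -[leLHS]real_normK ?num_real //.
by rewrite lerXn2r ?nnegrE ?mulr_ge0 ?euclid_ge0 // norm_dot3_le.
Qed.

(** Everything the evolution needs to know about the data is expressed by the single function [h1]:
    it is the profile of [u1], and that of [u0] is a primitive of [- s * h1 s]. The gradient of [u0]
    enters only through the bound with [B]. *)
Lemma outgoing_profile rho (u0 u1 : R3 R -> R) (B : R) : 0 < rho -> H1dot u0 -> Lp_fun 2%:E u1 ->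
  radial u0 -> radial u1 -> outgoing u0 u1 ->
  supported_outside_ball rho u0 -> supported_outside_ball rho u1 ->
  H1dot_norm u0 = B%:E -> 0 <= B ->
  exists h1 : R -> R, [/\ measurable_fun setT h1, forall r, r <= rho -> h1 r = 0,
    integ mu (fun s => (s * h1 s) ^+ 2), {ae leb3, forall x, u1 x = h1 (euclid x)} &
    {ae leb3, forall x, u0 x = - prim (fun s => s * h1 s) rho (euclid x) / euclid x} /\
    forall r, 0 < r -> `|prim (fun s => s * h1 s) rho r| <=
      B / Num.sqrt (4 * disk_area) * Num.sqrt r].
Proof.
move=> rho0 [L6 [g0 wg0]] L2 [h' mh' u0h] [h1' mh1' u1h] out s0 s1 NB B0.
have c0 : 0 < 4 * (disk_area : R) by rewrite mulr_gt0 // disk_area_gt0.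
pose h r := if r <= rho then 0 else h' r.
pose h1 r := if r <= rho then 0 else h1' r.
(* [G] is read off from the outgoing condition, so that it is a measurable function of the radius by
   construction; the radial component of the gradient is identified with it afterwards. *)
pose G r := if r <= rho then 0 else - h1 r - h r / r.
have mcut (f : R -> R) : measurable_fun setT f -> measurable_fun setT (fun r : R => if r <= rho then 0 else f r).
  move=> mf; apply: measurable_fun_ifT; [|exact: measurable_cst|exact: mf].
  by apply: measurable_fun_ler => //; exact: measurable_cst.
have mh : measurable_fun setT h by exact: mcut.
have mh1 : measurable_fun setT h1 by exact: mcut.
have mG : measurable_fun setT G.
  apply: mcut; apply: measurable_funB; first exact: measurableT_comp.
  by apply: measurable_funM => //; exact: measurable_inv.
have h_0 r : r <= rho -> h r = 0 by rewrite /h => ->.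
have h1_0 r : r <= rho -> h1 r = 0 by rewrite /h1 => ->.
have G_0 r : r <= rho -> G r = 0 by rewrite /G => ->.
have aeu0 : {ae leb3, forall x, u0 x = h (euclid x)}.
  apply: (@ae_imply2 _ (R3meas R) _ leb3 _ _ _ u0h s0) => x e1 e2.
  by rewrite /h; case: ifP => // xr; rewrite e2.
have aeu1 : {ae leb3, forall x, u1 x = h1 (euclid x)}.
  apply: (@ae_imply2 _ (R3meas R) _ leb3 _ _ _ u1h s1) => x e1 e2.
  by rewrite /h1; case: ifP => // xr; rewrite e2.
pose g := grad u0.
have wg : weak_gradient u0 g.
  exact: (@xgetPex _ (fun=> 0) [set g | weak_gradient u0 g] (ex_intro _ g0 wg0)).
have aeG : {ae leb3, forall x, dot3 (g x) x / euclid x = G (euclid x)}.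
  have A := @ae_imply2 _ (R3meas R) _ leb3 _ _ _ aeu0 aeu1 (fun x => @conj _ _).
  apply: (@ae_imply2 _ (R3meas R) _ leb3 _ _ _ A out) => x [e0 e1].
  rewrite /radial_derivative -/g e0 e1 => e2.
  rewrite /G; case: ifP => xr; last by rewrite e2; ring.
  by move: e2; rewrite h_0 // h1_0 // mul0r subr0 => /eqP; rewrite eq_sym oppr_eq0 => /eqP.
have W : weak_radial_derivative h G.
  move=> th th' b sth sth' dth thb.
  exact: (weak_gradient_radial L6 wg mh mG aeu0 aeG sth sth' dth thb).
have mpow n (f : R -> R) : measurable_fun setT f -> measurable_fun setT (fun r => `|f r| ^+ n).
  by move=> mf; apply: measurable_funX; exact: measurableT_comp.
have j6 : integ mu (fun r => sphere_weight r * `|h r| ^+ 6).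
  apply: (polar_integ (mpow 6 h mh)).1.
  apply: (@integ_ae _ (R3meas R) _ leb3 _ _ (@Lp_integ R 5 u0 L6) (measurable_comp_euclid (mpow 6 h mh))).
  by apply: (@ae_imply _ (R3meas R) _ leb3 _ _ _ aeu0) => x ->.
have j2 : integ mu (fun r => sphere_weight r * `|h1 r| ^+ 2).
  apply: (polar_integ (mpow 2 h1 mh1)).1.
  apply: (@integ_ae _ (R3meas R) _ leb3 _ _ (@Lp_integ R 1 u1 L2) (measurable_comp_euclid (mpow 2 h1 mh1))).
  by apply: (@ae_imply _ (R3meas R) _ leb3 _ _ _ aeu1) => x ->.
have sqE (f : R -> R) r : (forall r, r <= rho -> f r = 0) ->
    (r * f r) ^+ 2 = (4 * disk_area)^-1 * (sphere_weight r * `|f r| ^+ 2).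
  move=> f0; have [rr|rr] := leP r rho; first by rewrite f0 // mulr0 normr0 !expr0n /= !mulr0.
  rewrite /sphere_weight ltW ?(lt_trans rho0) // real_normK ?num_real // exprMn.
  by field; rewrite gt_eqF // disk_area_gt0.
have jh1 : integ mu (fun s => (s * h1 s) ^+ 2).
  apply: (@integ_ext _ (measurableTypeR R) _ mu (fun r => (4 * disk_area)^-1 * (sphere_weight r * `|h1 r| ^+ 2))).
    by move=> r; rewrite -sqE.
  exact: integZ.
pose F x := (dot3 (g x) x / euclid x) ^+ 2.
have Lg i : integ leb3 (fun x => `|coord3 i (g x)| ^+ 2) := @Lp_integ R 1 _ (wg i).1.
have gE x : euclid (g x) ^+ 2 = `|coord3 (@Ordinal 3 0 isT) (g x)| ^+ 2 +
    `|coord3 (@Ordinal 3 1 isT) (g x)| ^+ 2 + `|coord3 (@Ordinal 3 2 isT) (g x)| ^+ 2.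
  by rewrite euclid_sqr !real_normK ?num_real.
have jg : integ leb3 (fun x => euclid (g x) ^+ 2).
  apply: (@integ_ext _ (R3meas R) _ leb3 _ _ (fun x => esym (gE x))).
  exact: (@integD _ (R3meas R) _ leb3 _ _ (@integD _ (R3meas R) _ leb3 _ _ (Lg _) (Lg _)) (Lg _)).
have mF : measurable_fun setT (F : R3meas R -> R).
  apply: measurable_funX; apply: measurable_funM; last by apply: measurable_inv; exact: measurable_euclid.
  rewrite (_ : (fun x : R3meas R => dot3 (g x) x) = (fun x : R3meas R =>
     coord3 (@Ordinal 3 0 isT) (g x) * coord3 (@Ordinal 3 0 isT) x +
     coord3 (@Ordinal 3 1 isT) (g x) * coord3 (@Ordinal 3 1 isT) x +
     coord3 (@Ordinal 3 2 isT) (g x) * coord3 (@Ordinal 3 2 isT) x)); last first.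
    by apply/funext => x; rewrite dot3E.
  have mgx i : measurable_fun setT (fun x : R3meas R => coord3 i (g x) * coord3 i x).
    by apply: measurable_funM; [case: ((wg i).1)|exact: measurable_coord3].
  exact: (measurable_funD (measurable_funD (mgx _) (mgx _)) (mgx _)).
have jF : integ leb3 F.
  apply: (@integ_le _ (R3meas R) _ leb3 _ _ mF jg) => x.
  by rewrite ger0_norm ?sqr_ge0 // dot3_sqr_le.
have aeF : {ae leb3, forall x, F x = `|G (euclid x)| ^+ 2}.
  by apply: (@ae_imply _ (R3meas R) _ leb3 _ _ _ aeG) => x e; rewrite /F e real_normK ?num_real.
have mG2 := measurable_comp_euclid (mpow 2 G mG).
have jG2 := (polar_integ (mpow 2 G mG)).1 (@integ_ae _ (R3meas R) _ leb3 _ _ jF mG2 aeF).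
have jG : integ mu (fun s => (s * G s) ^+ 2).
  apply: (@integ_ext _ (measurableTypeR R) _ mu (fun r => (4 * disk_area)^-1 * (sphere_weight r * `|G r| ^+ 2))).
    by move=> r; rewrite -sqE.
  exact: integZ.
have gB : Rintegral leb3 setT (fun x => euclid (g x) ^+ 2) = B ^+ 2.
  apply: EFin_inj; rewrite EFin_Rint //.
  have n2 : (2 : R) != 0 by rewrite pnatr_eq0.
  have := poweR_Lnorm (leb3 : {measure set (R3meas R) -> \bar R}) (EFin \o (euclid \o g)) n2.
  have -> : ('N[leb3]_(2%:E)[EFin \o (euclid \o g)])%E = B%:E by exact: NB.
  rewrite poweR_EFin powR_mulrn // => ->; apply: eq_integral => x _ /=.
  by rewrite powR_mulrn // real_normK ?num_real.
(* The radial component is at most the whole gradient, and polar coordinates carry the factor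
   [4 * disk_area], whose square root appears in the bound on the profile. *)
have GD : Rintegral mu setT (fun s => (s * G s) ^+ 2) <= (B / Num.sqrt (4 * disk_area)) ^+ 2.
  have -> : Rintegral mu setT (fun s => (s * G s) ^+ 2) =
      (4 * disk_area)^-1 * Rintegral leb3 setT F.
    rewrite (Rint_ae mF mG2 aeF) (polar_Rint (mpow 2 G mG)) -(RintZ _ jG2).
    by apply: Rint_ext => r; rewrite -sqE.
  rewrite exprMn exprVn sqr_sqrtr ?(ltW c0) // mulrC ler_wpM2r ?invr_ge0 ?(ltW c0) // -gB.
  by apply: Rint_le => // x; exact: dot3_sqr_le.
have lh y : integ mu (fun s => iv rho y s * h s) by exact: (radial_locally_integrable y rho0 mh j6).
have lG y : integ mu (fun s => iv rho y s * G s) by exact: (radial_locally_integrable y rho0 mG jG2).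
have hg := weak_radial_primitive rho0 mh mG h_0 G_0 lh lG W.
have vel y : rho < y -> y * prim G rho y = - prim (fun s => s * h1 s) rho y.
  move=> ry; apply: (weak_radial_velocity rho0 ry mG mh1 _ (lG y) hg) => s rs.
  by rewrite /G (leNgt s rho) rs.
pose A := Num.sqrt (Rintegral mu setT (fun s => (s * h1 s) ^+ 2)).
have D0 : 0 <= B / Num.sqrt (4 * disk_area) by rewrite divr_ge0 // sqrtr_ge0.
exists h1; split => //; split.
- have hh := ae_radial hg.
  apply: (@ae_imply2 _ (R3meas R) _ leb3 _ _ _ aeu0 hh) => x -> hx.
  have [xr|xr] := leP (euclid x) rho; first by rewrite h_0 // prim_eq0 // oppr0 mul0r.
  have x0 : euclid x != 0 by rewrite gt_eqF // (lt_trans rho0).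
  by rewrite hx // -vel // mulrAC mulfV // mul1r.
- move=> r r0; have [rr|rr] := leP r rho.
    by rewrite prim_eq0 // normr0 mulr_ge0 // sqrtr_ge0.
  have := @profile_bound R rho G h1 (B / Num.sqrt (4 * disk_area)) A r rho0 D0 (sqrtr_ge0 _) rr mG mh1
    jG GD jh1; rewrite sqr_sqrtr; last by apply: Rint_ge0 => s; exact: sqr_ge0.
  move=> /(_ (lexx _) lG vel) H.
  rewrite -[prim _ _ _]opprK -vel // normrN normrM (gtr0_norm r0).
  have sr : 0 < Num.sqrt r by rewrite sqrtr_gt0.
  rewrite mulrC; apply: (le_trans (ler_wpM2r (ltW r0) H)).
  by rewrite -{2}(sqr_sqrtr (ltW r0)) expr2 mulrA divfK // gt_eqF.
Qed.

End OutgoingData.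

(** * Picard iteration *)

Section DuhamelBound.
Context {R : realType}.
Notation mu := (@lebesgue_measure R).
Implicit Types (r s t y a b k : R) (V W : R -> R).

Lemma Rint_box_shift t r V : measurable_fun setT V ->
  Rintegral mu setT (fun a => box t a * V (r + a)) =
  Rintegral mu setT (fun y => box t (y - r) * V y).
Proof.
move=> mV; have mU : measurable_fun setT (fun y => box t (y - r) * V y).
  apply: measurable_funM => //.
  by have := measurable_shift (- r) (measurable_box t).
rewrite -(Rint_shift r mU); apply: Rint_ext => a.
by rewrite addrK (addrC a r).
Qed.

Lemma Rint_odd V : odd_fun V -> integ mu V -> Rintegral mu setT V = 0.
Proof.
move=> oV iV; have := mp_Rint (@lebesgue_neg R) (integ_meas iV).
have -> : (fun x => V (- x)) = (fun x => - V x) by apply/funext => x; rewrite oV.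
by rewrite RintN //; lra.
Qed.

(** By oddness the part of the window [[r - t, r + t]] that is symmetric about 0 cancels, which
    leaves the radii from [|r - t|] to [r + t]: the base of the backward light cone in radial
    form. *)
Lemma avg_odd t V r : 0 <= t -> 0 <= r -> odd_fun V -> adm V ->
  avg t V r = 2^-1 * prim V `|r - t| (r + t).
Proof.
move=> t0 r0 oV aV; have mV := proj1 aV; rewrite /avg; congr (_ * _).
have jb c : 0 <= c -> integ mu (fun y => box c y * V y).
  move=> c0; apply: (@adm_mul _ _ _ ((1 + c) ^+ 2)) => //; first exact: measurable_box.
  by move=> a; exact: box_wt.
have ji a b : integ mu (fun y => iv a b y * V y).
  have h : 0 <= `|a| + `|b| by rewrite addr_ge0.
  apply: (@integ_le _ (measurableTypeR R) _ mu _ (fun y => `|box (`|a| + `|b|) y * V y|)).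
  - by apply: measurable_funM => //; exact: measurable_iv.
  - exact: (integ_abs (jb _ h)).
  - by move=> y; rewrite !normrM ler_wpM2r // (ger0_norm (iv_ge0 _ _ _)) (ger0_norm (box_ge0 _ _)) iv_le_box.
have E y : y <> r - t -> box t (y - r) * V y =
    iv `|r - t| (r + t) y * V y + (if r <= t then box (t - r) y * V y else 0).
  move=> yrt; rewrite /box /iv !ler_norml.
  have [rt|tr] := leP r t.
    rewrite (_ : `|r - t| = t - r); last by rewrite ler0_norm; lra.
    case: (leP y (r + t)) => h1; case: (ltP (t - r) y) => h2; case: (leP (- (t - r)) y) => h3;
      case: (leP y (t - r)) => h4; case: (leP (- t) (y - r)) => h5; case: (leP (y - r) t) => h6 /=;
      rewrite ?mul0r ?mul1r ?addr0 ?add0r //; exfalso; lra.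
  rewrite (_ : `|r - t| = r - t); last by rewrite gtr0_norm; lra.
  have h0 : (r - t < y) = (- t <= y - r).
    by apply/idP/idP => h; [lra|rewrite lt_neqAle; apply/andP; split; [apply/eqP => e; apply: yrt|lra]].
  rewrite h0 addr0; congr (_ * _).
  by have -> : (y <= r + t) = (y - r <= t) by rewrite lerBlDl.
rewrite (Rint_box_shift _ _ mV).
have mm : measurable_fun setT (fun y => if r <= t then box (t - r) y * V y else 0).
  case: leP => [rt|_]; last exact: measurable_cst.
  have c0 : 0 <= t - r by lra.
  exact: integ_meas (jb _ c0).
rewrite (@Rint_ae _ (measurableTypeR R) _ mu _ (fun y => iv `|r - t| (r + t) y * V y +
   (if r <= t then box (t - r) y * V y else 0))).
- have [rt|tr] := leP r t; last by apply: Rint_ext => y; rewrite addr0.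
  have c0 : 0 <= t - r by lra.
  rewrite (RintD (ji _ _) (jb _ c0)) (_ : Rintegral mu setT (fun y => box (t - r) y * V y) = 0) ?addr0 //.
  apply: Rint_odd; last exact: jb.
  by move=> y; rewrite oV /box normrN mulrN.
- apply: measurable_funM => //; exact: (measurable_shift (- r) (measurable_box t)).
- by apply: measurable_funD => //; exact: integ_meas (ji _ _).
- exists [set r - t]; split => //; first exact: lebesgue_measure_set1.
  by move=> y /= hy; apply: contrapT => yrt; apply: hy; exact: E.
Qed.

Lemma prim_inv_sqrt m a b : 0 < m -> 0 <= a <= b ->
  prim (fun y => (Num.sqrt (`|y| + m))^-1) a b = 2 * (Num.sqrt (b + m) - Num.sqrt (a + m)).
Proof.
move=> m0 /andP[a0 ab]; pose f y := (Num.sqrt (y + m))^-1.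
have sh (x : R) : is_derive x 1 (fun y : R => y + m) 1.
  by apply: is_derive_eq; rewrite /GRing.scale /=; ring.
have p0 x : a <= x <= b -> 0 < x + m by move=> /andP[ax _]; lra.
have dF (x : R) : a <= x <= b -> is_derive x 1 (fun y : R => 2 * Num.sqrt (y + m)) (f x).
  move=> /p0 xm; have d1 := @is_derive1_comp _ Num.sqrt (fun y : R => y + m) x _ _ (is_derive1_sqrt xm) (sh x).
  apply: (is_derive_eq (@is_deriveZ _ _ _ _ 2 _ _ _ d1)).
  by rewrite /GRing.scale /= mulr1 invfM mulrA mulfV ?mul1r.
have cf (x : R) : a <= x <= b -> {for x, continuous f}.
  move=> /p0 xm; apply: cvgV; first by rewrite gt_eqF // sqrtr_gt0.
  apply: (@continuous_comp _ _ _ (fun y : R => y + m) Num.sqrt); last exact: sqrt_continuous.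
  by apply: cvgD; [exact: cvg_id|exact: cvg_cst].
have mf : measurable_fun setT f.
  apply: measurable_inv; apply: measurable_sqrt; exact: measurable_funD.
have -> : prim (fun y => (Num.sqrt (`|y| + m))^-1) a b = fine (\int[mu]_(s in [set` `[a, b]]) (f s)%:E)%E.
  rewrite -integral_itv_obnd_cbnd; last first.
    by apply: measurableT_comp => //; exact: measurable_funTS.
  congr fine; rewrite [RHS]integral_mkcond; apply: eq_integral => s _.
  rewrite patchE mem_setE in_itv /= /iv; case: ifP => [/andP[h1 h2]|_]; last by rewrite mul0r.
  by rewrite mul1r ger0_norm //; lra.
by rewrite (FTC_itv ab cf dF) mulrBr.
Qed.

Context (N : nat) (rho : R) (hN : (4 < N)%N) (rho0 : 0 < rho).

Definition jap t r : R := Num.sqrt (`|r| + t + rho).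

(** The bound [K * wgt t] on an odd profile is the bound [K / jap t] on the radial function. *)
Definition wgt t r : R := `|r| / jap t r.

Lemma jap_gt0 t r : 0 <= t -> 0 < jap t r.
Proof. by move=> t0; rewrite sqrtr_gt0 ltr_wpDl // addr_ge0. Qed.

Lemma jap_sqr t r : 0 <= t -> jap t r ^+ 2 = `|r| + t + rho.
Proof. by move=> t0; rewrite sqr_sqrtr // addr_ge0 ?(ltW rho0) // addr_ge0. Qed.

Lemma wgt_ge0 t r : 0 <= wgt t r.
Proof. by rewrite divr_ge0 // sqrtr_ge0. Qed.

Lemma sqrt_le_jap s r : Num.sqrt (s + rho) <= jap s r.
Proof. by apply: ler_wsqrtr; have := normr_ge0 r; lra. Qed.

(** The pointwise bound is that of the profile of [|u|^N u] when [u] is bounded by a multiple of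
    [1 / jap]: the nonlinearity has [N + 1] inverse powers of [jap], and its profile one more factor
    [|r|]. *)
Definition admissible_source F (A s : R) :=
  [/\ measurable_fun setT F, odd_fun F & forall r, `|F r| <= A * (`|r| * jap s r ^- N.+1)].

(** Of the [N + 1] inverse powers of [jap], two absorb the factor [|r|], [N - 2] are spent on decay
    in time, and one is kept for the integral in space. *)
Lemma le_jap s r : 0 <= s -> `|r| * jap s r ^- N.+1 <= Num.sqrt (s + rho) ^- (N - 2) * (jap s r)^-1.
Proof.
move=> s0; have X0 := jap_gt0 r s0; set y := Num.sqrt (s + rho).
have y0 : 0 < y by rewrite sqrtr_gt0 ltr_wpDl.
have yX : y <= jap s r by exact: sqrt_le_jap.
have rX : `|r| <= jap s r ^+ 2 by rewrite jap_sqr // -addrA lerDl addr_ge0 // ltW.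
have [n ->] : exists n, N = n.+2 by exists (N - 2)%N; lia.
rewrite (_ : (n.+2 - 2 = n)%N); last by lia.
set X := jap s r in X0 yX rX *.
have -> : `|r| * X ^- n.+3 = `|r| * X ^- 2 * (X ^- n * X^-1).
  by rewrite !exprS expr0; field; rewrite expf_neq0 ?gt_eqF.
apply: (@le_trans _ _ (1 * (X ^- n * X^-1))).
  apply: ler_wpM2r; first by rewrite mulr_ge0 ?invr_ge0 ?exprn_ge0 ?ltW.
  by rewrite ler_pdivrMr ?exprn_gt0 // mul1r.
rewrite mul1r; apply: ler_wpM2r; first by rewrite invr_ge0 ltW.
by rewrite lef_pV2 ?posrE ?exprn_gt0 // lerXn2r ?nnegrE ?(ltW y0) ?(ltW X0).
Qed.

Lemma source_adm F A s : 0 <= s -> 0 <= A -> admissible_source F A s -> adm F.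
Proof.
move=> s0 A0 [mF oF bF]; have y0 : 0 < Num.sqrt (s + rho) by rewrite sqrtr_gt0 ltr_wpDl.
apply: (@adm_bounded _ _ (A * (Num.sqrt (s + rho) ^- (N - 2) * (Num.sqrt (s + rho))^-1))) => // r.
apply: (le_trans (bF r)); apply: ler_wpM2l => //; apply: (le_trans (le_jap r s0)).
apply: ler_wpM2l; first by rewrite invr_ge0 exprn_ge0 // ltW.
by rewrite lef_pV2 ?posrE ?jap_gt0 // sqrt_le_jap.
Qed.

(* On the backward light cone [s + |y| >= |r - t|], and [2 (sqrt P - sqrt Q) <= 4 r / sqrt P]. *)
Lemma avg_source_bound F A s t r : 0 <= s <= t -> 0 <= A -> admissible_source F A s ->
  `|avg (t - s) F r| <= A * 2 * wgt t r * Num.sqrt (s + rho) ^- (N - 2).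
Proof.
move=> /andP[s0 st] A0 sF; have [mF oF bF] := sF; have aF := source_adm s0 A0 sF.
have t0 : 0 <= t by exact: le_trans st.
have ts0 : 0 <= t - s by rewrite subr_ge0.
wlog r0 : r / 0 <= r.
  move=> H; have [|r0] := leP 0 r; first exact: H.
  have := H (- r); rewrite (odd_avg ts0 aF oF) normrN /wgt /jap normrN; apply.
  by rewrite oppr_ge0 ltW.
rewrite avg_odd // normrM ger0_norm //.
set c := `|r - (t - s)|; set d := r + (t - s); set Y := Num.sqrt (s + rho) ^- (N - 2).
have Y0 : 0 <= Y by rewrite invr_ge0 exprn_ge0 // sqrtr_ge0.
have m0 : 0 < s + rho by rewrite ltr_wpDl.
have cd : 0 <= c <= d by rewrite normr_ge0 /c /d ler_norml; apply/andP; split; lra.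
have jj : integ mu (fun y => iv c d y * (Num.sqrt (`|y| + (s + rho)))^-1).
  apply: (@integ_le _ (measurableTypeR R) _ mu _ (fun y => (Num.sqrt (s + rho))^-1 * iv c d y)).
  - apply: measurable_funM; first exact: measurable_iv.
    by apply: measurable_inv; apply: measurable_sqrt; apply: measurable_funD.
  - by apply: integZ; exact: integ_iv.
  - move=> y; rewrite normrM mulrC (ger0_norm (iv_ge0 _ _ _)) ler_wpM2r ?iv_ge0 //.
    have h : 0 < `|y| + (s + rho) by rewrite ltr_wpDl.
    rewrite ger0_norm ?invr_ge0 ?sqrtr_ge0 // lef_pV2 ?posrE ?sqrtr_gt0 //.
    by apply: ler_wsqrtr; rewrite lerDr.
have h1 : `|prim F c d| <= A * Y * prim (fun y => (Num.sqrt (`|y| + (s + rho)))^-1) c d.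
  rewrite /prim -(RintZ _ jj); apply: Rint_norm_ub.
  - by apply: measurable_funM => //; exact: measurable_iv.
  - exact: integZ.
  - move=> y; rewrite normrM (ger0_norm (iv_ge0 _ _ _)) [leRHS]mulrCA; apply: ler_wpM2l; first exact: iv_ge0.
    apply: (le_trans (bF y)); rewrite -mulrA; apply: ler_wpM2l => //.
    by have := le_jap y s0; rewrite /jap addrA.
rewrite (prim_inv_sqrt m0 cd) in h1.
have PE : d + (s + rho) = `|r| + t + rho by rewrite /d (ger0_norm r0); ring.
rewrite PE -/(jap t r) in h1.
set Q := Num.sqrt (c + (s + rho)) in h1.
have X0 := jap_gt0 r t0; have XE := jap_sqr r t0; rewrite (ger0_norm r0) in XE.
have Q0 : 0 <= Q by exact: sqrtr_ge0.
have QE : Q ^+ 2 = c + (s + rho) by case/andP: cd => hc0 _; rewrite /Q sqr_sqrtr // addr_ge0 // ltW.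
have hc : t - s - r <= c by rewrite /c distrC ler_norm.
have QX : Q <= jap t r by rewrite /jap -PE; apply: ler_wsqrtr; rewrite lerD2r; case/andP: cd.
(* After multiplication by [jap t r] the claim follows from [Q ^+ 2 <= Q * jap t r] and
   [jap t r ^+ 2 - Q ^+ 2 <= 2 r]. *)
have key : jap t r - Q <= 2 * (r / jap t r).
  rewrite mulrA ler_pdivlMr //; have : Q ^+ 2 <= Q * jap t r by rewrite expr2 ler_wpM2l.
  rewrite QE; have : jap t r * jap t r = r + t + rho by rewrite -expr2.
  by rewrite mulrBl; lra.
apply: (@le_trans _ _ (2^-1 * (A * Y * (2 * (2 * (r / jap t r)))))).
  apply: ler_wpM2l => //; apply: (le_trans h1); apply: ler_wpM2l; first exact: mulr_ge0.
  by rewrite ler_pM2l.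
rewrite /wgt (ger0_norm r0); apply: le_of_eq; field; by rewrite gt_eqF.
Qed.

Definition duh (F : R -> R -> R) t r : R := Rintegral mu setT (fun s => iv 0 t s * avg (t - s) (F s) r).

Lemma measurable_duh_integrand (F : R -> R -> R) :
  measurable_fun setT (fun p : measurableTypeR R * measurableTypeR R => F p.1 p.2) ->
  measurable_fun setT (fun q : measurableTypeR R * measurableTypeR R * measurableTypeR R =>
    iv 0 q.1.1 q.2 * avg (q.1.1 - q.2) (F q.2) q.1.2).
Proof.
move=> mF; set T3 := (measurableTypeR R * measurableTypeR R * measurableTypeR R)%type.
have m1 : measurable_fun setT (fun q : T3 => q.1.1 : R) by exact: measurable_x1.
have m2 : measurable_fun setT (fun q : T3 => q.1.2 : R) by exact: measurable_x2.
have m3 : measurable_fun setT (fun q : T3 => q.2 : R) by exact: measurable_x3.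
apply: measurable_funM; first by apply: measurable_iv_comp => //; exact: measurable_cst.
apply: measurable_funM; first exact: measurable_cst.
apply: (@measurable_Rint1 _ _ T3 (measurableTypeR R) R mu
  (fun z => box (z.1.1.1 - z.1.2) z.2 * F z.1.2 (z.1.1.2 + z.2))).
have n1 := measurableT_comp m1 (measurable_fst : measurable_fun setT (fst : T3 * measurableTypeR R -> T3)).
have n2 := measurableT_comp m2 (measurable_fst : measurable_fun setT (fst : T3 * measurableTypeR R -> T3)).
have n3 := measurableT_comp m3 (measurable_fst : measurable_fun setT (fst : T3 * measurableTypeR R -> T3)).
have n4 : measurable_fun setT (snd : T3 * measurableTypeR R -> R) by exact: measurable_snd.
apply: measurable_funM.
  apply: measurable_fun_ifT; [|exact: measurable_cst|exact: measurable_cst].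
  by apply: measurable_fun_ler; [exact: measurableT_comp|exact: measurable_funB].
apply: (measurableT_comp mF (_ : measurable_fun setT (fun z : T3 * measurableTypeR R =>
  (z.1.2, z.1.1.2 + z.2) : measurableTypeR R * measurableTypeR R))).
by apply: measurable_fun_pair => //; exact: measurable_funD.
Qed.

Lemma measurable_duh (F : R -> R -> R) :
  measurable_fun setT (fun p : measurableTypeR R * measurableTypeR R => F p.1 p.2) ->
  measurable_fun setT (fun p : measurableTypeR R * measurableTypeR R => duh F p.1 p.2).
Proof.
move=> mF; exact: (@measurable_Rint1 _ _ (measurableTypeR R * measurableTypeR R)%type
  (measurableTypeR R) R mu _ (measurable_duh_integrand mF)).
Qed.

(** The integrand is the power [-(N - 2)/2] of [s + rho], integrable at infinity because [N > 4].
    The bound does not depend on [t], which is what makes the solution global. *)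
Lemma time_integral t : integ mu (fun s => iv 0 t s * Num.sqrt (s + rho) ^- (N - 2)) /\
  Rintegral mu setT (fun s => iv 0 t s * Num.sqrt (s + rho) ^- (N - 2)) <=
    2 / (N%:R - 4) * rho `^ (- ((N%:R - 4) / 2)).
Proof.
have N4 : 0 < N%:R - 4 :> R by rewrite subr_gt0 (ltr_nat R 4 N).
have mf : measurable_fun setT (fun s => iv 0 t s * Num.sqrt (s + rho) ^- (N - 2)).
  apply: measurable_funM; first exact: measurable_iv.
  by apply: measurable_inv; apply: measurable_funX; apply: measurable_sqrt; apply: measurable_funD.
have jf : integ mu (fun s => iv 0 t s * Num.sqrt (s + rho) ^- (N - 2)).
  apply: (@integ_le _ (measurableTypeR R) _ mu _ (fun s => Num.sqrt rho ^- (N - 2) * iv 0 t s) mf).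
    by apply: integZ; exact: integ_iv.
  move=> s; rewrite normrM (ger0_norm (iv_ge0 _ _ _)) mulrC /iv; case: ifP => [/andP[h1 h2]|_]; last by rewrite !mulr0.
  rewrite !mulr1 ger0_norm ?invr_ge0 ?exprn_ge0 ?sqrtr_ge0 //.
  rewrite lef_pV2 ?posrE ?exprn_gt0 ?sqrtr_gt0 ?addr_gt0 //.
  by rewrite lerXn2r ?nnegrE ?sqrtr_ge0 //; apply: ler_wsqrtr; rewrite lerDr ltW.
split=> //; rewrite -lee_fin EFin_Rint //.
have p0 : 0 < (N%:R - 4) / 2 :> R by rewrite divr_gt0.
have := @integral_powR_tail R rho _ rho0 p0; rewrite invf_div => <-.
rewrite [leRHS]integral_mkcond; apply: ge0_le_integral => //.
- move=> s _; rewrite lee_fin mulr_ge0 ?iv_ge0 // invr_ge0 exprn_ge0 // sqrtr_ge0 //.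
- exact/measurable_EFinP.
- apply/(measurable_restrictT _ _).1 => //; apply/measurable_EFinP; apply: measurable_funTS.
  apply: (measurableT_comp (@measurable_powR R _ : measurable_fun setT _)).
  by apply: measurable_funD.
- move=> s _; rewrite patchE mem_setE in_itv /= andbT; have [s0|s0] := leP 0 s; last first.
    by rewrite /iv (ltNge 0 s) (ltW s0) /= mul0r.
  have as0 : 0 < s + rho by rewrite ltr_wpDl.
  have E : (rho + s) `^ (- ((N%:R - 4) / 2) - 1) = Num.sqrt (s + rho) ^- (N - 2).
    rewrite -powR12_sqrt ?(ltW as0) // -powR_mulrn ?powR_ge0 // -powRN -powRrM (addrC rho s).
    congr (_ `^ _); rewrite natrB; last by lia.
    by field.
  rewrite lee_fin E; apply: ler_piMl; first by rewrite invr_ge0 exprn_ge0 // sqrtr_ge0.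
  exact: iv_le1.
Qed.

(** The factor 2 of the light cone estimate times the bound on the time integral: the norm of the
    Duhamel operator between the weighted spaces. *)
Definition kappa : R := 4 / (N%:R - 4) * rho `^ (- ((N%:R - 4) / 2)).

Lemma integ_duh (F : R -> R -> R) A t r : 0 <= t -> 0 <= A ->
  measurable_fun setT (fun p : measurableTypeR R * measurableTypeR R => F p.1 p.2) ->
  (forall s, 0 < s -> s <= t -> admissible_source (F s) A s) ->
  integ mu (fun s => iv 0 t s * avg (t - s) (F s) r) /\ `|duh F t r| <= A * kappa * wgt t r.
Proof.
move=> t0 A0 mF sF; have [jT bT] := time_integral t.
have B s : `|iv 0 t s * avg (t - s) (F s) r| <=
    A * 2 * wgt t r * (iv 0 t s * Num.sqrt (s + rho) ^- (N - 2)).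
  rewrite normrM (ger0_norm (iv_ge0 _ _ _)) [leRHS]mulrCA; rewrite /iv.
  case: ifP => [/andP[h1 h2]|_]; last by rewrite !mul0r.
  by rewrite !mul1r; apply: avg_source_bound; [rewrite (ltW h1) h2|exact: A0|exact: sF].
have mS : measurable_fun setT (fun s => iv 0 t s * avg (t - s) (F s) r).
  exact: (measurableT_comp (measurable_duh_integrand mF)
    (pair1_measurable ((t, r) : measurableTypeR R * measurableTypeR R))).
have jb := integZ (A * 2 * wgt t r) jT.
split; first exact: (@integ_le _ (measurableTypeR R) _ mu _ _ mS jb B).
have H := @Rint_norm_ub _ (measurableTypeR R) _ mu _ _ mS jb B; rewrite (RintZ _ jT) in H; apply: (le_trans H).
have A2 : 0 <= A * 2 * wgt t r by rewrite mulr_ge0 ?wgt_ge0 // mulr_ge0.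
apply: (le_trans (ler_wpM2l A2 bT)); apply: le_of_eq; rewrite /kappa; ring.
Qed.

End DuhamelBound.

(** * The fixed point in the weighted class *)

Section PicardIteration.
Context {R : realType}.
Notation mu := (@lebesgue_measure R).
Implicit Types (r s t : R) (V W : R -> R).

(** Both sides carry one more factor [M], so that no exponent [n - 1] occurs and the induction
    starts at 0. *)
Lemma exprn_diff_le n (M x y : R) : `|x| <= M -> `|y| <= M ->
  `|x ^+ n - y ^+ n| * M <= n%:R * M ^+ n * `|x - y|.
Proof.
move=> xM yM; have M0 : 0 <= M by exact: le_trans xM.
elim: n => [|n IH]; first by rewrite !expr0 subrr normr0 !mul0r.
have -> : x ^+ n.+1 - y ^+ n.+1 = x * (x ^+ n - y ^+ n) + (x - y) * y ^+ n by rewrite !exprS; ring.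
apply: (@le_trans _ _ (M * (`|x ^+ n - y ^+ n| * M) + `|x - y| * M ^+ n * M)).
  rewrite mulrA -mulrDl; apply: ler_wpM2r => //; apply: (le_trans (ler_normD _ _)).
  rewrite !normrM; apply: lerD; first exact: ler_wpM2r.
  by apply: ler_wpM2l => //; rewrite normrX lerXn2r ?nnegrE.
have -> : n.+1%:R * M ^+ n.+1 * `|x - y| = M * (n%:R * M ^+ n * `|x - y|) + `|x - y| * M ^+ n * M.
  by rewrite exprS -natr1; ring.
by rewrite lerD2r; apply: ler_wpM2l.
Qed.

Lemma power_diff_le n (M x y : R) : `|x| <= M -> `|y| <= M ->
  `| `|x| ^+ n * x - `|y| ^+ n * y| <= n.+1%:R * M ^+ n * `|x - y|.
Proof.
move=> xM yM; have M0 : 0 <= M by exact: le_trans xM.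
have -> : `|x| ^+ n * x - `|y| ^+ n * y = `|x| ^+ n * (x - y) + (`|x| ^+ n - `|y| ^+ n) * y by ring.
apply: (le_trans (ler_normD _ _)).
have -> : n.+1%:R * M ^+ n * `|x - y| = M ^+ n * `|x - y| + n%:R * M ^+ n * `|x - y|.
  by rewrite -natr1; ring.
apply: lerD.
  rewrite normrM; apply: ler_wpM2r => //.
  by rewrite normrX normr_id lerXn2r ?nnegrE.
rewrite normrM; apply: (@le_trans _ _ (`| `|x| ^+ n - `|y| ^+ n| * M)); first exact: ler_wpM2l.
apply: (le_trans (exprn_diff_le _ _ _)); rewrite ?normr_id //.
apply: ler_wpM2l; first by rewrite mulr_ge0 // exprn_ge0.
exact: ler_dist_dist.
Qed.

(* [u n - c 2^-n] increases and [u n + c 2^-n] decreases. *)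
Lemma geometric_cvg (u : nat -> R) (c : R) : 
  (forall n, `|u n.+1 - u n| <= c * 2^-1 ^+ n.+1) ->
  u n @[n --> \oo] --> limn u /\ forall n, `|u n - limn u| <= c * 2^-1 ^+ n.
Proof.
move=> uc; have q0 n : 0 <= (2^-1 : R) ^+ n by rewrite exprn_ge0.
pose lo n := u n - c * 2^-1 ^+ n; pose hi n := u n + c * 2^-1 ^+ n.
have qS n : c * 2^-1 ^+ n = c * 2^-1 ^+ n.+1 + c * 2^-1 ^+ n.+1 by rewrite exprS; field.
have loS n : lo n <= lo n.+1.
  by have := uc n; rewrite ler_norml => /andP[h _]; rewrite /lo (qS n); lra.
have hiS n : hi n.+1 <= hi n.
  by have := uc n; rewrite ler_norml => /andP[_ h]; rewrite /hi (qS n); lra.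
have c0 : 0 <= c.
  have := le_trans (normr_ge0 _) (uc 0); rewrite pmulr_lge0 //.
have nlo : {homo lo : n m / (n <= m)%N >-> n <= m} by apply/nondecreasing_seqP.
have nhi : {homo hi : n m / (n <= m)%N >-> m <= n}.
  by move=> n m nm; have /nonincreasing_seqP := hiS; apply.
have lohi n : lo n <= hi n by rewrite /lo /hi; have := mulr_ge0 c0 (q0 n); lra.
have clo : cvgn lo.
  apply: nondecreasing_is_cvgn => //; exists (hi 0) => _ [n _ <-].
  by apply: (le_trans (lohi n)); exact: nhi.
have cq : (c * 2^-1 ^+ n) @[n --> \oo] --> (0 : R).
  rewrite -(mulr0 c); apply: cvgM; first exact: cvg_cst.
  by apply: cvg_expr; rewrite ger0_norm; lra.
have cu : u n @[n --> \oo] --> limn lo.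
  rewrite -[limn lo]addr0; have -> : u = (fun n => lo n + c * 2^-1 ^+ n).
    by apply/funext => n; rewrite /lo subrK.
  exact: cvgD.
have lu : limn u = limn lo by exact: (cvg_lim (@norm_hausdorff _ _) cu).
rewrite lu; split => // n.
have h1 : lo n <= limn lo by exact: nondecreasing_cvgn_le.
have h2 : limn lo <= hi n.
  apply: limr_le => //; exists n => // m /= nm.
  by apply: (le_trans (lohi m)); exact: nhi.
by rewrite ler_norml; apply/andP; split; rewrite /lo /hi in h1 h2; lra.
Qed.

Context (N : nat) (rho : R) (hN : (4 < N)%N) (rho0 : 0 < rho).
Notation wgt := (@wgt R rho).
Notation jap := (@jap R rho).
Notation kappa := (@kappa R N rho).
Notation admissible_source := (@admissible_source R N rho).

(* The odd profile of [|u|^N u] when [V] is that of [u]. *)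
Definition pw V r : R := `|V r| ^+ N * V r / `|r| ^+ N.

Lemma measurable_pw d (T : measurableType d) (V S : T -> R) :
  measurable_fun setT V -> measurable_fun setT S ->
  measurable_fun setT (fun z => `|V z| ^+ N * V z / `|S z| ^+ N).
Proof.
move=> mV mS; apply: measurable_funM; last first.
  by apply: measurable_inv; apply: measurable_funX; exact: measurableT_comp.
by apply: measurable_funM => //; apply: measurable_funX; exact: measurableT_comp.
Qed.

Lemma odd_pw V : odd_fun V -> odd_fun (pw V).
Proof. by move=> oV r; rewrite /pw oV !normrN mulrN mulNr. Qed.

(** The Lipschitz estimate for [|v|^N v] produces [N + 1] factors [wgt s r]. The division by
    [|r| ^+ N] in [pw] removes all but one factor [|r|] and leaves the shape of an admissible
    source. *)
Lemma pw_diff_bound V W (K d s r : R) : 0 <= s -> 0 <= K ->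
  `|V r| <= K * wgt s r -> `|W r| <= K * wgt s r -> `|V r - W r| <= d * wgt s r ->
  `|pw V r - pw W r| <= N.+1%:R * K ^+ N * d * (`|r| * jap s r ^- N.+1).
Proof.
move=> s0 K0 bV bW bD; have X0 := jap_gt0 rho0 r s0.
(* At the origin the bound forces both profiles to vanish, so the quotient by 0 in [pw] is
   harmless. *)
have [r0|r0] := eqVneq r 0.
  have w0 : wgt s r = 0 by rewrite /wgt r0 normr0 mul0r.
  rewrite w0 mulr0 in bV bW; move: bV bW; rewrite !normr_le0 => /eqP V0 /eqP W0.
  by rewrite /pw V0 W0 !mulr0 !mul0r subrr normr0 r0 normr0 mul0r mulr0.
have nr : 0 < `|r| by rewrite normr_gt0.
rewrite /pw -mulrBl normrM [X in _ * X]ger0_norm ?invr_ge0 ?exprn_ge0 //.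
rewrite ler_pdivrMr ?exprn_gt0 //.
apply: (le_trans (power_diff_le N bV bW)).
apply: (@le_trans _ _ (N.+1%:R * (K * wgt s r) ^+ N * (d * wgt s r))).
  apply: ler_wpM2l => //; apply: mulr_ge0 => //; apply: exprn_ge0.
  by apply: mulr_ge0 => //; exact: wgt_ge0.
apply: le_of_eq; rewrite /wgt !exprMn exprVn exprS; field.
by rewrite expf_neq0 ?gt_eqF.
Qed.

Lemma pw_diff_source V W (K d s : R) : 0 <= s -> 0 <= K ->
  measurable_fun setT V -> measurable_fun setT W -> odd_fun V -> odd_fun W ->
  (forall r, `|V r| <= K * wgt s r) -> (forall r, `|W r| <= K * wgt s r) ->
  (forall r, `|V r - W r| <= d * wgt s r) ->
  admissible_source (fun r => pw V r - pw W r) (N.+1%:R * K ^+ N * d) s.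
Proof.
move=> s0 K0 mV mW oV oW bV bW bD; split.
- by apply: measurable_funB; exact: measurable_pw.
- by move=> r; rewrite !odd_pw // opprD opprK.
- by move=> r; apply: pw_diff_bound.
Qed.

Lemma pw_source V (K s : R) : 0 <= s -> 0 <= K -> measurable_fun setT V -> odd_fun V ->
  (forall r, `|V r| <= K * wgt s r) -> admissible_source (pw V) (N.+1%:R * K ^+ N * K) s.
Proof.
move=> s0 K0 mV oV bV.
have z0 : pw (fun=> 0) = (fun=> 0) :> (R -> R).
  by apply/funext => r; rewrite /pw mulr0 mul0r.
have := @pw_diff_source V (fun=> 0) K K s s0 K0 mV (@measurable_cst _ _ _ _ _ (0 : R)) oV.
rewrite z0 => H.
have E : (fun r => pw V r - 0) = pw V by apply/funext => r; rewrite subr0.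
rewrite -E; apply: H => //.
- by move=> r; rewrite oppr0.
- by move=> r; rewrite normr0 mulr_ge0 // wgt_ge0.
- by move=> r; rewrite subr0.
Qed.

Definition spacetime_class (K : R) (V : R -> R -> R) :=
  [/\ measurable_fun setT (fun p : measurableTypeR R * measurableTypeR R => V p.1 p.2),
    forall t, 0 <= t -> odd_fun (V t) & forall t r, 0 <= t -> `|V t r| <= K * wgt t r].

Lemma class_section (K : R) (V : R -> R -> R) t : spacetime_class K V -> measurable_fun setT (V t).
Proof.
by move=> [mV _ _]; exact: (measurableT_comp mV (pair1_measurable (t : measurableTypeR R))).
Qed.

Lemma measurable_pw_class (K : R) (V : R -> R -> R) : spacetime_class K V ->
  measurable_fun setT (fun p : measurableTypeR R * measurableTypeR R => pw (V p.1) p.2).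
Proof. by move=> [mV _ _]; apply: measurable_pw => //; exact: measurable_snd. Qed.

Lemma class_pw_source (K : R) (V : R -> R -> R) t s : 0 <= K -> spacetime_class K V -> 0 < s -> s <= t ->
  admissible_source (pw (V s)) (N.+1%:R * K ^+ N * K) s.
Proof.
move=> K0 cV s0 st; have [mV oV bV] := cV.
by apply: pw_source; [exact: ltW|exact: K0|exact: class_section cV|exact/oV/ltW|move=> r; exact/bV/ltW].
Qed.

Lemma odd_duh (F : R -> R -> R) A t : 0 <= A ->
  (forall s, 0 < s -> s <= t -> admissible_source (F s) A s) -> 
  measurable_fun setT (fun p : measurableTypeR R * measurableTypeR R => F p.1 p.2) ->
  0 <= t -> odd_fun (duh F t).
Proof.
move=> A0 sF mF t0 r; have [jr _] := integ_duh hN rho0 r t0 A0 mF sF.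
rewrite /duh -RintN //; apply: Rint_ext => s; rewrite /iv; case: ifP => [/andP[s0 st]|_]; last by rewrite !mul0r oppr0.
have h := sF s s0 st; have [_ oF _] := h.
have ts : 0 <= t - s by lra.
by rewrite !mul1r; exact: (odd_avg ts (source_adm hN rho0 (ltW s0) A0 h) oF).
Qed.

Lemma duh_diff (V W : R -> R -> R) (K d t r : R) : 0 <= t -> 0 <= K -> 0 <= d ->
  spacetime_class K V -> spacetime_class K W ->
  (forall s r, 0 <= s -> `|V s r - W s r| <= d * wgt s r) ->
  `|duh (fun s => pw (V s)) t r - duh (fun s => pw (W s)) t r| <=
    N.+1%:R * K ^+ N * d * kappa * wgt t r.
Proof.
move=> t0 K0 d0 cV cW bD.
have A0 (e : R) : 0 <= e -> 0 <= N.+1%:R * K ^+ N * e by move=> e0; rewrite mulr_ge0 // mulr_ge0 // exprn_ge0.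
have sV s : 0 < s -> s <= t -> admissible_source (pw (V s)) (N.+1%:R * K ^+ N * K) s by move=> *; exact: (@class_pw_source K V t).
have sW s : 0 < s -> s <= t -> admissible_source (pw (W s)) (N.+1%:R * K ^+ N * K) s by move=> *; exact: (@class_pw_source K W t).
have [jV _] := integ_duh hN rho0 r t0 (A0 K K0) (measurable_pw_class cV) sV.
have [jW _] := integ_duh hN rho0 r t0 (A0 K K0) (measurable_pw_class cW) sW.
have mD : measurable_fun setT (fun p : measurableTypeR R * measurableTypeR R => pw (V p.1) p.2 - pw (W p.1) p.2).
  by apply: measurable_funB; [exact: measurable_pw_class cV|exact: measurable_pw_class cW].
have sD s : 0 < s -> s <= t ->
    admissible_source ((fun s r => pw (V s) r - pw (W s) r) s) (N.+1%:R * K ^+ N * d) s.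
  move=> s0 st; have [_ oV bV] := cV; have [_ oW bW] := cW; have s0' := ltW s0.
  by apply: pw_diff_source => //; [exact: class_section cV|exact: class_section cW|exact: oV|
    exact: oW|move=> r'; exact: bV|move=> r'; exact: bW|move=> r'; exact: bD].
have [_ H] := integ_duh hN rho0 r t0 (A0 d d0) mD sD.
suff -> : duh (fun s => pw (V s)) t r - duh (fun s => pw (W s)) t r =
  duh (fun s r => pw (V s) r - pw (W s) r) t r by [].
rewrite /duh -(RintB jV jW); apply: Rint_ext => s; rewrite /iv; case: ifP => [/andP[s0 st]|_]; last by rewrite !mul0r subr0.
rewrite !mul1r /avg -mulrBr; congr (_ * _).
have ts : 0 <= t - s by lra.
have a1 := source_adm hN rho0 (ltW s0) (A0 K K0) (sV s s0 st).
have a2 := source_adm hN rho0 (ltW s0) (A0 K K0) (sW s s0 st).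
rewrite -(RintB (integ_box r ts a1) (integ_box r ts a2)).
by apply: Rint_ext => a; rewrite mulrBr.
Qed.

Definition picard_map (sg : R) (L : R -> R -> R) (V : R -> R -> R) t r : R :=
  L t r - sg * duh (fun s => pw (V s)) t r.

(** The budget [K] is divided evenly: one half for the linear wave, one half for the Duhamel term
    under the smallness condition. *)
Lemma picard_class (sg K : R) (L V : R -> R -> R) : `|sg| <= 1 -> 0 <= K -> N.+1%:R * K ^+ N * kappa <= 2^-1 ->
  spacetime_class (K / 2) L -> spacetime_class K V -> spacetime_class K (picard_map sg L V).
Proof.
move=> sg1 K0 Kk cL cV; have [mL oL bL] := cL.
have A0 : 0 <= N.+1%:R * K ^+ N * K by rewrite mulr_ge0 // mulr_ge0 // exprn_ge0.
have sV t s : 0 < s -> s <= t -> admissible_source (pw (V s)) (N.+1%:R * K ^+ N * K) s by move=> *; exact: (@class_pw_source K V t).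
split.
- apply: measurable_funB => //; apply: measurable_funM; first exact: measurable_cst.
  exact: (measurable_duh (measurable_pw_class cV)).
- move=> t t0 r; rewrite /picard_map oL //.
  by rewrite (odd_duh A0 (sV t) (measurable_pw_class cV) t0) mulrN; ring.
- move=> t r t0; have [_ H] := integ_duh hN rho0 r t0 A0 (measurable_pw_class cV) (sV t).
  apply: (le_trans (ler_normB _ _)).
  have -> : K * wgt t r = K / 2 * wgt t r + K / 2 * wgt t r by field.
  apply: lerD; first exact: bL.
  rewrite normrM; apply: (@le_trans _ _ `|duh (fun s => pw (V s)) t r|); first by rewrite ler_piMl.
  apply: (le_trans H); apply: ler_wpM2r; first exact: wgt_ge0.
  by rewrite (_ : _ * kappa = K * (N.+1%:R * K ^+ N * kappa)); [rewrite ler_wpM2l|ring].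
Qed.

(** Banach's iteration carried out pointwise in [(t, r)]: the differences of the iterates, measured
    by [wgt], are halved at each step. Measurability, oddness and the bound pass to pointwise
    limits, so no completeness of a function space is required. *)
Lemma picard_fixpoint (sg K : R) (L : R -> R -> R) : `|sg| <= 1 -> 0 <= K -> N.+1%:R * K ^+ N * kappa <= 2^-1 ->
  spacetime_class (K / 2) L ->
  exists2 V, spacetime_class K V & forall t r, 0 <= t -> V t r = picard_map sg L V t r.
Proof.
move=> sg1 K0 Kk cL; have [mL oL bL] := cL.
pose U n := iter n (picard_map sg L) (fun _ _ => 0).
have cU n : spacetime_class K (U n).
  elim: n => [|n IH]; last exact: picard_class.
  split; first exact: measurable_cst.
    by move=> t _ r; rewrite oppr0.
  by move=> t r _; rewrite normr0 mulr_ge0 // wgt_ge0.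
have contr (V W : R -> R -> R) (d : R) t r : 0 <= t -> 0 <= d -> spacetime_class K V -> spacetime_class K W ->
    (forall s r, 0 <= s -> `|V s r - W s r| <= d * wgt s r) ->
    `|picard_map sg L V t r - picard_map sg L W t r| <= d / 2 * wgt t r.
  move=> t0 d0 cV cW bD; have H := duh_diff r t0 K0 d0 cV cW bD.
  have -> : picard_map sg L V t r - picard_map sg L W t r =
    - sg * (duh (fun s => pw (V s)) t r - duh (fun s => pw (W s)) t r).
    by rewrite /picard_map; move: (duh (fun s => pw (V s)) t r) (duh (fun s => pw (W s)) t r) => a b; ring.
  rewrite normrM normrN; apply: (@le_trans _ _ `|duh (fun s => pw (V s)) t r - duh (fun s => pw (W s)) t r|).
    by rewrite ler_piMl.
  apply: (le_trans H); apply: ler_wpM2r; first exact: wgt_ge0.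
  by rewrite (_ : _ * kappa = d * (N.+1%:R * K ^+ N * kappa)); [rewrite ler_wpM2l|ring].
have step n : forall t r, 0 <= t -> `|U n.+1 t r - U n t r| <= K * 2^-1 ^+ n * wgt t r.
  elim: n => [|n IH] t r t0.
    by rewrite expr0 mulr1 subr0; have [_ _] := cU 1%N; exact.
  have -> : K * 2^-1 ^+ n.+1 = K * 2^-1 ^+ n / 2 by rewrite exprSr mulrA.
  have d0 : 0 <= K * 2^-1 ^+ n by rewrite mulr_ge0 // exprn_ge0.
  exact: (contr (U n.+1) (U n) _ t r t0 d0 (cU _) (cU _) IH).
(* The estimates hold for [t >= 0] only. With the value 0 at negative times the sequence converges
   everywhere, and the limit is measurable on the whole plane. *)
pose u n t r := if 0 <= t then U n t r else 0.
pose V t r := limn (fun n => u n t r).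
have H t r : u n t r @[n --> \oo] --> V t r /\
    forall n, `|u n t r - V t r| <= 2 * K * wgt t r * 2^-1 ^+ n.
  apply: geometric_cvg => n; rewrite /u; case: ifP => t0.
    apply: (le_trans (step n t r t0)); by apply: le_of_eq; rewrite exprS; field.
  by rewrite subrr normr0 mulr_ge0 ?exprn_ge0 // mulr_ge0 ?wgt_ge0 // mulr_ge0.
have mu_ n : measurable_fun setT (fun p : measurableTypeR R * measurableTypeR R => u n p.1 p.2).
  apply: measurable_fun_ifT; [|by case: (cU n)|exact: measurable_cst].
  by apply: measurable_fun_ler; [exact: measurable_cst|exact: measurable_fst].
have cV : spacetime_class K V.
  split.
  - by apply: (measurable_fun_cvg mu_) => p _; exact: (H p.1 p.2).1.
  - move=> t t0 r; have h1 := (H t (- r)).1; have h2 := (H t r).1.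
    have E : (fun n => u n t (- r)) = (fun n => - u n t r).
      by apply/funext => n; rewrite /u t0; have [_ oU _] := cU n; rewrite oU.
    rewrite E in h1; exact: (cvg_unique (@norm_hausdorff _ _) h1 (cvgN h2)).
  - move=> t r t0; have h : `|u n t r| @[n --> \oo] --> `|V t r| by apply: cvg_norm; exact: (H t r).1.
    have <- : limn (fun n => `|u n t r|) = `|V t r| by exact: (cvg_lim (@norm_hausdorff _ _) h).
    apply: limr_le; first by apply/cvg_ex; exists `|V t r|.
    by near=> n; rewrite /u t0; have [_ _ bU] := cU n; exact: bU.
exists V => // t r t0; apply/eqP; rewrite -subr_eq0 -normr_le0.
have B n : `|V t r - picard_map sg L V t r| <= 2 * K * wgt t r * 2^-1 ^+ n.
  have h1 := (H t r).2 n.+1; rewrite {1}/u t0 in h1.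
  have h2 : `|picard_map sg L (U n) t r - picard_map sg L V t r| <= (2 * K * 2^-1 ^+ n) / 2 * wgt t r.
    apply: contr => //; first by rewrite mulr_ge0 ?exprn_ge0 // mulr_ge0.
    move=> s y s0; have := (H s y).2 n; rewrite /u s0; move/le_trans; apply.
    by apply: le_of_eq; ring.
  have -> : V t r - picard_map sg L V t r = - (U n.+1 t r - V t r) +
      (picard_map sg L (U n) t r - picard_map sg L V t r).
    rewrite -[picard_map sg L (U n) t r]/(U n.+1 t r).
    by move: (V t r) (U n.+1 t r) (picard_map sg L V t r) => a b c; ring.
  apply: (le_trans (ler_normD _ _)); rewrite normrN.
  apply: (le_trans (lerD h1 h2)); by apply: le_of_eq; rewrite exprS; field.
have cq : (2 * K * wgt t r * 2^-1 ^+ n) @[n --> \oo] --> (0 : R).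
  rewrite -(mulr0 (2 * K * wgt t r)); apply: cvgM; first exact: cvg_cst.
  by apply: cvg_expr; rewrite ger0_norm; lra.
rewrite -(cvg_lim (@norm_hausdorff _ _) cq); apply: limr_ge; first by apply/cvg_ex; exists 0.
by near=> n; exact: B.
Unshelve. all: by end_near.
Qed.

End PicardIteration.

(** * The solution *)

Section LinearPart.
Context {R : realType}.
Notation mu := (@lebesgue_measure R).
Implicit Types (r s t : R) (V W : R -> R).

Lemma adm_sqrt : adm (fun r : R => Num.sqrt `|r|).
Proof.
have ms : measurable_fun setT (fun r : R => Num.sqrt `|r|) by exact: measurable_sqrt.
split=> //; have h : integ mu (fun r : R => if 0 <= r then wt r * Num.sqrt `|r| else 0).
  apply: (@integ_le _ (measurableTypeR R) _ mu _ (fun r => if 0 <= r then (1 + r) `^ (- (1 / 2) - 1) else 0)).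
  - apply: measurable_fun_ifT; [|by apply: measurable_funM => //; exact: measurable_wt|exact: measurable_cst].
    by apply: measurable_fun_ler => //; exact: measurable_cst.
  - have p0 : 0 < 1 / 2 :> R by rewrite divr_gt0.
    have mp : measurable_fun setT (fun r : R => if 0 <= r then (1 + r) `^ (- (1 / 2) - 1) else 0).
      apply: measurable_fun_ifT; [|apply: (measurableT_comp (@measurable_powR R _ : measurable_fun setT _))|exact: measurable_cst].
        by apply: measurable_fun_ler => //; exact: measurable_cst.
      by apply: measurable_funD.
    apply: (@integP _ (measurableTypeR R) _ mu _ mp).
    have E := @integral_powR_tail R 1 _ ltr01 p0.
    have -> : (\int[mu]_x (`|if 0 <= x then (1 + x) `^ (- (1 / 2) - 1) else 0|)%:E =
        \int[mu]_(x in `[0%R, +oo[) ((1 + x) `^ (- (1 / 2) - 1))%:E)%E.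
      rewrite [RHS]integral_mkcond; apply: eq_integral => r _.
      rewrite patchE mem_setE in_itv /= andbT; case: ifP => _; last by rewrite normr0.
      by rewrite ger0_norm // powR_ge0.
    by rewrite E ltry.
  - move=> r; case: ifP => r0; last by rewrite normr0.
    have r1 : 0 < 1 + r by rewrite ltr_pwDl.
    rewrite ger0_norm ?mulr_ge0 ?wt_ge0 ?sqrtr_ge0 // /wt (ger0_norm r0).
    have -> : (1 + r) `^ (- (1 / 2) - 1) = (1 + r) ^- 2 * Num.sqrt (1 + r).
      rewrite -powR12_sqrt ?(ltW r1) // -powR_mulrn ?(ltW r1) // -powRN -powRD; first by congr (_ `^ _); field.
      by rewrite (gt_eqF r1) implybT.
    apply: ler_wpM2l; first by rewrite invr_ge0 exprn_ge0 // ltW.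
    by apply: ler_wsqrtr; rewrite lerDr.
have ew r : wt (- r) * Num.sqrt `|- r| = wt r * Num.sqrt `|r| by rewrite /= /wt normrN.
by have [] := even_extension (measurable_funM measurable_wt ms) ew h.
Qed.

Lemma adm_sqr_integrable V : measurable_fun setT V -> integ mu (fun r => V r ^+ 2) -> adm V.
Proof.
move=> mV iV; split => //.
apply: (@integ_le _ (measurableTypeR R) _ mu _ (fun r => wt r + V r ^+ 2)).
- by apply: measurable_funM => //; exact: measurable_wt.
- by apply: integD => //; exact: integ_wt.
- move=> r; have w0 := wt_ge0 r; have w1 : wt r <= 1.
    have := wtK r; have : 1 <= (1 + `|r|) ^+ 2 by rewrite exprn_ege1 // lerDl.
    nra.
  rewrite normrM (ger0_norm w0) -(real_normK (num_real (V r))).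
  have := normr_ge0 (V r); nra.
Qed.

(** For a function vanishing on the negative half-line and at 0 this is its odd extension; the
    profiles of the data are of this kind. *)
Definition oddify V r : R := V r - V (- r).

Lemma odd_oddify V : odd_fun (oddify V).
Proof. by move=> r; rewrite /oddify opprK; ring. Qed.

Lemma measurable_opp V : measurable_fun setT V -> measurable_fun setT (fun r : R => V (- r)).
Proof. by move=> mV; have [mo _] := @lebesgue_neg R; exact: (measurableT_comp (mV : measurable_fun setT _) mo). Qed.

Lemma adm_opp V : adm V -> adm (fun r => V (- r)).
Proof.
move=> [mV iV]; split; first exact: measurable_opp.
have := mp_integ (@lebesgue_neg R) iV; apply: integ_ext => r.
by rewrite /= /wt normrN.
Qed.

Lemma adm_oddify V : adm V -> adm (oddify V).
Proof.
move=> aV; have h : adm (fun r => V r + -1 * V (- r)) by apply: admD => //; apply: admZ; exact: adm_opp.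
by move: h; congr adm; apply/funext => r; rewrite mulN1r.
Qed.

Context (rho : R) (rho0 : 0 < rho) (M : R -> R) (mM : measurable_fun setT M)
  (M0 : forall r, r <= rho -> M r = 0) (iM : integ mu (fun r => M r ^+ 2)).

(** With [M] the profile [s * h1 s] of [u1], this is the profile [r * u0 r], by the integrated
    outgoing condition. *)
Let v r : R := - prim M rho r.

Lemma square_integrable_iv a b : integ mu (fun s => iv a b s * M s).
Proof.
apply: (@integ_le _ (measurableTypeR R) _ mu _ (fun r => iv a b r + M r ^+ 2)).
- by apply: measurable_funM => //; exact: measurable_iv.
- by apply: integD => //; exact: integ_iv.
- move=> r; rewrite normrM (ger0_norm (iv_ge0 _ _ _)) -(real_normK (num_real (M r))).
  rewrite /iv; have := normr_ge0 (M r); case: ifP => _; nra.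
Qed.

Lemma velocity_vanish r : r <= rho -> v r = 0.
Proof. by move=> rr; rewrite /v prim_eq0 ?oppr0. Qed.

Lemma measurable_velocity : measurable_fun setT v.
Proof. by apply: measurableT_comp => //; exact: measurable_prim. Qed.

Lemma prim_velocity a b : a <= b -> prim M a b = v a - v b.
Proof.
move=> ab; rewrite /v opprK addrC /prim -(RintB (square_integrable_iv _ _) (square_integrable_iv _ _)).
apply: Rint_ext => s; have [sr|rs] := leP s rho; first by rewrite M0 // !mulr0 subr0.
rewrite -mulrBl; congr (_ * _); rewrite /iv rs /=.
case: (ltP a s) => h1; case: (leP s b) => h2 /=; rewrite ?subr0 ?subrr //; exfalso; lra.
Qed.

Lemma Rint_box_velocity t r : 0 <= t -> Rintegral mu setT (fun a => box t a * M (r + a)) = v (r - t) - v (r + t).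
Proof.
move=> t0; have rt : r - t <= r + t by lra.
rewrite -(prim_velocity rt) Rint_box_shift //; apply: Rint_ae.
- by apply: measurable_funM => //; exact: (measurable_shift (- r) (measurable_box t)).
- by apply: measurable_funM => //; exact: measurable_iv.
- exists [set r - t]; split => //; first exact: lebesgue_measure_set1.
  move=> y /= hy; apply: contrapT => yrt; apply: hy; congr (_ * _).
  rewrite /box /iv ler_norml (_ : (r - t < y) = (- t <= y - r)).
    by rewrite (_ : (y - r <= t) = (y <= r + t)) // lerBlDl.
  by apply/idP/idP => h; [lra|rewrite lt_neqAle; apply/andP; split; [apply/eqP => e; apply: yrt|lra]].
Qed.

(** The average of [M] contributes [(v (r - t) - v (r + t)) / 2], whose second term cancels that of
    the half-sum. The remaining [v (- r - t)] is the odd reflection; it vanishes for [r >= 0]. *)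
Lemma outgoing_wave t r : 0 <= t ->
  halfsum t (oddify v) r + avg t (oddify M) r = v (r - t) - v (- r - t).
Proof.
move=> t0; have aM := adm_sqr_integrable mM iM.
have -> : avg t (oddify M) r = 2^-1 * ((v (r - t) - v (r + t)) - (v (- r - t) - v (- r + t))).
  rewrite -(Rint_box_velocity r t0) -(Rint_box_velocity (- r) t0) /avg; congr (_ * _).
  have j1 := integ_box r t0 aM; have j2 := integ_box (- r) t0 aM.
  have j3 := mp_integ (@lebesgue_neg R) j2.
  rewrite -(mp_Rint (@lebesgue_neg R) (integ_meas j2)) -(RintB j1 j3).
  by apply: Rint_ext => a; rewrite /= /box normrN /oddify opprD -mulrBr.
rewrite /halfsum /oddify (_ : - (r + t) = - r - t); last by ring.
by rewrite (_ : - (r - t) = - r + t); [field|ring].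
Qed.

Context (D : R) (D0 : 0 <= D) (vD : forall r, 0 < r -> `|v r| <= D * Num.sqrt r).

Lemma adm_velocity : adm v.
Proof.
have h := admZ D adm_sqrt; apply: (adm_le measurable_velocity h) => r.
rewrite normrM (ger0_norm D0) (ger0_norm (sqrtr_ge0 _)).
have [r0|r0] := leP r 0; last by rewrite (gtr0_norm r0); exact: vD.
by rewrite velocity_vanish ?(le_trans r0) ?(ltW rho0) // normr0 mulr_ge0 // sqrtr_ge0.
Qed.

Lemma outgoing_wave_class :
  spacetime_class rho (Num.sqrt 2 * D) (fun t r => v (r - t) - v (- r - t)).
Proof.
have mv := measurable_velocity.
have m1 : measurable_fun setT (fst : measurableTypeR R * measurableTypeR R -> R) by exact: measurable_fst.
have m2 : measurable_fun setT (snd : measurableTypeR R * measurableTypeR R -> R) by exact: measurable_snd.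
split.
- apply: measurable_funB; apply: (measurableT_comp (mv : measurable_fun setT _)).
    exact: measurable_funB.
  by apply: measurable_funB => //; exact: measurableT_comp.
- by move=> t _ r; rewrite (opprK r) opprB.
- move=> t r t0; wlog r0 : r / 0 <= r.
    move=> H; have [|r0] := leP 0 r; first exact: H.
    have := H (- r); rewrite (opprK r) -normrN opprB /wgt /jap normrN; apply.
    by rewrite oppr_ge0 ltW.
  have rt : - r - t <= rho by move: rho0; lra.
  rewrite (velocity_vanish rt) subr0; have [h|h] := leP (r - t) rho.
    by rewrite velocity_vanish // normr0; apply: mulr_ge0; [rewrite mulr_ge0 // sqrtr_ge0|exact: wgt_ge0].
  have y0 : 0 < r - t by move: rho0; lra.
  apply: (le_trans (vD y0)); rewrite -mulrA mulrCA; apply: ler_wpM2l => //.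
  have X0 := jap_gt0 rho0 r t0; rewrite /wgt (ger0_norm r0) mulrA ler_pdivlMr //.
  rewrite /jap (ger0_norm r0) -sqrtrM ?(ltW y0) //.
  (* The factor [sqrt 2] comes from [(r - t) * (r + t + rho) <= 2 * r ^+ 2], valid since
     [rho < r - t]. *)
  rewrite -[X in _ <= _ * X]ger0_norm // -sqrtr_sqr -sqrtrM //; apply: ler_wsqrtr; move: rho0; nra.
Qed.

End LinearPart.

(** * The solution as a function on space-time *)

Section MildSolution.
Context {R : realType}.
Notation mu := (@lebesgue_measure R).
Implicit Types (r s t th : R) (x : R3 R) (psi : R3 R -> R).
Context (N : nat) (rho : R) (hN : (4 < N)%N) (rho0 : 0 < rho).

Lemma radial_of_pw V x : power_nonlinearity N (radial_of V) x = radial_of (@pw R N V) x.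
Proof.
rewrite /power_nonlinearity /radial_of /pw normrM normfV (ger0_norm (euclid_ge0 x)) exprMn exprVn.
ring.
Qed.

Lemma bounded_tempered (f : R3 R -> R) (M : R) : measurable_fun setT (f : R3meas R -> R) ->
  (forall x, `|f x| <= M) -> tempered f.
Proof.
move=> mf fM; split => // phi sphi; have [jp _] := schwartz_fourier_decay sphi.
exact: (@integ_bndM _ (R3meas R) _ leb3 phi f M jp mf fM).
Qed.

Context (K : R) (V : R -> R -> R) (K0 : 0 <= K) (cV : spacetime_class rho K V).

Lemma solution_bound t x : 0 <= t -> `|radial_of (V t) x| <= K / Num.sqrt (t + rho).
Proof.
move=> t0; have [_ _ bV] := cV; have e0 := euclid_ge0 x.
have y0 : 0 < Num.sqrt (t + rho) by rewrite sqrtr_gt0 ltr_wpDl.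
rewrite /radial_of normrM normfV (ger0_norm e0).
have [x0|x0] := eqVneq (euclid x) 0; first by rewrite x0 invr0 mulr0 divr_ge0 // ltW.
have ex : 0 < euclid x by rewrite lt_neqAle eq_sym x0.
rewrite ler_pdivrMr //; apply: (le_trans (bV t (euclid x) t0)).
rewrite -mulrA; apply: ler_wpM2l => //; rewrite /wgt (ger0_norm e0) mulrC; apply: ler_wpM2r => //.
by rewrite lef_pV2 ?posrE ?jap_gt0 // sqrt_le_jap.
Qed.

Lemma measurable_solution : measurable_fun setT (fun z : measurableTypeR R * R3meas R => radial_of (V z.1) z.2).
Proof.
have [mV _ _] := cV.
have me : measurable_fun setT (fun z : measurableTypeR R * R3meas R => euclid z.2).
  exact: (measurableT_comp measurable_euclid measurable_snd).
apply: measurable_funM; last exact: measurable_inv.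
apply: (measurableT_comp mV (_ : measurable_fun setT (fun z : measurableTypeR R * R3meas R =>
  (z.1, euclid z.2) : measurableTypeR R * measurableTypeR R))).
by apply: measurable_fun_pair => //; exact: measurable_fst.
Qed.

Lemma measurable_solution_section t : measurable_fun setT (fun x : R3meas R => radial_of (V t) x).
Proof. exact: measurable_radial_of (class_section t cV). Qed.

Lemma solution_tempered t : 0 <= t -> tempered (fun x => radial_of (V t) x).
Proof.
by move=> t0; apply: (bounded_tempered (measurable_solution_section t)) => x; exact: solution_bound.
Qed.

Lemma nonlinearity_tempered t : 0 <= t -> tempered (power_nonlinearity N (fun x => radial_of (V t) x)).
Proof.
move=> t0; have ms := measurable_solution_section t; pose M := K / Num.sqrt (t + rho).
apply: (@bounded_tempered _ (M ^+ N * M)).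
  by apply: measurable_funM => //; apply: measurable_funX; exact: measurableT_comp.
move=> x; have b := solution_bound x t0; rewrite /power_nonlinearity normrM normrX normr_id.
by apply: ler_pM => //; rewrite ?exprn_ge0 // lerXn2r ?nnegrE // (le_trans _ b).
Qed.

Let A := N.+1%:R * K ^+ N * K.

Let A0 : 0 <= A. Proof. by rewrite mulr_ge0 // mulr_ge0 // exprn_ge0. Qed.

Let F s := @pw R N (V s).

Let sF s : 0 <= s -> admissible_source N rho (F s) A s.
Proof.
move=> s0; have [_ oV bV] := cV; apply: (pw_source N rho0 s0 K0).
- exact: class_section cV.
- exact: oV.
- by move=> r; exact: bV.
Qed.

Lemma nonlinear_multiplier psi th t s : schwartz psi -> 0 <= s <= t ->
  [/\ integ leb3 (fun x => radial_of (F s) x * phase_fourier th (fun xi => sin_symbol (t - s) xi * psi xi) x),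
    integ leb3 (fun x => radial_of (avg (t - s) (F s)) x * phase_fourier th psi x) &
  Rintegral leb3 setT (fun x => radial_of (F s) x * phase_fourier th (fun xi => sin_symbol (t - s) xi * psi xi) x) =
  Rintegral leb3 setT (fun x => radial_of (avg (t - s) (F s)) x * phase_fourier th psi x)].
Proof.
move=> sp /andP[s0 st]; have [_ oF _] := sF s0.
have ts : 0 <= t - s by rewrite subr_ge0.
exact: (radial_sin_multiplier th sp ts oF (source_adm hN rho0 s0 A0 (sF s0))).
Qed.

Lemma adm_wgt t : 0 <= t -> adm (wgt rho t).
Proof.
move=> t0; have mw : measurable_fun setT (wgt rho t).
  apply: measurable_funM => //; apply: measurable_inv; apply: measurable_sqrt.
  by apply: measurable_funD => //; exact: measurable_funD.
apply: (adm_le mw (@adm_sqrt R)) => r; rewrite (ger0_norm (wgt_ge0 _ _ _)) (ger0_norm (sqrtr_ge0 _)).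
rewrite /wgt ler_pdivrMr ?jap_gt0 //.
rewrite -{1}(@sqr_sqrtr _ `|r|) // expr2; apply: ler_wpM2l; first exact: sqrtr_ge0.
by apply: ler_wsqrtr; rewrite -addrA lerDl addr_ge0 // ltW.
Qed.

(** Exchanges the time integral with the pairing in space. The light cone estimate bounds the
    integrand by a product of a function of [x], integrable thanks to the decay of the transform of
    [psi], and an integrable function of [s]. *)
Lemma duhamel_term psi th t : schwartz psi -> 0 <= t ->
  let S s := Rintegral leb3 setT (fun x => radial_of (avg (t - s) (F s)) x * phase_fourier th psi x) in
  [/\ integ mu (fun s => iv 0 t s * S s),
    integ leb3 (fun x => radial_of (duh F t) x * phase_fourier th psi x) &
  Rintegral mu setT (fun s => iv 0 t s * S s) =
    Rintegral leb3 setT (fun x => radial_of (duh F t) x * phase_fourier th psi x)].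
Proof.
move=> sp t0 S; have [C [C0 hC _ _]] := schwartz_wave_decay sp t0.
have [jp _] := schwartz_fourier_decay sp.
have mPsi := measurable_phase_fourier th (integ_meas jp).
pose H (z : R3 R * R) := (iv 0 t z.2 * avg (t - z.2) (F z.2) (euclid z.1)) / euclid z.1 *
  phase_fourier th psi z.1.
have me : measurable_fun setT (fun z : R3meas R * measurableTypeR R => euclid z.1).
  exact: (measurableT_comp measurable_euclid measurable_fst).
have mH : measurable_fun setT (H : R3meas R * measurableTypeR R -> R).
  apply: measurable_funM; last exact: (measurableT_comp mPsi measurable_fst).
  apply: measurable_funM; last exact: measurable_inv.
  apply: (measurableT_comp (measurable_duh_integrand (measurable_pw_class N cV))
    (_ : measurable_fun setT (fun z : R3meas R * measurableTypeR R =>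
      ((t, euclid z.1), z.2) : measurableTypeR R * measurableTypeR R * measurableTypeR R))).
  apply: measurable_fun_pair; last exact: measurable_snd.
  by apply: measurable_fun_pair => //; exact: measurable_cst.
have [jT _] := time_integral hN rho0 t.
pose G x := A * 2 * (C * `|radial_of (wgt rho t) x * decay 3 x|).
have jG : integ leb3 G by exact: (integZ _ (integZ _ (integ_abs (adm_radial_integ (adm_wgt t0))))).
have bH x s : `|H (x, s)| <= G x * (iv 0 t s * Num.sqrt (s + rho) ^- (N - 2)).
  rewrite /H /= /iv; case: ifP => [/andP[s0 st]|_]; last by rewrite !mul0r normr0 mulr0.
  have st' : 0 <= s <= t by rewrite (ltW s0) st.
  have h1 := avg_source_bound hN rho0 (euclid x) st' A0 (sF (ltW s0)).
  have h2 : `|phase_fourier th psi x| <= C * decay 3 x by exact: hC.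
  set Y := Num.sqrt (s + rho) ^- (N - 2) in h1 *.
  move: h1 h2; move: (avg (t - s) (F s) (euclid x)) (phase_fourier th psi x) => a p h1 h2.
  move: h1 h2 (wgt_ge0 rho t (euclid x)) (decay_ge0 3 x); rewrite !mul1r /G /radial_of.
  move: (wgt rho t (euclid x)) (decay 3 x) => w d h1 h2 w0 d0.
  rewrite !normrM (ger0_norm w0) (ger0_norm d0).
  apply: (@le_trans _ _ (A * 2 * w * Y * `|(euclid x)^-1| * (C * d))).
    by apply: ler_pM => //; apply: ler_wpM2r.
  by apply: le_of_eq; ring.
have jH : integ (leb3 \x mu)%E H.
  exact: (@integ_prodM _ _ _ _ _ leb3 mu H G _ mH jG jT bH).
have E1 s : Rintegral leb3 setT (fun x => H (x, s)) = iv 0 t s * S s.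
  rewrite /H /=; have [h|h] := boolP ((0 < s) && (s <= t)); last first.
    have -> : iv 0 t s = 0 by rewrite /iv (negbTE h).
    by rewrite mul0r -[RHS](Rint0 leb3); apply: Rint_ext => x; rewrite !mul0r.
  have st : 0 <= s <= t by case/andP: h => h1 ->; rewrite ltW.
  have [_ j _] := nonlinear_multiplier th sp st.
  by rewrite -(RintZ _ j); apply: Rint_ext => x; rewrite /radial_of; ring.
have E2 x : Rintegral mu setT (fun s => H (x, s)) = radial_of (duh F t) x * phase_fourier th psi x.
  have sF' s : 0 < s -> s <= t -> admissible_source N rho (F s) A s by move=> s0 _; exact/sF/ltW.
  have [j _] := integ_duh hN rho0 (euclid x) t0 A0 (measurable_pw_class N cV) sF'.
  have -> : radial_of (duh F t) x * phase_fourier th psi x =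
      phase_fourier th psi x / euclid x * duh F t (euclid x) by rewrite /radial_of mulrC mulrA mulrAC.
  by rewrite /duh -(RintZ _ j); apply: Rint_ext => s; rewrite /H /=; ring.
have j1 := Fubini_integ1 jH; have j2 := Fubini_integ2 jH.
split.
- exact: (@integ_ext _ (measurableTypeR R) _ mu _ _ E1 j2).
- exact: (@integ_ext _ (R3meas R) _ leb3 _ _ E2 j1).
- by rewrite -(Rint_ext mu E1) -(Fubini_swap jH); exact: Rint_ext.
Qed.

End MildSolution.

(** * The weak Duhamel formula *)

Section DuhamelFormula.
Context {R : realType}.
Notation mu := (@lebesgue_measure R).
Implicit Types (r s t th : R) (x : R3 R) (psi : R3 R -> R).

Lemma fourier_re_phase psi x : fourier_re psi x = phase_fourier 0 psi x.
Proof. by apply: Rint_ext => xi; rewrite addr0. Qed.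

Lemma fourier_im_phase psi x : integ leb3 psi -> fourier_im psi x = phase_fourier (pi / 2) psi x.
Proof.
move=> jp; rewrite /fourier_im -RintN; last first.
  apply: (@integ_bndM _ (R3meas R) _ leb3 psi _ 1 jp).
    by apply: measurable_comp_cont; [exact: continuous_sin|exact: measurable_dot3_l].
  by move=> xi; exact: sin_max.
by apply: Rint_ext => xi; rewrite cosD cos_pihalf sin_pihalf mulr0 mulr1 sub0r mulNr.
Qed.

Lemma Rint_itv0 t (f g : R -> R) : 0 <= t ->
  (forall s, 0 <= s <= t -> f s = g s) -> integ mu (fun s => iv 0 t s * g s) ->
  mu.-integrable `[0, t] (EFin \o f) /\
  Rintegral mu `[0, t] f = Rintegral mu setT (fun s => iv 0 t s * g s).
Proof.
move=> t0 fg jg; pose k s := if (0 <= s) && (s <= t) then f s else 0.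
have kE s : k s = iv 0 t s * g s + g 0 * box 0 s.
  rewrite /k /iv /box normr_le0; have [s0|s0|<-] := ltgtP 0 s.
  - rewrite /= mulr0 addr0; case: ifP => st; last by rewrite mul0r.
    by rewrite mul1r fg // ltW.
  - by rewrite /= mul0r mulr0 addr0.
  - by rewrite t0 /= mul0r add0r mulr1 fg // lexx.
have jk : integ mu k.
  apply: (@integ_ext _ (measurableTypeR R) _ mu _ _ (fun s => esym (kE s))).
  by apply: integD => //; apply: integZ; apply: integ_boxT.
have kp : (fun s => (k s)%:E) = ((EFin \o f) \_ (`[0, t] : set (measurableTypeR R))).
  by apply/funext => s; rewrite patchE mem_setE in_itv /= /k; case: ifP.
split; first by rewrite integrable_mkcond //; move: jk; rewrite /integ /comp kp.
have -> : Rintegral mu `[0, t] f = Rintegral mu setT k.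
  by congr fine; rewrite [LHS]integral_mkcond -kp.
apply: Rint_ae; [exact: integ_meas jk|exact: integ_meas jg|].
exists [set 0]; split => //; first exact: lebesgue_measure_set1.
move=> s /= hs; apply: contrapT => s0; apply: hs; rewrite kE /box normr_le0.
by case: eqP => // _; rewrite mulr0 addr0.
Qed.

(** [F] stands for the real or the imaginary part of the Fourier transform, which differ only by the
    phase [th]. Each multiplier in the formula is moved onto a profile, after which all terms are
    pairings with the same function and the claim is the fixed point equation. *)
Lemma radial_duhamel (F : (R3 R -> R) -> R3 R -> R) th (N : nat) (rho K : R) (b : bool)
    (u0 u1 : R3 R -> R) (V0 V1 : R -> R) (V L : R -> R -> R) :
  (4 < N)%N -> 0 < rho -> 0 <= K ->
  (forall psi x, integ leb3 psi -> F psi x = phase_fourier th psi x) ->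
  measurable_fun setT (u0 : R3meas R -> R) -> measurable_fun setT (u1 : R3meas R -> R) ->
  {ae leb3, forall x, u0 x = radial_of V0 x} -> {ae leb3, forall x, u1 x = radial_of V1 x} ->
  odd_fun V0 -> odd_fun V1 -> adm V0 -> adm V1 ->
  (forall t r, 0 <= t -> halfsum t V0 r + avg t V1 r = L t r) ->
  spacetime_class rho K V -> (forall t r, 0 <= t -> V t r = picard_map N ((-1) ^+ b) L V t r) ->
  duhamel F N b u0 u1 (fun t x => radial_of (V t) x).
Proof.
move=> hN rho0 K0 HF mu0 mu1 e0 e1 o0 o1 a0 a1 HL cV fV t psi t0 sp.
have [jp _] := schwartz_fourier_decay sp.
have js s : 0 <= s -> integ leb3 (fun xi => sin_symbol s xi * psi xi) by move=> s0; exact: (integ_sin_symbol s0 jp).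
have jc := integ_cos_symbol t jp.
pose Psi x := phase_fourier th psi x.
pose G s := @pw R N (V s).
have FE f : integ leb3 f -> F f = phase_fourier th f by move=> jf; apply/funext => x; exact: HF.
have sE s : 0 <= s <= t -> multiplier_ft F (sin_symbol (t - s))
      (power_nonlinearity N (fun x => radial_of (V s) x)) psi =
    Rintegral leb3 setT (fun x => radial_of (avg (t - s) (G s)) x * Psi x).
  move=> st; have [_ _ <-] := nonlinear_multiplier hN rho0 K0 cV th sp st.
  have ts : 0 <= t - s by case/andP: st => _; rewrite subr_ge0.
  rewrite /multiplier_ft /pairing (FE _ (js _ ts)); apply: Rint_ext => x.
  by rewrite radial_of_pw.
have [jS jD SD] := duhamel_term hN rho0 K0 cV th sp t0.
have [i1 i2] := Rint_itv0 t0 sE jS.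
split; first exact: i1.
rewrite i2 SD.
have [c1 c2 cE] := radial_cos_multiplier th sp t0 o0 a0.
have [s1 s2 sE1] := radial_sin_multiplier th sp t0 o1 a1.
have -> : multiplier_ft F (cos_symbol t) u0 psi =
    Rintegral leb3 setT (fun x => radial_of (halfsum t V0) x * Psi x).
  rewrite -cE /multiplier_ft /pairing (FE _ jc); apply: Rint_ae.
  - exact: (measurable_funM mu0 (measurable_phase_fourier th (integ_meas jc))).
  - exact: integ_meas c1.
  - by apply: (@ae_imply _ (R3meas R) _ leb3 _ _ _ e0) => x ->.
have -> : multiplier_ft F (sin_symbol t) u1 psi =
    Rintegral leb3 setT (fun x => radial_of (avg t V1) x * Psi x).
  rewrite -sE1 /multiplier_ft /pairing (FE _ (js t t0)); apply: Rint_ae.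
  - exact: (measurable_funM mu1 (measurable_phase_fourier th (integ_meas (js t t0)))).
  - exact: integ_meas s1.
  - by apply: (@ae_imply _ (R3meas R) _ leb3 _ _ _ e1) => x ->.
rewrite /pairing (FE _ jp) -(RintD c2 s2) -(RintZ _ jD) -(RintB (integD c2 s2) (integZ _ jD)).
apply: Rint_ext => x; rewrite /radial_of (fV t (euclid x) t0) /picard_map -(HL t (euclid x) t0) -/(Psi x).
move: (Psi x) (halfsum t V0 _) (avg t V1 _) (duh _ t _) => a h g d; ring.
Qed.

End DuhamelFormula.

(** * The space-time norm *)

Section DispersiveNorm.
Context {R : realType}.
Notation mu := (@lebesgue_measure R).

(** The integral of a nonnegative function is a supremum over simple functions below it, hence
    monotone for arbitrary functions. It is applied to the essential supremum norm of [u t], whose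
    measurability in [t] is thus not at issue. *)
Lemma ge0_le_integral_nonmeasurable (D : set (measurableTypeR R)) (f g : R -> \bar R) :
  (forall x, D x -> 0 <= f x)%E -> (forall x, D x -> f x <= g x)%E ->
  (\int[mu]_(x in D) f x <= \int[mu]_(x in D) g x)%E.
Proof.
move=> f0 fg; have g0 x : D x -> (0 <= g x)%E by move=> Dx; exact: le_trans (f0 x Dx) (fg x Dx).
rewrite (ge0_integralE _ f0) (ge0_integralE _ g0); apply: le_ereal_sup => _ /= [h hf <-].
exists h => // x; apply: (le_trans (hf x)); rewrite !patchE; case: ifPn => // /set_mem; exact: fg.
Qed.

Lemma Lnorm_infty_le (f : R3 R -> R) (M : R) : 0 <= M -> (forall x, `|f x| <= M) ->
  ('N[leb3]_+oo [EFin \o f] <= M%:E)%E.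
Proof.
move=> M0 fM; rewrite unlock /=; case: ifP => _; last by rewrite lee_fin.
by apply/ess_supP; apply: aeW => x /=; rewrite lee_fin.
Qed.

(** The function [(t + rho)^(-1/2)] is in [L^p] of the half-line for [p > 2], with norm a multiple
    of [rho^(1/p - 1/2)]. For [p = N/2] the condition is [N > 4] and the power of [rho] is
    [2/N - 1/2]. *)
Lemma LpLq_norm_le (p k rho : R) (u : R -> R3 R -> R) : 2 < p -> 0 < rho -> 0 <= k ->
  (forall t x, 0 <= t -> `|u t x| <= k / Num.sqrt (t + rho)) ->
  (LpLq_norm p +oo u <= (k * (2 / (p - 2)) `^ p^-1 * rho `^ (p^-1 - 1 / 2))%:E)%E.
Proof.
move=> p2 rho0 k0 hu; have p0 : 0 < p by lra.
have q0 : 0 < p / 2 - 1 by lra.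
have E := @integral_powR_tail R rho _ rho0 q0.
have h1 (t : R) : 0 <= t -> ('N[leb3]_+oo [EFin \o u t] `^ p <=
    (k `^ p * (rho + t) `^ (- (p / 2 - 1) - 1))%:E)%E.
  move=> t0; have st : 0 < t + rho by rewrite ltr_wpDl.
  have M0 : 0 <= k / Num.sqrt (t + rho) by rewrite divr_ge0 // sqrtr_ge0.
  have h := Lnorm_infty_le M0 (fun x => hu t x t0).
  have -> : (k `^ p * (rho + t) `^ (- (p / 2 - 1) - 1))%:E = ((k / Num.sqrt (t + rho))%:E `^ p)%E.
    rewrite poweR_EFin powRM // ?invr_ge0 ?sqrtr_ge0 //; congr (_ * _)%:E.
    have -> : (Num.sqrt (t + rho))^-1 = (t + rho) `^ (- 2^-1) by rewrite powRN powR12_sqrt // ltW.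
    by rewrite -powRrM (addrC rho t); congr (_ `^ _); field.
  have pos (z : \bar R) : (0 <= z)%E -> z \in `[0%E, +oo%E] by move=> z0; rewrite in_itv /= z0 leey.
  apply: (gt0_ler_poweR (ltW p0)) => //; apply: pos; first exact: Lnorm_ge0.
  by rewrite lee_fin.
have I : (\int[mu]_(t in `[0%R, +oo[) ('N[leb3]_+oo [EFin \o u t] `^ p) <=
    (k `^ p * ((2 / (p - 2)) * rho `^ (- (p / 2 - 1))))%:E)%E.
  apply: (@le_trans _ _ (\int[mu]_(t in `[0%R, +oo[) (k `^ p * (rho + t) `^ (- (p / 2 - 1) - 1))%:E)%E).
    apply: ge0_le_integral_nonmeasurable => t /=; rewrite in_itv /= andbT => t0; first exact: poweR_ge0.
    exact: h1.
  under eq_integral => t _ do rewrite EFinM.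
  rewrite ge0_integralZl //.
  - rewrite E -EFinM lee_fin; apply: le_of_eq; congr (_ * (_ * _)); field.
    by rewrite gt_eqF // subr_gt0.
  - apply/measurable_EFinP; apply: measurable_funTS.
    apply: (measurableT_comp (@measurable_powR R _ : measurable_fun setT _)).
    exact: measurable_funD.
  - by move=> t _; rewrite lee_fin powR_ge0.
  - by rewrite lee_fin powR_ge0.
rewrite /LpLq_norm.
have -> : (k * (2 / (p - 2)) `^ p^-1 * rho `^ (p^-1 - 1 / 2))%:E =
  ((k `^ p * ((2 / (p - 2)) * rho `^ (- (p / 2 - 1))))%:E `^ p^-1)%E.
  have p20 : 0 <= 2 / (p - 2) by rewrite divr_ge0 // subr_ge0 ltW.
  move: (2 / (p - 2)) p20 => a a0.
  rewrite poweR_EFin powRM ?powR_ge0 ?mulr_ge0 ?powR_ge0 // powRM ?powR_ge0 //.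
  rewrite -!powRrM mulfV ?gt_eqF // powRr1 // -mulrA; congr (_ * (_ * _ `^ _))%:E.
  by field; rewrite gt_eqF.
apply: gt0_ler_poweR => //; first by rewrite invr_ge0 ltW.
  by rewrite in_itv /= leey andbT; apply: integral_ge0 => t _; exact: poweR_ge0.
rewrite in_itv /= leey andbT.
rewrite lee_fin mulr_ge0 ?powR_ge0 // mulr_ge0 ?powR_ge0 //.
by rewrite divr_ge0 // subr_ge0 ltW.
Qed.

End DispersiveNorm.

(** * The smallness condition *)

Section Smallness.
Context {R : realType}.

(** The contraction factor is this constant times the power [N/2] of [B^2 rho^(4/N - 1)]. The base
    [2 / disk_area] is [K^2 / B^2] for the radius [K] of the weighted ball. *)
Definition picard_constant (N : nat) : R :=
  N.+1%:R * (4 / (N%:R - 4)) * (2 / disk_area) `^ (N%:R / 2).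

Lemma picard_constant_gt0 N : (4 < N)%N -> 0 < picard_constant N.
Proof.
move=> hN; have N4 : 0 < N%:R - 4 :> R by rewrite subr_gt0 (ltr_nat R 4 N).
by rewrite !mulr_gt0 ?ltr0n ?invr_gt0 ?powR_gt0 ?divr_gt0 ?disk_area_gt0.
Qed.

Lemma picard_smallness N (rho B : R) : (4 < N)%N -> 0 < rho -> 0 <= B ->
  B ^+ 2 * rho `^ (4 / N%:R - 1) <= (2 * picard_constant N)^-1 `^ (2 / N%:R) ->
  N.+1%:R * (2 * (Num.sqrt 2 * (B / Num.sqrt (4 * disk_area)))) ^+ N * kappa N rho <= 2^-1.
Proof.
move=> hN rho0 B0 small; have C0 := picard_constant_gt0 hN.
have N0 : 0 < N%:R :> R by rewrite ltr0n; lia.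
have N2 : 0 < N%:R / 2 :> R by rewrite divr_gt0.
have N4 : 0 < N%:R - 4 :> R by rewrite subr_gt0 (ltr_nat R 4 N).
have c0 := @disk_area_gt0 R; have c4 : 0 < 4 * (disk_area : R) by rewrite mulr_gt0.
set K := 2 * _; have K0 : 0 <= K.
  by rewrite mulr_ge0 // mulr_ge0 ?sqrtr_ge0 // divr_ge0 // sqrtr_ge0.
have K2 : K ^+ 2 = 2 / disk_area * B ^+ 2.
  by rewrite /K !exprMn exprVn !sqr_sqrtr ?(ltW c4) //; field; rewrite gt_eqF.
have B2 : 0 <= B ^+ 2 by exact: sqr_ge0.
have dc : 0 <= 2 / disk_area :> R by rewrite divr_ge0 // ltW.
have KN : K ^+ N = (2 / disk_area) `^ (N%:R / 2) * (B ^+ 2) `^ (N%:R / 2).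
  by rewrite -powRM // -K2 -powR_mulrn // -[in RHS]powR_mulrn // -powRrM; congr (_ `^ _); field.
have kE : kappa N rho = 4 / (N%:R - 4) * (rho `^ (4 / N%:R - 1)) `^ (N%:R / 2).
  by rewrite /kappa -powRrM; congr (_ * _ `^ _); field; rewrite gt_eqF.
have -> : N.+1%:R * K ^+ N * kappa N rho =
    picard_constant N * (B ^+ 2 * rho `^ (4 / N%:R - 1)) `^ (N%:R / 2).
  by rewrite powRM ?powR_ge0 // KN kE /picard_constant; ring.
have h : (B ^+ 2 * rho `^ (4 / N%:R - 1)) `^ (N%:R / 2) <=
    ((2 * picard_constant N)^-1 `^ (2 / N%:R)) `^ (N%:R / 2).
  by apply: ge0_ler_powR; rewrite ?nnegrE ?mulr_ge0 ?powR_ge0 // ltW.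
rewrite -powRrM (_ : 2 / N%:R * (N%:R / 2) = 1) in h; last by field; rewrite gt_eqF.
rewrite powRr1 in h; last by rewrite invr_ge0 mulr_ge0 // ltW.
apply: (le_trans (ler_wpM2l (ltW C0) h)); apply: le_of_eq; field.
by rewrite gt_eqF.
Qed.

End Smallness.

Unset Implicit Arguments.
Set Strict Implicit.
Set Printing Implicit Defensive.

Theorem corollary1p3 (R : realType) (N : nat) (hN : (4 < N <= 12)%N) :
  exists eps0 C : R, 0 < eps0 /\
  forall (b : bool) (rho : R) (u0 u1 : R3 R -> R),
    0 < rho ->
    H1dot u0 -> Lp_fun 2%:E u1 ->
    radial u0 -> radial u1 -> outgoing u0 u1 ->
    supported_outside_ball rho u0 -> supported_outside_ball rho u1 ->
    (H1dot_norm u0 ^+ 2 * (rho `^ (4 / N%:R - 1))%:E <= eps0%:E)%E ->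
    exists u : R -> R3 R -> R,
      global_mild_solution N b u0 u1 u /\
      (LpLq_norm (N%:R / 2) +oo u <=
         C%:E * H1dot_norm u0 * (rho `^ (2 / N%:R - 1 / 2))%:E)%E.
Proof.
case/andP: hN => hN _.
have N0 : 0 < N%:R :> R by rewrite ltr0n; lia.
have N4 : 4 < N%:R :> R by rewrite (ltr_nat R 4 N).
have C0 : 0 < picard_constant N :> R by exact: picard_constant_gt0.
have c0 := @disk_area_gt0 R; have c4 : 0 < 4 * (disk_area : R) by rewrite mulr_gt0.
(* The first constant is the value at which the contraction factor equals [1/2]. The second is the
   ratio of [K] to the norm of [u0], times the factor [(2 / (p - 2))^(1/p)] of the time norm for
   [p = N/2]. *)
exists ((2 * picard_constant N)^-1 `^ (2 / N%:R)),
  (2 * Num.sqrt 2 / Num.sqrt (4 * disk_area) * (4 / (N%:R - 4)) `^ (2 / N%:R)).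
split; first by rewrite powR_gt0 // invr_gt0 mulr_gt0.
move=> b rho u0 u1 rho0 H0 L1 r0 r1 out s0 s1 small.
have r4 : 0 < rho `^ (4 / N%:R - 1) by exact: powR_gt0.
(* The norm is an extended real; the value [+oo] would contradict the smallness assumption because
   the power of [rho] is positive. *)
have [B B0 NB] : exists2 B : R, 0 <= B & H1dot_norm u0 = B%:E.
  move: small; have := @Lnorm_ge0 _ _ R leb3 2%:E (EFin \o (euclid \o grad u0)).
  rewrite -/(H1dot_norm u0); case: (H1dot_norm u0) => [B| |] //; first by exists B.
  by rewrite expe2 mulyy gt0_mulye // leye_eq.
rewrite NB -EFin_expe -EFinM lee_fin in small.
have [h1 [mh1 h1_0 jh1 ae1 [ae0 vD]]] := outgoing_profile rho0 H0 L1 r0 r1 out s0 s1 NB B0.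
set D := B / Num.sqrt (4 * disk_area) in vD.
have D0 : 0 <= D by rewrite divr_ge0 // sqrtr_ge0.
pose M s := s * h1 s; pose v r := - prim M rho r.
have mM : measurable_fun setT M by exact: measurable_funM.
have M0 r : r <= rho -> M r = 0 by move=> rr; rewrite /M h1_0 // mulr0.
have vD' r : 0 < r -> `|v r| <= D * Num.sqrt r by move=> h; rewrite /v normrN; exact: vD.
(* Twice the bound [sqrt 2 * D] of the linear wave, as [picard_fixpoint] asks the linear part to lie
   in half the ball. *)
pose K := 2 * (Num.sqrt 2 * D).
have K0 : 0 <= K by rewrite mulr_ge0 // mulr_ge0 // sqrtr_ge0.
have Kk : N.+1%:R * K ^+ N * kappa N rho <= 2^-1 by exact: picard_smallness.
have cL := outgoing_wave_class rho0 mM D0 vD'.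
have K2 : K / 2 = Num.sqrt 2 * D by rewrite /K; field.
rewrite -K2 in cL.
have sg1 : `|(-1) ^+ b| <= 1 :> R by rewrite normrX normrN1 expr1n.
have [V cV fV] := picard_fixpoint hN rho0 sg1 K0 Kk cL.
have a0 := adm_oddify (adm_velocity rho0 mM D0 vD').
have a1 := adm_oddify (adm_sqr_integrable mM jh1).
(* The reflected term of the odd extension is evaluated at [- |x| <= rho], where the profile is
   0. *)
have e0 : {ae leb3, forall x, u0 x = radial_of (oddify v) x}.
  apply: (@ae_imply _ (R3meas R) _ leb3 _ _ _ ae0) => x ->; rewrite /radial_of /oddify.
  have nx : - euclid x <= rho by apply: le_trans (ltW rho0); rewrite oppr_le0 euclid_ge0.
  by rewrite /v (prim_eq0 _ nx) oppr0 subr0.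
have e1 : {ae leb3, forall x, u1 x = radial_of (oddify M) x}.
  apply: (@ae_imply2 _ (R3meas R) _ leb3 _ _ _ ae1 ae_euclid_neq0) => x -> x0.
  have nx : - euclid x <= rho by apply: le_trans (ltW rho0); rewrite oppr_le0 euclid_ge0.
  by rewrite /radial_of /oddify (M0 _ nx) subr0 /M mulrAC mulfV // mul1r.
have du th F (HF : forall psi x, integ leb3 psi -> F psi x = phase_fourier th psi x) :
    duhamel F N b u0 u1 (fun t x => radial_of (V t) x).
  apply: (@radial_duhamel R F th N rho K b u0 u1 _ _ V _ hN rho0 K0 HF H0.1.1 L1.1 e0 e1
    (odd_oddify v) (odd_oddify M) a0 a1 _ cV fV) => t r t0.
  exact: (outgoing_wave mM M0 jh1 r t0).
exists (fun t x => radial_of (V t) x); split.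
  split.
  - by apply: measurable_funTS; exact: measurable_solution cV.
  - by move=> t; exact: (solution_tempered rho0 K0 cV).
  - by apply: aeW => t; exact: (nonlinearity_tempered N rho0 K0 cV).
  - by apply: (du 0) => psi x _; exact: fourier_re_phase.
  - by apply: (du (pi / 2)) => psi x; exact: fourier_im_phase.
have p2 : 2 < N%:R / 2 :> R by lra.
have H := LpLq_norm_le p2 rho0 K0 (fun t x t0 => solution_bound rho0 K0 cV x t0).
apply: (le_trans H); rewrite NB -!EFinM lee_fin; apply: le_of_eq.
rewrite invf_div (_ : 2 / (N%:R / 2 - 2) = 4 / (N%:R - 4)); last first.
  by field; do ?[apply/andP; split]; rewrite gt_eqF //; lra.
rewrite /K /D; ring.
Qed.
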